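(* Let $\bar\tau\in(0,\infty]$, $s\in[1,\infty]$ with Hölder conjugate $s'$, let $\psi\in L^1\big(0,\bar\tau;W^{2,s'}_{\mathcal H}(\mathbb{H}^n)\big)$, and let $\mathbf b$ be the time-dependent contact vector field $$\mathbf b=-4\psi\,T+\sum_{j=1}^n\big(Y_j\psi\,X_j-X_j\psi\,Y_j\big)\qquad\text{on }(0,\bar\tau)\times\mathbb{H}^n .$$ Let $c\in L^1\big(0,\bar\tau;L^{s'}_{\mathrm{loc}}(\mathbb{H}^n)\big)$, $u_0\in L^s_{\mathrm{loc}}(\mathbb{H}^n)$ and $u\in L^\infty\big(0,\bar\tau;L^s_{\mathrm{loc}}(\mathbb{H}^n)\big)$. Extend $u,\mathbf b,c$ to $(-\infty,\bar\tau)\times\mathbb{H}^n$ by setting $\mathbf b(\tau,p)=0$, $c(\tau,p)=0$ and $u(\tau,p)=u_0(p)$ for $\tau<0$. For $\varepsilon>0$ set $\mathscr C_\varepsilon=\mathscr C^1_\varepsilon+\mathscr C^2_\varepsilon$, where for a.e. $(\tau,p)\in(-\infty,\bar\tau)\times\mathbb{H}^n$ $$\mathscr C^1_\varepsilon(\tau,p)=-\big((u\operatorname{div}\mathbf b)*\rho_\varepsilon\big)(\tau,p)-\int_{\mathbb{H}^n}u(\tau,p\cdot q^{-1})\sum_{j=1}^N\big[b_j(\tau,p)Z_j\rho_\varepsilon(q)-b_j(\tau,p\cdot q^{-1})Z^r_j\rho_\varepsilon(q)\big]\,dq,$$ $$\mathscr C^2_\varepsilon(\tau,p)=\int_{\mathbb{H}^n}u(\tau,p\cdot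 q^{-1})\rho_\varepsilon(q)\big[c(\tau,p)-c(\tau,p\cdot q^{-1})\big]\,dq.$$ Then $\mathscr C_\varepsilon\to0$ in $L^1\big(-\infty,\bar\tau;L^1_{\mathrm{loc}}(\mathbb{H}^n)\big)$ as $\varepsilon\searrow0$.
   Context: $n\ge1$, $N=2n+1$, $Q=2n+2$; $\mathbb{H}^n$ is $\mathbb{R}^N=\mathbb{R}^n\times\mathbb{R}^n\times\mathbb{R}$ with group law $(x,y,t)\cdot(x',y',t')=\big(x+x',\,y+y',\,t+t'+2\sum_{j=1}^n(x_j'y_j-x_jy_j')\big)$, inverse $p^{-1}=-p$, dilations $\delta_\lambda(x,y,t)=(\lambda x,\lambda y,\lambda^2t)$, and Lebesgue measure. Left-invariant frame: $Z_j=X_j=\partial_{x_j}+2y_j\partial_t$, $Z_{n+j}=Y_j=\partial_{y_j}-2x_j\partial_t$ ($j=1,\dots,n$), $Z_N=T=\partial_t$. Right-invariant fields: $Z_j^r=\partial_{x_j}-2y_j\partial_t$, $Z_{n+j}^r=\partial_{y_j}+2x_j\partial_t$, $Z_N^r=\partial_t$. A vector field is written $\mathbf b=\sum_{j=1}^Nb_jZ_j$ and $\operatorname{div}\mathbf b=\sum_jZ_jb_j$ (equal to the Euclidean divergence). $W^{2,s}_{\mathcal H}(\mathbb{H}^n)$ is the space of $u\in L^s(\mathbb{H}^n)$ whose distributional derivatives $Z_ju$, $Z_iZ_ju$ ($i,j=1,\dots,2n$) belong to $L^s(\mathbb{H}^n)$, normed by the sum of $L^s$ norms. Mollifier: $\rho\in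 C_c^\infty(\mathbb{H}^n)$ is fixed with $\rho\ge0$, $\rho(p)=\rho(p^{-1})$, $\int\rho=1$, $\operatorname{supp}\rho\subseteq B(0,1)$ (unit ball of the Carnot–Carathéodory distance, i.e. the distance given by minimal length of absolutely continuous curves with a.e. velocity in $\operatorname{span}(Z_1,\dots,Z_{2n})$, where $Z_1,\dots,Z_{2n}$ are orthonormal), and $\rho_\varepsilon(p)=\varepsilon^{-Q}\rho(\delta_{1/\varepsilon}(p))$. The spatial group convolution is $(g*\rho_\varepsilon)(\tau,p)=\int_{\mathbb{H}^n}g(\tau,p\cdot q^{-1})\rho_\varepsilon(q)\,dq$. Convergence in $L^1(-\infty,\bar\tau;L^1_{\mathrm{loc}}(\mathbb{H}^n))$ means $\int_{-\infty}^{\bar\tau}\|\mathscr C_\varepsilon(\tau,\cdot)\|_{L^1(K)}\,d\tau\to0$ for every compact $K\subset\mathbb{H}^n$. *)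

(* Defs.v *)
From HB Require Import structures.
From mathcomp Require Import all_boot all_order all_algebra.
From mathcomp Require Import all_classical all_reals all_analysis.

Set Implicit Arguments.
Unset Strict Implicit.
Unset Printing Implicit Defensive.

Import Order.TTheory GRing.Theory Num.Theory.
Import numFieldNormedType.Exports.

Local Open Scope classical_set_scope.
Local Open Scope ring_scope.

Section measurable_rV.
Context {R : realType} (m : nat).

Let coors : 'I_m -> 'rV[R]_m -> R := fun i v => v ord0 i.

Let rV_set0 : g_sigma_preimage coors set0.
Proof. exact: sigma_algebra0. Qed.

Let rV_setC A : g_sigma_preimage coors A -> g_sigma_preimage coors (~` A).
Proof. exact: sigma_algebraC. Qed.

Let rV_bigcup (F : _^nat) : (forall i, g_sigma_preimage coors (F i)) ->
  g_sigma_preimage coors (\bigcup_i (F i)).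
Proof. exact: sigma_algebra_bigcup. Qed.

(* The sigma-algebra generated by the coordinates, as for n.-tuple R. *)
HB.instance Definition _ :=
  @isMeasurable.Build (measure_tuple_display default_measure_display)
  'rV[R]_m (g_sigma_preimage coors) rV_set0 rV_setC rV_bigcup.

Lemma measurable_coord_rV (i : 'I_m) :
  measurable_fun [set: 'rV[R]_m] (fun v : 'rV[R]_m => v ord0 i).
Proof.
move=> _ Y mY; rewrite setTI; apply: sub_sigma_algebra => /=.
rewrite -bigcup_seq/=; exists i => /=; first by rewrite mem_index_enum.
by exists Y => //; rewrite setTI.
Qed.

Lemma measurable_fun_rV d (T : measurableType d) (f : T -> 'rV[R]_m) :
  (forall i, measurable_fun [set: T] (fun x => f x ord0 i)) ->
  measurable_fun [set: T] f.
Proof.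
move=> mf.
suff: g_sigma_preimage (fun i => coors i \o f) `<=` measurable.
  rewrite g_sigma_preimage_comp => prefS _ A mA.
  by apply: prefS; exists A.
apply: smallest_sub; first exact: sigma_algebra_measurable.
move=> A; rewrite -bigcup_seq/= => -[i _ [B mB <-]].
exact: mf.
Qed.

End measurable_rV.

Definition rV_cons {R : realType} m (z : ('rV[R]_m * R)%type) : 'rV[R]_m.+1 :=
  row_mx (const_mx z.2 : 'rV[R]_1) z.1.

Lemma measurable_rV_cons (R : realType) m :
  measurable_fun [set: ('rV[R]_m * R)%type] (@rV_cons R m).
Proof.
apply: measurable_fun_rV => i.
case: (@splitP 1 m i) => j ij.
- rewrite (_ : (fun _ => _) = snd); first exact: measurable_snd.
  apply/funext => z; rewrite /rV_cons (_ : i = lshift m j); last exact: val_inj.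
  by rewrite (@row_mxEl _ _ 1 m) mxE.
- rewrite (_ : (fun _ => _) = (fun v : 'rV[R]_m => v ord0 j) \o fst).
    exact: measurableT_comp (measurable_coord_rV j) measurable_fst.
  apply/funext => z; rewrite /rV_cons (_ : i = rshift 1 j); last exact: val_inj.
  by rewrite (@row_mxEr _ _ 1 m).
Qed.

Local Notation pushforward_measure :=
  measure_function_pushforward__canonical__measure_function_Measure.

(* Lebesgue measure on the Borel sets: the image of the product measure on
   R^m x R by (v, x) |-> (x, v); the library only needs the second factor of a
   product to be sigma-finite, whence this order. *)
Fixpoint lebesgue_rV (R : realType) (m : nat) :
    {measure set 'rV[R]_m -> \bar R} :=
  if m is m'.+1 then
    pushforward_measure (lebesgue_rV R m' \x @lebesgue_measure R)%E
      (@measurable_rV_cons R m')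
  else \d_(0 : 'rV[R]_0).

Section calculus_rV.
Context {R : realType} {m : nat}.
Implicit Types (f : 'rV[R]_m -> R) (V : 'rV[R]_m -> 'rV[R]_m).

Definition basis_rV (k : 'I_m) : 'rV[R]_m := delta_mx ord0 k.

Definition partial (k : 'I_m) f : 'rV[R]_m -> R :=
  fun p => 'D_(basis_rV k) f p.

(* C^infinity: f and all its iterated partial derivatives are differentiable *)
Definition smooth f : Prop :=
  forall (l : seq 'I_m) p, differentiable (foldr partial f l) p.

Definition support_rV f : set 'rV[R]_m := closure [set p | f p != 0].

Definition test_function f : Prop := smooth f /\ compact (support_rV f).

(* The action V f of a vector field V, seen as a map p |-> V p, on a function *)
Definition lie V f : 'rV[R]_m -> R := fun p => 'D_(V p) f p.

Definition locally_integrable_rV f : Prop :=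
  measurable_fun setT f /\
  forall K, compact K -> (lebesgue_rV R m).-integrable K (EFin \o f).

End calculus_rV.

Definition absolutely_continuous_curve {R : realType} {V : normedModType R}
    (a b : R) (gamma : R -> V) : Prop :=
  forall e : R, 0 < e -> exists2 d : R, 0 < d &
    forall (k : nat) (x y : 'I_k -> R),
      (forall i, a <= x i /\ x i <= y i /\ y i <= b) ->
      trivIset setT (fun i => `]x i, y i[%classic) ->
      \sum_(i < k) (y i - x i) < d ->
      \sum_(i < k) `|gamma (y i) - gamma (x i)| < e.

(* A point (x, y, t) of R^n x R^n x R is the row vector with blocks x, y, t. *)
Notation heis R n := ('rV[R]_(n + n + 1)).

Section heisenberg.
Context {R : realType} {n : nat}.
Local Notation H := (heis R n).
Implicit Types (p q : H) (f g phi : H -> R).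

Definition idx_x (j : 'I_n) : 'I_(n + n + 1) := lshift 1 (lshift n j).
Definition idx_y (j : 'I_n) : 'I_(n + n + 1) := lshift 1 (rshift n j).
Definition idx_t : 'I_(n + n + 1) := rshift (n + n) ord0.
Definition idx_h (j : 'I_(n + n)) : 'I_(n + n + 1) := lshift 1 j.

Definition xpart p : 'rV[R]_n := lsubmx (lsubmx p).
Definition ypart p : 'rV[R]_n := rsubmx (lsubmx p).
Definition tpart p : R := p ord0 idx_t.
Definition heis_pt (x y : 'rV[R]_n) (t : R) : H :=
  row_mx (row_mx x y) (const_mx t).

Definition heis_mul p q : H :=
  heis_pt (xpart p + xpart q) (ypart p + ypart q)
    (tpart p + tpart q +
     2 * \sum_(j < n) (xpart q ord0 j * ypart p ord0 j
                       - xpart p ord0 j * ypart q ord0 j)).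

Definition heis_inv p : H := - p.

Definition heis_dil (l : R) p : H :=
  heis_pt (l *: xpart p) (l *: ypart p) (l ^+ 2 * tpart p).

(* [field_frame s] has components X_j = d/dx_j + 2 s y_j d/dt,
   Y_j = d/dy_j - 2 s x_j d/dt and T = d/dt: the left-invariant frame for
   s = 1 and the right-invariant one for s = -1. *)
Definition field_frame (s : R) (k : 'I_(n + n + 1)) p : H :=
  match fintype.split k with
  | inl h => match fintype.split h with
    | inl j => basis_rV (idx_x j) + (2 * s * ypart p ord0 j) *: basis_rV idx_t
    | inr j => basis_rV (idx_y j) - (2 * s * xpart p ord0 j) *: basis_rV idx_t
    end
  | inr _ => basis_rV idx_t
  end.

Definition Zleft : 'I_(n + n + 1) -> H -> H := field_frame 1.
Definition Zright : 'I_(n + n + 1) -> H -> H := field_frame (-1).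

Definition mu_heis : {measure set H -> \bar R} := lebesgue_rV R (n + n + 1).

(* [h] gives the coordinates of the velocity in Z_1, ..., Z_{2n}. *)
Definition horizontal_curve (gamma : R -> H) (h : 'I_(n + n) -> R -> R) : Prop :=
  [/\ absolutely_continuous_curve 0 1 gamma,
      forall j, measurable_fun `[0%R : R, 1%R] (h j)
    & {ae @lebesgue_measure R, forall s : R, 0 <= s <= 1 ->
        is_derive s (1 : R) gamma
          (\sum_(j < n + n) h j s *: Zleft (idx_h j) (gamma s))}].

Definition horizontal_length (h : 'I_(n + n) -> R -> R) : \bar R :=
  (\int[@lebesgue_measure R]_(s in `[0%R, 1%R])
     (Num.sqrt (\sum_(j < n + n) h j s ^+ 2))%:E)%E.

Definition cc_dist p q : \bar R :=
  ereal_inf [set L | exists gamma h,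
    [/\ horizontal_curve gamma h, gamma 0 = p, gamma 1 = q
      & L = horizontal_length h]].

Definition cc_ball p (r : R) : set H := [set q | (cc_dist p q < r%:E)%E].

Record mollifier (rho : H -> R) : Prop := Mollifier {
  mollifier_test : test_function rho;
  mollifier_ge0 : forall p, 0 <= rho p;
  mollifier_sym : forall p, rho (heis_inv p) = rho p;
  mollifier_int : (\int[mu_heis]_p (rho p)%:E = 1)%E;
  mollifier_supp : support_rV rho `<=` cc_ball 0 1 }.

Definition mollify (rho : H -> R) (eps : R) : H -> R :=
  fun p => (eps ^+ (2 * n + 2))^-1 * rho (heis_dil eps^-1 p).

Definition heis_conv (g f : H -> R) : H -> R :=
  fun p => \int[mu_heis]_q (g (heis_mul p (heis_inv q)) * f q).

(* The Z_j preserve Lebesgue measure, so that the adjoint of Z_j is -Z_j. *)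
Definition weak_derivative (j : 'I_(n + n + 1)) f g : Prop :=
  [/\ locally_integrable_rV f, locally_integrable_rV g
    & forall phi, test_function phi ->
        \int[mu_heis]_p (f p * lie (Zleft j) phi p) =
        - \int[mu_heis]_p (g p * phi p)].

(* div b = sum_j Z_j b_j in the sense of distributions *)
Definition weak_divergence (b : 'I_(n + n + 1) -> H -> R) g : Prop :=
  [/\ forall j, locally_integrable_rV (b j), locally_integrable_rV g
    & forall phi, test_function phi ->
        \int[mu_heis]_p (\sum_j b j p * lie (Zleft j) phi p) =
        - \int[mu_heis]_p (g p * phi p)].

Definition Ls_norm (s : \bar R) f : \bar R := 'N[mu_heis]_s[EFin \o f]%E.

Definition Ls_norm_on (K : set H) (s : \bar R) f : \bar R :=
  Ls_norm s (f \_ K).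

Definition Ls_loc (s : \bar R) f : Prop :=
  measurable_fun setT f /\
  forall K, compact K -> (Ls_norm_on K s f < +oo)%E.

Definition W2H_norm (s : \bar R) f (Df : 'I_(n + n) -> H -> R)
    (D2f : 'I_(n + n) -> 'I_(n + n) -> H -> R) : \bar R :=
  (Ls_norm s f + \sum_j Ls_norm s (Df j)
   + \sum_i \sum_j Ls_norm s (D2f i j))%E.

(* f belongs to W^{2,s}_H, with Df j = Z_j f and D2f i j = Z_i Z_j f *)
Record W2H (s : \bar R) f (Df : 'I_(n + n) -> H -> R)
    (D2f : 'I_(n + n) -> 'I_(n + n) -> H -> R) : Prop := MkW2H {
  W2H_measurable : measurable_fun setT f;
  W2H_first : forall j, weak_derivative (idx_h j) f (Df j);
  W2H_second : forall i j, weak_derivative (idx_h i) (Df j) (D2f i j);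
  W2H_finite : (W2H_norm s f Df D2f < +oo)%E }.

Implicit Types (taubar s : \bar R) (u v : R -> H -> R).

Definition time_int taubar : set R := [set tau | 0 < tau /\ (tau%:E < taubar)%E].
Definition time_left taubar : set R := [set tau | (tau%:E < taubar)%E].

Definition joint_measurable (I : set R) u : Prop :=
  measurable_fun (I `*` [set: H]) (fun z : (R * H)%type => u z.1 z.2).

(* u belongs to L^r(0, taubar; L^s_loc), for r = 1 or r = +oo *)
Definition LrLs_loc (r s taubar : \bar R) u : Prop :=
  joint_measurable (time_int taubar) u /\
  forall K, compact K ->
    ('N[@lebesgue_measure R]_r[(fun tau => Ls_norm_on K s (u tau))
                                 \_ (time_int taubar)] < +oo)%E.

(* psi belongs to L^1(0, taubar; W^{2,s}_H), with horizontal derivatives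
   Dpsi and D2psi *)
Record L1W2H (s taubar : \bar R) (psi : R -> H -> R)
    (Dpsi : 'I_(n + n) -> R -> H -> R)
    (D2psi : 'I_(n + n) -> 'I_(n + n) -> R -> H -> R) : Prop := MkL1W2H {
  L1W2H_measurable : joint_measurable (time_int taubar) psi;
  L1W2H_measurable1 : forall j, joint_measurable (time_int taubar) (Dpsi j);
  L1W2H_measurable2 :
    forall i j, joint_measurable (time_int taubar) (D2psi i j);
  L1W2H_ae : {ae @lebesgue_measure R, forall tau, time_int taubar tau ->
    W2H s (psi tau) (fun j => Dpsi j tau) (fun i j => D2psi i j tau)};
  L1W2H_finite :
    (\int[@lebesgue_measure R]_(tau in time_int taubar)
       W2H_norm s (psi tau) (fun j => Dpsi j tau) (fun i j => D2psi i j tau)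
     < +oo)%E }.

(* Components in the frame Z of - 4 psi T + sum_j (Y_j psi X_j - X_j psi Y_j) *)
Definition contact_field (psi : R -> H -> R) (Dpsi : 'I_(n + n) -> R -> H -> R)
    (k : 'I_(n + n + 1)) : R -> H -> R := fun tau p =>
  match fintype.split k with
  | inl h => match fintype.split h with
    | inl j => Dpsi (rshift n j) tau p
    | inr j => - Dpsi (lshift n j) tau p
    end
  | inr _ => - 4 * psi tau p
  end.

Definition extend (f0 : H -> R) u : R -> H -> R :=
  fun tau p => if tau < 0 then f0 p else u tau p.

(* divb is a representative of the distributional divergence of b. *)
Definition commutator1 (rho : H -> R) (eps : R) u
    (b : 'I_(n + n + 1) -> R -> H -> R) (divb : R -> H -> R) (tau : R) p : R :=
  - heis_conv (fun q => u tau q * divb tau q) (mollify rho eps) p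
  - \int[mu_heis]_q (u tau (heis_mul p (heis_inv q)) *
      \sum_j (b j tau p * lie (Zleft j) (mollify rho eps) q
              - b j tau (heis_mul p (heis_inv q))
                * lie (Zright j) (mollify rho eps) q)).

Definition commutator2 (rho : H -> R) (eps : R) u (c : R -> H -> R)
    (tau : R) p : R :=
  \int[mu_heis]_q (u tau (heis_mul p (heis_inv q)) * mollify rho eps q *
                   (c tau p - c tau (heis_mul p (heis_inv q)))).

Definition commutator (rho : H -> R) (eps : R) u
    (b : 'I_(n + n + 1) -> R -> H -> R) (divb c : R -> H -> R)
    (tau : R) p : R :=
  commutator1 rho eps u b divb tau p + commutator2 rho eps u c tau p.

End heisenberg.

(* Main.v *)
Require Import Defs.
From HB Require Import structures.
From mathcomp Require Import all_boot all_order all_algebra.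
From mathcomp Require Import all_classical all_reals all_analysis.
From mathcomp Require Import measurable_realfun ess_sup_inf ring lra.
Set Implicit Arguments.
Unset Strict Implicit.
Unset Printing Implicit Defensive.
Import Order.TTheory GRing.Theory Num.Theory.
Import numFieldNormedType.Exports.
Local Open Scope classical_set_scope.
Local Open Scope ring_scope.

(* After the substitution q = dil e w, the commutator C^1_e(p) becomes the integral
   over w of a kernel Phi_e(p, w) which only involves rho(w) and the first-order
   right-invariant derivatives of rho at w, multiplied by u(p q^-1) and by the
   difference quotients e^-1 (Z_h psi(p) - Z_h psi(p q^-1)) and
   e^-2 (psi(p q^-1) - psi(p) + e sum_h w_h Z_h psi(p)); the contact structure of b
   is what produces these two.  Moving from p to p q^-1 along flows of horizontal
   fields (the vertical component being a commutator of flows of X_1 and Y_1), the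
   fundamental theorem of calculus for weak horizontal derivatives bounds both
   quotients by translates of |Z_i Z_j psi|, and L^1-continuity of translations
   together with the Hoelder inequality lets them converge, against |u|, to first-
   and second-order Taylor terms Phi_0(p, w).  Integration by parts in w turns
   the integral of Phi_0(p, .) into - u(p) (div b - sum_h sign_h Z_h Z_{dual_h} psi
   - [X_1, Y_1] psi)(p) = 0.  Hence C^1_e is bounded by the integral of
   |Phi_e - Phi_0|, which tends to 0 at a.e. time and is dominated by the
   W^{2,s'} norm of psi; dominated convergence in time concludes.  The term C^2_e
   is a translation difference of c against u, treated the same way. *)

(** * Lebesgue measure on row vectors *)

(** Second-order horizontal regularity suffices because of the two frames: at w, the left field Z_h
    minus the right one is 4 sign_h w_{dual h} T. Summed against the horizontal components of b,
    these terms supply the first-order part that - 4 psi T lacks, so the singular factor e^-2 meets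
    a Taylor remainder. T psi is not among the data; it appears as - [X_1, Y_1] psi / 4, recovered
    weakly by expanding psi along a commutator path.

    The exponents 1 and +oo obstruct translating in L^s or L^{s'}. As rho has compact support, u may
    be cut off to a large box, and then lies in L^1 as well as in L^s. Now u converges in L^1 under
    translation, its partner is split into a bounded part and a part small in L^{s'}, and
    differences of the partner are moved onto u and onto the integrable product. All s in [1, +oo]
    are treated alike.

    Measurability of the commutator in p and in time is never established: it is only compared from
    above with integrals of measurable kernels, since the integral of nonnegative functions is
    monotone in general. *)

Section rV_borel.
Context {R : realType} {m : nat}.
Implicit Types (v c : 'rV[R]_m).

Definition rV_box (r : R) : set 'rV[R]_m :=
  [set v | forall i, `|v ord0 i| <= r].

Lemma measurable_coord_preimage (i : 'I_m) (A : set R) :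
  measurable A -> measurable [set v : 'rV[R]_m | A (v ord0 i)].
Proof.
move=> mA; have := measurable_coord_rV i measurableT mA.
by rewrite setTI.
Qed.

Lemma measurable_forall_coord (A : 'I_m -> set R) :
  (forall i, measurable (A i)) ->
  measurable [set v : 'rV[R]_m | forall i, A i (v ord0 i)].
Proof.
move=> mA.
have -> : [set v : 'rV[R]_m | forall i, A i (v ord0 i)] =
    \bigcap_(i in setT) [set v | A i (v ord0 i)].
  apply/seteqP; split => v /= h i => [_|]; [exact: h|exact: (h i I)].
apply: fin_bigcap_measurable => //.
by move=> i _; exact: measurable_coord_preimage.
Qed.

Lemma measurable_rV_box (r : R) : measurable (rV_box r).
Proof.
apply: (@measurable_forall_coord (fun=> [set x : R | `|x| <= r])) => _.
rewrite (_ : [set x : R | _] = `[- r, r]%classic) //.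
by apply/seteqP; split => x /=; rewrite in_itv/= ler_norml.
Qed.

Lemma le_rV_box (r r' : R) : r <= r' -> rV_box r `<=` rV_box r'.
Proof. by move=> rr' v vr i; exact: le_trans (vr i) rr'. Qed.

(** The sigma-algebra is generated by the coordinates. By density of the rationals an open set is
    the countable union of the rational boxes it contains, and a box is a finite intersection of
    coordinate preimages. *)
Lemma open_measurable_rV (U : set 'rV[R]_m) : open U -> measurable U.
Proof.
move=> oU.
pose B (c : 'rV[rat]_m * rat) : set 'rV[R]_m :=
  [set v | forall i, `|v ord0 i - ratr (c.1 ord0 i)| < ratr c.2].
have -> : U = \bigcup_(c in [set c | B c `<=` U]) B c.
  apply/seteqP; split => [v Uv|v [c /= + Bv]]; last exact.
  have := oU _ Uv => /nbhs_ballP[e /= e0 evU].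
  have [q] : exists q : rat, ratr q \in `](0 : R), (e / 2)[.
    by apply: rat_in_itvoo; rewrite divr_gt0.
  rewrite in_itv/= => /andP[q0 qe].
  have /choice[c Hc] : forall i : 'I_m, exists a : rat,
      `|v ord0 i - ratr a| < ratr q.
    move=> i; have [a] : exists a : rat,
        ratr a \in `](v ord0 i - ratr q), (v ord0 i + ratr q)[.
      by apply: rat_in_itvoo; lra.
    by rewrite in_itv/= => /andP[? ?]; exists a; rewrite ltr_norml; lra.
  exists (\row_i c i, q) => /=; last by move=> i; rewrite mxE.
  move=> w wB; apply: evU; split => // i j; rewrite ord1.
  rewrite /ball/=; have := wB j; rewrite /= mxE; have := Hc j.
  rewrite !ltr_norml => /andP[? ?] /andP[? ?]; lra.
rewrite bigcup_mkcond; apply: countable_bigcupT_measurable => // c.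
case: ifPn => // _.
apply: (@measurable_forall_coord
  (fun i => [set x : R | `|x - ratr (c.1 ord0 i)| < ratr c.2])) => i.
rewrite (_ : [set x : R | _] =
  `](ratr (c.1 ord0 i) - ratr c.2), (ratr (c.1 ord0 i) + ratr c.2)[%classic) //.
by apply/seteqP; split => x /=; rewrite in_itv/= ltr_norml => /andP[? ?];
  apply/andP; split; lra.
Qed.

Lemma continuous_measurable_rV (f : 'rV[R]_m -> R) :
  continuous f -> measurable_fun setT f.
Proof.
move=> /continuousP cf.
apply: (measurability _ (measurable_realfun.RGenOpens.measurableE R)).
move=> _ -[_ [a [b ->] <-]]; rewrite setTI.
by apply: open_measurable_rV; exact/cf/interval_open.
Qed.

Lemma compact_rV_box (K : set 'rV[R]_m) : compact K ->
  exists2 r : R, 0 < r & K `<=` rV_box r.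
Proof.
move=> /compact_bounded[M [_ KM]].
exists (`|M| + 1) => [|v Kv i]; first by rewrite ltr_wpDl.
have := KM (`|M| + 1); rewrite (le_lt_trans (ler_norm _)) ?ltrDl// => /(_ isT).
move=> /(_ _ Kv) /=; apply: le_trans.
have /mapP[j Hj ->] : `|v ord0 i| \in [seq `|v x.1 x.2| | x : 'I_1 * 'I_m].
  by apply/mapP; exists (ord0, i) => //=; rewrite mem_enum.
by rewrite [leRHS]/Num.norm /= mx_normrE; apply/bigmax_geP; right => /=; exists j.
Qed.

Lemma rV_box_compact (r : R) : compact (rV_box r).
Proof.
rewrite (_ : rV_box r =
  [set v : 'rV[R]_m | forall i, v ord0 i \in `[- r, r]]); last first.
  by apply/seteqP; split => v /= h i; move: (h i); rewrite in_itv/= ler_norml.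
apply: (@rV_compact _ _ (fun=> `[- r, r]%classic)).
by move=> _; apply: segment_compact.
Qed.

End rV_borel.

Lemma lebesgue_rVS (R : realType) m (A : set 'rV[R]_m.+1) :
  lebesgue_rV R m.+1 A =
  (lebesgue_rV R m \x @lebesgue_measure R)%E (@rV_cons R m @^-1` A).
Proof. by []. Qed.

Lemma rV_cons0 (R : realType) m (z : 'rV[R]_m * R) : rV_cons z ord0 ord0 = z.2.
Proof.
rewrite /rV_cons (_ : ord0 = lshift m ord0 :> 'I_(1 + m)); last exact: val_inj.
by rewrite (@row_mxEl _ _ 1 m) mxE.
Qed.

Lemma rV_cons_lift (R : realType) m (z : 'rV[R]_m * R) (i : 'I_m) :
  rV_cons z ord0 (lift ord0 i) = z.1 ord0 i.
Proof.
rewrite /rV_cons (_ : lift ord0 i = rshift 1 i :> 'I_(1 + m)); last first.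
  exact: val_inj.
by rewrite (@row_mxEr _ _ 1 m).
Qed.

Lemma lebesgue_rV_box (R : realType) m (r : R) :
  (lebesgue_rV R m (rV_box r) < +oo)%E.
Proof.
elim: m => [|m IH].
  by rewrite /= diracE; case: (_ \in _); rewrite ltry.
have -> : lebesgue_rV R m.+1 (rV_box r) =
    (lebesgue_rV R m (rV_box r) * lebesgue_measure `[(- r)%R, r])%E.
  rewrite lebesgue_rVS -product_measure1E//; last exact: measurable_rV_box.
  congr (_ _); apply/seteqP; split => [z /= zr|z /= [z1 z2] i].
    split; last by have := zr ord0; rewrite rV_cons0 in_itv/= ler_norml.
    by move=> i; have := zr (lift ord0 i); rewrite rV_cons_lift.
  case: (unliftP ord0 i) => [j ->|->]; first by rewrite rV_cons_lift.
  by rewrite rV_cons0 ler_norml; move: z2; rewrite in_itv.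
rewrite lte_mul_pinfty//; last first.
  by rewrite lebesgue_measure_itv/=; case: ifPn => _; rewrite ?ltry// -EFinD ltry.
by rewrite ge0_fin_numE.
Qed.

Lemma bigcup_rV_box (R : realType) m :
  \bigcup_k rV_box (k%:R : R) = [set: 'rV[R]_m].
Proof.
apply/seteqP; split => // v _.
pose M := (\big[Order.max/0]_(i < m) `|v ord0 i|).
exists (Num.truncn M).+1 => // i; apply: ltW.
apply: le_lt_trans (truncnS_gt _).
by rewrite /M; apply: (le_bigmax_cond _ (fun i => `|v ord0 i|)).
Qed.

Lemma sigma_finite_lebesgue_rV (R : realType) m :
  sigma_finite [set: 'rV[R]_m] (lebesgue_rV R m).
Proof.
exists (fun k => rV_box (k%:R : R)); first by rewrite bigcup_rV_box.
by move=> i; split; [exact: measurable_rV_box|exact: lebesgue_rV_box].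
Qed.

(** A copy of [mu] that carries a proof of sigma-finiteness as a structure, so that Fubini and
    Tonelli accept [lebesgue_rV], for which this property is a lemma obtained by exhausting the
    space with boxes. *)
Definition sigma_finite_alias d (T : measurableType d) (R : realType)
  (mu : {measure set T -> \bar R}) of sigma_finite setT mu :
  set T -> \bar R := mu.

HB.instance Definition _ d (T : measurableType d) (R : realType)
    (mu : {measure set T -> \bar R}) (sf : sigma_finite setT mu) :=
  Measure.copy (sigma_finite_alias sf) mu.

HB.instance Definition _ d (T : measurableType d) (R : realType)
    (mu : {measure set T -> \bar R}) (sf : sigma_finite setT mu) :=
  Measure_isSigmaFinite.Build _ _ _ (sigma_finite_alias sf) sf.

Section sigma_finite_tonelli.
Local Open Scope ereal_scope.
Context d1 d2 (T1 : measurableType d1) (T2 : measurableType d2) (R : realType).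
Variables (m1 : {measure set T1 -> \bar R}) (m2 : {measure set T2 -> \bar R}).
Variable f : T1 * T2 -> \bar R.
Hypotheses (mf : measurable_fun setT f) (f0 : forall z, 0 <= f z).

Lemma measurable_integral_snd : sigma_finite setT m2 ->
  measurable_fun setT (fun x => \int[m2]_y f (x, y)).
Proof.
move=> sf2.
exact: (@measurable_fun_fubini_tonelli_F _ _ T1 T2 R (sigma_finite_alias sf2) f mf f0).
Qed.

Lemma sigma_finite_tonelli : sigma_finite setT m1 -> sigma_finite setT m2 ->
  \int[m1]_x \int[m2]_y f (x, y) = \int[m2]_y \int[m1]_x f (x, y).
Proof.
move=> sf1 sf2.
exact: (@fubini_tonelli _ _ T1 T2 R (sigma_finite_alias sf1) (sigma_finite_alias sf2)
  f mf f0).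
Qed.

End sigma_finite_tonelli.

(** * Fubini in one coordinate and elementary changes of variables *)

Section coordinate_fubini.
Context {R : realType}.
Local Open Scope ereal_scope.

(** [lebesgue_rV] is built along the first coordinate, while shears and dilations act along an
    arbitrary one; every coordinate must be able to serve as the inner variable of integration. *)
Definition insert_coord m (k : 'I_m.+1) (z : 'rV[R]_m * R) : 'rV[R]_m.+1 :=
  \row_i (if unlift k i is Some j then z.1 ord0 j else z.2).

Lemma insert_coord0 m : @insert_coord m ord0 = @rV_cons R m.
Proof.
apply/funext => z; apply/rowP => i; rewrite mxE.
by case: (unliftP ord0 i) => [j ->|->]; rewrite ?rV_cons_lift ?rV_cons0.
Qed.

Lemma measurable_insert_coord m (k : 'I_m.+1) :
  measurable_fun [set: 'rV[R]_m * R] (insert_coord k).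
Proof.
apply: measurable_fun_rV => i.
under eq_fun do rewrite mxE.
case: (unlift k i) => [j|]; last exact: measurable_snd.
exact: measurableT_comp (measurable_coord_rV j) measurable_fst.
Qed.

Lemma insert_coord_lift m (k : 'I_m.+1) (v : 'rV[R]_m) (s t : R) :
  insert_coord (lift ord0 k) (rV_cons (v, s), t) = rV_cons (insert_coord k (v, t), s).
Proof.
apply/rowP => i; rewrite mxE.
case: (unliftP ord0 i) => [i' ->|->].
  rewrite rV_cons_lift mxE; case: (unliftP k i') => [j ->|->].
    have -> : lift ord0 (lift k j) = lift (lift ord0 k) (lift ord0 j).
      by apply: val_inj => /=; rewrite /bump/= !add1n ltnS addnS.
    by rewrite liftK rV_cons_lift.
  by rewrite unlift_none.
rewrite rV_cons0.
have -> : ord0 = lift (lift ord0 k) ord0 :> 'I_m.+2 by exact: val_inj.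
by rewrite liftK rV_cons0.
Qed.

Lemma integral_lebesgue_rVS m (f : 'rV[R]_m.+1 -> \bar R) :
  measurable_fun setT f -> (forall v, 0 <= f v) ->
  \int[lebesgue_rV R m.+1]_v f v =
  \int[lebesgue_rV R m]_v \int[lebesgue_measure]_s f (rV_cons (v, s)).
Proof.
move=> mf f0.
have mf' : measurable_fun setT (fun z => f (rV_cons z)).
  exact: measurableT_comp mf (@measurable_rV_cons R m).
rewrite [LHS](_ : _ =
  \int[pushforward (lebesgue_rV R m \x @lebesgue_measure R) (@rV_cons R m)]_v f v)//.
rewrite ge0_integral_pushforward//; last exact: measurable_rV_cons.
rewrite preimage_setT.
exact: (@fubini_tonelli1 _ _ _ _ R
  (sigma_finite_alias (sigma_finite_lebesgue_rV R m)) lebesgue_measure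
  (fun z => f (rV_cons z)) mf' (fun z => f0 _)).
Qed.

(** Induction on the dimension: the first coordinate is split off on both sides, the induction
    hypothesis isolates coordinate [k] among the others, and Tonelli exchanges the one-dimensional
    integrals with the rest. *)
Lemma integral_insert_coord m (k : 'I_m.+1) (f : 'rV[R]_m.+1 -> \bar R) :
  measurable_fun setT f -> (forall v, 0 <= f v) ->
  \int[lebesgue_rV R m.+1]_v f v =
  \int[lebesgue_rV R m]_v \int[lebesgue_measure]_s f (insert_coord k (v, s)).
Proof.
elim: m k f => [|m IH] k f mf f0.
  by rewrite ord1 insert_coord0; exact: integral_lebesgue_rVS.
apply: (etrans (integral_lebesgue_rVS mf f0)).
case: (unliftP ord0 k) => [j ->|->]; last by rewrite insert_coord0.
have mcons : measurable_fun setT (fun z => f (rV_cons z)).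
  exact: measurableT_comp mf (@measurable_rV_cons R m.+1).
rewrite (@sigma_finite_tonelli _ _ _ _ R (lebesgue_rV R m.+1) lebesgue_measure
  (fun z => f (rV_cons z)))//; last 2 first.
- exact: sigma_finite_lebesgue_rV.
- exact: sigma_finiteT.
have mins : measurable_fun setT (fun z => f (insert_coord (lift ord0 j) z)).
  exact: measurableT_comp mf (@measurable_insert_coord _ _).
apply/esym; apply: (etrans (integral_lebesgue_rVS _ _)).
  exact: (@measurable_fun_fubini_tonelli_F _ _ _ _ R lebesgue_measure
    (fun z => f (insert_coord (lift ord0 j) z))).
  by move=> v; apply: integral_ge0.
have mrow : measurable_fun setT
    (fun z : ('rV[R]_m * R) * R => f (rV_cons (insert_coord j (z.1.1, z.2), z.1.2))).
  apply: (measurableT_comp mcons).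
  apply: measurable_fun_pair; last first.
    exact: measurableT_comp measurable_snd measurable_fst.
  apply: (measurableT_comp (measurable_insert_coord j)).
  apply: measurable_fun_pair; last exact: measurable_snd.
  exact: measurableT_comp measurable_fst measurable_fst.
have E z s : f (insert_coord (lift ord0 j) (rV_cons z, s)) =
    f (rV_cons (insert_coord j (z.1, s), z.2)).
  by rewrite {1}(surjective_pairing z) insert_coord_lift.
rewrite (@sigma_finite_tonelli _ _ _ _ R (lebesgue_rV R m) lebesgue_measure
  (fun z => \int[lebesgue_measure]_s f (insert_coord (lift ord0 j) (rV_cons z, s))))//; last 4 first.
- under eq_fun do under eq_integral do rewrite E.
  exact: (@measurable_fun_fubini_tonelli_F _ _ _ _ R lebesgue_measure _ mrow).
- by move=> z; exact: integral_ge0.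
- exact: sigma_finite_lebesgue_rV.
- exact: sigma_finiteT.
apply: eq_integral => s _; apply/esym.
apply: (etrans (IH j _ _ _)) => //.
  by apply: (measurableT_comp mcons); exact: measurable_pair2.
by apply: eq_integral => v _; apply: eq_integral => t _; rewrite insert_coord_lift.
Qed.

End coordinate_fubini.

Section affine_line.
Context {R : realType}.
Local Open Scope ereal_scope.

Lemma measurable_affine (a b : R) :
  measurable_fun [set: R] (fun s => a * s + b)%R.
Proof. by apply: measurable_funD => //; apply: measurable_funM. Qed.

(** The pushforward of Lebesgue measure, multiplied by a, has the right values on half-open
    intervals, so uniqueness of Lebesgue measure applies. *)
Lemma lebesgue_measure_affine (a b : R) (A : set R) : (0 < a)%R -> measurable A ->
  lebesgue_measure A =
  a%:E * lebesgue_measure ((fun s => a * s + b)%R @^-1` A).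
Proof.
move=> a0 mA.
have maff := measurable_affine a b.
apply: (@lebesgue_measure_unique R (mscale (NngNum (ltW a0)) (pushforward lebesgue_measure
    ((fun s => a * s + b)%R : measurableTypeR R -> measurableTypeR R))) _ A mA).
move=> X [[x y]] _ <-; pose L : set R -> \bar R := lebesgue_measure.
rewrite -[RHS]/(a%:E * L ((fun s => a * s + b)%R @^-1` `]x, y]%classic)).
have -> : (fun s => a * s + b)%R @^-1` `]x, y]%classic =
    `]((x - b) / a)%R, ((y - b) / a)%R]%classic.
  apply/seteqP; split => s /=; rewrite !in_itv/=;
  by rewrite ltr_pdivrMr// ler_pdivlMr// (mulrC s) ltrBlDr lerBrDr.
rewrite /L !lebesgue_measure_itv/= !lte_fin ltr_pM2r ?invr_gt0// ltrD2r.
case: ifPn => // xy; last by rewrite mule0.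
rewrite -!EFinB -EFinM; congr EFin.
by field; rewrite gt_eqF.
Qed.

Lemma integral_affine (a b : R) (F : R -> \bar R) : (0 < a)%R ->
  measurable_fun setT F -> (forall s, 0 <= F s) ->
  \int[lebesgue_measure]_s F (a * s + b)%R =
  (a^-1)%:E * \int[lebesgue_measure]_s F s.
Proof.
move=> a0 mF F0.
have maff := measurable_affine a b.
transitivity (\int[pushforward lebesgue_measure
    ((fun s => a * s + b)%R : measurableTypeR R -> measurableTypeR R)]_s F s).
  by rewrite ge0_integral_pushforward.
rewrite [in RHS](@eq_measure_integral _ _ _ _
  (mscale (NngNum (ltW a0)) (pushforward lebesgue_measure
    ((fun s => a * s + b)%R : measurableTypeR R -> measurableTypeR R)))).
  by rewrite ge0_integral_mscale//= muleA -EFinM mulVf ?mul1e// gt_eqF.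
by move=> A mA _; exact: (lebesgue_measure_affine b a0 mA).
Qed.

End affine_line.

Section coordinate_affine.
Context {R : realType}.
Local Open Scope ereal_scope.

Lemma measurable_rV_update m (k : 'I_m) (h : 'rV[R]_m -> R) :
  measurable_fun setT h -> measurable_fun setT (fun v : 'rV[R]_m => v + h v *: basis_rV k)%R.
Proof.
move=> mh; apply: measurable_fun_rV => i.
under eq_fun do rewrite !mxE.
apply: measurable_funD; first exact: measurable_coord_rV.
by apply: measurable_funM.
Qed.

(** The map replaces v_k by a v_k + g(v), with g constant along the lines in direction k, so on each
    such line it is a one-dimensional affine map. Shears, translations and anisotropic dilations are
    compositions of maps of this kind. *)
Lemma integral_coord_affine m (k : 'I_m) (a : R) (g : 'rV[R]_m -> R)
    (f : 'rV[R]_m -> \bar R) :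
  (0 < a)%R -> measurable_fun setT g ->
  (forall v s, g (v + s *: basis_rV k)%R = g v) ->
  measurable_fun setT f -> (forall v, 0 <= f v) ->
  \int[lebesgue_rV R m]_v
    f (v + ((a - 1) * v ord0 k + g v) *: basis_rV k)%R =
  (a^-1)%:E * \int[lebesgue_rV R m]_v f v.
Proof.
case: m k g f => [[]//|m] k g f a0 mg gk mf f0.
have mf' : measurable_fun setT
    (fun v : 'rV[R]_m.+1 => f (v + ((a - 1) * v ord0 k + g v) *: basis_rV k)%R).
  apply: (measurableT_comp mf); apply: measurable_rV_update.
  apply: measurable_funD => //; apply: measurable_funM => //.
  exact: measurable_coord_rV.
apply: etrans (integral_insert_coord k mf' _) _ => //.
rewrite (integral_insert_coord k mf f0) -ge0_integralZl//; last 3 first.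
- exact: (@measurable_integral_snd _ _ _ _ R lebesgue_measure
    (fun z => f (insert_coord k z)) (measurableT_comp mf (measurable_insert_coord k))
    (fun=> f0 _) (@sigma_finiteT _ _ _ lebesgue_measure)).
- by move=> v _; apply: integral_ge0.
- by rewrite lee_fin invr_ge0 ltW.
apply: eq_integral => v _.
have mfv : measurable_fun setT (fun s => f (insert_coord k (v, s))).
  apply: (measurableT_comp mf); apply: (measurableT_comp (measurable_insert_coord k)).
  exact: measurable_pair1.
rewrite -(integral_affine (g (insert_coord k (v, 0%R))) a0 mfv)//.
apply: eq_integral => s _; congr (f _); apply/rowP => i.
have insE t : insert_coord k (v, t) = (insert_coord k (v, 0) + t *: basis_rV k)%R.
  apply/rowP => j; rewrite !mxE eqxx/=.
  by case: (unliftP k j) => [j' ->|->]; rewrite ?eqxx/= ?lift_eqF ?mulr0 ?mulr1 ?addr0 ?add0r.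
rewrite [in LHS]insE [in g _]insE gk [in RHS]insE.
rewrite !mxE scale0r addr0 !eqxx unlift_none/=.
by case: (unliftP k i) => [j' ->|->]; rewrite ?eqxx/= ?lift_eqF/=; ring.
Qed.

Lemma integral_shear m (k : 'I_m) (g : 'rV[R]_m -> R) (f : 'rV[R]_m -> \bar R) :
  measurable_fun setT g -> (forall v s, g (v + s *: basis_rV k)%R = g v) ->
  measurable_fun setT f -> (forall v, 0 <= f v) ->
  \int[lebesgue_rV R m]_v f (v + g v *: basis_rV k)%R = \int[lebesgue_rV R m]_v f v.
Proof.
move=> mg gk mf f0.
have := integral_coord_affine ltr01 mg gk mf f0.
rewrite invr1 mul1e => <-; apply: eq_integral => v _.
by rewrite subrr mul0r add0r.
Qed.

Lemma integral_translate m (a : 'rV[R]_m) (f : 'rV[R]_m -> \bar R) :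
  measurable_fun setT f -> (forall v, 0 <= f v) ->
  \int[lebesgue_rV R m]_v f (v + a)%R = \int[lebesgue_rV R m]_v f v.
Proof.
move=> mf f0.
have madd b : measurable_fun setT (fun v : 'rV[R]_m => v + b)%R.
  apply: measurable_fun_rV => i; under eq_fun do rewrite mxE.
  by apply: measurable_funD => //; exact: measurable_coord_rV.
suff h (s : seq 'I_m) : \int[lebesgue_rV R m]_v
    f (v + \sum_(i <- s) a ord0 i *: basis_rV i)%R = \int[lebesgue_rV R m]_v f v.
  rewrite -[RHS](h (index_enum 'I_m)); apply: eq_integral => v _.
  by rewrite [in LHS](row_sum_delta a).
elim: s => [|i s IH]; first by apply: eq_integral => v _; rewrite big_nil addr0.
rewrite -IH; have mfs := measurableT_comp mf (madd (\sum_(i <- s) a ord0 i *: basis_rV i)%R).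
have := @integral_shear m i (cst (a ord0 i)) _ (measurable_cst _) _ mfs => /= <- //.
by apply: eq_integral => v _; rewrite big_cons addrA.
Qed.

Lemma integral_coord_scale m (l : 'I_m -> R) (f : 'rV[R]_m -> \bar R) :
  (forall i, 0 < l i)%R ->
  measurable_fun setT f -> (forall v, 0 <= f v) ->
  \int[lebesgue_rV R m]_v f (\row_i (l i * v ord0 i))%R =
  (\prod_i (l i)^-1)%:E * \int[lebesgue_rV R m]_v f v.
Proof.
move=> l0 mf f0.
(* Only the coordinates listed in [s] are rescaled; adding an index composes with a dilation in one
   coordinate. *)
pose S (s : seq 'I_m) (v : 'rV[R]_m) : 'rV[R]_m :=
  \row_i ((if i \in s then l i else 1) * v ord0 i)%R.
have mS s : measurable_fun setT (S s).
  apply: measurable_fun_rV => i; under eq_fun do rewrite mxE.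
  by apply: measurable_funM => //; exact: measurable_coord_rV.
suff h (s : seq 'I_m) : uniq s -> \int[lebesgue_rV R m]_v f (S s v) =
   (\prod_(i <- s) (l i)^-1)%:E * \int[lebesgue_rV R m]_v f v.
  rewrite -h ?index_enum_uniq//; apply: eq_integral => v _; congr f.
  by apply/rowP => i; rewrite !mxE mem_index_enum.
elim: s => [_|i s IH /=]; [| move=> /andP[Nis us]].
  rewrite big_nil mul1e; apply: eq_integral => v _; congr f.
  by apply/rowP => i; rewrite mxE in_nil mul1r.
rewrite big_cons EFinM -muleA -IH//.
rewrite -(@integral_coord_affine m i (l i) (cst 0%R))//; last first.
  exact: measurableT_comp mf (mS s).
apply: eq_integral => v _; congr f.
apply/rowP => j; rewrite !mxE eqxx/= in_cons.
by case: eqVneq => [->|ji]/=; rewrite ?(negbTE Nis); [ring|rewrite mulr0 addr0].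
Qed.

End coordinate_affine.

(** * The Heisenberg group *)

Section heisenberg_group.
Context {R : realType} {n : nat}.
Local Notation H := (heis R n).
Implicit Types (p q a : H).

Lemma rV_ext m (u v : 'rV[R]_m) : (forall i, u ord0 i = v ord0 i) -> u = v.
Proof. by move=> uv; apply/rowP => i; exact: uv. Qed.

Lemma rVDE m (u v : 'rV[R]_m) i : (u + v) ord0 i = u ord0 i + v ord0 i.
Proof. by rewrite mxE. Qed.

Lemma rVNE m (u : 'rV[R]_m) i : (- u) ord0 i = - u ord0 i.
Proof. by rewrite mxE. Qed.

Lemma rVZE m (s : R) (u : 'rV[R]_m) i : (s *: u) ord0 i = s * u ord0 i.
Proof. by rewrite mxE. Qed.

Lemma basis_rVE m (k i : 'I_m) : (basis_rV k : 'rV[R]_m) ord0 i = (i == k)%:R.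
Proof. by rewrite mxE. Qed.

Definition rVE := (rVDE, rVNE, rVZE, basis_rVE).

Lemma idx_ind (P : 'I_(n + n + 1) -> Prop) :
  (forall j, P (idx_x j)) -> (forall j, P (idx_y j)) -> P idx_t -> forall k, P k.
Proof.
move=> Px Py Pt k; case: (split_ordP k) => [h ->|i ->]; last by rewrite ord1.
by case: (split_ordP h) => j ->; [exact: Px|exact: Py].
Qed.

Lemma split_idx_h (h : 'I_(n + n)) : fintype.split (idx_h h) = inl h.
Proof. exact: (unsplitK (inl h : 'I_(n + n) + 'I_1)). Qed.

Lemma split_idx_t : fintype.split (@idx_t n) = inr ord0.
Proof. exact: (unsplitK (inr ord0 : 'I_(n + n) + 'I_1)). Qed.

Lemma split_lshift_n (j : 'I_n) : fintype.split (lshift n j) = inl j.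
Proof. exact: (unsplitK (inl j : 'I_n + 'I_n)). Qed.

Lemma split_rshift_n (j : 'I_n) : fintype.split (rshift n j) = inr j.
Proof. exact: (unsplitK (inr j : 'I_n + 'I_n)). Qed.

Lemma field_frame_x (s : R) (j : 'I_n) p : field_frame s (idx_x j) p =
  basis_rV (idx_x j) + (2 * s * ypart p ord0 j) *: basis_rV idx_t.
Proof. by rewrite /field_frame (split_idx_h (lshift n j)) split_lshift_n. Qed.

Lemma field_frame_y (s : R) (j : 'I_n) p : field_frame s (idx_y j) p =
  basis_rV (idx_y j) - (2 * s * xpart p ord0 j) *: basis_rV idx_t.
Proof. by rewrite /field_frame (split_idx_h (rshift n j)) split_rshift_n. Qed.

Lemma field_frame_t (s : R) p : field_frame s idx_t p = basis_rV idx_t.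
Proof. by rewrite /field_frame split_idx_t. Qed.

Lemma xpartE p (j : 'I_n) : xpart p ord0 j = p ord0 (idx_x j).
Proof. by rewrite !mxE. Qed.

Lemma ypartE p (j : 'I_n) : ypart p ord0 j = p ord0 (idx_y j).
Proof. by rewrite !mxE. Qed.

Lemma idx_xx (i j : 'I_n) : (idx_x i == idx_x j) = (i == j).
Proof. by rewrite /idx_x !eq_lshift. Qed.

Lemma idx_yy (i j : 'I_n) : (idx_y i == idx_y j) = (i == j).
Proof. by rewrite /idx_y eq_lshift eq_rshift. Qed.

Lemma idx_xy (i j : 'I_n) : (idx_x i == idx_y j) = false.
Proof. by rewrite /idx_x /idx_y eq_lshift eq_lrshift. Qed.

Lemma idx_yx (i j : 'I_n) : (idx_y i == idx_x j) = false.
Proof. by rewrite eq_sym idx_xy. Qed.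

(** The symplectic form omega of the group law, which reads p + q + 2 omega(p, q) e_t; bilinearity,
    antisymmetry and the vanishing of omega on e_t give the group identities. *)
Definition heis_form p q : R :=
  \sum_(j < n) (q ord0 (idx_x j) * p ord0 (idx_y j)
                - p ord0 (idx_x j) * q ord0 (idx_y j)).

Lemma heis_mulE p q : heis_mul p q = p + q + (2 * heis_form p q) *: basis_rV idx_t.
Proof.
have fE : \sum_(j < n) (xpart q ord0 j * ypart p ord0 j
                       - xpart p ord0 j * ypart q ord0 j) = heis_form p q.
  by apply: eq_bigr => j _; rewrite !xpartE !ypartE.
rewrite /heis_mul fE; apply: rV_ext; apply: idx_ind => [j|j|]; rewrite /heis_pt.
- rewrite (@row_mxEl _ _ (n + n) 1 _ _ ord0 (lshift n j)) row_mxEl !mxE eqxx/=.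
  by rewrite (_ : idx_x j == idx_t = false) ?mulr0 ?addr0// eq_lrshift.
- rewrite (@row_mxEl _ _ (n + n) 1 _ _ ord0 (rshift n j)) row_mxEr !mxE eqxx/=.
  by rewrite (_ : idx_y j == idx_t = false) ?mulr0 ?addr0// eq_lrshift.
- by rewrite (@row_mxEr _ _ (n + n) 1 _ _ ord0 ord0) !mxE !eqxx mulr1.
Qed.

Lemma basis_rV_h (h : 'I_(n + n)) : (basis_rV idx_t : H) ord0 (idx_h h) = 0.
Proof. by rewrite mxE eqxx/= /idx_h /idx_t eq_lrshift. Qed.

Lemma basis_rV_t : (basis_rV idx_t : H) ord0 idx_t = 1.
Proof. by rewrite mxE !eqxx. Qed.

Lemma heis_mul_h p q (h : 'I_(n + n)) :
  heis_mul p q ord0 (idx_h h) = p ord0 (idx_h h) + q ord0 (idx_h h).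
Proof. by rewrite heis_mulE !rVDE rVZE basis_rV_h mulr0 addr0. Qed.

Lemma heis_mul_t p q :
  heis_mul p q ord0 idx_t = p ord0 idx_t + q ord0 idx_t + 2 * heis_form p q.
Proof. by rewrite heis_mulE !rVDE rVZE basis_rV_t mulr1. Qed.

Lemma heis_formDl p p' q : heis_form (p + p') q = heis_form p q + heis_form p' q.
Proof. by rewrite /heis_form -big_split; apply: eq_bigr => j _ /=; rewrite !rVE; ring. Qed.

Lemma heis_formDr p q q' : heis_form p (q + q') = heis_form p q + heis_form p q'.
Proof. by rewrite /heis_form -big_split; apply: eq_bigr => j _ /=; rewrite !rVE; ring. Qed.

Lemma heis_formZl s p q : heis_form (s *: p) q = s * heis_form p q.
Proof. by rewrite /heis_form mulr_sumr; apply: eq_bigr => j _; rewrite !rVE; ring. Qed.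

Lemma heis_formZr s p q : heis_form p (s *: q) = s * heis_form p q.
Proof. by rewrite /heis_form mulr_sumr; apply: eq_bigr => j _; rewrite !rVE; ring. Qed.

Lemma heis_form_tl q : heis_form (basis_rV idx_t) q = 0.
Proof.
apply: big1 => j _.
by rewrite !(basis_rV_h (lshift n j), basis_rV_h (rshift n j)); ring.
Qed.

Lemma heis_form_tr p : heis_form p (basis_rV idx_t) = 0.
Proof.
apply: big1 => j _.
by rewrite !(basis_rV_h (lshift n j), basis_rV_h (rshift n j)); ring.
Qed.

Lemma heis_formxx p : heis_form p p = 0.
Proof. by apply: big1 => j _; ring. Qed.

Lemma heis_formC p q : heis_form p q = - heis_form q p.
Proof. by rewrite /heis_form -sumrN; apply: eq_bigr => j _; ring. Qed.

Lemma heis_mulA : associative (@heis_mul R n).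
Proof.
move=> p q r; rewrite !heis_mulE !(heis_formDl, heis_formDr, heis_formZl, heis_formZr).
by rewrite heis_form_tl heis_form_tr; apply: rV_ext => i; rewrite !rVE; ring.
Qed.

Lemma heis_mul0 p : heis_mul p 0 = p.
Proof.
by rewrite heis_mulE -(scale0r (0 : H)) heis_formZr mul0r mulr0 !scale0r !addr0.
Qed.

Lemma heis_0mul p : heis_mul 0 p = p.
Proof.
by rewrite heis_mulE -(scale0r (0 : H)) heis_formZl mul0r mulr0 !scale0r addr0 add0r.
Qed.

Lemma heis_mulV p : heis_mul p (heis_inv p) = 0.
Proof.
rewrite heis_mulE /heis_inv -scaleN1r heis_formZr heis_formxx !mulr0 scale0r.
by rewrite scaleN1r subrr addr0.
Qed.

Lemma heis_Vmul p : heis_mul (heis_inv p) p = 0.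
Proof.
rewrite heis_mulE /heis_inv -scaleN1r heis_formZl heis_formxx !mulr0 scale0r.
by rewrite scaleN1r addNr addr0.
Qed.

(* [s *: basis_rV k] is exp(s Z_k), and both flows are straight lines. *)
Lemma heis_mul_exp (k : 'I_(n + n + 1)) p (s : R) :
  heis_mul p (s *: basis_rV k) = p + s *: Zleft k p.
Proof.
rewrite heis_mulE heis_formZr /Zleft.
have fx (j : 'I_n) : heis_form p (basis_rV (idx_x j)) = p ord0 (idx_y j).
  rewrite /heis_form (bigD1 j)//= big1 ?addr0; last first.
    by move=> i ij; rewrite !rVE idx_xx idx_yx (negbTE ij)/= !mulr0n; ring.
  by rewrite !rVE idx_xx idx_yx eqxx/= mulr0n mulr1n; ring.
have fy (j : 'I_n) : heis_form p (basis_rV (idx_y j)) = - p ord0 (idx_x j).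
  rewrite /heis_form (bigD1 j)//= big1 ?addr0; last first.
    by move=> i ij; rewrite !rVE idx_yy idx_xy (negbTE ij)/= !mulr0n; ring.
  by rewrite !rVE idx_yy idx_xy eqxx/= mulr0n mulr1n; ring.
rewrite -addrA; congr (p + _).
elim/idx_ind: k => [j|j|].
- rewrite field_frame_x fx ypartE scalerDr scalerA.
  by congr (_ + _ *: _); ring.
- rewrite field_frame_y fy xpartE scalerBr scalerA -scaleNr.
  by congr (_ + _ *: _); ring.
- by rewrite field_frame_t heis_form_tr !mulr0 scale0r addr0.
Qed.

Lemma heis_exp_mul (k : 'I_(n + n + 1)) p (s : R) :
  heis_mul (s *: basis_rV k) p = p + s *: Zright k p.
Proof.
have := heis_mul_exp k p s; rewrite !heis_mulE heis_formC -!addrA => /addrI.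
rewrite /Zright /Zleft addrCA => h.
congr (p + _); move: h; elim/idx_ind: k => [j|j|].
- rewrite !field_frame_x !scalerDr !scalerA => /addrI.
  rewrite mulrN scaleNr => /eqP; rewrite eqr_oppLR => /eqP ->.
  by congr (_ + _); rewrite -scaleNr; congr (_ *: _); ring.
- rewrite !field_frame_y !scalerBr !scalerA => /addrI.
  rewrite mulrN scaleNr => /eqP; rewrite eqr_opp => /eqP ->.
  by congr (_ + _); rewrite -scaleNr; congr (_ *: _); ring.
- by rewrite !field_frame_t heis_formZl heis_form_tl !mulr0 scale0r addr0.
Qed.

(** The field depends at most on the coordinate dual to k, which its own flow does not move. *)
Lemma field_frame_flow (r s : R) (k : 'I_(n + n + 1)) p :
  field_frame r k (p + s *: field_frame r k p) = field_frame r k p.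
Proof.
elim/idx_ind: k => [j|j|]; last by rewrite !field_frame_t.
- rewrite !field_frame_x !ypartE !rVE idx_yx (_ : idx_y j == idx_t = false).
    by rewrite !mulr0 addr0 mulr0 addr0.
  by rewrite /idx_y /idx_t eq_lrshift.
- rewrite !field_frame_y !xpartE !rVE idx_xy (_ : idx_x j == idx_t = false).
    by rewrite !mulr0 oppr0 addr0 mulr0 addr0.
  by rewrite /idx_x /idx_t eq_lrshift.
Qed.

Lemma heis_dil_h (l : R) p (h : 'I_(n + n)) :
  heis_dil l p ord0 (idx_h h) = l * p ord0 (idx_h h).
Proof.
rewrite /heis_dil /heis_pt /idx_h (@row_mxEl _ _ (n + n) 1).
by case: (split_ordP h) => j ->; rewrite ?row_mxEl ?row_mxEr !mxE.
Qed.

Lemma heis_dil_t (l : R) p : heis_dil l p ord0 idx_t = l ^+ 2 * p ord0 idx_t.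
Proof. by rewrite /heis_dil /heis_pt /idx_t (@row_mxEr _ _ (n + n) 1) mxE. Qed.

Lemma idx_ht (P : 'I_(n + n + 1) -> Prop) :
  (forall h, P (idx_h h)) -> P idx_t -> forall k, P k.
Proof. by move=> Ph Pt; apply: idx_ind => [j|j|//]; exact: Ph. Qed.

Lemma heis_dilM (l : R) p q :
  heis_dil l (heis_mul p q) = heis_mul (heis_dil l p) (heis_dil l q).
Proof.
apply: rV_ext; apply: idx_ht => [h|].
  by rewrite heis_mul_h !heis_dil_h heis_mul_h mulrDr.
rewrite heis_mul_t !heis_dil_t heis_mul_t.
rewrite (_ : heis_form (heis_dil l p) _ = l ^+ 2 * heis_form p q); first by ring.
rewrite /heis_form mulr_sumr; apply: eq_bigr => j _.
by rewrite !(heis_dil_h _ _ (lshift n j), heis_dil_h _ _ (rshift n j)); ring.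
Qed.

Lemma heis_dilV (l : R) p : heis_dil l (heis_inv p) = heis_inv (heis_dil l p).
Proof.
apply: rV_ext; apply: idx_ht => [h|]; rewrite /heis_inv rVNE ?heis_dil_h ?heis_dil_t;
by rewrite rVNE mulrN.
Qed.

Lemma heis_dilK (l : R) p : l != 0 -> heis_dil l^-1 (heis_dil l p) = p.
Proof.
move=> l0; apply: rV_ext; apply: idx_ht => [h|]; first by rewrite !heis_dil_h mulKf.
by rewrite !heis_dil_t exprVn mulKf// expf_neq0.
Qed.

Lemma heis_dil_exp (l s : R) (h : 'I_(n + n)) :
  heis_dil l (s *: basis_rV (idx_h h)) = (l * s) *: basis_rV (idx_h h).
Proof.
apply: rV_ext; apply: idx_ht => [h'|].
  by rewrite heis_dil_h !rVE mulrA.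
by rewrite heis_dil_t !rVE /idx_h /idx_t eq_rlshift !mulr0.
Qed.

Lemma heis_mulK p q : heis_mul (heis_mul p q) (heis_inv q) = p.
Proof. by rewrite -heis_mulA heis_mulV heis_mul0. Qed.

Lemma heis_mulVK p q : heis_mul (heis_mul p (heis_inv q)) q = p.
Proof. by rewrite -heis_mulA heis_Vmul heis_mul0. Qed.

Lemma heis_exp_inv (k : 'I_(n + n + 1)) (s : R) :
  heis_inv (s *: basis_rV k : H) = (- s) *: basis_rV k.
Proof. by rewrite /heis_inv scaleNr. Qed.

End heisenberg_group.

(** * Invariance and homogeneity of Lebesgue measure on the group *)

Section heisenberg_measure.
Context {R : realType} {n : nat}.
Local Notation H := (heis R n).
Local Notation mu := (@mu_heis R n).
Implicit Types (p q a : H).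

Lemma sigma_finite_heis : sigma_finite [set: H] mu.
Proof. exact: sigma_finite_lebesgue_rV. Qed.

Lemma measurable_rVD d (T : measurableType d) m (f g : T -> 'rV[R]_m) :
  measurable_fun setT f -> measurable_fun setT g ->
  measurable_fun setT (fun x => f x + g x).
Proof.
move=> mf mg; apply: measurable_fun_rV => i; under eq_fun do rewrite rVDE.
by apply: measurable_funD; apply: (measurableT_comp (measurable_coord_rV i)).
Qed.

Lemma measurable_rVZ d (T : measurableType d) m (f : T -> R) (g : T -> 'rV[R]_m) :
  measurable_fun setT f -> measurable_fun setT g ->
  measurable_fun setT (fun x => f x *: g x).
Proof.
move=> mf mg; apply: measurable_fun_rV => i; under eq_fun do rewrite rVZE.
by apply: measurable_funM => //; apply: (measurableT_comp (measurable_coord_rV i)).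
Qed.

Lemma measurable_rVN d (T : measurableType d) m (g : T -> 'rV[R]_m) :
  measurable_fun setT g -> measurable_fun setT (fun x => - g x).
Proof.
move=> mg; under eq_fun do rewrite -scaleN1r.
exact: measurable_rVZ (measurable_cst _) mg.
Qed.

Lemma measurable_heis_form d (T : measurableType d) (f g : T -> H) :
  measurable_fun setT f -> measurable_fun setT g ->
  measurable_fun setT (fun x => heis_form (f x) (g x)).
Proof.
move=> mf mg; apply: measurable_sum => j.
apply: measurable_funB; apply: measurable_funM;
exact: (measurableT_comp (measurable_coord_rV _)).
Qed.

Lemma measurable_heis_mul d (T : measurableType d) (f g : T -> H) :
  measurable_fun setT f -> measurable_fun setT g ->
  measurable_fun setT (fun x => heis_mul (f x) (g x)).
Proof.
move=> mf mg; under eq_fun do rewrite heis_mulE.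
apply: measurable_rVD; first exact: measurable_rVD.
apply: measurable_rVZ => //; apply: measurable_funM => //.
exact: measurable_heis_form.
Qed.

Lemma measurable_heis_inv d (T : measurableType d) (f : T -> H) :
  measurable_fun setT f -> measurable_fun setT (fun x => heis_inv (f x)).
Proof. exact: measurable_rVN. Qed.

Lemma measurable_heis_dil d (T : measurableType d) (l : T -> R) (f : T -> H) :
  measurable_fun setT l -> measurable_fun setT f ->
  measurable_fun setT (fun x => heis_dil (l x) (f x)).
Proof.
move=> ml mf; apply: measurable_fun_rV; apply: idx_ht => [h|].
  under eq_fun do rewrite heis_dil_h; apply: measurable_funM => //.
  exact: (measurableT_comp (measurable_coord_rV _)).
under eq_fun do rewrite heis_dil_t; apply: measurable_funM.
  by apply: measurable_funX.
exact: (measurableT_comp (measurable_coord_rV _)).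
Qed.

Lemma heis_form_shear p a s : heis_form (p + s *: basis_rV idx_t) a = heis_form p a.
Proof. by rewrite heis_formDl heis_formZl heis_form_tl mulr0 addr0. Qed.

(** A group translation is a Euclidean translation composed with a shear in t whose height does not
    depend on t; both preserve the measure. *)
Lemma integral_heis_mulr a (f : H -> \bar R) :
  measurable_fun setT f -> (forall p, 0 <= f p)%E ->
  (\int[mu]_p f (heis_mul p a) = \int[mu]_p f p)%E.
Proof.
move=> mf f0; rewrite /mu_heis -(integral_translate a mf f0).
rewrite -(@integral_shear R _ idx_t (fun p => 2 * heis_form p a)
  (fun p => f (p + a)))//.
- by apply: eq_integral => p _; rewrite heis_mulE addrAC.
- by apply: measurable_funM => //; exact: measurable_heis_form.
- by move=> v s; rewrite heis_form_shear.
- by apply: (measurableT_comp mf); exact: measurable_rVD.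
Qed.

Lemma integral_heis_mull a (f : H -> \bar R) :
  measurable_fun setT f -> (forall p, 0 <= f p)%E ->
  (\int[mu]_p f (heis_mul a p) = \int[mu]_p f p)%E.
Proof.
move=> mf f0; rewrite /mu_heis -(integral_translate a mf f0).
rewrite -(@integral_shear R _ idx_t (fun p => 2 * heis_form a p)
  (fun p => f (p + a)))//.
- by apply: eq_integral => p _; rewrite heis_mulE (addrC a) addrAC.
- by apply: measurable_funM => //; exact: measurable_heis_form.
- by move=> v s; rewrite heis_formC heis_form_shear -heis_formC.
- by apply: (measurableT_comp mf); exact: measurable_rVD.
Qed.

(** The 2n horizontal factors l and the vertical factor l^2 multiply to l^(2n + 2), the homogeneous
    dimension being 2n + 2. *)
Lemma integral_heis_dil (l : R) (f : H -> \bar R) : 0 < l ->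
  measurable_fun setT f -> (forall p, 0 <= f p)%E ->
  (\int[mu]_p f (heis_dil l p) = ((l ^+ (2 * n + 2))^-1)%:E * \int[mu]_p f p)%E.
Proof.
move=> l0 mf f0.
pose L (i : 'I_(n + n + 1)) := if fintype.split i is inl _ then l else l ^+ 2.
have L0 i : 0 < L i by rewrite /L; case: fintype.split => _ //; exact: exprn_gt0.
have -> : l ^+ (2 * n + 2) = \prod_i L i.
  rewrite exprD big_split_ord/= big_ord1 /L; congr (_ * _).
    rewrite (eq_bigr (fun=> l)); last by move=> i _; rewrite (split_idx_h i).
    by rewrite big_const_ord iter_mulr mulr1 mul2n -addnn.
  by rewrite (_ : rshift _ _ = idx_t) ?split_idx_t.
rewrite -prodfV -(integral_coord_scale L0 mf f0); apply: eq_integral => p _.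
congr f; apply: rV_ext; apply: idx_ht => [h|].
  by rewrite heis_dil_h [RHS]mxE /L split_idx_h.
by rewrite heis_dil_t [RHS]mxE /L split_idx_t.
Qed.

End heisenberg_measure.

(** * Continuity of translations *)

Section cvge0.
Local Open Scope ereal_scope.
Context (R : realType) (T : Type) (F : set_system T).
Context {FF : Filter F}.

Lemma ge0_cvge0 (f : T -> \bar R) : (forall x, 0 <= f x) ->
  (forall e : R, (0 < e)%R -> \forall x \near F, f x <= e%:E) ->
  f x @[x --> F] --> 0.
Proof.
move=> f0 fe; apply/fine_cvgP; split.
  apply: filterS (fe 1%R ltr01) => x fx1.
  by rewrite ge0_fin_numE//; apply: le_lt_trans fx1 _; rewrite ltry.
apply/cvgr0Pnorm_le => e e0; apply: filterS (fe e e0) => x fxe.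
rewrite ger0_norm ?fine_ge0// -lee_fin fineK// ge0_fin_numE//.
by apply: le_lt_trans fxe _; rewrite ltry.
Qed.

Lemma cvge0_near (f : T -> \bar R) : f x @[x --> F] --> 0 ->
  forall e : R, (0 < e)%R -> \forall x \near F, f x <= e%:E.
Proof.
move=> /fine_cvgP[ffin fcvg] e e0.
have fe := (cvgr0Pnorm_le _).1 fcvg e e0.
apply: filterS2 ffin (fe FF) => x xfin xe.
by rewrite -(fineK xfin) lee_fin; exact: le_trans (ler_norm _) xe.
Qed.

End cvge0.

(** * Monotonicity of the integral and dominated convergence to zero *)

Section integral_monotone.
Local Open Scope ereal_scope.
Context d (T : measurableType d) (R : realType) (mu : {measure set T -> \bar R}).

(* The integral of a nonnegative function is a supremum over simple functions,
   so no measurability is needed. *)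
Lemma le_integral_nonmeas (D : set T) (f g : T -> \bar R) :
  (forall x, D x -> 0 <= f x) -> (forall x, D x -> f x <= g x) ->
  \int[mu]_(x in D) f x <= \int[mu]_(x in D) g x.
Proof.
move=> f0 fg; have g0 x : D x -> 0 <= g x by move=> Dx; exact: le_trans (f0 _ Dx) (fg _ Dx).
rewrite !ge0_integralE//; apply: ge_ereal_sup => _ [h /= hf <-].
apply: ereal_sup_ubound; exists h => //= x; apply: le_trans (hf x) _.
by rewrite /patch; case: ifPn => // /set_mem; exact: fg.
Qed.

(** Setting [g] to +oo on the exceptional null set keeps its integral and makes the inequality hold
    everywhere. In this way the commutator, as [f], is compared with measurable kernels. *)
Lemma le_integral_ae_nonmeas (D : set T) (f g : T -> \bar R) :
  measurable D -> measurable_fun D g ->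
  (forall x, D x -> 0 <= f x) -> (forall x, D x -> 0 <= g x) ->
  {ae mu, forall x, D x -> f x <= g x} ->
  \int[mu]_(x in D) f x <= \int[mu]_(x in D) g x.
Proof.
move=> mD mg f0 g0 [N [mN N0 fgN]].
pose g' x := if x \in N then +oo else g x.
have mg' : measurable_fun D g'.
  apply: measurable_fun_if => //.
  - apply: (measurable_fun_bool true).
    rewrite (_ : _ @^-1` _ = N)//; first exact: measurableI.
    by apply/seteqP; split => x /=; [move/set_mem|move/mem_set].
  - exact: measurable_funS mg.
have ge0' x : D x -> 0 <= g' x by rewrite /g'; case: ifPn => // _; exact: g0.
have -> : \int[mu]_(x in D) g x = \int[mu]_(x in D) g' x.
  apply: ge0_ae_eq_integral => //.
  exists N; split => // x /= h; apply: contrapT => xN; apply: h => Dx.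
  by rewrite /g' memNset.
apply: le_integral_nonmeas => // x Dx; rewrite /g'.
case: ifPn => [_|/negP xN]; first exact: leey.
apply: contrapT => h; apply: xN; apply/mem_set; apply: fgN => /= h'.
by apply: h; exact: h'.
Qed.

(** The mirror argument: [f] is set to 0 on the exceptional null set. *)
Lemma le_integral_ae_nonmeas_r (D : set T) (f g : T -> \bar R) :
  measurable D -> measurable_fun D f ->
  (forall x, D x -> 0 <= f x) -> (forall x, D x -> 0 <= g x) ->
  {ae mu, forall x, D x -> f x <= g x} ->
  \int[mu]_(x in D) f x <= \int[mu]_(x in D) g x.
Proof.
move=> mD mf f0 g0 [N [mN N0 fgN]].
pose f' x := if x \in N then 0 else f x.
have mf' : measurable_fun D f'.
  apply: measurable_fun_if => //.
  - apply: (measurable_fun_bool true).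
    rewrite (_ : _ @^-1` _ = N)//; first exact: measurableI.
    by apply/seteqP; split => x /=; [move/set_mem|move/mem_set].
  - exact: measurable_funS mf.
have f0' x : D x -> 0 <= f' x by rewrite /f'; case: ifPn => // _; exact: f0.
have -> : \int[mu]_(x in D) f x = \int[mu]_(x in D) f' x.
  apply: ge0_ae_eq_integral => //.
  exists N; split => // x /= h; apply: contrapT => xN; apply: h => Dx.
  by rewrite /f' memNset.
apply: le_integral_nonmeas => // x Dx; rewrite /f'.
case: ifPn => [_|/negP xN]; first exact: g0.
apply: contrapT => h; apply: xN; apply/mem_set; apply: fgN => /= h'.
by apply: h; exact: h'.
Qed.

End integral_monotone.

Section dominated.
Local Open Scope ereal_scope.
Context d (T : measurableType d) (R : realType) (mu : {measure set T -> \bar R}).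

(** The dominating function passed on is the supremum [G] of the sequence, which is measurable and
    whose integral is at most that of [g]. *)
Lemma dominated_cvg0 (D : set T) (f : (T -> \bar R)^nat) (g : T -> \bar R) :
  measurable D -> (forall k, measurable_fun D (f k)) ->
  (forall k x, D x -> 0 <= f k x) -> (forall x, D x -> 0 <= g x) ->
  {ae mu, forall x, D x -> f k x @[k --> \oo] --> 0} ->
  {ae mu, forall x, D x -> forall k, f k x <= g x} ->
  \int[mu]_(x in D) g x < +oo ->
  \int[mu]_(x in D) f k x @[k --> \oo] --> 0.
Proof.
move=> mD mf f0 g0 fcvg fg gfin.
pose G x := ereal_sup (range (fun k => f k x)).
have mG : measurable_fun D G.
  rewrite (_ : G = fun x => esups (f ^~ x) 0%N); first exact: measurable_fun_esups.
  apply/funext => x; rewrite /G /esups/=; congr ereal_sup.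
  by apply/seteqP; split => _ [k _ <-]; exists k.
have fG k x : f k x <= G x by apply: ereal_sup_ubound; exists k.
have G0 x : D x -> 0 <= G x.
  by move=> Dx; apply: le_trans (fG 0%N x); exact: f0.
have Gfin : \int[mu]_(x in D) G x < +oo.
  apply: le_lt_trans gfin; apply: le_integral_ae_nonmeas_r => //.
  apply: filterS fg => x fg Dx; apply: ge_ereal_sup => _ [k _ <-]; exact: fg.
have iG : mu.-integrable D G.
  apply/integrableP; split => //; apply: le_lt_trans Gfin.
  by apply: le_integral_nonmeas => // x Dx; rewrite gee0_abs// G0.
have [] := @dominated_convergence _ _ _ mu D mD f (cst 0) G mf _ fcvg iG _.
- exact: measurable_cst.
- by apply: nearW => x k Dx; rewrite gee0_abs//; exact: f0.
- by move=> _ _; rewrite integral0.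
Qed.

End dominated.

(** * Continuity in L^1 under measure-preserving maps tending to the identity *)

Section translation_continuity.
Local Open Scope ereal_scope.
Context (R : realType) (m : nat).
Local Notation mu := (lebesgue_rV R m).

Variable tau : ('rV[R]_m -> 'rV[R]_m)^nat.
Hypothesis mtau : forall k, measurable_fun setT (tau k).
Hypothesis tau_inv : forall k (f : 'rV[R]_m -> \bar R),
  measurable_fun setT f -> (forall v, 0 <= f v) ->
  \int[mu]_v f (tau k v) = \int[mu]_v f v.
Hypothesis tau_cvg : forall v, tau k v @[k --> \oo] --> v.

(** Group translations by points tending to 0 are the intended [tau]; only preservation of the
    measure and pointwise convergence to the identity enter. *)
Definition L1_dist_translate (f : 'rV[R]_m -> R) k : \bar R :=
  \int[mu]_v (`|f (tau k v) - f v|)%:E.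

Definition L1_translation_continuous (f : 'rV[R]_m -> R) :=
  measurable_fun setT f /\ L1_dist_translate f k @[k --> \oo] --> 0.

Lemma measurable_dist_translate (f : 'rV[R]_m -> R) k D :
  measurable_fun setT f -> measurable_fun D (fun v => (`|f (tau k v) - f v|)%:E).
Proof.
move=> mf; apply: measurable_funTS; apply/measurable_EFinP.
apply: measurableT_comp => //; apply: measurable_funB => //.
exact: (measurableT_comp mf).
Qed.

Lemma L1_dist_translate_ge0 f k : 0 <= L1_dist_translate f k.
Proof. by apply: integral_ge0 => v _; rewrite lee_fin. Qed.

Lemma L1_translation_continuous_le (f g h : 'rV[R]_m -> R) :
  measurable_fun setT f ->
  L1_translation_continuous g -> L1_translation_continuous h ->
  (forall k v, `|f (tau k v) - f v| <=
     `|g (tau k v) - g v| + `|h (tau k v) - h v|)%R ->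
  L1_translation_continuous f.
Proof.
move=> mf [mg gg] [mh hh] fgh; split => //.
have : (L1_dist_translate g k + L1_dist_translate h k) @[k --> \oo] --> 0 + 0.
  exact: cvgeD.
rewrite adde0 => c.
apply: (squeeze_cvge _ (cvg_cst 0) c); apply: nearW => k.
rewrite L1_dist_translate_ge0/= /L1_dist_translate -ge0_integralD//.
- by apply: le_integral_nonmeas => v _; rewrite ?lee_fin// -EFinD lee_fin.
- exact: measurable_dist_translate.
- exact: measurable_dist_translate.
Qed.

Lemma L1_translation_continuousD (g h : 'rV[R]_m -> R) :
  L1_translation_continuous g -> L1_translation_continuous h ->
  L1_translation_continuous (fun v => g v + h v)%R.
Proof.
move=> cg ch; apply: (L1_translation_continuous_le _ cg ch).
  by apply: measurable_funD; [exact: cg.1|exact: ch.1].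
by move=> k v; rewrite opprD addrACA ler_normD.
Qed.

Lemma L1_translation_continuousZ (c : R) (g : 'rV[R]_m -> R) :
  L1_translation_continuous g ->
  L1_translation_continuous (fun v => c * g v)%R.
Proof.
move=> [mg cg]; split; first exact: measurable_funM.
have -> : L1_dist_translate (fun v => c * g v)%R =
    (fun k => `|c|%:E * L1_dist_translate g k).
  apply/funext => k; rewrite /L1_dist_translate -ge0_integralZl//.
  - by apply: eq_integral => v _; rewrite -mulrBr normrM EFinM.
  exact: measurable_dist_translate.
rewrite -[X in _ --> X](mule0 `|c|%:E); exact: cvgeZl.
Qed.

(** S and its preimage under [tau k] have equal finite measure, so the two halves of their symmetric
    difference are equally large and the distance is twice the integral over S. There the integrand
    is eventually 0 at each point, because S is open, and it is dominated by 1. *)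
Lemma L1_translation_continuous_indic (S : set 'rV[R]_m) :
  open S -> mu S < +oo ->
  L1_translation_continuous \1_S.
Proof.
move=> oS Sfin; have mS := open_measurable_rV oS; split; first exact: measurable_indic.
have mI : measurable_fun setT (fun v => (\1_S v : R)%:E).
  by apply/measurable_EFinP; exact: measurable_indic.
pose d k v : \bar R := (`|\1_S (tau k v) - \1_S v : R|)%:E.
have md k D : measurable_fun D (d k).
  by apply: measurable_dist_translate; exact: measurable_indic.
have E k : L1_dist_translate \1_S k = 2%:E * \int[mu]_(v in S) d k v.
  have : L1_dist_translate \1_S k + mu S = mu S + 2%:E * \int[mu]_(v in S) d k v.
    have muE : mu S = \int[mu]_v (\1_S v : R)%:E by rewrite integral_indic// setIT.
    have muE' : mu S = \int[mu]_v (\1_S (tau k v) : R)%:E.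
      by rewrite muE (tau_inv k mI).
    rewrite {1}muE {1}muE'.
    rewrite -ge0_integralZl//; last by move=> v _; rewrite lee_fin.
    rewrite [X in _ = _ + X]integral_mkcond -!ge0_integralD//=.
    - apply: eq_integral => v _; rewrite /patch /d -EFinD !indicE.
      case: ifPn => vS; last first.
        by rewrite subr0 addr0 ger0_norm//; exact: (esym (adde0 _)).
      rewrite vS -EFinM -EFinD; case: (tau k v \in S); congr EFin;
      by rewrite /= ?mulr1n ?mulr0n ?subrr ?normr0 ?sub0r ?normrN ?normr1; lra.
    - by apply: (measurableT_comp mI).
    - move=> v _; rewrite /patch; case: ifPn => // _.
      by rewrite -EFinM lee_fin mulr_ge0.
    - apply/(measurable_restrictT _ mS).
      by apply: measurable_funeM.
    - by apply: md.
  move/eqP; rewrite addeC => /eqP h.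
  have Sf : mu S \is a fin_num by rewrite ge0_fin_numE.
  by have := congr1 (fun x => x - mu S) h; rewrite ![mu S + _]addeC !addeK.
suff : \int[mu]_(v in S) d k v @[k --> \oo] --> 0.
  move=> /(cvgeZl (isT : 2%:E \is a fin_num)); rewrite mule0.
  by under eq_fun do rewrite -E.
apply: (@dominated_cvg0 _ _ _ mu S d (cst 1)) => //.
- by move=> k v _; rewrite lee_fin.
- apply: nearW => v vS; apply: cvg_near_cst.
  have nS : \forall k \near \oo, S (tau k v).
    by apply: (tau_cvg (v := v)); exact: open_nbhs_nbhs.
  apply: filterS nS => k kS.
  by rewrite /d !indicE !mem_set// subrr normr0.
- apply: nearW => v _ k; rewrite lee_fin !indicE; do 2 case: (_ \in _);
  by rewrite ?subr0 ?subrr ?sub0r ?normrN ?normr1 ?normr0.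
- by rewrite integral_cst// mul1e.
Qed.

Let case_indic_tac := ((@subrr R, @sub0r R, @subr0 R, @normrN R R, @normr1 R, @normr0 R R), (@addr0 R, @add0r R, @ler01 R)).

Section window.
Variable W : set 'rV[R]_m.
Hypotheses (oW : open W) (Wfin : mu W < +oo).

Let mW : measurable W := open_measurable_rV oW.

Let cW : L1_translation_continuous \1_W.
Proof. exact: L1_translation_continuous_indic. Qed.

(** Cutting by an open window of finite measure makes the class stable under complements and
    countable unions, hence a sigma-algebra. *)
Definition window_good (A : set 'rV[R]_m) :=
  measurable A /\ L1_translation_continuous \1_(A `&` W).

Lemma window_goodC A : window_good A -> window_good (~` A).
Proof.
move=> [mA gA]; split; first exact: measurableC.
have mB : measurable (~` A `&` W) by apply: measurableI => //; exact: measurableC.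
apply: (L1_translation_continuous_le _ cW gA); first exact: measurable_indic.
move=> k v; rewrite !indicE !in_setI !in_setC.
case: (tau k v \in A); case: (v \in A); case: (tau k v \in W); case: (v \in W) => //=;
by rewrite ?case_indic_tac// lerDl.
Qed.

Lemma window_goodU A B : window_good A -> window_good B -> window_good (A `|` B).
Proof.
move=> [mA gA] [mB gB]; split; first exact: measurableU.
have mC : measurable ((A `|` B) `&` W) by apply: measurableI => //; exact: measurableU.
apply: (L1_translation_continuous_le _ gA gB); first exact: measurable_indic.
move=> k v; rewrite !indicE !in_setI !in_setU.
case: (tau k v \in A); case: (v \in A); case: (tau k v \in W); case: (v \in W);
case: (tau k v \in B); case: (v \in B) => //=;
by rewrite ?case_indic_tac// lerDl.
Qed.

Lemma window_good0 : window_good set0.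
Proof.
split => //; rewrite set0I; split; first exact: measurable_indic.
rewrite (_ : L1_dist_translate _ = cst 0); first exact: cvg_cst.
apply/funext => k; apply: integral0_eq => v _.
by rewrite !indicE !in_set0 subrr normr0.
Qed.

(** The finite union [U j] misses only the part [D j] of the window, whose measure tends to 0. The
    indicator of [D j] and its composition with [tau k] both have integral mu (D j), which together
    with the good set [U j] gives three thirds of e. *)
Lemma window_good_bigcup (A : (set 'rV[R]_m)^nat) :
  (forall i, window_good (A i)) -> window_good (\bigcup_i A i).
Proof.
move=> gA; have mU : measurable (\bigcup_i A i).
  by apply: bigcupT_measurable => i; exact: (gA i).1.
split => //; split; first by apply: measurable_indic; exact: measurableI.
pose U j := \big[setU/set0]_(i < j) A i.
have gU j : window_good (U j).
  rewrite /U; elim/big_ind: _ => //; [exact: window_good0|exact: window_goodU].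
pose D j := (\bigcup_i A i `\` U j) `&` W.
have mD j : measurable (D j).
  by apply: measurableI => //; apply: measurableD => //; exact: (gU j).1.
have UE i j x : (i < j)%N -> A i x -> U j x.
  by move=> ij Aix; rewrite /U -bigcup_mkord; exists i.
have D0 : mu (D j) @[j --> \oo] --> 0.
  have -> : 0 = mu (\bigcap_j D j).
    rewrite (_ : \bigcap_j D j = set0) ?measure0//.
    apply/seteqP; split => // x Dx.
    have [[[i _ Aix] _] _] := Dx 0%N I.
    by have [[_ +] _] := Dx i.+1 I; apply; exact: UE Aix.
  apply: nonincreasing_cvg_mu => //.
  - apply: le_lt_trans Wfin; apply: le_measure; rewrite ?inE//.
    exact: subIsetr.
  - exact: bigcapT_measurable.
  - move=> i j ij; apply/subsetPset => x [[Ux UNx] Wx]; split => //; split => //.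
    move=> Uix; apply: UNx; move: Uix; rewrite /U -!bigcup_mkord => -[l /= li Alx].
    by exists l => //=; exact: leq_trans li ij.
have bound j k : L1_dist_translate \1_(\bigcup_i A i `&` W) k <=
    L1_dist_translate \1_(U j `&` W) k + (mu (D j) + mu (D j)).
  have mI : measurable_fun setT (fun v => (\1_(D j) v : R)%:E).
    by apply/measurable_EFinP; exact: measurable_indic.
  have muE : mu (D j) = \int[mu]_v (\1_(D j) v : R)%:E by rewrite integral_indic// setIT.
  have muE' : mu (D j) = \int[mu]_v (\1_(D j) (tau k v) : R)%:E.
    by rewrite muE (tau_inv k mI).
  have mI' : measurable_fun setT (fun v => (\1_(D j) (tau k v) : R)%:E).
    exact: (measurableT_comp mI).
  rewrite {1}muE' muE -!ge0_integralD//=; last 3 first.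
  - by apply: measurable_dist_translate; apply: measurable_indic; apply: measurableI => //; exact: (gU j).1.
  - by move=> v _; rewrite adde_ge0// lee_fin.
  - exact: emeasurable_funD.
  apply: le_integral_nonmeas => v _; first by rewrite lee_fin.
  rewrite -!EFinD lee_fin.
  have E x : (\1_(\bigcup_i A i `&` W) x = \1_(U j `&` W) x + \1_(D j) x :> R)%R.
    have sub : U j x -> (\bigcup_i A i) x.
      by rewrite /U -bigcup_mkord => -[l _ Alx]; exists l.
    have -> : \1_(D j) x = ((x \in \bigcup_i A i) && (x \notin U j) && (x \in W))%:R :> R.
      by rewrite indicE /D in_setI in_setD.
    rewrite !indicE !in_setI.
    have [xU|xU] := boolP (x \in U j).
      by rewrite (mem_set (sub (set_mem xU))) andbF/= addr0.
    by rewrite andbT /= add0r.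
  rewrite !E; apply: le_trans (_ : _ <= `|\1_(U j `&` W) (tau k v) - \1_(U j `&` W) v| +
     `|\1_(D j) (tau k v) - \1_(D j) v|)%R _; first by rewrite opprD addrACA ler_normD.
  rewrite lerD2l; apply: le_trans (ler_normB _ _) _.
  by rewrite !ger0_norm.
apply: ge0_cvge0; first by move=> k; exact: L1_dist_translate_ge0.
move=> e e0.
have e3 : (0 < e / 3)%R by rewrite divr_gt0.
have [j _ Dj] := cvge0_near D0 e3.
have {}Dj : mu (D j) <= (e / 3)%:E by exact: Dj (leqnn j).
apply: filterS (cvge0_near (gU j).2.2 e3) => k kj.
apply: le_trans (bound j k) _.
apply: le_trans (leeD kj (leeD Dj Dj)) _.
by rewrite -!EFinD lee_fin; lra.
Qed.

(** Open half-lines generate the Borel sets of R, and their preimages are open, so that the case of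
    open sets applies to the generators. *)
Lemma window_good_coord (i : 'I_m) (B : set R) : measurable B ->
  window_good [set v | B (v ord0 i)].
Proof.
pose G := [set B : set R | window_good [set v | B (v ord0 i)]].
rewrite [X in X B](measurable_realfun.RGenOInfty.measurableE R).
apply: (@smallest_sub _ _ _ G); last first.
  move=> _ [a ->]; split.
    by apply: measurable_coord_preimage.
  apply: L1_translation_continuous_indic.
    apply: openI => //.
    by apply: (@open_comp _ _ (fun v : 'rV[R]_m => v ord0 i)) => [v _|]; [exact: coord_continuous|exact: interval_open].
  apply: le_lt_trans Wfin; apply: le_measure; rewrite ?inE//.
  by apply: measurableI => //; exact: measurable_coord_preimage.
split.
- exact: window_good0.
- by move=> A /window_goodC; rewrite /G setTD.
- move=> A gA.
  have : window_good (\bigcup_k [set v : 'rV[R]_m | A k (v ord0 i)]).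
    exact: window_good_bigcup.
  rewrite /G/=; congr window_good; by apply/seteqP; split.
Qed.

Lemma window_good_measurable (A : set 'rV[R]_m) : measurable A -> window_good A.
Proof.
move: A; suff : measurable `<=` [set A : set 'rV[R]_m | window_good A] by [].
apply: smallest_sub.
  split; [exact: window_good0| |by move=> F /window_good_bigcup].
  by move=> F /window_goodC; rewrite setTD.
move=> A; rewrite -bigcup_seq/= => -[i _ [B mB <-]]; rewrite setTI.
exact: window_good_coord mB.
Qed.

End window.

Definition open_rV_box (r : R) : set 'rV[R]_m :=
  [set v | forall i, (`|v ord0 i| < r)%R].

Lemma open_open_rV_box r : open (open_rV_box r).
Proof.
rewrite openE => v vr.
have h i : \forall w \near v, (`|(w : 'rV[R]_m) ord0 i| < r)%R.
  exact: (cvgr_norm_lt _ (@coord_continuous _ 1 m ord0 i v) _ (vr i)).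
exact: filter_forall h.
Qed.

Lemma open_rV_box_fin r : mu (open_rV_box r) < +oo.
Proof.
apply: le_lt_trans (lebesgue_rV_box m r); apply: le_measure; rewrite ?inE.
- by apply: open_measurable_rV; exact: open_open_rV_box.
- exact: measurable_rV_box.
- by move=> v vr i; exact: ltW.
Qed.

Lemma L1_translation_continuous_sum (I : Type) (l : seq I)
    (f : I -> 'rV[R]_m -> R) :
  (forall i, L1_translation_continuous (f i)) ->
  L1_translation_continuous (fun v => \sum_(i <- l) f i v)%R.
Proof.
move=> cf; elim: l => [|i l IH].
  have -> : (fun v => \sum_(i <- [::]) f i v)%R = (fun v => 0 * \1_(set0 `&` open_rV_box 0) v)%R.
    by apply/funext => v; rewrite big_nil mul0r.
  apply: L1_translation_continuousZ.
  exact: (window_good0 _).2.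
rewrite (_ : (fun v => _) = (fun v => f i v + \sum_(i <- l) f i v)%R).
  exact: L1_translation_continuousD.
by apply/funext => v; rewrite big_cons.
Qed.

(** A three-term estimate: by preservation of the measure the composed error f - g is as small as
    the error itself. *)
Lemma L1_translation_continuous_approx (f : 'rV[R]_m -> R) :
  measurable_fun setT f ->
  (forall e : R, (0 < e)%R -> exists2 g, L1_translation_continuous g &
    \int[mu]_v (`|f v - g v|)%:E <= e%:E) ->
  L1_translation_continuous f.
Proof.
move=> mf fg; split => //; apply: ge0_cvge0; first exact: L1_dist_translate_ge0.
move=> e e0; have e3 : (0 < e / 3)%R by rewrite divr_gt0.
have [g [mg cg] fge] := fg _ e3.
apply: filterS (cvge0_near cg e3) => k ke.
have mfg : measurable_fun setT (fun v => (`|f v - g v|)%:E).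
  by apply/measurable_EFinP; apply: measurableT_comp => //; exact: measurable_funB.
have fgk := tau_inv k mfg.
apply: (@le_trans _ _ (\int[mu]_v (`|f (tau k v) - g (tau k v)|)%:E +
  (L1_dist_translate g k + \int[mu]_v (`|f v - g v|)%:E))); last first.
  rewrite fgk//; apply: le_trans (leeD fge (leeD ke fge)) _.
  by rewrite -!EFinD lee_fin; lra.
rewrite -!ge0_integralD//=; last 4 first.
- by apply: (measurableT_comp mfg).
- by move=> v _; rewrite adde_ge0// lee_fin.
- by apply: emeasurable_funD => //; exact: measurable_dist_translate.
- exact: measurable_dist_translate.
apply: le_integral_nonmeas => v _; first by rewrite lee_fin.
rewrite -!EFinD lee_fin.
have -> : (f (tau k v) - f v = (f (tau k v) - g (tau k v)) +
  ((g (tau k v) - g v) + (g v - f v)))%R by ring.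
apply: le_trans (ler_normD _ _) _; rewrite lerD2l.
by apply: le_trans (ler_normD _ _) _; rewrite lerD2l distrC.
Qed.

Import HBNNSimple.

(** Simple functions cut off to the open boxes [W j] are finite combinations of indicators of good
    sets, and they converge to [f] in L^1 because [f] dominates the error. *)
Lemma L1_translation_continuous_ge0 (f : 'rV[R]_m -> R) :
  mu.-integrable setT (EFin \o f) -> (forall v, 0 <= f v)%R ->
  L1_translation_continuous f.
Proof.
move=> fi f0; have mEf := measurable_int _ fi.
have mf : measurable_fun setT f by exact/measurable_EFinP.
apply: L1_translation_continuous_approx => // e e0.
pose g j : {nnsfun _ >-> R} := nnsfun_approx (@measurableT _ 'rV[R]_m) mEf j.
have gc v : g j v @[j --> \oo] --> f v.
  have : (EFin \o g ^~ v) j @[j --> \oo] --> (f v)%:E.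
    by apply: cvg_nnsfun_approx => // w _; rewrite lee_fin.
  exact: fine_cvg.
have gf j v : (g j v <= f v)%R.
  have gnd : nondecreasing_seq (g ^~ v).
    by move=> a b ab; have /lefP := nd_nnsfun_approx (@measurableT _ 'rV[R]_m) mEf ab; exact.
  rewrite -(cvg_lim _ (gc v))//; apply: (nondecreasing_cvgn_le gnd).
  by apply/cvg_ex; exists (f v); exact: gc.
pose W j := open_rV_box (j%:R : R).
pose h j v := (g j v * \1_(W j) v)%R.
have mW j : measurable (W j) by apply: open_measurable_rV; exact: open_open_rV_box.
have hf j v : (0 <= h j v <= f v)%R.
  rewrite /h indicE.
  by case: (_ \in _); rewrite ?mulr1 ?mulr0; apply/andP; split.
have mh j : measurable_fun setT (h j).
  by apply: measurable_funM => //; exact: measurable_indic.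
have ch j : L1_translation_continuous (h j).
  rewrite (_ : h j = fun v => \sum_(r <- finmap.enum_fset (fset_set (range (g j)))) r * \1_(g j @^-1` [set r] `&` W j) v)%R.
    apply: L1_translation_continuous_sum => r; apply: L1_translation_continuousZ.
    have mr : measurable (g j @^-1` [set r]) by exact: measurable_sfunP.
    have oW : open (W j) by exact: open_open_rV_box.
    have [_ H] := window_good_measurable oW (open_rV_box_fin _) mr.
    exact H.
  apply/funext => v; rewrite /h fimfunE fsbig_finite//= mulr_suml.
  by apply: eq_bigr => r _; rewrite indicI/= mulrA.
have c : \int[mu]_v (`|f v - h j v|)%:E @[j --> \oo] --> 0.
  apply: (@dominated_cvg0 _ _ _ mu setT _ (EFin \o f)) => //.
  - move=> j; apply/measurable_EFinP; apply: measurableT_comp => //.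
    exact: measurable_funB.
  - by move=> v _; rewrite lee_fin.
  - apply: nearW => v _.
    apply: ge0_cvge0 => [j|e' e'0]; first by rewrite lee_fin.
    have ge := (cvgrPdist_le _ _).1 (gc v) e' e'0.
    have [K _ Kv] : (\bigcup_k rV_box (k%:R : R)) v by rewrite bigcup_rV_box.
    have nK : \forall j \near \oo, (K < j)%N by exact: nbhs_infty_gt.
    apply: filterS2 (ge _) nK => j gj Kj.
    rewrite lee_fin /h indicE mem_set ?mulr1//.
    by move=> i; apply: le_lt_trans (Kv i) _; rewrite ltr_nat.
  - apply: nearW => v _ j; rewrite lee_fin; have /andP[h0 hf'] := hf j v.
    by rewrite ger0_norm ?subr_ge0// gerBl.
  - move/integrableP : fi => [_]; apply: le_lt_trans.
    by apply: le_integral_nonmeas => v _; rewrite /= ?lee_fin// ler_norm.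
have [j _ je] := cvge0_near c e0.
by exists (h j) => //; exact: je (leqnn j).
Qed.

Lemma L1_translation_continuous_integrable (f : 'rV[R]_m -> R) :
  mu.-integrable setT (EFin \o f) -> L1_translation_continuous f.
Proof.
move=> fi.
have fE : f = (fun v => (f^\+ v)%R + -1 * (f^\- v)%R)%R.
  by apply/funext => v; rewrite mulN1r; have /(congr1 (@^~ v)) <- := funrposBneg f.
rewrite fE; apply: L1_translation_continuousD.
  apply: L1_translation_continuous_ge0 => [|v]; last exact: funrpos_ge0.
  exact: integrable_funrpos.
apply: L1_translation_continuousZ.
apply: L1_translation_continuous_ge0 => [|v]; last exact: funrneg_ge0.
exact: integrable_funrneg.
Qed.

End translation_continuity.

Lemma cvge0D (R : realType) (f g : nat -> \bar R) :
  (f k @[k --> \oo] --> 0 -> g k @[k --> \oo] --> 0 ->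
   (f k + g k) @[k --> \oo] --> 0)%E.
Proof.
move=> f0 g0; have : (f k + g k @[k --> \oo] --> 0 + 0)%E by apply: cvgeD.
by rewrite adde0.
Qed.

Lemma cvge0_le (R : realType) (f g : nat -> \bar R) :
  (forall k, 0 <= f k)%E -> (forall k, f k <= g k)%E ->
  (g k @[k --> \oo] --> 0 -> f k @[k --> \oo] --> 0)%E.
Proof.
move=> f0 fg g0; apply: (squeeze_cvge _ (cvg_cst 0%E) g0).
by apply: nearW => k; rewrite f0 fg.
Qed.

Section integral_add.
Local Open Scope ereal_scope.
Context d (T : measurableType d) (R : realType) (mu : {measure set T -> \bar R}).
Implicit Types f g h k : T -> R.

Lemma le_integralD f g h : measurable_fun setT g -> measurable_fun setT h ->
  (forall x, 0 <= f x)%R -> (forall x, 0 <= g x)%R -> (forall x, 0 <= h x)%R ->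
  (forall x, f x <= g x + h x)%R ->
  \int[mu]_x (f x)%:E <= \int[mu]_x (g x)%:E + \int[mu]_x (h x)%:E.
Proof.
move=> mg mh f0 g0 h0 fgh; rewrite -ge0_integralD//; last 4 first.
- by move=> x _; rewrite lee_fin.
- exact/measurable_EFinP.
- by move=> x _; rewrite lee_fin.
- exact/measurable_EFinP.
by apply: le_integral_nonmeas => x _; rewrite -?EFinD lee_fin.
Qed.

Lemma le_integralD3 f g h k : measurable_fun setT g -> measurable_fun setT h ->
  measurable_fun setT k ->
  (forall x, 0 <= f x)%R -> (forall x, 0 <= g x)%R -> (forall x, 0 <= h x)%R ->
  (forall x, 0 <= k x)%R -> (forall x, f x <= g x + (h x + k x))%R ->
  \int[mu]_x (f x)%:E <=
    \int[mu]_x (g x)%:E + (\int[mu]_x (h x)%:E + \int[mu]_x (k x)%:E).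
Proof.
move=> mg mh mk f0 g0 h0 k0 fghk.
have hk0 x : (0 <= h x + k x)%R by rewrite addr_ge0.
apply: le_trans (le_integralD mg (measurable_funD mh mk) f0 g0 hk0 fghk) _.
by apply: leeD => //; exact: le_integralD.
Qed.

Lemma integralZl_ge0 (c : R) f : (0 <= c)%R -> measurable_fun setT f ->
  (forall x, 0 <= f x)%R ->
  \int[mu]_x (c * f x)%:E = c%:E * \int[mu]_x (f x)%:E.
Proof.
move=> c0 mf f0; rewrite -ge0_integralZl//; first exact/measurable_EFinP.
by move=> x _; rewrite lee_fin.
Qed.

End integral_add.

(** * Conjugate exponents and truncation *)

Section Lnorm_extra.
Local Open Scope ereal_scope.
Context d (T : measurableType d) (R : realType) (mu : {measure set T -> \bar R}).
Hypothesis mu_gt0 : 0 < mu setT.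
Implicit Types (f g : T -> R) (s : \bar R).
Local Notation "'N_ p [ f ]" := (Lnorm mu p (EFin \o f)).

Lemma Lnorm_le s f g : 0 < s -> {ae mu, forall x, (`|f x| <= `|g x|)%R} ->
  measurable_fun setT f -> measurable_fun setT g ->
  'N_s[f] <= 'N_s[g].
Proof.
move=> s0 fg mf mg; rewrite unlock; case: s s0 => [r r0||//]; last first.
  by move=> _; rewrite mu_gt0; apply: le_ess_sup; apply: filterS fg => x; rewrite /= lee_fin.
rewrite lte_fin in r0.
apply: gt0_ler_poweR; first by rewrite invr_ge0 ltW.
- by rewrite in_itv/= leey andbT; apply: integral_ge0 => x _ /=; rewrite lee_fin powR_ge0.
- by rewrite in_itv/= leey andbT; apply: integral_ge0 => x _ /=; rewrite lee_fin powR_ge0.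
have mp (h : T -> R) : measurable_fun setT h -> measurable_fun setT (fun x => `|(EFin \o h) x| `^ r).
  move=> mh; apply: (measurableT_comp (measurable_poweR _)).
  by apply: measurableT_comp => //; exact/measurable_EFinP.
apply: le_integral_ae_nonmeas => //.
- exact: mp.
- by move=> x _; exact: poweR_ge0.
- by move=> x _; exact: poweR_ge0.
- apply: filterS fg => x fgx _ /=; rewrite lee_fin.
  by apply: ge0_ler_powR; rewrite ?nnegrE// ltW.
Qed.

Lemma ae_le_Lnormy f : {ae mu, forall x, (`|f x|)%:E <= 'N_+oo[f]}.
Proof. by rewrite unlock mu_gt0; exact: (ess_sup_ge mu (abse \o (EFin \o f))). Qed.

Lemma holder1y f g : measurable_fun setT f -> measurable_fun setT g ->
  'N_+oo[g] < +oo ->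
  \int[mu]_x (`|f x * g x|)%:E <= 'N_1[f] * 'N_+oo[g].
Proof.
move=> mf mg goo.
have gfin : 'N_+oo[g] \is a fin_num by rewrite ge0_fin_numE ?Lnorm_ge0.
rewrite Lnorm1 -(fineK gfin) -ge0_integralZr//; last 2 first.
- by apply: measurableT_comp => //; exact/measurable_EFinP.
- by rewrite lee_fin fine_ge0// Lnorm_ge0.
apply: le_integral_ae_nonmeas => //.
- apply: emeasurable_funM => //; apply: measurableT_comp => //; exact/measurable_EFinP.
- by move=> x _; rewrite mule_ge0// lee_fin fine_ge0// Lnorm_ge0.
apply: filterS (ae_le_Lnormy g) => x gx _ /=.
by rewrite normrM EFinM; apply: lee_wpmul2l => //; rewrite fineK.
Qed.

(** The end exponents pair L^1 with the essential supremum; in between, the conjugate of r is r / (r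
    - 1). *)
Lemma holder_conj s f g : 1 <= s -> measurable_fun setT f -> measurable_fun setT g ->
  'N_s[f] < +oo -> 'N_(hoelder_conjugate s)[g] < +oo ->
  \int[mu]_x (`|f x * g x|)%:E <= 'N_s[f] * 'N_(hoelder_conjugate s)[g].
Proof.
move=> s1 mf mg.
have [->|sy] := eqVneq s +oo.
  rewrite hoelder_conjugatey => foo _; rewrite muleC.
  by under eq_integral do rewrite mulrC; exact: holder1y.
have [->|sN1] := eqVneq s 1.
  by rewrite hoelder_conjugate1 => _ goo; exact: holder1y.
case: s s1 sy sN1 => [r||//] //; rewrite lee_fin eqe => r1 _ rN1.
have {}r1 : (1 < r)%R by rewrite lt_neqAle eq_sym rN1.
have r0 : (0 < r)%R by exact: lt_trans r1.
have -> : hoelder_conjugate r%:E = (r / (r - 1))%:E :> \bar R.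
  rewrite /hoelder_conjugate/= eqe gt_eqF// -EFinB inver subr_eq0 gt_eqF//.
have rr0 : (0 < r / (r - 1))%R by rewrite divr_gt0// subr_gt0.
move=> _ _; have := @hoelder _ _ _ mu f g r (r / (r - 1)) mf mg r0 rr0.
rewrite Lnorm1; apply; rewrite invf_div.
by field; rewrite gt_eqF.
Qed.

Definition excess (L : R) f : T -> R := fun x => if (L < `|f x|)%R then f x else 0%R.

Lemma measurable_excess L f : measurable_fun setT f -> measurable_fun setT (excess L f).
Proof.
move=> mf; apply: measurable_fun_ifT => //.
apply: measurable_fun_ltr => //; exact: measurableT_comp.
Qed.

Lemma excess_le L f x : (`|excess L f x| <= `|f x|)%R.
Proof. by rewrite /excess; case: ifPn => // _; rewrite normr0. Qed.

(** For a finite exponent r the r-th powers of the excess tend to 0 pointwise and are dominated by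
    that of f. For +oo, a level above the essential supremum makes the excess vanish almost
    everywhere. *)
Lemma Lnorm_excess s f (e : R) : 1 <= s -> measurable_fun setT f ->
  'N_s[f] < +oo -> (0 < e)%R -> exists2 L : R, (0 < L)%R & 'N_s[excess L f] <= e%:E.
Proof.
move=> s1 mf foo e0; have [sy|sy] := eqVneq s +oo.
  rewrite sy in foo *.
  have ffin : 'N_+oo[f] \is a fin_num by rewrite ge0_fin_numE ?Lnorm_ge0.
  exists (fine 'N_+oo[f] + 1)%R; first by rewrite ltr_wpDl// fine_ge0// Lnorm_ge0.
  rewrite unlock mu_gt0; apply: le_trans (_ : 0 <= _); last by rewrite lee_fin ltW.
  apply/ess_supP; apply: filterS (ae_le_Lnormy f) => x fx /=.
  rewrite /excess ifF ?normr0//; apply/negbTE; rewrite -leNgt.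
  move: fx; rewrite unlock mu_gt0 in ffin * => fx.
  by rewrite -lee_fin EFinD fineK//; apply: le_trans fx _; rewrite leeDl.
case: s s1 sy foo => [r||//] //; rewrite lee_fin => r1 _ foo.
have r0 : (0 < r)%R by exact: lt_le_trans r1.
pose F k x := `|(EFin \o excess k%:R f) x| `^ r.
have F0 k x : 0 <= F k x by exact: poweR_ge0.
have mp (h : T -> R) : measurable_fun setT h -> measurable_fun setT (fun x => `|(EFin \o h) x| `^ r).
  move=> mh; apply: (measurableT_comp (measurable_poweR _)).
  by apply: measurableT_comp => //; exact/measurable_EFinP.
have c : \int[mu]_x F k x @[k --> \oo] --> 0.
  apply: (@dominated_cvg0 _ _ _ mu setT F (fun x => `|(EFin \o f) x| `^ r)) => //.
  - by move=> k; apply: mp; exact: measurable_excess.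
  - by move=> x _; exact: poweR_ge0.
  - apply: nearW => x _; apply: cvg_near_cst.
    have nK : \forall j \near \oo, (Num.truncn `|f x| < j)%N by exact: nbhs_infty_gt.
    apply: filterS nK => k Kk; rewrite /F /excess /= ifF.
      by rewrite normr0 powR0// gt_eqF.
    apply/negbTE; rewrite -leNgt; apply: le_trans (ltW (truncnS_gt _)) _.
    by rewrite ler_nat.
  - apply: nearW => x _ k; rewrite /F /= lee_fin.
    by apply: ge0_ler_powR; rewrite ?nnegrE ?excess_le// ltW.
  - apply: (@lty_poweRy _ _ r^-1); first by rewrite invr_eq0 gt_eqF.
    by move: foo; rewrite unlock.
have er : (0 < e `^ r)%R by exact: powR_gt0.
have [k _ kc] := cvge0_near c er.
exists (maxn k 1)%:R; first by rewrite ltr0n leq_max orbT.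
have := kc (maxn k 1) (leq_maxl _ _) => h.
rewrite unlock; apply: le_trans (_ : (e `^ r)%:E `^ r^-1 <= _).
  apply: gt0_ler_poweR => //; first by rewrite invr_ge0 ltW.
  - by rewrite in_itv/= leey andbT; apply: integral_ge0 => x _ /=; rewrite lee_fin powR_ge0.
  - by rewrite in_itv/= leey andbT lee_fin ltW.
by rewrite poweR_EFin -powRrM divff ?powRr1 ?lexx// ?ltW// gt_eqF.
Qed.

End Lnorm_extra.

(** * Translation differences in products of L^s and L^{s'} functions *)

Section heis_translation.
Context {R : realType} {n : nat}.
Local Notation H := (heis R n).
Local Notation mu := (@mu_heis R n).
Implicit Types (p q a : H) (s : \bar R) (u D f g : H -> R).

Lemma heis_form_cvg p (a : nat -> H) : a k @[k --> \oo] --> (0 : H) ->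
  heis_form p (a k) @[k --> \oo] --> (0 : R).
Proof.
move=> a0.
have ac i : a k ord0 i @[k --> \oo] --> (0 : R).
  have := cvg_comp _ _ a0 (@coord_continuous _ 1 _ ord0 i (0 : H)).
  by rewrite mxE.
suff h (l : seq 'I_n) : \sum_(j <- l) (a k ord0 (idx_x j) * p ord0 (idx_y j)
    - p ord0 (idx_x j) * a k ord0 (idx_y j)) @[k --> \oo] --> (0 : R) by exact: h.
elim: l => [|j l IH].
  by under eq_cvg do rewrite big_nil; exact: cvg_cst.
under eq_cvg do rewrite big_cons.
suff : a k ord0 (idx_x j) * p ord0 (idx_y j) - p ord0 (idx_x j) * a k ord0 (idx_y j) +
    \sum_(j <- l) (a k ord0 (idx_x j) * p ord0 (idx_y j)
    - p ord0 (idx_x j) * a k ord0 (idx_y j)) @[k --> \oo] --> (0 + 0 : R).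
  by rewrite addr0.
have c1 : a k ord0 (idx_x j) * p ord0 (idx_y j) @[k --> \oo] --> 0 * p ord0 (idx_y j).
  by apply: cvgMl; exact: ac.
have c2 : p ord0 (idx_x j) * a k ord0 (idx_y j) @[k --> \oo] --> p ord0 (idx_x j) * 0.
  by apply: cvgMr; exact: ac.
rewrite mul0r in c1; rewrite mulr0 in c2.
have c12 : a k ord0 (idx_x j) * p ord0 (idx_y j) - p ord0 (idx_x j) * a k ord0 (idx_y j)
    @[k --> \oo] --> (0 - 0 : R) by apply: cvgB.
rewrite subr0 in c12.
by apply: cvgD.
Qed.

Lemma heis_mul_cvg p (a : nat -> H) : a k @[k --> \oo] --> (0 : H) ->
  heis_mul p (a k) @[k --> \oo] --> p.
Proof.
move=> a0.
have h : p + a k + (2 * heis_form p (a k)) *: (basis_rV idx_t : H) @[k --> \oo] -->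
    p + 0 + (2 * 0) *: (basis_rV idx_t : H).
  apply: cvgD; first by apply: cvgD => //; exact: cvg_cst.
  by apply: cvgZl; apply: cvgMr; exact: heis_form_cvg.
move: h; rewrite mulr0 scale0r !addr0.
by under eq_cvg do rewrite -heis_mulE.
Qed.

Lemma measurable_heis_mulr a : measurable_fun [set: H] (fun p => heis_mul p a).
Proof. exact: measurable_heis_mul. Qed.

Lemma heis_translate_cvg (a : nat -> H) f : a k @[k --> \oo] --> (0 : H) ->
  mu.-integrable setT (EFin \o f) ->
  (\int[mu]_p (`|f (heis_mul p (a k)) - f p|)%:E @[k --> \oo] --> 0)%E.
Proof.
move=> a0 fi.
have [] := @L1_translation_continuous_integrable R _ (fun k p => heis_mul p (a k)) _ _ _ f fi => //.
- by move=> k; exact: measurable_heis_mulr.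
- by move=> k g mg g0; exact: (integral_heis_mulr (a k) mg g0).
- by move=> p; exact: heis_mul_cvg.
Qed.

Hypothesis mu_gt0 : (0 < mu setT)%E.

Lemma ae_heis_mulr a (P : H -> Prop) : {ae mu, forall p, P p} ->
  {ae mu, forall p, P (heis_mul p a)}.
Proof.
move=> [N [mN N0 PN]]; exists ((heis_mul ^~ a) @^-1` N); split.
- by rewrite -[_ @^-1` _]setTI; exact: measurable_heis_mulr.
- rewrite -(setIT (_ @^-1` _)) -integral_indic//; last first.
    by rewrite -[_ @^-1` _]setTI; exact: measurable_heis_mulr.
  have mI : measurable_fun setT (fun p => (\1_N p : R)%:E).
    by apply/measurable_EFinP; exact: measurable_indic.
  transitivity (\int[mu]_p (\1_N (heis_mul p a))%:E)%E.
    by apply: eq_integral => p _; rewrite !indicE; congr ((_ : bool)%:R%:E); apply/idP/idP; rewrite !inE.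
  rewrite (integral_heis_mulr a mI); last by move=> p; rewrite lee_fin.
  by rewrite integral_indic// setIT.
- by move=> p /= nP; apply: PN.
Qed.

Lemma Ls_norm_heis_mulr s a f : (0 < s)%E -> measurable_fun setT f ->
  (Ls_norm s (fun p => f (heis_mul p a)) <= Ls_norm s f)%E.
Proof.
move=> s0 mf; rewrite /Ls_norm unlock; case: s s0 => [r r0||//]; last first.
  move=> _; rewrite mu_gt0; apply/ess_supP.
  exact: (ae_heis_mulr a (ess_sup_ge mu (abse \o (EFin \o f)))).
rewrite (integral_heis_mulr a (f := fun p => (`|(EFin \o f) p| `^ r)%E))//.
- apply: (measurableT_comp (measurable_poweR _)).
  by apply: measurableT_comp => //; exact/measurable_EFinP.
- by move=> p; exact: poweR_ge0.
Qed.

Variables (s : \bar R) (s_ge1 : (1 <= s)%E).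
Local Notation s' := (hoelder_conjugate s).

Let s_gt0 : (0 < s)%E. Proof. exact: lt_le_trans s_ge1. Qed.
Let s'_gt0 : (0 < s')%E.
Proof. by apply: lt_le_trans (hoelder_conj_ge1 s_ge1). Qed.

Lemma holder_translate u D a b : measurable_fun setT u -> measurable_fun setT D ->
  (Ls_norm s u < +oo)%E -> (Ls_norm s' D < +oo)%E ->
  (\int[mu]_p (`|u (heis_mul p a) * D (heis_mul p b)|)%:E <=
   Ls_norm s u * Ls_norm s' D)%E.
Proof.
move=> mu_ mD ufin Dfin.
have mua : measurable_fun setT (fun p => u (heis_mul p a)).
  exact: (measurableT_comp mu_ (measurable_heis_mulr a)).
have mDb : measurable_fun setT (fun p => D (heis_mul p b)).
  exact: (measurableT_comp mD (measurable_heis_mulr b)).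
have ua := Ls_norm_heis_mulr a s_gt0 mu_.
have Db := Ls_norm_heis_mulr b s'_gt0 mD.
apply: le_trans (holder_conj mu_gt0 s_ge1 mua mDb _ _) _.
- exact: le_lt_trans ua ufin.
- exact: le_lt_trans Db Dfin.
- by apply: lee_pmul => //; exact: Lnorm_ge0.
Qed.

Lemma holder_heis u D a : measurable_fun setT u -> measurable_fun setT D ->
  (Ls_norm s u < +oo)%E -> (Ls_norm s' D < +oo)%E ->
  (\int[mu]_p (`|u (heis_mul p a) * D p|)%:E <= Ls_norm s u * Ls_norm s' D)%E.
Proof.
move=> mu_ mD ufin Dfin; apply: le_trans (holder_translate a 0 mu_ mD ufin Dfin).
by under [leRHS]eq_integral do rewrite heis_mul0.
Qed.

(** Translations are not continuous on L^s for s = +oo. The part of D bounded by L is paired with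
    the L^1-continuity of u, and the excess is small in L^{s'} whatever the translation. *)
Lemma translate_mul_cvg u D (a : nat -> H) :
  measurable_fun setT u -> measurable_fun setT D ->
  (Ls_norm s u < +oo)%E -> (Ls_norm s' D < +oo)%E ->
  mu.-integrable setT (EFin \o u) -> a k @[k --> \oo] --> (0 : H) ->
  (\int[mu]_p (`|u (heis_mul p (a k)) - u p| * `|D p|)%:E @[k --> \oo] --> 0)%E.
Proof.
move=> mu_ mD ufin Dfin iu a0.
apply: ge0_cvge0 => [k|e e0].
  by apply: integral_ge0 => p _; rewrite lee_fin mulr_ge0.
pose M := fine (Ls_norm s u).
have M0 : 0 <= M by rewrite fine_ge0// Lnorm_ge0.
have ME : Ls_norm s u = M%:E by rewrite fineK// ge0_fin_numE// Lnorm_ge0.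
(* The excess meets both u and its translate, at a cost of at most e / 4 each, and the bounded part
   receives e / 2; M + 1 keeps the denominator positive. *)
pose eta := e / (4 * (M + 1)).
have eta0 : 0 < eta by rewrite divr_gt0// mulr_gt0// ltr_wpDl.
have [L L0 DL] := Lnorm_excess mu_gt0 (hoelder_conj_ge1 s_ge1) mD Dfin eta0.
have mE := measurable_excess L mD.
have eL : 0 < e / (2 * L) by rewrite divr_gt0// mulr_gt0.
apply: filterS (cvge0_near (heis_translate_cvg a0 iu) eL) => k kL.
have mua : measurable_fun setT (fun p => u (heis_mul p (a k))).
  exact: (measurableT_comp mu_ (measurable_heis_mulr _)).
have mdiff : measurable_fun setT (fun p => `|u (heis_mul p (a k)) - u p|).
  by apply: measurableT_comp => //; exact: measurable_funB.
have mabs (g h : H -> R) : measurable_fun setT g -> measurable_fun setT h ->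
    measurable_fun setT (fun p => (`|g p * h p|)%:E).
  move=> mg mh; apply/measurable_EFinP; apply: measurableT_comp => //.
  exact: measurable_funM.
apply: (@le_trans _ _ (L%:E * \int[mu]_p (`|u (heis_mul p (a k)) - u p|)%:E +
  (\int[mu]_p (`|u (heis_mul p (a k)) * excess L D p|)%:E +
   \int[mu]_p (`|u (heis_mul p 0) * excess L D p|)%:E))%E).
  rewrite -integralZl_ge0//; last exact: ltW.
  apply: le_integralD3 => [|||p|p|p|p|p]; rewrite ?mulr_ge0 ?(ltW L0)//.
  - exact: measurable_funM.
  - by apply: measurableT_comp => //; exact: measurable_funM.
  - apply: measurableT_comp => //; apply: measurable_funM => //.
    exact: (measurableT_comp mu_ (measurable_heis_mulr _)).
  rewrite heis_mul0 !normrM -mulrDl.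
  rewrite /excess; case: ltP => LD.
    apply: ler_wpDl; first by rewrite mulr_ge0// ltW.
    by rewrite ler_wpM2r// ler_normB.
  by rewrite normr0 mulr0 addr0 mulrC ler_wpM2r.
apply: (@le_trans _ _ (L%:E * (e / (2 * L))%:E + (M%:E * eta%:E + M%:E * eta%:E))%E).
  apply: leeD; first by rewrite lee_pmul2l// lte_fin.
  have Lfin : (Ls_norm s' (excess L D) < +oo)%E.
    by apply: le_lt_trans DL _; rewrite ltry.
  by apply: leeD; apply: le_trans (holder_heis _ mu_ mE ufin Lfin) _;
    rewrite ME lee_wpmul2l// lee_fin.
rewrite -!EFinM -!EFinD lee_fin.
have -> : L * (e / (2 * L)) = e / 2 by field; rewrite gt_eqF.
have : M * eta <= e / 4.
  rewrite /eta mulrA ler_pdivrMr ?mulr_gt0 ?ltr_wpDl//.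
  rewrite (_ : e / 4 * (4 * (M + 1)) = e * (M + 1)); last by field.
  by rewrite mulrC ler_wpM2l ?(ltW e0)// lerDl.
lra.
Qed.

Lemma integrable_mul_heis u D : measurable_fun setT u -> measurable_fun setT D ->
  (Ls_norm s u < +oo)%E -> (Ls_norm s' D < +oo)%E ->
  mu.-integrable setT (EFin \o (fun p => u p * D p)).
Proof.
move=> mu_ mD ufin Dfin; apply/integrableP; split.
  by apply/measurable_EFinP; exact: measurable_funM.
apply: le_lt_trans (_ : Ls_norm s u * Ls_norm s' D < +oo)%E.
  apply: le_trans (holder_heis 0 mu_ mD ufin Dfin).
  by under [leRHS]eq_integral do rewrite heis_mul0.
by rewrite lte_mul_pinfty// ?Lnorm_ge0// ge0_fin_numE// Lnorm_ge0.
Qed.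

(** Translations need not be continuous on L^{s'}, but the product uD is in L^1. So u(pa) (D(pb) -
    D(p)) is written as (u(pa) - u(pb)) D(pb), plus a translation difference of uD, minus (u(pa) -
    u(p)) D(p); a translation by b turns the first term into a difference of u against D. *)
Lemma translate_mul_cvg2 u D (a b : nat -> H) :
  measurable_fun setT u -> measurable_fun setT D ->
  (Ls_norm s u < +oo)%E -> (Ls_norm s' D < +oo)%E ->
  mu.-integrable setT (EFin \o u) ->
  a k @[k --> \oo] --> (0 : H) -> b k @[k --> \oo] --> (0 : H) ->
  heis_mul (heis_inv (b k)) (a k) @[k --> \oo] --> (0 : H) ->
  (\int[mu]_p (`|u (heis_mul p (a k))| * `|D (heis_mul p (b k)) - D p|)%:E
     @[k --> \oo] --> 0)%E.
Proof.
move=> mu_ mD ufin Dfin iu a0 b0 c0.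
have Nb0 : heis_inv (b k) @[k --> \oo] --> (0 : H).
  by have := cvgN b0; rewrite oppr0; exact.
have h1 := translate_mul_cvg mu_ mD ufin Dfin iu c0.
have h2 := heis_translate_cvg Nb0 (integrable_mul_heis mu_ mD ufin Dfin).
have h3 := translate_mul_cvg mu_ mD ufin Dfin iu a0.
have h := cvge0D h1 (cvge0D h2 h3).
have mtr (g : H -> R) c : measurable_fun setT g -> measurable_fun setT (fun p => g (heis_mul p c)).
  by move=> mg; exact: (measurableT_comp mg (measurable_heis_mulr _)).
apply: cvge0_le h => k.
  by apply: integral_ge0 => p _; rewrite lee_fin mulr_ge0.
have mFr c : measurable_fun setT (fun p => `|u (heis_mul p c) - u p| * `|D p|).
  apply: measurable_funM; last exact: measurableT_comp.
  by apply: measurableT_comp => //; apply: measurable_funB => //; exact: mtr.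
have mF c : measurable_fun setT (fun p => (`|u (heis_mul p c) - u p| * `|D p|)%:E).
  exact/measurable_EFinP.
rewrite -(integral_heis_mulr (b k) (mF _)); last by move=> p; rewrite lee_fin mulr_ge0.
pose G2r p := `|u (heis_mul p (heis_inv (b k))) * D (heis_mul p (heis_inv (b k))) - u p * D p|.
have mG2r : measurable_fun setT G2r.
  apply: measurableT_comp => //; apply: measurable_funB.
    by apply: measurable_funM; exact: mtr.
  exact: measurable_funM.
have mG2 : measurable_fun setT (fun p => (G2r p)%:E) by exact/measurable_EFinP.
rewrite -(integral_heis_mulr (b k) mG2); last by move=> p; rewrite lee_fin /G2r.
apply: le_integralD3 => [|||p|p|p|p|p]; rewrite ?mulr_ge0//.
- exact: (measurableT_comp (mFr _) (measurable_heis_mulr (b k))).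
- exact: (measurableT_comp mG2r (measurable_heis_mulr (b k))).
- by rewrite /G2r.
rewrite /G2r heis_mulK -heis_mulA (heis_mulA (b k)) heis_mulV heis_0mul.
set U := u (heis_mul p (a k)); set V := u (heis_mul p (b k)).
rewrite -!normrM.
have -> : U * (D (heis_mul p (b k)) - D p) = (U - V) * D (heis_mul p (b k)) +
   (- (u p * D p - V * D (heis_mul p (b k))) - (U - u p) * D p) by ring.
apply: le_trans (ler_normD _ _) _; rewrite lerD2l.
by apply: le_trans (ler_normB _ _) _; rewrite normrN.
Qed.

End heis_translation.

(** * Test functions and weak derivatives along flows *)

Section affine_maps.
Context {R : realType}.

(** [L] plays the role of the linear part of [A]. The identity has the shape of a difference
    quotient, so directional derivatives of f o A follow by rewriting. *)
Definition affine_with {V W : normedModType R} (L A : V -> W) :=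
  forall (h : R) (v p : V), A (h *: v + p) = h *: L v + A p.

Lemma derive_affine (V W : normedModType R) (L A : V -> W) (f : W -> R) (v p : V) :
  affine_with L A -> 'D_v (f \o A) p = 'D_(L v) f (A p).
Proof.
move=> aA; rewrite /derive.
have -> // : (fun h => h^-1 *: ((f \o A \o shift p) (h *: v) - (f \o A) p)) =
  (fun h => h^-1 *: ((f \o shift (A p)) (h *: L v) - f (A p))).
by apply/funext => h /=; rewrite aA.
Qed.

Lemma derivable_affine (V W : normedModType R) (L A : V -> W) (f : W -> R) (v p : V) :
  affine_with L A -> derivable f (A p) (L v) -> derivable (f \o A) p v.
Proof.
move=> aA; rewrite /derivable.
have -> // : (fun h => h^-1 *: ((f \o A \o shift p) (h *: v) - (f \o A) p)) =
  (fun h => h^-1 *: ((f \o shift (A p)) (h *: L v) - f (A p))).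
by apply/funext => h /=; rewrite aA.
Qed.

Variable m : nat.
Local Notation V := 'rV[R]_m.
Implicit Types (L A : V -> V) (f g : V -> R).

Lemma rV_sum_basis (v : V) : v = \sum_i v ord0 i *: basis_rV i.
Proof. exact: row_sum_delta. Qed.

Lemma affine_with_sum L A : affine_with L A ->
  A = (fun p => A 0 + \sum_i p ord0 i *: L (basis_rV i)).
Proof.
move=> aA; apply/funext => p; rewrite {1}(rV_sum_basis p).
suff h (s : seq 'I_m) : A (\sum_(i <- s) p ord0 i *: basis_rV i) =
   A 0 + \sum_(i <- s) p ord0 i *: L (basis_rV i) by exact: h.
elim: s => [|i s IH]; first by rewrite !big_nil addr0.
by rewrite !big_cons aA IH addrCA.
Qed.

Lemma differentiable_affine L A p : affine_with L A -> differentiable A p.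
Proof.
move=> /affine_with_sum ->.
apply: differentiableD; first exact: differentiable_cst.
have -> : (fun q : V => \sum_i q ord0 i *: L (basis_rV i)) =
    \sum_i (fun q : V => q ord0 i *: L (basis_rV i)).
  by apply/funext => q; rewrite fct_sumE.
apply: differentiable_sum => i; apply: differentiableZl.
exact: differentiable_coord.
Qed.

Lemma continuous_affine L A : affine_with L A -> continuous A.
Proof. by move=> aA p; exact/differentiable_continuous/differentiable_affine/aA. Qed.

Lemma derive_partial f p v : differentiable f p ->
  'D_v f p = \sum_i v ord0 i * partial i f p.
Proof.
move=> df; rewrite deriveE// {1}(rV_sum_basis v) linear_sum.
by apply: eq_bigr => i _; rewrite linearZ /= /partial deriveE.
Qed.

Lemma smooth_differentiable f p : smooth f -> differentiable f p.
Proof. by move=> /(_ [::] p). Qed.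

Lemma smooth_partial f i : smooth f -> smooth (partial i f).
Proof. by move=> sf l p; have := sf (rcons l i) p; rewrite foldr_rcons. Qed.

Lemma smooth_continuous f : smooth f -> continuous f.
Proof. by move=> sf p; apply: differentiable_continuous; exact: smooth_differentiable. Qed.

Lemma derive_lincomb (I : Type) (J : seq I) (c : I -> R) (g : I -> V -> R) p v :
  (forall j, differentiable (g j) p) ->
  differentiable (fun x => \sum_(j <- J) c j * g j x) p /\
  'D_v (fun x => \sum_(j <- J) c j * g j x) p = \sum_(j <- J) c j * 'D_v (g j) p.
Proof.
move=> dg; elim: J => [|j J [IHd IHD]].
  have -> : (fun x => \sum_(j <- [::]) c j * g j x) = cst 0.
    by apply/funext => x; rewrite big_nil.
  by rewrite derive_cst big_nil; split => //; exact: differentiable_cst.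
have -> : (fun x => \sum_(j <- j :: J) c j * g j x) =
    (c j *: g j) + (fun x => \sum_(j <- J) c j * g j x).
  by apply/funext => x; rewrite big_cons.
have dcg : differentiable (c j *: g j) p by exact: differentiableZ.
split; first exact: differentiableD.
rewrite deriveD; [|exact: diff_derivable|exact: diff_derivable].
by rewrite IHD big_cons deriveZ//; exact: diff_derivable.
Qed.

(** The linear part is constant, so the chain rule produces no derivatives of coefficients: a
    partial derivative of a combination of derivatives of f at A p is again one. *)
Lemma foldr_partial_affine L A f (l : seq 'I_m) : affine_with L A -> smooth f ->
  exists J : seq (R * seq 'I_m), foldr partial (f \o A) l =
    (fun p => \sum_(j <- J) j.1 * foldr partial f j.2 (A p)).
Proof.
move=> aA sf; elim: l => [|k l [J IH]].
  by exists [:: (1, [::])]; apply/funext => p; rewrite big_seq1 mul1r.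
exists [seq (j.1 * L (basis_rV k) ord0 i, i :: j.2) | j <- J, i <- index_enum 'I_m].
rewrite /= IH; apply/funext => p; rewrite /partial.
have dA := differentiable_affine (A p) aA.
have dg (j : R * seq 'I_m) : differentiable (foldr partial f j.2 \o A) p.
  by apply: differentiable_comp; [exact: differentiable_affine aA|exact: sf].
have [_ ->] := derive_lincomb J (fun j => j.1) (basis_rV k) dg.
rewrite big_allpairs_dep; apply: eq_bigr => j _.
rewrite (derive_affine _ _ _ aA) derive_partial; last exact: sf.
by rewrite mulr_sumr; apply: eq_bigr => i _; rewrite /= mulrA.
Qed.

Lemma smooth_affine L A f : affine_with L A -> smooth f -> smooth (f \o A).
Proof.
move=> aA sf l p; have [J ->] := foldr_partial_affine l aA sf.
have dg (j : R * seq 'I_m) : differentiable (foldr partial f j.2 \o A) p.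
  by apply: differentiable_comp; [exact: differentiable_affine aA|exact: sf].
by have [d _] := derive_lincomb J (fun j => j.1) 0 dg.
Qed.

(** The continuous left inverse carries the compact support of f onto a compact set that contains
    the support of f o A. *)
Lemma test_function_affine L A (B : V -> V) f : affine_with L A ->
  continuous B -> cancel A B ->
  test_function f -> test_function (f \o A).
Proof.
move=> aA cB AK [sf cf]; split; first exact: smooth_affine aA sf.
have cBf : compact (B @` support_rV f).
  by apply: continuous_compact => //; exact: continuous_subspaceT.
apply: (subclosed_compact _ cBf); first exact: closed_closure.
have clBf : closed (B @` support_rV f).
  by apply: compact_closed => //; exact: norm_hausdorff.
rewrite [X in _ `<=` X]((closure_id _).1 clBf); apply: closure_subset => p /= fp.
by exists (A p); [apply: subset_closure|rewrite AK].
Qed.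

(** Off its closed support f vanishes on a neighbourhood, so its derivatives vanish there as
    well. *)
Lemma support_box f : compact (support_rV f) -> exists2 r : R, 0 < r &
  forall p, ~ rV_box r p -> f p = 0 /\ forall W, lie W f p = 0.
Proof.
move=> /[dup] cf /compact_rV_box[r r0 fr]; exists r => // p pr.
have pf : ~ support_rV f p by move/fr.
split.
  by apply/eqP/negPn/negP => fp; apply: pf; exact: subset_closure.
move=> W; rewrite /lie (near_eq_derive (g := cst 0)) ?derive_cst//.
have : open (~` support_rV f) by apply: closed_openC; exact: closed_closure.
rewrite openE => /(_ p pf); apply: filterS => q qf.
by apply/eqP/negPn/negP => fq; apply: qf; exact: subset_closure.
Qed.

Lemma continuous_support_bounded (g : V -> R) (r : R) : continuous g ->
  (forall p, ~ rV_box r p -> g p = 0) -> exists2 C : R, 0 < C & forall p, `|g p| <= C.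
Proof.
move=> cg g0.
have : compact (g @` rV_box r).
  by apply: continuous_compact; [exact: continuous_subspaceT|exact: rV_box_compact].
move=> /compact_bounded[M [_ gM]]; exists (`|M| + 1); first by rewrite ltr_wpDl.
move=> p; have [pr|/g0->] := pselect (rV_box r p); last by rewrite normr0 addr_ge0.
by apply: (gM (`|M| + 1)); [rewrite (le_lt_trans (ler_norm _)) ?ltrDl|exists p].
Qed.

End affine_maps.

(** * Fubini and change of variables for real-valued integrals *)

Section real_fubini.
Local Open Scope ereal_scope.
Context d1 d2 (T1 : measurableType d1) (T2 : measurableType d2) (R : realType).
Variables (m1 : {measure set T1 -> \bar R}) (m2 : {measure set T2 -> \bar R}).

Lemma EFin_Rintegral (g : T1 -> R) : m1.-integrable setT (EFin \o g) ->
  (\int[m1]_x g x)%R%:E = \int[m1]_x (g x)%:E.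
Proof. by move=> ig; rewrite fineK//; exact: integrable_fin_num. Qed.

Lemma integrable_absP (g : T1 -> R) : measurable_fun setT g ->
  \int[m1]_x (`|g x|)%:E < +oo -> m1.-integrable setT (EFin \o g).
Proof. by move=> mg fg; apply/integrableP; split => //; exact/measurable_EFinP. Qed.

Lemma integrable_abs_lty (g : T1 -> R) :  m1.-integrable setT (EFin \o g) ->
  measurable_fun setT g /\ \int[m1]_x (`|g x|)%:E < +oo.
Proof. by move=> /integrableP[mg fg]; split => //; exact/measurable_EFinP. Qed.

Hypotheses (sf1 : sigma_finite setT m1) (sf2 : sigma_finite setT m2).

(** Almost every section is integrable, and on those sections [fine] loses nothing. *)
Lemma Rintegral_fubini_fst (f : T1 * T2 -> R) : measurable_fun setT f ->
  \int[m1]_x \int[m2]_y (`|f (x, y)|)%:E < +oo ->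
  [/\ {ae m1, forall x, m2.-integrable setT (fun y => (f (x, y))%:E)},
      m1.-integrable setT (fun x => (\int[m2]_y f (x, y))%R%:E) &
      (\int[m1]_x \int[m2]_y f (x, y))%R%:E = \int[m1]_x \int[m2]_y (f (x, y))%:E].
Proof.
move=> mf fin.
have mEf : measurable_fun setT (EFin \o f) by exact/measurable_EFinP.
have imf : (sigma_finite_alias sf1 \x sigma_finite_alias sf2)%E.-integrable setT (EFin \o f).
  exact/(@integrable12ltyP _ _ _ _ _ (sigma_finite_alias sf1) (sigma_finite_alias sf2)
    (EFin \o f) mEf).
have ae := ae_integrable1 imf.
have /integrableP[mF fF] := integrable_fubini_F imf.
have fineF : {ae m1, forall x, setT x -> (\int[m2]_y f (x, y))%R%:E = \int[m2]_y (f (x, y))%:E}.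
  by apply: filterS ae => x ix _; rewrite fineK//; exact: integrable_fin_num.
have mR : measurable_fun setT (fun x => (\int[m2]_y f (x, y))%R%:E).
  by apply/measurable_EFinP; exact: (measurableT_comp (fine_measurable measurableT) mF).
have iR : m1.-integrable setT (fun x => (\int[m2]_y f (x, y))%R%:E).
  apply/integrableP; split => //; apply: le_lt_trans fF.
  apply: le_integral_ae_nonmeas => //.
    by apply: measurableT_comp mF.
  by apply: filterS fineF => x /(_ I) -> _.
split => //; rewrite EFin_Rintegral//.
exact: ae_eq_integral.
Qed.

End real_fubini.

Section real_fubini_swap.
Local Open Scope ereal_scope.
Context d1 d2 (T1 : measurableType d1) (T2 : measurableType d2) (R : realType).
Variables (m1 : {measure set T1 -> \bar R}) (m2 : {measure set T2 -> \bar R}).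
Hypotheses (sf1 : sigma_finite setT m1) (sf2 : sigma_finite setT m2).

Lemma Rintegral_fubini (f : T1 * T2 -> R) : measurable_fun setT f ->
  \int[m1]_x \int[m2]_y (`|f (x, y)|)%:E < +oo ->
  (\int[m1]_x \int[m2]_y f (x, y) = \int[m2]_y \int[m1]_x f (x, y))%R.
Proof.
move=> mf fin.
have mEf : measurable_fun setT (EFin \o f) by exact/measurable_EFinP.
have mAf : measurable_fun setT (fun z => (`|f z|)%:E).
  by apply/measurable_EFinP; exact: measurableT_comp.
have imf : (sigma_finite_alias sf1 \x sigma_finite_alias sf2)%E.-integrable setT (EFin \o f).
  exact/(@integrable12ltyP _ _ _ _ _ (sigma_finite_alias sf1) (sigma_finite_alias sf2)
    (EFin \o f) mEf).
have [_ _ e1] := Rintegral_fubini_fst sf1 sf2 mf fin.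
have mf' : measurable_fun setT (fun z : T2 * T1 => f (z.2, z.1)).
  by apply: (measurableT_comp mf); exact: measurable_fun_pair.
have fin' : \int[m2]_y \int[m1]_x (`|f (x, y)|)%:E < +oo.
  by rewrite -(sigma_finite_tonelli mAf _ sf1 sf2)// => z; rewrite lee_fin.
have [_ _ e2] := Rintegral_fubini_fst sf2 sf1 mf' fin'.
apply: EFin_inj; rewrite e1 e2.
exact: (Fubini imf).
Qed.

End real_fubini_swap.

Section change_of_variables.
Local Open Scope ereal_scope.
Context d (T : measurableType d) (R : realType) (mu : {measure set T -> \bar R}).

(** The rule is given for nonnegative functions and extends to signed ones through positive and
    negative parts. *)
Lemma Rintegral_change (A : T -> T) (c : R) (f : T -> R) : (0 <= c)%R ->
  (forall g : T -> \bar R, measurable_fun setT g -> (forall x, 0 <= g x) ->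
     \int[mu]_x g (A x) = c%:E * \int[mu]_x g x) ->
  measurable_fun setT A -> mu.-integrable setT (EFin \o f) ->
  mu.-integrable setT (EFin \o (f \o A)) /\
  (\int[mu]_x f (A x) = c * \int[mu]_x f x)%R.
Proof.
move=> c0 hA mA iF; have [mf ff] := integrable_abs_lty iF.
have iA : mu.-integrable setT (EFin \o (f \o A)).
  apply: integrable_absP; first exact: measurableT_comp.
  rewrite (hA (fun x => (`|f x|)%:E)).
  - by rewrite lte_mul_pinfty ?lee_fin.
  - by apply/measurable_EFinP; exact: measurableT_comp.
  - by move=> x; rewrite lee_fin.
split => //; apply: EFin_inj; rewrite EFinM !EFin_Rintegral//.
have mEf : measurable_fun setT (EFin \o f) by exact/measurable_EFinP.
rewrite integralE [in RHS]integralE.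
have -> : \int[mu]_x (fun x => (f (A x))%:E)^\+ x = c%:E * \int[mu]_x (EFin \o f)^\+ x.
  transitivity (\int[mu]_x (EFin \o f)^\+ (A x)); first by apply: eq_integral => x _; rewrite ?funeposE ?funenegE.
  by rewrite hA//; exact: measurable_funepos.
have -> : \int[mu]_x (fun x => (f (A x))%:E)^\- x = c%:E * \int[mu]_x (EFin \o f)^\- x.
  transitivity (\int[mu]_x (EFin \o f)^\- (A x)); first by apply: eq_integral => x _; rewrite ?funeposE ?funenegE.
  by rewrite hA//; exact: measurable_funeneg.
rewrite -muleBr//.
exact: integrable_add_def.
Qed.

End change_of_variables.

(** * Means over the unit interval and smooth functions along lines *)

Section unit_interval.
Context {R : realType}.
Local Open Scope ereal_scope.

Local Notation U := (uniform_prob (@ltr01 R)).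

Lemma sigma_finite_unit : sigma_finite setT U.
Proof. exact: sigma_finiteT. Qed.

(** Integration over [0, 1] is done against the uniform probability [U]: all integrals then run over
    the whole type, as in the Fubini lemmas, and constants are their own means. *)
Lemma integral_unit (f : R -> \bar R) : measurable_fun setT f -> (forall r, 0 <= f r) ->
  \int[U]_r f r = \int[lebesgue_measure]_(r in `[0%R, 1%R]) f r.
Proof. by move=> mf f0; rewrite integral_uniform// subr0 invr1 mul1e. Qed.

Lemma integral_unit_le (f : R -> \bar R) (C : R) : measurable_fun setT f ->
  (forall r, 0 <= f r) -> (forall r, (0 <= r <= 1)%R -> f r <= C%:E) ->
  \int[U]_r f r <= C%:E.
Proof.
move=> mf f0 fC; rewrite integral_unit//.
have <- : \int[lebesgue_measure]_(r in `[0%R, 1%R : R]) (cst C%:E r) = C%:E.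
  by rewrite integral_cst//= lebesgue_measure_itv/= lte_fin ltr01 sube0 mule1.
by apply: le_integral_nonmeas => // r /=; rewrite in_itv /= => r01; exact: fC.
Qed.

Lemma integrable_unit (f : R -> R) (C : R) : measurable_fun setT f ->
  (forall r, (0 <= r <= 1)%R -> (`|f r| <= C)%R) -> U.-integrable setT (EFin \o f).
Proof.
move=> mf fC; apply: integrable_absP => //.
apply: (le_lt_trans (integral_unit_le _ _ _)); last exact: (ltry C).
- by apply/measurable_EFinP; exact: measurableT_comp.
- by move=> r; rewrite lee_fin.
- by move=> r r01; rewrite lee_fin fC.
Qed.

Lemma Rintegral_unit (f : R -> R) : U.-integrable setT (EFin \o f) ->
  (\int[U]_r f r = \int[lebesgue_measure]_(r in `[0%R, 1%R]) f r)%R.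
Proof.
move=> iF; have mf : measurable_fun setT (EFin \o f) by exact: measurable_int iF.
rewrite /Rintegral; congr fine; rewrite integralE [in RHS]integralE.
rewrite !integral_unit//; [exact: measurable_funeneg|exact: measurable_funepos].
Qed.

Lemma Rintegral_unit_affine (a b : R) : (\int[U]_r (a + b * r) = a + b / 2)%R.
Proof.
have mi : measurable_fun setT (fun r : R => r : R) by exact: measurable_id.
have bnd : forall r : R, (0 <= r <= 1)%R -> (`|r| <= 1)%R.
  by move=> r /andP[r0 r1]; rewrite ger0_norm.
have ir : U.-integrable setT (EFin \o (fun r : R => r)) by exact: (integrable_unit _ bnd).
have ia : U.-integrable setT (EFin \o (fun _ : R => a)).
  exact: finite_measure_integrable_cst.
have ibr : U.-integrable setT (EFin \o (fun r : R => b * r)%R).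
  by apply: eq_integrable (integrableZl measurableT b ir).
rewrite RintegralD// RintegralZl// Rintegral_cst//.
rewrite [X in (a * fine X)%R](_ : _ = 1); last exact: probability_setT.
rewrite mulr1; congr (_ + _ * _)%R.
rewrite Rintegral_unit// /Rintegral.
rewrite (continuous_FTC2 (F := fun r : R => (r ^+ 2 / 2)%R)) //.
- by rewrite expr1n expr0n mul0r sube0 mul1r.
- by apply: continuous_subspaceT => x; exact: cvg_id.
- have cF : continuous (fun r : R => (r ^+ 2 / 2)%R).
    by move=> x; apply: cvgMl; exact: exprn_continuous.
  split; [by move=> x _; exact: derivableM| |].
  - by apply: cvg_at_right_filter; exact: cF.
  - by apply: cvg_at_left_filter; exact: cF.
- move=> x _; rewrite derive1E deriveM// derive_cst scaler0 add0r exp_derive.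
  by rewrite /= expr1 /GRing.scale /= mulr1 mulrA mulVf// mul1r.
Qed.

End unit_interval.

Section smooth_flow.
Context {R : realType} (m : nat).
Local Notation V := 'rV[R]_m.
Local Notation U := (uniform_prob (@ltr01 R)).
Implicit Types (p v : V) (f : V -> R).

Lemma is_derive_line f p v (r : R) : differentiable f (p + r *: v) ->
  derivable (fun s : R => f (p + s *: v)) r 1 /\
  'D_1 (fun s : R => f (p + s *: v)) r = 'D_v f (p + r *: v).
Proof.
move=> df; have aA : affine_with (fun s : R => s *: v) (fun s : R => p + s *: v).
  by move=> h s1 s2; rewrite scalerDl -scalerA addrCA.
split.
  by apply: (derivable_affine (f := f) aA); rewrite scale1r; exact: diff_derivable.
by rewrite (derive_affine _ _ _ aA) scale1r.
Qed.

Lemma derive_smooth_continuous f v : smooth f -> continuous (fun p => 'D_v f p).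
Proof.
move=> sf; have -> : (fun p => 'D_v f p) = (fun p => \sum_i v ord0 i * partial i f p).
  by apply/funext => p; rewrite derive_partial//; exact: smooth_differentiable.
have cp i : continuous (fun p : V => v ord0 i * partial i f p : R).
  have cp : continuous (partial i f) by apply: smooth_continuous; exact: smooth_partial.
  by move=> p; apply: (cvgMl_tmp (F := nbhs p)); exact: cp.
apply: continuous_big => [|i _]; first exact: add_continuous.
exact: cp.
Qed.

Lemma line_continuous p v : continuous (fun s : R => p + s *: v).
Proof. by move=> s; apply: cvgD; [exact: cvg_cst|apply: cvgZr_tmp]. Qed.

Lemma ftc_line f p v : smooth f ->
  U.-integrable setT (fun r => ('D_v f (p + r *: v))%:E) /\
  f (p + v) - f p = \int[U]_r 'D_v f (p + r *: v).
Proof.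
move=> sf; pose g (r : R) : R := 'D_v f (p + r *: v).
have cg : continuous g.
  move=> r; change {for r, continuous ((fun q => 'D_v f q) \o (fun s : R => p + s *: v))}.
  by apply: continuous_comp; [exact: line_continuous|exact: derive_smooth_continuous].
have : compact (g @` `[0, 1]).
  by apply: continuous_compact; [exact: continuous_subspaceT|exact: segment_compact].
move=> /compact_bounded[M [_ gM]].
have ig : U.-integrable setT (EFin \o g).
  apply: (@integrable_unit _ _ (`|M| + 1)).
    exact: continuous_measurable_fun.
  move=> r r01; apply: (gM (`|M| + 1)).
    by rewrite (le_lt_trans (ler_norm _)) ?ltrDl.
  by exists r => //=; rewrite in_itv.
split => //; rewrite Rintegral_unit//.
have cf : continuous (fun s : R => f (p + s *: v)).
  move=> r; change {for r, continuous (f \o (fun s : R => p + s *: v))}.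
  by apply: continuous_comp; [exact: line_continuous|exact: smooth_continuous].
rewrite /Rintegral (continuous_FTC2 (F := fun s : R => f (p + s *: v)))//.
- by rewrite /= scale1r scale0r addr0.
- exact: continuous_subspaceT.
- split; first by move=> r _; apply: (is_derive_line _).1; exact: smooth_differentiable.
  + by apply: cvg_at_right_filter; exact: cf.
  + by apply: cvg_at_left_filter; exact: cf.
- move=> r _; rewrite derive1E; apply: (is_derive_line _).2.
  exact: smooth_differentiable.
Qed.

End smooth_flow.

(** * Calculus along the invariant frames *)

Section heis_calculus.
Context {R : realType} {n : nat}.
Local Notation H := (heis R n).
Local Notation U := (uniform_prob (@ltr01 R)).
Implicit Types (p q a v : H) (f g phi : H -> R) (k : 'I_(n + n + 1)) (s sg : R).

Let affine_withP (L A : H -> H) :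
  (forall h (v p : H), A (h *: v + p) = h *: L v + A p :> H) -> affine_with L A.
Proof. by []. Qed.

Lemma affine_heis_mulr a :
  affine_with (fun v : H => v + (2 * heis_form v a) *: basis_rV idx_t)
    (fun p : H => heis_mul p a).
Proof.
apply: affine_withP => h v p; rewrite !heis_mulE heis_formDl heis_formZl.
by apply: rV_ext => i; rewrite !rVE; ring.
Qed.

Lemma affine_heis_mull a :
  affine_with (fun v : H => v + (2 * heis_form a v) *: basis_rV idx_t)
    (fun p : H => heis_mul a p).
Proof.
apply: affine_withP => h v p; rewrite !heis_mulE heis_formDr heis_formZr.
by apply: rV_ext => i; rewrite !rVE; ring.
Qed.

Lemma affine_heis_dil l : affine_with (@heis_dil R n l) (@heis_dil R n l).
Proof.
apply: affine_withP => h v p; apply: rV_ext => i; elim/(@idx_ht n): i => [i|].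
  by rewrite !rVE !heis_dil_h !rVE; ring.
by rewrite !rVE !heis_dil_t !rVE; ring.
Qed.

Lemma affine_comp (V : normedModType R) (L1 L2 A1 A2 : V -> V) :
  affine_with L1 A1 -> affine_with L2 A2 -> affine_with (L1 \o L2) (A1 \o A2).
Proof. by move=> a1 a2 h v p; rewrite /= a2 a1. Qed.

Lemma derive_dirD f p u v s : differentiable f p ->
  'D_(u + s *: v) f p = 'D_u f p + s * 'D_v f p.
Proof. by move=> df; rewrite !deriveE// linearD linearZ. Qed.

Lemma derive_dirZ f p v s : differentiable f p -> 'D_(s *: v) f p = s * 'D_v f p.
Proof. by move=> df; rewrite !deriveE// linearZ. Qed.

(** The field is constant along its own flow, so the derivative along the straight segment is s
    times the Lie derivative at the current point. *)
Lemma ftc_frame sg k phi p s : smooth phi ->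
  U.-integrable setT (fun r => (lie (field_frame sg k) phi
     (p + (s * r) *: field_frame sg k p))%:E) /\
  phi (p + s *: field_frame sg k p) - phi p =
  s * \int[U]_r lie (field_frame sg k) phi (p + (s * r) *: field_frame sg k p).
Proof.
(* For s nonzero, integrability of the Lie derivative is obtained by dividing by s. *)
move=> sphi; have [s0|s0] := eqVneq s 0.
  rewrite s0 !mul0r scale0r addr0 subrr; split => //.
  have -> : (fun r : R => (lie (field_frame sg k) phi
      (p + (0 * r) *: field_frame sg k p))%:E) = EFin \o cst (lie (field_frame sg k) phi p).
    by apply/funext => r /=; rewrite mul0r scale0r addr0.
  exact: finite_measure_integrable_cst.
have [+ ->] := ftc_line p (s *: field_frame sg k p) sphi.
have E r : 'D_(s *: field_frame sg k p) phi (p + r *: (s *: field_frame sg k p)) =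
    s * lie (field_frame sg k) phi (p + (s * r) *: field_frame sg k p).
  rewrite derive_dirZ; last exact: smooth_differentiable.
  by rewrite /lie scalerA [r * s]mulrC field_frame_flow.
under eq_fun do rewrite E.
move=> iE; have iL : U.-integrable setT (fun r => (lie (field_frame sg k) phi
     (p + (s * r) *: field_frame sg k p))%:E).
  have := integrableZl measurableT s^-1 iE; apply: eq_integrable => // r _.
  by rewrite -EFinM mulKf.
split => //; rewrite -RintegralZl//; apply: eq_Rintegral => r _; exact: E.
Qed.

Lemma ftc_left k phi p s : smooth phi ->
  U.-integrable setT (fun r => (lie (Zleft k) phi
     (heis_mul p ((s * r) *: basis_rV k)))%:E) /\
  phi (heis_mul p (s *: basis_rV k)) - phi p =
  s * \int[U]_r lie (Zleft k) phi (heis_mul p ((s * r) *: basis_rV k)).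
Proof.
move=> /(ftc_frame 1 k p s)[i e]; rewrite heis_mul_exp.
by split; [under eq_fun do rewrite heis_mul_exp|
  under eq_Rintegral do rewrite heis_mul_exp].
Qed.

Lemma ftc_right k phi p s : smooth phi ->
  U.-integrable setT (fun r => (lie (Zright k) phi
     (heis_mul ((s * r) *: basis_rV k) p))%:E) /\
  phi (heis_mul (s *: basis_rV k) p) - phi p =
  s * \int[U]_r lie (Zright k) phi (heis_mul ((s * r) *: basis_rV k) p).
Proof.
move=> /(ftc_frame (-1) k p s)[i e]; rewrite heis_exp_mul.
by split; [under eq_fun do rewrite heis_exp_mul|
  under eq_Rintegral do rewrite heis_exp_mul].
Qed.

(* [exp (s Z_k)] is the time-s flow of the left-invariant field [Z_k]. *)
Lemma lie_left_flow k phi s p :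
  lie (Zleft k) (fun q => phi (heis_mul q (s *: basis_rV k))) p =
  lie (Zleft k) phi (heis_mul p (s *: basis_rV k)).
Proof.
rewrite /lie (derive_affine _ _ _ (affine_heis_mulr (s *: basis_rV k))).
congr ('D_ _ phi _); rewrite heis_mul_exp /Zleft field_frame_flow -/(Zleft k).
rewrite -[RHS]addr0; congr (_ + _); rewrite heis_formZr.
suff -> : heis_form (Zleft k p) (basis_rV k) = 0 by rewrite !mulr0 scale0r.
rewrite /Zleft; elim/(@idx_ind n): k => [j|j|].
- by rewrite field_frame_x heis_formDl heis_formZl heis_form_tl heis_formxx mulr0 addr0.
- by rewrite field_frame_y -scaleNr heis_formDl heis_formZl heis_form_tl heis_formxx mulr0 addr0.
- by rewrite field_frame_t heis_formxx.
Qed.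

Lemma continuous_lie sg k phi : smooth phi -> continuous (lie (field_frame sg k) phi).
Proof.
move=> sphi; have dp v : continuous ('D_v phi) by exact: derive_smooth_continuous.
have cc i : continuous (fun p : H => p ord0 i) by move=> p; exact: coord_continuous.
have cD v (c : R) i : continuous (fun p : H => 'D_v phi p + (c * p ord0 i) * 'D_(basis_rV idx_t) phi p).
  move=> p; apply: (cvgD (F := nbhs p)); first exact: dp.
  apply: (cvgM (F := nbhs p)); last exact: dp.
  by apply: (cvgMl_tmp (F := nbhs p)); exact: cc.
move: k; apply: idx_ind => [j|j|].
- have -> : lie (field_frame sg (idx_x j)) phi = (fun p => 'D_(basis_rV (idx_x j)) phi p +
     ((2 * sg) * p ord0 (idx_y j)) * 'D_(basis_rV idx_t) phi p).
    apply/funext => p; rewrite /lie field_frame_x derive_dirD ?ypartE//.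
    exact: smooth_differentiable.
  exact: cD.
- have -> : lie (field_frame sg (idx_y j)) phi = (fun p => 'D_(basis_rV (idx_y j)) phi p +
     ((- (2 * sg)) * p ord0 (idx_x j)) * 'D_(basis_rV idx_t) phi p).
    apply/funext => p; rewrite /lie field_frame_y -scaleNr derive_dirD ?xpartE ?mulNr//.
    exact: smooth_differentiable.
  exact: cD.
- have -> : lie (field_frame sg idx_t) phi = 'D_(basis_rV idx_t) phi.
    by apply/funext => p; rewrite /lie field_frame_t.
  exact: dp.
Qed.

(** A common class for test functions, their derivatives along the frames and indicators of boxes;
    its members pair with every locally integrable function. *)
Definition bounded_supp (phi : H -> R) := measurable_fun setT phi /\
  exists C r : R, [/\ 0 <= C, 0 <= r, forall p, `|phi p| <= C &
    forall p, ~ rV_box r p -> phi p = 0].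

Lemma bounded_supp_test phi : test_function phi -> bounded_supp phi.
Proof.
move=> [sphi cphi]; have [r r0 hr] := support_box cphi.
have cp : continuous phi by exact: smooth_continuous.
split; first exact: continuous_measurable_rV.
have [C C0 hC] := continuous_support_bounded cp (fun p pr => (hr p pr).1).
by exists C, r; split; [exact: ltW|exact: ltW| |move=> p /hr[]].
Qed.

Lemma bounded_supp_lie sg k phi : test_function phi -> bounded_supp (lie (field_frame sg k) phi).
Proof.
move=> [sphi cphi]; have [r r0 hr] := support_box cphi.
have cp : continuous (lie (field_frame sg k) phi) by exact: continuous_lie.
split; first exact: continuous_measurable_rV.
have [C C0 hC] := continuous_support_bounded cp (fun p pr => (hr p pr).2 _).
by exists C, r; split; [exact: ltW|exact: ltW| |move=> p /hr[_]].
Qed.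

End heis_calculus.

Section measurable_parameter_Rintegral.
Context d1 d2 (T1 : measurableType d1) (T2 : measurableType d2) (R : realType).
Variable m2 : {measure set T2 -> \bar R}.

Lemma measurable_Rintegral_snd (f : T1 * T2 -> R) : sigma_finite setT m2 ->
  measurable_fun setT f -> measurable_fun setT (fun x => \int[m2]_y f (x, y)).
Proof.
move=> sf2 mf; have mEf : measurable_fun setT (EFin \o f) by exact/measurable_EFinP.
apply: (measurableT_comp (fine_measurable measurableT)).
have -> : (fun x => \int[m2]_y (f (x, y))%:E)%E =
  (fun x => \int[m2]_y (EFin \o f)^\+ (x, y) - \int[m2]_y (EFin \o f)^\- (x, y))%E.
  apply/funext => x; rewrite integralE; congr (_ - _)%E; apply: eq_integral => y _.
    by rewrite !funeposE.
  by rewrite !funenegE.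
apply: emeasurable_funB.
  exact: (measurable_integral_snd (measurable_funepos mEf)).
exact: (measurable_integral_snd (measurable_funeneg mEf)).
Qed.

End measurable_parameter_Rintegral.

(** * Local integrability tested on boxes *)

Section box_integrability.
Context {R : realType} {n : nat}.
Local Notation H := (heis R n).
Local Notation mu := (@mu_heis R n).
Local Notation U := (uniform_prob (@ltr01 R)).
Implicit Types (p q a v : H) (f g h phi : H -> R) (k : 'I_(n + n + 1)) (s r : R).

Lemma rV_box_heis_mul r1 r2 : exists2 r3 : R, 0 <= r3 &
  forall p q, rV_box r1 p -> rV_box r2 q -> rV_box r3 (heis_mul p q).
Proof.
have m10 : 0 <= `|r1| by []. have m20 : 0 <= `|r2| by [].
move: `|r1| (ler_norm r1) m10 `|r2| (ler_norm r2) m20 => m1 rm1 m10 m2 rm2 m20.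
pose e : R := m1 + m2 + 2 * (\sum_(j < n) (m2 * m1 + m1 * m2)).
have s0 : 0 <= \sum_(j < n) (m2 * m1 + m1 * m2).
  by apply: sumr_ge0 => j _; rewrite addr_ge0// mulr_ge0.
have e0 : 0 <= e by rewrite !addr_ge0// mulr_ge0.
exists e => // p q pr qr.
have pm i : `|p ord0 i| <= m1 by rewrite (le_trans (pr i)).
have qm i : `|q ord0 i| <= m2 by rewrite (le_trans (qr i)).
apply: idx_ht => [i|].
  rewrite heis_mul_h (le_trans (ler_normD _ _))// (le_trans (lerD (pm _) (qm _)))//.
  by rewrite /e lerDl mulr_ge0.
rewrite heis_mul_t (le_trans (ler_normD _ _))// lerD//.
  by rewrite (le_trans (ler_normD _ _))// lerD.
rewrite normrM ger0_norm// ler_pM2l// /heis_form (le_trans (ler_norm_sum _ _ _))//.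
apply: ler_sum => j _; rewrite (le_trans (ler_normB _ _))// !normrM lerD// ler_pM//.
Qed.

Lemma rV_box_basis s r k : `|s| <= r -> rV_box r (s *: basis_rV k : H).
Proof.
move=> sr i; rewrite !rVE normrM; case: (i == k); rewrite ?normr1 ?mulr1//.
by rewrite normr0 mulr0 (le_trans _ sr).
Qed.

Definition boxed r f : H -> R := fun p => f p * \1_(rV_box r) p.

Lemma boxed_in r f p : rV_box r p -> boxed r f p = f p.
Proof. by move=> pr; rewrite /boxed indicE mem_set// mulr1. Qed.

Lemma boxed_out r f p : ~ rV_box r p -> boxed r f p = 0.
Proof. by move=> pr; rewrite /boxed indicE memNset// mulr0. Qed.

Lemma measurable_boxed r f : measurable_fun setT f -> measurable_fun setT (boxed r f).
Proof.
by move=> mf; apply: measurable_funM => //; apply: measurable_indic; exact: measurable_rV_box.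
Qed.

(** Boxes replace compact sets here because the product of two boxes lies in a box, which makes
    stability under translations explicit. *)
Definition box_integrable f := measurable_fun setT f /\
  forall r, mu.-integrable setT (EFin \o boxed r f).

Lemma locally_box_integrable f : locally_integrable_rV f -> box_integrable f.
Proof.
move=> [mf fi]; split => // r.
have := fi _ (@rV_box_compact R (n + n + 1) r).
rewrite integrable_mkcond; last exact: measurable_rV_box.
apply: eq_integrable => // p _; rewrite /restrict /=.
have [pr|pr] := pselect (rV_box r p); first by rewrite mem_set// boxed_in.
by rewrite memNset// boxed_out.
Qed.

Lemma bounded_supp_box r : 0 <= r -> bounded_supp (\1_(rV_box r) : H -> R).
Proof.
move=> r0; split; first by apply: measurable_indic; exact: measurable_rV_box.
exists 1, r; split => // p.
  by rewrite indicE; case: (_ \in _); rewrite ?normr1 ?normr0.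
by move=> pr; rewrite indicE memNset.
Qed.

(** The bound is uniform over translations from a box, so that it can be integrated over the time r
    of a flow. *)
Lemma box_integrable_translate f phi (S : R) : box_integrable f -> bounded_supp phi ->
  exists2 M : R, 0 <= M & forall a, rV_box S a ->
    (\int[mu]_p (`|f (heis_mul p a) * phi p|)%:E <= M%:E)%E.
Proof.
move=> [mf fi] [mphi [C [r [C0 r0 phiC phir]]]].
have [r3 r30 hr3] := rV_box_heis_mul r S.
have [mb fb] := integrable_abs_lty (fi r3).
have fin : (\int[mu]_x (`|boxed r3 f x|)%:E)%E \is a fin_num.
  by rewrite ge0_fin_numE//; apply: integral_ge0 => p _; rewrite lee_fin.
exists (C * fine (\int[mu]_x (`|boxed r3 f x|)%:E)).
  by rewrite mulr_ge0// fine_ge0// integral_ge0// => p _; rewrite lee_fin.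
move=> a ar; rewrite EFinM fineK//.
rewrite -(integral_heis_mulr a (f := fun p => (`|boxed r3 f p|)%:E)); last 2 first.
  by apply/measurable_EFinP; exact: measurableT_comp.
  by move=> p; rewrite lee_fin.
rewrite -integralZl_ge0//; last first.
  apply: measurableT_comp => //.
  by apply: measurableT_comp mb _; exact: measurable_heis_mulr.
apply: le_integral_nonmeas => p _; rewrite lee_fin// normrM mulrC.
have [pr|/phir->] := pselect (rV_box r p); last by rewrite normr0 mul0r mulr_ge0.
by rewrite ler_pM// boxed_in//; exact: hr3.
Qed.

Lemma heis_mulr0 f phi : (fun p => f (heis_mul p 0) * phi p) = (fun p => f p * phi p).
Proof. by apply/funext => p; rewrite heis_mul0. Qed.

Lemma box_integrableM f phi a : box_integrable f -> bounded_supp phi ->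
  mu.-integrable setT (EFin \o (fun p => f (heis_mul p a) * phi p)).
Proof.
move=> bf bphi; have [mf _] := bf; have [mphi _] := bphi.
apply: integrable_absP.
  apply: measurable_funM => //; apply: measurableT_comp mf _; exact: measurable_heis_mulr.
have [S aS] : exists S, rV_box S a.
  exists (\sum_i `|a ord0 i|) => i; rewrite (bigD1 i)//= lerDl.
  by apply: sumr_ge0 => j _.
have [M M0 hM] := box_integrable_translate S bf bphi.
by rewrite (le_lt_trans (hM _ aS))// ltry.
Qed.

Lemma box_integrableM0 f phi : box_integrable f -> bounded_supp phi ->
  mu.-integrable setT (EFin \o (fun p => f p * phi p)).
Proof. by move=> bf bphi; rewrite -heis_mulr0; exact: box_integrableM. Qed.

Lemma box_integrable_heis_mulr f a : box_integrable f ->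
  box_integrable (fun p => f (heis_mul p a)).
Proof.
move=> bf; have [mf _] := bf; split.
  by apply: measurableT_comp mf _; exact: measurable_heis_mulr.
move=> r; have [r0|r0] := leP 0 r; first exact: (box_integrableM a bf (bounded_supp_box r0)).
have -> : boxed r (fun p => f (heis_mul p a)) = cst 0.
  apply/funext => p; rewrite boxed_out// => /(_ idx_t).
  by rewrite leNgt (lt_le_trans r0).
exact: integrable0.
Qed.

Lemma box_integrableB f g : box_integrable f -> box_integrable g ->
  box_integrable (fun p => f p - g p).
Proof.
move=> [mf fi] [mg gi]; split; first exact: measurable_funB.
move=> r; have := integrableB measurableT (fi r) (gi r); apply: eq_integrable => // p _.
by rewrite /= /boxed mulrBl EFinB.
Qed.

Lemma box_integrableZ c f : box_integrable f -> box_integrable (fun p => c * f p).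
Proof.
move=> [mf fi]; split; first exact: measurable_funM.
move=> r; have := integrableZl measurableT c (fi r); apply: eq_integrable => // p _.
by rewrite /= /boxed -mulrA EFinM.
Qed.

Lemma ae_boxes (P : H -> Prop) : (forall N : nat, {ae mu, forall p, rV_box N%:R p -> P p}) ->
  {ae mu, forall p, P p}.
Proof.
move=> h; have : {ae mu, forall p, forall N : nat, rV_box N%:R p -> P p} by exact/ae_foralln.
apply: filterS => p hp.
have : [set: H] p by []. rewrite -(@bigcup_rV_box R (n + n + 1)) => -[N _]; exact: hp.
Qed.

End box_integrability.

(** * The fundamental lemma of the calculus of variations *)

Section fundamental_lemma.
Context {R : realType} {n : nat}.
Local Notation H := (heis R n).
Local Notation mu := (@mu_heis R n).
Implicit Types (p q a v w z : H) (F f g h phi rho : H -> R).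

Lemma heis_dil_box (l r : R) w : 0 <= l <= 1 -> rV_box r w -> rV_box r (heis_dil l w).
Proof.
move=> /andP[l0 l1] wr; apply: idx_ht => [i|].
  rewrite heis_dil_h normrM (le_trans _ (wr (idx_h i)))// ler_piMl//.
  by rewrite ger0_norm.
rewrite heis_dil_t normrM (le_trans _ (wr idx_t))// ler_piMl//.
by rewrite ger0_norm ?exprn_ge0// exprn_ile1.
Qed.

Lemma heis_dil_cvg0 w (e : nat -> R) : e k @[k --> \oo] --> (0 : R) ->
  heis_dil (e k) w @[k --> \oo] --> (0 : H).
Proof.
move=> e0; have -> : (fun k => heis_dil (e k) w) = (fun k => e k *: w +
    ((e k ^+ 2 - e k) * w ord0 idx_t) *: basis_rV idx_t).
  apply/funext => k; apply: rV_ext; apply: idx_ht => [i|].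
    by rewrite heis_dil_h rVDE !rVZE basis_rV_h mulr0 addr0.
  by rewrite heis_dil_t rVDE !rVZE basis_rV_t; ring.
have -> : (0 : H) = 0 *: w + ((0 ^+ 2 - 0) * w ord0 idx_t) *: basis_rV idx_t.
  by rewrite expr0n subrr mul0r !scale0r addr0.
apply: cvgD; first exact: cvgZr_tmp.
apply: cvgZr_tmp; apply: cvgMr_tmp; apply: cvgB => //.
by rewrite expr2; under eq_cvg do rewrite expr2; exact: cvgM.
Qed.

Lemma test_function_rescale rho p (e : R) : e != 0 -> test_function rho ->
  test_function (fun z => rho (heis_dil e^-1 (heis_mul (heis_inv p) z))).
Proof.
move=> e0 trho.
apply: (@test_function_affine _ _ _ _ (fun w => heis_mul p (heis_dil e w)) _
  (affine_comp (affine_heis_dil e^-1) (affine_heis_mull (heis_inv p)))) => //.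
  apply: (continuous_affine (affine_comp (affine_heis_mull p) (affine_heis_dil e))).
move=> z /=; have /(heis_dilK (heis_mul (heis_inv p) z)) : e^-1 != 0 by rewrite invr_eq0.
by rewrite invrK => ->; rewrite heis_mulA heis_mulV heis_0mul.
Qed.

Lemma integral_heis_rescale p (e : R) (f : H -> \bar R) : 0 < e ->
  measurable_fun setT f -> (forall z, 0 <= f z)%E ->
  (\int[mu]_w f (heis_mul p (heis_dil e w)) = ((e ^+ (2 * n + 2))^-1)%:E * \int[mu]_z f z)%E.
Proof.
move=> e0 mf f0; have mp : measurable_fun setT (fun z => heis_mul p z).
  by apply: measurable_heis_mul; [exact: measurable_cst|exact: measurable_id].
rewrite (integral_heis_dil e0 (f := fun z => f (heis_mul p z)))//; last first.
  exact: measurableT_comp.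
by rewrite integral_heis_mull.
Qed.

(** A translated and dilated [rho] is again a test function, so F averages to 0 against [rho] around
    every point and at every scale. *)
Lemma Rintegral_mollify_test F rho p (e : R) : 0 < e -> test_function rho ->
  box_integrable F ->
  (forall phi, test_function phi -> \int[mu]_z (F z * phi z) = 0) ->
  mu.-integrable setT (EFin \o (fun w => F (heis_mul p (heis_dil e w)) * rho w)) /\
  \int[mu]_w (F (heis_mul p (heis_dil e w)) * rho w) = 0.
Proof.
move=> e0 trho bF F0.
pose phi z := rho (heis_dil e^-1 (heis_mul (heis_inv p) z)).
have tphi : test_function phi by apply: test_function_rescale => //; rewrite gt_eqF.
pose A w := heis_mul p (heis_dil e w).
have mA : measurable_fun setT A.
  apply: measurable_heis_mul; first exact: measurable_cst.
  by apply: measurable_heis_dil; [exact: measurable_cst|exact: measurable_id].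
have c0 : 0 <= (e ^+ (2 * n + 2))^-1 by rewrite invr_ge0 exprn_ge0// ltW.
have hA (g : H -> \bar R) : measurable_fun setT g -> (forall z, 0 <= g z)%E ->
    (\int[mu]_w g (A w) = ((e ^+ (2 * n + 2))^-1)%:E * \int[mu]_z g z)%E.
  by move=> mg g0; exact: integral_heis_rescale.
have := Rintegral_change c0 hA mA
  (box_integrableM0 bF (bounded_supp_test tphi)).
rewrite F0// mulr0 /phi /=.
have E w : heis_dil e^-1 (heis_mul (heis_inv p) (A w)) = w.
  by rewrite /A heis_mulA heis_Vmul heis_0mul heis_dilK// gt_eqF.
by rewrite /comp; under eq_fun do rewrite E; under eq_Rintegral do rewrite E.
Qed.

(** As F averages to 0 around p, F(p) is the mean of F(p) - F(p dil_e w) against rho. Integrating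
    over a box bounds the L^1 norm of F there by translation differences, which vanish with e. *)
Lemma fundamental_lemma F rho : mollifier rho -> box_integrable F ->
  (forall phi, test_function phi -> \int[mu]_z (F z * phi z) = 0) ->
  {ae mu, forall p, F p = 0}.
Proof.
move=> mrho bF F0; have [mF iF] := bF; apply: ae_boxes => N.
have trho := mollifier_test mrho; have rho0 := mollifier_ge0 mrho.
have brho := bounded_supp_test trho.
have [mrh [C [r [C0 r0 rhoC rhor]]]] := brho.
have [r3 r30 hr3] := @rV_box_heis_mul R n N%:R r.
(* Large enough for [G] to equal F both at p and at p dil_e w, for p in the box of size N, w in the
   support of [rho] and e at most 1. *)
pose rN : R := Num.max r3 N%:R.
pose G := boxed rN F; have iG : mu.-integrable setT (EFin \o G) by exact: iF.
have [mG fG] := integrable_abs_lty iG.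
have GF p : rV_box N%:R p -> G p = F p.
  by move=> pN; rewrite /G boxed_in//; apply: le_rV_box pN; rewrite le_max lexx orbT.
have irho : mu.-integrable setT (EFin \o rho).
  apply: integrable_absP => //; under eq_integral do rewrite ger0_norm//.
  by rewrite (mollifier_int mrho) ltry.
have rho1 : \int[mu]_w rho w = 1.
  by apply: EFin_inj; rewrite EFin_Rintegral// (mollifier_int mrho).
pose e (k : nat) : R := k.+1%:R^-1.
have e0 k : 0 < e k by rewrite invr_gt0.
have e1 k : e k <= 1 by rewrite invf_le1// ler1n.
pose I k w : \bar R := (\int[mu]_p (`|G (heis_mul p (heis_dil (e k) w)) - G p|)%:E)%E.
have mT k : measurable_fun setT (fun z : H * H =>
    (`|G (heis_mul z.2 (heis_dil (e k) z.1)) - G z.2|)%R).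
  apply: measurableT_comp => //; apply: measurable_funB.
    apply: measurableT_comp mG _; apply: measurable_heis_mul; first exact: measurable_snd.
    by apply: measurable_heis_dil; [exact: measurable_cst|exact: measurable_fst].
  exact: measurableT_comp.
have mI k : measurable_fun setT (I k).
  apply: (measurable_integral_snd (f := fun z : H * H =>
    (`|G (heis_mul z.2 (heis_dil (e k) z.1)) - G z.2|)%:E)).
  - by apply/measurable_EFinP; exact: mT.
  - by move=> z; rewrite lee_fin.
  - exact: sigma_finite_heis.
have I0 k w : (0 <= I k w)%E by apply: integral_ge0 => p _; rewrite lee_fin.
have IG k w : (I k w <= 2%:E * \int[mu]_p (`|G p|)%:E)%E.
  have mGw : measurable_fun setT (fun p => `|G (heis_mul p (heis_dil (e k) w))|).
    apply: measurableT_comp => //; apply: measurableT_comp mG _; exact: measurable_heis_mulr.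
  have mGa : measurable_fun setT (fun p => `|G p|) by exact: measurableT_comp.
  have step : (I k w <= \int[mu]_p (`|G (heis_mul p (heis_dil (e k) w))|)%:E +
      \int[mu]_p (`|G p|)%:E)%E.
    by apply: le_integralD => // p; exact: ler_normB.
  apply: (le_trans step).
  rewrite (integral_heis_mulr _ (f := fun p => (`|G p|)%:E))//; last exact/measurable_EFinP.
  by rewrite -[2]/(1 + 1)%R EFinD ge0_muleDl// mul1e.
have key k : (\int[mu]_p (`|boxed N%:R F p|)%:E <= \int[mu]_w ((rho w)%:E * I k w))%E.
  have ptw p : rV_box N%:R p -> ((`|F p|)%:E <=
      \int[mu]_w (rho w * `|G (heis_mul p (heis_dil (e k) w)) - G p|)%:E)%E.
    move=> pN; have [i1 z1] := Rintegral_mollify_test p (e0 k) trho bF F0.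
    have i2 : mu.-integrable setT (EFin \o (fun w => F p * rho w)).
      by apply: eq_integrable (integrableZl measurableT (F p) irho).
    have E : F p = \int[mu]_w (F p * rho w - F (heis_mul p (heis_dil (e k) w)) * rho w).
      by rewrite RintegralB// z1 subr0 RintegralZl// rho1 mulr1.
    rewrite {1}E EFin_normr_Rintegral//; last exact: (integrableB measurableT i2 i1).
    have i3 := integrableB measurableT i2 i1.
    apply: (le_trans (le_abse_integral _ measurableT (measurable_int _ i3))).
    apply: le_integral_nonmeas => [w _|w _]; first by rewrite abse_ge0.
    rewrite lee_fin -mulrBl normrM mulrC (ger0_norm (rho0 _)).
    have [wr|/rhor->] := pselect (rV_box r w); last by rewrite !mul0r.
    rewrite (GF p)// distrC ler_wpM2l// /G boxed_in//.
    apply: (@le_rV_box _ _ r3); first by rewrite le_max lexx.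
    by apply: hr3 => //; apply: heis_dil_box => //; rewrite ltW//= e1.
  have mT2 : measurable_fun setT (fun z : H * H =>
      (rho z.1 * `|G (heis_mul z.2 (heis_dil (e k) z.1)) - G z.2|)%:E).
    apply/measurable_EFinP; apply: measurable_funM; last exact: mT.
    exact: measurableT_comp mrh measurable_fst.
  apply: (@le_trans _ _ (\int[mu]_p \int[mu]_w
      (rho w * `|G (heis_mul p (heis_dil (e k) w)) - G p|)%:E)%E).
    apply: le_integral_nonmeas => [p _|p _]; first by rewrite lee_fin.
    have [pN|pN] := pselect (rV_box N%:R p); first by rewrite boxed_in// ptw.
    rewrite boxed_out// normr0; apply: integral_ge0 => w _.
    by rewrite lee_fin mulr_ge0.
  rewrite -(sigma_finite_tonelli mT2); [|by move=> z; rewrite lee_fin mulr_ge0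
    |exact: sigma_finite_heis|exact: sigma_finite_heis].
  rewrite le_eqVlt; apply/orP; left; apply/eqP; apply: eq_integral => w _.
  rewrite -integralZl_ge0//.
  apply: measurableT_comp => //; apply: measurable_funB => //.
  by apply: measurableT_comp mG _; exact: measurable_heis_mulr.
have cvg : (\int[mu]_w ((rho w)%:E * I k w) @[k --> \oo] --> 0)%E.
  apply: (dominated_cvg0 (g := fun w => ((rho w)%:E * (2%:E * \int[mu]_p (`|G p|)%:E))%E)) => //.
  - by move=> k; apply: emeasurable_funM => //; exact/measurable_EFinP.
  - by move=> k w _; rewrite mule_ge0// lee_fin.
  - by move=> w _; rewrite !mule_ge0 ?lee_fin// integral_ge0// => p _; rewrite lee_fin.
  - apply: aeW => w _; rewrite -(mule0 (rho w)%:E); apply: cvgeZl => //.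
    apply: heis_translate_cvg => //; apply: heis_dil_cvg0.
    exact: cvg_harmonic.
  - by apply: aeW => w _ k; rewrite lee_wpmul2l// lee_fin.
  - rewrite ge0_integralZr//; last 3 first.
    + exact/measurable_EFinP.
    + by move=> w _; rewrite lee_fin.
    + by rewrite mule_ge0// ?lee_fin// integral_ge0// => p _; rewrite lee_fin.
    by rewrite (mollifier_int mrho) mul1e lte_mul_pinfty// lee_fin.
have z : (\int[mu]_p (`|boxed N%:R F p|)%:E = 0)%E.
  apply/eqP; rewrite eq_le integral_ge0 ?andbT; last by move=> p _; rewrite lee_fin.
  apply/lee_addgt0Pr => d d0; rewrite add0e.
  have [k _ hk] := cvge0_near cvg d0; exact: le_trans (key k) (hk k (leqnn k)).
have [mb _] := integrable_abs_lty (iF N%:R).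
have := (ae_eq_integral_abs mu measurableT
  (f := EFin \o boxed N%:R F)  _).1 z.
have mEb : measurable_fun setT (EFin \o boxed N%:R F) by exact/measurable_EFinP.
move=> /(_ mEb); apply: filterS => p /(_ Logic.I) [+ pN]; by rewrite boxed_in.
Qed.

End fundamental_lemma.

Lemma ae_eq_Rintegral d (T : measurableType d) (R : realType)
    (mu : {measure set T -> \bar R}) (f g : T -> R) :
  measurable_fun setT f -> measurable_fun setT g -> {ae mu, forall x, f x = g x} ->
  \int[mu]_x f x = \int[mu]_x g x.
Proof.
move=> mf mg fg; rewrite /Rintegral; congr fine; apply: ae_eq_integral => //.
- exact/measurable_EFinP.
- exact/measurable_EFinP.
- by apply: filterS fg => x -> _.
Qed.

Lemma measurable_uncurry_swap d1 d2 (T1 : measurableType d1) (T2 : measurableType d2)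
    d3 (T3 : measurableType d3) (f : T1 -> T2 -> T3) :
  measurable_fun setT (fun z : T1 * T2 => f z.1 z.2) ->
  measurable_fun setT (fun z : T2 * T1 => f z.2 z.1).
Proof.
move=> mf; exact: (measurableT_comp mf (measurable_fun_pair measurable_snd measurable_fst)).
Qed.

Section curried_tonelli.
Context d1 d2 (T1 : measurableType d1) (T2 : measurableType d2) (R : realType).
Variables (m1 : {measure set T1 -> \bar R}) (m2 : {measure set T2 -> \bar R}).
Hypotheses (sf1 : sigma_finite setT m1) (sf2 : sigma_finite setT m2).

Lemma tonelli_ge0 (f : T1 -> T2 -> R) : (forall x y, 0 <= f x y) ->
  measurable_fun setT (fun z : T1 * T2 => f z.1 z.2) ->
  (\int[m1]_x \int[m2]_y (f x y)%:E = \int[m2]_y \int[m1]_x (f x y)%:E)%E.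
Proof.
move=> f0 mf; apply: (sigma_finite_tonelli (f := fun z => (f z.1 z.2)%:E)) => //.
  exact/measurable_EFinP.
by move=> z; rewrite lee_fin.
Qed.

Lemma tonelli_abs (f : T1 -> T2 -> R) :
  measurable_fun setT (fun z : T1 * T2 => f z.1 z.2) ->
  (\int[m1]_x \int[m2]_y (`|f x y|)%:E = \int[m2]_y \int[m1]_x (`|f x y|)%:E)%E.
Proof. by move=> mf; apply: (tonelli_ge0 (f := fun x y => `|f x y|)) => //; exact: measurableT_comp. Qed.

Lemma measurable_integral_ge0 (f : T1 -> T2 -> R) : (forall x y, 0 <= f x y) ->
  measurable_fun setT (fun z : T1 * T2 => f z.1 z.2) ->
  measurable_fun setT (fun x => \int[m2]_y (f x y)%:E)%E.
Proof.
move=> f0 mf; apply: (measurable_integral_snd (f := fun z => (f z.1 z.2)%:E)) => //.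
  exact/measurable_EFinP.
by move=> z; rewrite lee_fin.
Qed.

Lemma measurable_Rintegral_param (f : T1 -> T2 -> R) :
  measurable_fun setT (fun z : T1 * T2 => f z.1 z.2) ->
  measurable_fun setT (fun x => \int[m2]_y f x y).
Proof. by move=> mf; exact: (measurable_Rintegral_snd (f := fun z => f z.1 z.2)). Qed.

End curried_tonelli.

Opaque mu_heis.

(** * The fundamental theorem of calculus for weak derivatives *)

Section weak_taylor.
Context {R : realType} {n : nat}.
Local Notation H := (heis R n).
Local Notation mu := (@mu_heis R n).
Local Notation U := (uniform_prob (@ltr01 R)).
Implicit Types (p q a : H) (f g phi : H -> R) (k : 'I_(n + n + 1)) (s r : R).

Definition along s k (p : H) r : H := heis_mul p ((s * r) *: basis_rV k).

Lemma measurable_along s k (g : H -> R) : measurable_fun setT g ->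
  measurable_fun setT (fun z : H * R => g (along s k z.1 z.2)).
Proof.
move=> mg; apply: measurableT_comp mg _.
apply: measurable_heis_mul; first exact: measurable_fst.
apply: measurable_rVZ; last exact: measurable_cst.
by apply: measurable_funM; [exact: measurable_cst|exact: measurable_snd].
Qed.

Lemma along_box s k r : 0 <= r <= 1 -> rV_box `|s| ((s * r) *: basis_rV k : H).
Proof.
move=> /andP[r0 r1]; apply: rV_box_basis.
by rewrite normrM (ger0_norm r0) ler_piMr.
Qed.

(** For r in [0, 1] the translation stays in the box of size |s|, so the integral in p is bounded
    uniformly in r. *)
Lemma along_fubini s k g phi : box_integrable g -> bounded_supp phi ->
  (\int[mu]_p \int[U]_r (`|g (along s k p r) * phi p|)%:E < +oo)%E.
Proof.
move=> bg bphi; have [mg _] := bg; have [mphi _] := bphi.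
have mF : measurable_fun setT (fun z : H * R => g (along s k z.1 z.2) * phi z.1).
  by apply: measurable_funM; [exact: measurable_along|exact: measurableT_comp mphi measurable_fst].
rewrite (tonelli_abs sigma_finite_heis sigma_finite_unit (f := fun p r => g (along s k p r) * phi p))//.
have [M M0 hM] := box_integrable_translate `|s| bg bphi.
apply: (@le_lt_trans _ _ M%:E); last exact: ltry.
apply: integral_unit_le.
- apply: (measurable_integral_ge0 sigma_finite_heis (f := fun r p => `|g (along s k p r) * phi p|)) => //.
  apply: (measurable_uncurry_swap (f := fun p r => `|g (along s k p r) * phi p|)).
  exact: measurableT_comp mF.
- by move=> r; apply: integral_ge0 => p _; rewrite lee_fin.
- by move=> r r01; apply: hM; exact: along_box.
Qed.

Definition along_mean s k g p : R := \int[U]_r g (along s k p r).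

Lemma along_mean_box s k g : box_integrable g -> box_integrable (along_mean s k g).
Proof.
move=> bg; have [mg _] := bg; split.
  apply: (measurable_Rintegral_param sigma_finite_unit (f := fun p r => g (along s k p r))).
  exact: measurable_along.
move=> r0; have [r00|r00] := leP 0 r0; last first.
  have -> : boxed r0 (along_mean s k g) = cst 0.
    apply/funext => p; rewrite boxed_out// => /(_ idx_t).
    by rewrite leNgt (lt_le_trans r00).
  exact: integrable0.
have bphi := bounded_supp_box (n := n) r00; have [mphi _] := bphi.
have mF : measurable_fun setT (fun z : H * R => g (along s k z.1 z.2) * \1_(rV_box r0) z.1 : R).
  by apply: measurable_funM; [exact: measurable_along|exact: measurableT_comp mphi measurable_fst].
have [_ + _] := Rintegral_fubini_fst sigma_finite_heis sigma_finite_unit mF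
  (along_fubini s k bg bphi).
apply: eq_integrable => // p _; congr EFin.
have [pr|pr] := pselect (rV_box r0 p).
  rewrite boxed_in//; apply: eq_Rintegral => r _ /=.
  by rewrite indicE mem_set// mulr1.
rewrite boxed_out//; under eq_Rintegral do rewrite /= indicE memNset// mulr0.
by rewrite Rintegral_cst ?mul0r.
Qed.

Lemma along_integrable s k g : box_integrable g ->
  {ae mu, forall p, U.-integrable setT (fun r => (g (along s k p r))%:E)}.
Proof.
move=> bg; have [mg _] := bg; apply: ae_boxes => N.
have bphi := bounded_supp_box (n := n) (ler0n R N); have [mphi _] := bphi.
have mF : measurable_fun setT (fun z : H * R => g (along s k z.1 z.2) * \1_(rV_box N%:R) z.1 : R).
  by apply: measurable_funM; [exact: measurable_along|exact: measurableT_comp mphi measurable_fst].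
have [+ _ _] := Rintegral_fubini_fst sigma_finite_heis sigma_finite_unit mF
  (along_fubini s k bg bphi).
apply: filterS => p + pN; apply: eq_integrable => // r _ /=.
by rewrite indicE mem_set// mulr1.
Qed.

(** Right translations preserve the measure, so the adjoint of a translation is the inverse
    translation. *)
Lemma Rintegral_flow_transpose k (h h' : H -> R) (c : R) : mu.-integrable setT (EFin \o (fun p =>
    h (heis_mul p (c *: basis_rV k)) * h' p)) ->
  mu.-integrable setT (EFin \o (fun p => h p * h' (heis_mul p ((- c) *: basis_rV k)))) /\
  \int[mu]_p (h p * h' (heis_mul p ((- c) *: basis_rV k))) =
  \int[mu]_p (h (heis_mul p (c *: basis_rV k)) * h' p).
Proof.
move=> ih; have [] := Rintegral_change (ler01 : 0 <= 1 :> R) (A := fun p => heis_mul p ((- c) *: basis_rV k))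
  _ (measurable_heis_mulr _) ih.
  by move=> g' mg' g'0; rewrite mul1e integral_heis_mulr.
have E p : heis_mul (heis_mul p ((- c) *: basis_rV k)) (c *: basis_rV k) = p.
  by rewrite -heis_exp_inv heis_mulVK.
by rewrite /comp; under eq_fun do rewrite E; under eq_Rintegral do rewrite E; rewrite mul1r.
Qed.

(* [Z_k] generates the right translations by [exp (s Z_k)], which preserve the
   measure; testing against [phi] translated backwards gives the fundamental
   theorem of calculus for weak derivatives. *)
Lemma weak_ftc k f g s (rho : H -> R) : mollifier rho -> weak_derivative k f g ->
  {ae mu, forall p, f (along s k p 1) - f p = s * along_mean s k g p}.
Proof.
move=> mrho [lf lg dfg].
have bf := locally_box_integrable lf; have bg := locally_box_integrable lg.
have [mf _] := bf; have [mg _] := bg.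
have bF : box_integrable (fun p => (f (along s k p 1) - f p) - s * along_mean s k g p).
  apply: box_integrableB; last exact/box_integrableZ/along_mean_box.
  by apply: box_integrableB => //; exact: box_integrable_heis_mulr.
suff h : {ae mu, forall p, (f (along s k p 1) - f p) - s * along_mean s k g p = 0}.
  by apply: filterS h => p /eqP; rewrite subr_eq0 => /eqP.
apply: (fundamental_lemma mrho bF) => phi tphi.
have bphi := bounded_supp_test tphi; have [mphi _] := bphi.
have blphi : bounded_supp (lie (Zleft k) phi) by exact: bounded_supp_lie.
have [mlphi _] := blphi; have [sphi _] := tphi.
have tr h h' c := @Rintegral_flow_transpose k h h' c.
have i1 : mu.-integrable setT (EFin \o (fun p => f (heis_mul p (s *: basis_rV k)) * phi p)).
  exact: box_integrableM.
have [i1' e1] := tr f phi s i1.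
have i2 : mu.-integrable setT (EFin \o (fun p => f p * phi p)) by exact: box_integrableM0.
have bG := along_mean_box s k bg.
have i3 : mu.-integrable setT (EFin \o (fun p => along_mean s k g p * phi p)).
  exact: box_integrableM0.
(* The mean along the flow is moved from g to phi: Fubini, then the weak derivative tested against
   phi translated by exp(- s r Z_k), then Fubini back. *)
have eG : \int[mu]_p (along_mean s k g p * phi p) =
    - \int[mu]_p (f p * \int[U]_r lie (Zleft k) phi (along (- s) k p r)).
  have mF : measurable_fun setT (fun z : H * R => g (along s k z.1 z.2) * phi z.1).
    by apply: measurable_funM; [exact: measurable_along|exact: measurableT_comp mphi measurable_fst].
  have mL : measurable_fun setT (fun z : H * R => f z.1 * lie (Zleft k) phi (along (- s) k z.1 z.2)).
    by apply: measurable_funM; [exact: measurableT_comp mf measurable_fst|exact: measurable_along].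
  have a1 := along_integrable s k bg.
  transitivity (\int[mu]_p \int[U]_r (g (along s k p r) * phi p)).
    apply: ae_eq_Rintegral.
    - by have [] := integrable_abs_lty i3.
    - have [_ + _] := Rintegral_fubini_fst sigma_finite_heis sigma_finite_unit mF
        (along_fubini s k bg bphi); by move=> /integrable_abs_lty[].
    - by apply: filterS a1 => p ip; rewrite /along_mean RintegralZr.
  rewrite (Rintegral_fubini sigma_finite_heis sigma_finite_unit mF (along_fubini s k bg bphi)).
  transitivity (\int[U]_r (- \int[mu]_p (f p * lie (Zleft k) phi (along (- s) k p r)))).
    apply: eq_Rintegral => r _.
    have j1 : mu.-integrable setT (EFin \o (fun p => g (heis_mul p ((s * r) *: basis_rV k)) * phi p)).
      exact: box_integrableM.
    have [_ <-] := tr g phi (s * r) j1.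
    rewrite -[LHS]opprK -dfg; last first.
      apply: (@test_function_affine _ _ _ _ (fun p => heis_mul p ((s * r) *: basis_rV k))
        _ (affine_heis_mulr _)) => //; first exact: (continuous_affine (affine_heis_mulr _)).
      by move=> p; rewrite -heis_exp_inv heis_mulVK.
    have E p : lie (Zleft k) (fun q => phi (heis_mul q (- (s * r) *: basis_rV k))) p =
        lie (Zleft k) phi (along (- s) k p r).
      by rewrite lie_left_flow -[in LHS]mulNr.
    by under eq_Rintegral do rewrite E.
  have finL : (\int[mu]_p \int[U]_r (`|f p * lie (Zleft k) phi (along (- s) k p r)|)%:E < +oo)%E.
    rewrite (tonelli_abs sigma_finite_heis sigma_finite_unit
      (f := fun p r => f p * lie (Zleft k) phi (along (- s) k p r)))//.
    have E : (\int[U]_r \int[mu]_p (`|f p * lie (Zleft k) phi (along (- s) k p r)|)%:E =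
        \int[U]_r \int[mu]_p (`|f (along s k p r) * lie (Zleft k) phi p|)%:E)%E.
      apply: eq_integral => r _.
      rewrite -(integral_heis_mulr ((s * r) *: basis_rV k)
        (f := fun p => (`|f p * lie (Zleft k) phi (along (- s) k p r)|)%:E)).
      - apply: eq_integral => p _; rewrite /along mulNr -heis_exp_inv heis_mulK//.
      - apply/measurable_EFinP; apply: measurableT_comp => //; apply: measurable_funM => //.
        by apply: measurableT_comp mlphi _; exact: measurable_heis_mulr.
      - by move=> p; rewrite lee_fin.
    rewrite E; have := along_fubini s k bf blphi.
    rewrite (tonelli_abs sigma_finite_heis sigma_finite_unit
      (f := fun p r => f (along s k p r) * lie (Zleft k) phi p)); last first.
      by apply: measurable_funM; [exact: measurable_along|exact: measurableT_comp mlphi measurable_fst].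
    by [].
  rewrite -[RHS]mulN1r.
  transitivity (\int[U]_r (-1 * \int[mu]_p (f p * lie (Zleft k) phi (along (- s) k p r)))).
    by apply: eq_Rintegral => r _; rewrite mulN1r.
  have mL2 : measurable_fun setT (fun z : R * H => f z.2 * lie (Zleft k) phi (along (- s) k z.2 z.1)).
    exact: (measurable_uncurry_swap (f := fun p r => f p * lie (Zleft k) phi (along (- s) k p r))).
  have finL2 : (\int[U]_r \int[mu]_p (`|f p * lie (Zleft k) phi (along (- s) k p r)|)%:E < +oo)%E.
    by rewrite -(tonelli_abs sigma_finite_heis sigma_finite_unit
      (f := fun p r => f p * lie (Zleft k) phi (along (- s) k p r))).
  have [_ iL _] := Rintegral_fubini_fst sigma_finite_unit sigma_finite_heis mL2 finL2.
  rewrite RintegralZl//; congr (_ * _).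
  rewrite -(Rintegral_fubini sigma_finite_heis sigma_finite_unit mL finL).
  apply: eq_Rintegral => p _; rewrite /= RintegralZl//.
  by have [] := ftc_left k p (- s) sphi.
transitivity (\int[mu]_p ((f (along s k p 1) * phi p - f p * phi p) - s * (along_mean s k g p * phi p))).
  by apply: eq_Rintegral => p _; rewrite !mulrBl mulrA.
have i4 : mu.-integrable setT (EFin \o (fun p => s * (along_mean s k g p * phi p))).
  by apply: eq_integrable (integrableZl measurableT s i3).
have i1a : mu.-integrable setT (EFin \o (fun p => f (along s k p 1) * phi p)).
  by move: i1; rewrite /along mulr1.
rewrite RintegralB//; last exact: (integrableB measurableT i1a i2).
have e1a : \int[mu]_p (f (along s k p 1) * phi p) =
    \int[mu]_p (f p * phi (heis_mul p (- s *: basis_rV k))).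
  by rewrite e1 /along mulr1.
rewrite RintegralB// RintegralZl// eG e1a.
suff -> : s * (- \int[mu]_p (f p * \int[U]_r lie (Zleft k) phi (along (- s) k p r))) =
  \int[mu]_p (f p * phi (heis_mul p (- s *: basis_rV k))) - \int[mu]_p (f p * phi p).
  by rewrite subrr.
rewrite -RintegralB// mulrN -mulNr -RintegralZl//.
  apply: eq_Rintegral => p _; have [_] := ftc_left k p (- s) sphi.
  by rewrite -mulrBr => ->; rewrite mulrCA.
(* For s nonzero the mean of the derivative of phi is a difference quotient of phi; for s = 0 it is
   the derivative itself. *)
have [s0|s0] := eqVneq s 0; last first.
  have := integrableZl measurableT (- s)^-1 (integrableB measurableT i1' i2).
  apply: eq_integrable => // p _; rewrite -EFinB -EFinM -mulrBr.
  have [_ ->] := ftc_left k p (- s) sphi.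
  by rewrite mulrCA mulKf ?oppr_eq0.
suff : bounded_supp (fun p => \int[U]_r lie (Zleft k) phi (along (- s) k p r)).
  exact: box_integrableM0.
have -> // : (fun p => \int[U]_r lie (Zleft k) phi (along (- s) k p r)) = lie (Zleft k) phi.
apply/funext => p; rewrite /along s0; under eq_Rintegral do rewrite oppr0 mul0r scale0r heis_mul0.
rewrite Rintegral_cst// [X in (_ * fine X)](_ : _ = 1%E) ?mulr1//.
exact: probability_setT.
Qed.

End weak_taylor.

(** * Taylor expansion along horizontal paths *)

Section words.
Context {R : realType} {n : nat}.
Local Notation H := (heis R n).
Local Notation mu := (@mu_heis R n).
Local Notation U := (uniform_prob (@ltr01 R)).
Implicit Types (p q a b : H) (f g u : H -> R) (k : 'I_(n + n + 1)) (s r e : R).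
Implicit Types (W B : seq ('I_(n + n) * R)).

(** c0 + c1 / 2 is the mean of c0 + c1 r over [0, 1]. The constants are quantified after p, so they
    can later be arbitrary functions of p. *)
Lemma weak_taylor k f g s (rho : H -> R) : mollifier rho -> weak_derivative k f g ->
  {ae mu, forall p, forall c0 c1 : R,
     ((`|f (along s k p 1) - f p - s * (c0 + c1 / 2)|)%:E <=
      (`|s|)%:E * \int[U]_r (`|g (along s k p r) - (c0 + c1 * r)|)%:E)%E}.
Proof.
move=> mrho dfg; have := weak_ftc s mrho dfg.
have bg : box_integrable g by case: dfg => _ /locally_box_integrable.
apply: filterS2 (along_integrable s k bg) => p ip -> c0 c1.
have ic : U.-integrable setT (EFin \o (fun r : R => c0 + c1 * r)).
  apply: (@integrable_unit _ _ (`|c0| + `|c1|)).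
    by apply: measurable_funD => //; exact: measurable_funM.
  move=> r /andP[r0 r1]; rewrite (le_trans (ler_normD _ _))// lerD2l normrM.
  by rewrite (ger0_norm r0) ler_piMr.
rewrite -mulrBr normrM EFinM lee_wpmul2l// -Rintegral_unit_affine -RintegralB//.
have i := integrableB measurableT ip ic.
rewrite EFin_normr_Rintegral//.
by apply: (le_trans (le_abse_integral _ measurableT (measurable_int _ i))).
Qed.

(** An L^1 seminorm weighted by a translate of u: the factor u(p q^-1) of the commutator is carried
    as a weight through all Taylor estimates. *)
Definition Nu u a g : \bar R := (\int[mu]_p (`|u (heis_mul p a)| * `|g p|)%:E)%E.

Lemma Nu_ge0 u a g : (0 <= Nu u a g)%E.
Proof. by apply: integral_ge0 => p _; rewrite lee_fin mulr_ge0. Qed.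

Section fixed_weight.
Variables (u : H -> R) (mu_u : measurable_fun setT u).

Lemma measurable_Nu_integrand a g : measurable_fun setT g ->
  measurable_fun setT (fun p => `|u (heis_mul p a)| * `|g p|).
Proof.
move=> mg; apply: measurable_funM; last exact: measurableT_comp.
apply: measurableT_comp => //; apply: measurableT_comp mu_u _; exact: measurable_heis_mulr.
Qed.

Lemma NuD a g g1 g2 : measurable_fun setT g1 -> measurable_fun setT g2 ->
  (forall p, `|g p| <= `|g1 p| + `|g2 p|) -> (Nu u a g <= Nu u a g1 + Nu u a g2)%E.
Proof.
move=> m1 m2 h; apply: le_integralD => [||p|p|p|p]; rewrite ?mulr_ge0//.
- exact: measurable_Nu_integrand.
- exact: measurable_Nu_integrand.
- by rewrite -mulrDr ler_wpM2l.
Qed.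

Lemma NuZ a g c : measurable_fun setT g -> Nu u a (fun p => c * g p) = (`|c|%:E * Nu u a g)%E.
Proof.
move=> mg; rewrite /Nu -integralZl_ge0//; first last.
- exact: measurable_Nu_integrand.
- by apply: eq_integral => p _; rewrite normrM mulrCA.
Qed.

(** One flow step: the pointwise Taylor bound at p b is integrated against the weight, and Tonelli
    brings the time r outside. *)
Lemma Nu_step (rho : H -> R) k f g s a b (c0 c1 : H -> R) : mollifier rho ->
  weak_derivative k f g -> measurable_fun setT c0 -> measurable_fun setT c1 ->
  (Nu u a (fun p => f (along s k (heis_mul p b) 1) - f (heis_mul p b) - s * (c0 p + c1 p / 2))%R <=
   `|s|%:E * \int[U]_r Nu u a (fun p => g (along s k (heis_mul p b) r) - (c0 p + c1 p * r))%R)%E.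
Proof.
move=> mrho dfg mc0 mc1.
have mg : measurable_fun setT g by case: dfg => _ [].
pose G p r := `|g (along s k (heis_mul p b) r) - (c0 p + c1 p * r)|.
have G0 p r : 0 <= G p r by exact: normr_ge0.
have mG : measurable_fun setT (fun z : H * R => G z.1 z.2).
  apply: measurableT_comp => //; apply: measurable_funB.
    apply: (measurableT_comp (measurable_along s k mg)
      (g := fun z : H * R => (heis_mul z.1 b, z.2))).
    apply: measurable_fun_pair; last exact: measurable_snd.
    exact: measurableT_comp (measurable_heis_mulr b) measurable_fst.
  apply: measurable_funD; first exact: measurableT_comp mc0 measurable_fst.
  by apply: measurable_funM => //; exact: measurableT_comp mc1 measurable_fst.
have mua : measurable_fun setT (fun p => `|u (heis_mul p a)|).
  by apply: measurableT_comp => //; apply: measurableT_comp mu_u _; exact: measurable_heis_mulr.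
have mI : measurable_fun setT (fun p => \int[U]_r (G p r)%:E)%E.
  by apply: (measurable_integral_ge0 sigma_finite_unit (f := G)) => // p r; exact: normr_ge0.
have mGp p : measurable_fun setT (G p) by exact: (measurableT_comp mG (measurable_pair1 p)).
apply: (@le_trans _ _ (\int[mu]_p ((`|u (heis_mul p a)|)%:E *
    ((`|s|)%:E * \int[U]_r (G p r)%:E)))%E).
  apply: le_integral_ae_nonmeas => //.
  - apply: emeasurable_funM; first exact/measurable_EFinP.
    exact: emeasurable_funM.
  - by move=> p _; rewrite !mule_ge0 ?lee_fin// integral_ge0// => r _; rewrite lee_fin.
  - apply: filterS (ae_heis_mulr b (weak_taylor s mrho dfg)) => p hp _.
    by rewrite EFinM lee_wpmul2l ?lee_fin.
rewrite (_ : (\int[mu]_p _)%E = (\int[mu]_p ((`|s|)%:E *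
   \int[U]_r (`|u (heis_mul p a)| * G p r)%:E))%E); last first.
  apply: eq_integral => p _; rewrite muleCA; congr (_ * _)%E.
  by apply/esym; apply: integralZl_ge0 => //; exact: mGp.
rewrite ge0_integralZl//; first last.
- by move=> p _; apply: integral_ge0 => r _; rewrite lee_fin mulr_ge0.
- apply: (measurable_integral_ge0 sigma_finite_unit (f := fun p r => `|u (heis_mul p a)| * G p r)).
    by move=> p r; rewrite mulr_ge0.
  by apply: measurable_funM => //; exact: measurableT_comp mua measurable_fst.
rewrite (tonelli_ge0 sigma_finite_heis sigma_finite_unit (f := fun p r => `|u (heis_mul p a)| * G p r))//.
  by move=> p r; rewrite mulr_ge0.
by apply: measurable_funM => //; exact: measurableT_comp mua measurable_fst.
Qed.

End fixed_weight.

(* A word lists pairs (h, a), the last move first; [wpt e W] is the end point of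
   the path from 0 along the flows of a e Z_h, and f (p . wpt e W) has the Taylor
   expansion [f p + e * e1 W (Zf) p + e ^+ 2 * e2 W (ZZf) p]. *)
Fixpoint wpt e W : H :=
  if W is m :: B then heis_mul (wpt e B) ((e * m.2) *: basis_rV (idx_h m.1)) else 0.

Definition wlen W : R := \sum_(m <- W) `|m.2|.

Definition e1 W (D : 'I_(n + n) -> H -> R) p : R := \sum_(m <- W) m.2 * D m.1 p.

Fixpoint e2 W (D2 : 'I_(n + n) -> 'I_(n + n) -> H -> R) p : R :=
  if W is m :: B then
    e2 B D2 p + m.2 * e1 B (D2 ^~ m.1) p + m.2 ^+ 2 / 2 * D2 m.1 m.1 p
  else 0.

Lemma wlen_ge0 W : 0 <= wlen W.
Proof. by apply: sumr_ge0 => m _. Qed.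

Lemma measurable_e1 W D : (forall j, measurable_fun setT (D j)) -> measurable_fun setT (e1 W D).
Proof.
by move=> mD; apply: measurable_sum => m; apply: measurable_funM.
Qed.

Lemma measurable_e2 W D2 : (forall i j, measurable_fun setT (D2 i j)) ->
  measurable_fun setT (e2 W D2).
Proof.
move=> mD; elim: W => [|m B IH]; first exact: measurable_cst.
apply: measurable_funD; last exact: measurable_funM.
apply: measurable_funD => //; apply: measurable_funM => //.
exact: measurable_e1.
Qed.

Lemma heis_mul_cvg2 (a b : nat -> H) : a k @[k --> \oo] --> (0 : H) ->
  b k @[k --> \oo] --> (0 : H) -> heis_mul (a k) (b k) @[k --> \oo] --> (0 : H).
Proof.
move=> a0 b0.
have c i (v : nat -> H) : v k @[k --> \oo] --> (0 : H) -> v k ord0 i @[k --> \oo] --> (0 : R).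
  move=> v0; have := cvg_comp _ _ v0 (@coord_continuous _ 1 _ ord0 i (0 : H)).
  by rewrite mxE.
under eq_cvg do rewrite heis_mulE.
have -> : (0 : H) = 0 + 0 + (2 * 0) *: basis_rV idx_t by rewrite mulr0 scale0r !addr0.
apply: cvgD; first exact: cvgD.
apply: cvgZr_tmp; apply: cvgMl_tmp.
suff : heis_form (a k) (b k) @[k --> \oo] --> (\sum_(j < n) (0 * 0 - 0 * 0) : R).
  by rewrite big1// => j _; rewrite mul0r subrr.
apply: cvg_big => // [|j _]; first exact: add_continuous.
by apply: cvgB; apply: cvgM; exact: c.
Qed.

Lemma heis_inv_cvg0 (a : nat -> H) : a k @[k --> \oo] --> (0 : H) ->
  heis_inv (a k) @[k --> \oo] --> (0 : H).
Proof. by move=> a0; rewrite -[X in _ --> X]oppr0; exact: cvgN. Qed.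

Lemma scale_cvg0 (e : nat -> R) (c : R) (v : H) : e k @[k --> \oo] --> (0 : R) ->
  (e k * c) *: v @[k --> \oo] --> (0 : H).
Proof.
move=> e0; rewrite -[X in _ --> X](scale0r v) -[X in X *: v](mul0r c).
by apply: cvgZr_tmp; exact: cvgMr_tmp.
Qed.

Lemma wpt_cvg0 (e : nat -> R) W : e k @[k --> \oo] --> (0 : R) ->
  wpt (e k) W @[k --> \oo] --> (0 : H).
Proof.
move=> e0; elim: W => [|m B IH] /=; first exact: cvg_cst.
by apply: heis_mul_cvg2 => //; exact: scale_cvg0.
Qed.

End words.

Lemma cvge0Z (R : realType) (c : R) (f : nat -> \bar R) :
  (f k @[k --> \oo] --> 0 -> c%:E * f k @[k --> \oo] --> 0)%E.
Proof. by move=> f0; rewrite -(mule0 c%:E); exact: cvgeZl. Qed.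

(** * Weighted Taylor remainders along words *)

Section word_estimates.
Context {R : realType} {n : nat}.
Local Notation H := (heis R n).
Local Notation mu := (@mu_heis R n).
Local Notation U := (uniform_prob (@ltr01 R)).
Implicit Types (p q a b : H) (f g : H -> R) (r e : R) (k : nat).
Implicit Types (W B : seq ('I_(n + n) * R)).
Implicit Types (D : 'I_(n + n) -> H -> R) (DD : 'I_(n + n) -> 'I_(n + n) -> H -> R).

(** The total mass 1 of [rho] excludes the null measure. Positivity is what turns the norm of
    exponent +oo into an essential supremum. *)
Lemma mollifier_mu_gt0 (rho : H -> R) : mollifier rho -> (0 < mu setT)%E.
Proof.
move=> mrho; rewrite lt0e measure_ge0 andbT; apply/eqP => mu0.
have := mollifier_int mrho.
have [mr _] := bounded_supp_test (mollifier_test mrho).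
rewrite (_ : (\int[mu]_p _)%E = 0%E) => [/eqP|]; first by rewrite eq_sym onee_eq0.
apply: null_set_integral => //; exact/measurable_EFinP.
Qed.

Lemma e1_cons m B D p : e1 (m :: B) D p = m.2 * D m.1 p + e1 B D p.
Proof. by rewrite /e1 big_cons. Qed.

Definition T1 e W f D p : R := f (heis_mul p (wpt e W)) - f p - e * e1 W D p.

Definition T2 e W f D DD p : R :=
  f (heis_mul p (wpt e W)) - f p - e * e1 W D p - e ^+ 2 * e2 W DD p.

Variables (rho : H -> R) (mrho : mollifier rho) (s : \bar R) (s_ge1 : (1 <= s)%E).
Local Notation s' := (hoelder_conjugate s).
Variables (u : H -> R) (mu_u : measurable_fun setT u) (us : (Ls_norm s u < +oo)%E).
Let mu_gt0 := mollifier_mu_gt0 mrho.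

Lemma measurable_T1 e W f D : measurable_fun setT f -> (forall j, measurable_fun setT (D j)) ->
  measurable_fun setT (T1 e W f D).
Proof.
move=> mf mD; apply: measurable_funB; last by apply: measurable_funM => //; exact: measurable_e1.
by apply: measurable_funB => //; apply: measurableT_comp mf _; exact: measurable_heis_mulr.
Qed.

Lemma measurable_T2 e W f D DD : measurable_fun setT f -> (forall j, measurable_fun setT (D j)) ->
  (forall i j, measurable_fun setT (DD i j)) -> measurable_fun setT (T2 e W f D DD).
Proof.
move=> mf mD mDD; apply: measurable_funB; last by apply: measurable_funM => //; exact: measurable_e2.
exact: measurable_T1.
Qed.

Lemma measurable_Nu_param a (F : R -> H -> R) :
  measurable_fun setT (fun z : R * H => F z.1 z.2) ->
  measurable_fun setT (fun r => Nu u a (F r)).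
Proof.
move=> mF.
apply: (measurable_integral_ge0 sigma_finite_heis (f := fun r p => `|u (heis_mul p a)| * `|F r p|)).
  by move=> r p; rewrite mulr_ge0.
apply: measurable_funM; last exact: measurableT_comp.
apply: measurableT_comp => //; apply: measurableT_comp mu_u _.
exact: measurableT_comp (measurable_heis_mulr a) measurable_snd.
Qed.

Lemma measurable_step c (k : 'I_(n + n + 1)) b g (c0 c1 : H -> R) : measurable_fun setT g ->
  measurable_fun setT c0 -> measurable_fun setT c1 ->
  measurable_fun setT (fun z : R * H =>
    g (along c k (heis_mul z.2 b) z.1) - (c0 z.2 + c1 z.2 * z.1)).
Proof.
move=> mg mc0 mc1; apply: measurable_funB.
  apply: (measurableT_comp (measurable_along c k mg)
    (g := fun z : R * H => (heis_mul z.2 b, z.1))).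
  apply: measurable_fun_pair; last exact: measurable_fst.
  exact: measurableT_comp (measurable_heis_mulr b) measurable_snd.
apply: measurable_funD; first exact: measurableT_comp mc0 measurable_snd.
by apply: measurable_funM => //; exact: measurableT_comp mc1 measurable_snd.
Qed.

Lemma Nu_diff_le a b g K : measurable_fun setT g -> (Ls_norm s' g < +oo)%E ->
  (Ls_norm s u * Ls_norm s' g <= K%:E)%E ->
  (Nu u a (fun p => g (heis_mul p b) - g p)%R <= (2 * K)%:E)%E.
Proof.
move=> mg gs' gK.
have mgb : measurable_fun setT (fun p => g (heis_mul p b)).
  by apply: measurableT_comp mg _; exact: measurable_heis_mulr.
apply: (le_trans (NuD mu_u a mgb mg _)); first by move=> p; exact: ler_normB.
rewrite mulr_natl mulr2n EFinD; apply: leeD; apply: le_trans gK.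
  rewrite /Nu; under eq_integral do rewrite -normrM.
  exact: (holder_translate mu_gt0 s_ge1).
rewrite /Nu; under eq_integral do rewrite -normrM.
exact: (holder_heis mu_gt0 s_ge1).
Qed.

Section first_order.
Variables (f : H -> R) (D : 'I_(n + n) -> H -> R) (K : R).
Hypotheses (fD : forall j, weak_derivative (idx_h j) f (D j))
  (Ds' : forall j, (Ls_norm s' (D j) < +oo)%E)
  (DK : forall j, (Ls_norm s u * Ls_norm s' (D j) <= K%:E)%E) (K0 : 0 <= K).

Let mD j : measurable_fun setT (D j). Proof. by have [_ []] := fD j. Qed.

(** The term 0 * r matches the form c0 + c1 r of [Nu_step], here with c1 = 0. *)
Definition increment e m B r p : R :=
  D m.1 (along (e * m.2) (idx_h m.1) (heis_mul p (wpt e B)) r) - (D m.1 p + 0 * r).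

(** Stopping the last move at time r shortens it to length m.2 * r, so the point reached is again
    the end of a word. *)
Lemma increment_diff e m B r : increment e m B r =
  (fun p => D m.1 (heis_mul p (wpt e ((m.1, m.2 * r) :: B))) - D m.1 p).
Proof.
by apply/funext => p; rewrite /increment /along /= mul0r addr0 -heis_mulA mulrA.
Qed.

Lemma word1_step e m B a : measurable_fun setT f -> 
  (Nu u a (T1 e (m :: B) f D) <=
   `|e * m.2|%:E * \int[U]_r Nu u a (increment e m B r) + Nu u a (T1 e B f D))%E.
Proof.
move=> mf.
apply: le_trans (leeD (Nu_step mu_u (e * m.2) a (wpt e B) mrho (fD m.1) (mD m.1)
  (measurable_cst (0 : R))) (lexx _)).
apply: NuD => //; last 2 first.
- exact: measurable_T1.
- move=> p; apply: le_trans (ler_normD _ _); rewrite le_eqVlt; apply/orP; left; apply/eqP.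
  congr `|_|; rewrite /T1 /e1 big_cons /along /= mulr1 heis_mulA mul0r addr0; ring.
apply: measurable_funB.
  apply: measurable_funB; apply: measurableT_comp mf _; last exact: measurable_heis_mulr.
  rewrite /along; apply: measurable_heis_mul; last exact: measurable_cst.
  exact: measurable_heis_mulr.
by apply: measurable_funM => //; apply: measurable_funD => //; exact: measurable_funM.
Qed.

Lemma Nu_T1_nil e a : Nu u a (T1 e [::] f D) = 0%E.
Proof.
rewrite /Nu; under eq_integral => p _.
  rewrite /T1 /e1 /= heis_mul0 big_nil mulr0 subrr subr0 normr0 mulr0.
  over.
exact: integral0.
Qed.

(** A move of length a costs at most e |a| times 2 K, where 2 K bounds a weighted difference of
    translates. *)
Lemma word1_bound e W a : measurable_fun setT f -> 0 <= e ->
  (Nu u a (T1 e W f D) <= (e * (2 * K * wlen W))%:E)%E.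
Proof.
move=> mf e0; elim: W => [|m B IH].
  by rewrite /wlen big_nil !mulr0 Nu_T1_nil.
apply: (le_trans (word1_step e m B a mf)).
rewrite /wlen big_cons -/(wlen B).
have -> : e * (2 * K * (`|m.2| + wlen B)) = `|e * m.2| * (2 * K) + e * (2 * K * wlen B).
  by rewrite normrM (ger0_norm e0); ring.
rewrite EFinD leeD// EFinM lee_wpmul2l// ?lee_fin//.
apply: integral_unit_le.
- apply: measurable_Nu_param; exact: (measurable_step _ _ _ (mD _) (mD _) (measurable_cst _)).
- by move=> r; exact: Nu_ge0.
- by move=> r _; rewrite increment_diff; exact: Nu_diff_le.
Qed.

Hypothesis ui : mu.-integrable setT (EFin \o u).

(** For fixed r the weighted increment tends to 0 by [translate_mul_cvg2]; the constant 2 K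
    dominates it in r. *)
Lemma word1_cvg (e : nat -> R) (a : nat -> H) W : measurable_fun setT f ->
  (forall k, 0 < e k) -> e k @[k --> \oo] --> (0 : R) -> a k @[k --> \oo] --> (0 : H) ->
  (((e k)^-1)%:E * Nu u (a k) (T1 (e k) W f D) @[k --> \oo] --> 0)%E.
Proof.
move=> mf epos e0 a0; elim: W => [|m B IH].
  under eq_cvg do rewrite Nu_T1_nil mule0.
  exact: (@cvg_cst (\bar R) 0%E nat \oo).
pose I k := (\int[U]_r Nu u (a k) (increment (e k) m B r))%E.
have I0 k : (0 <= I k)%E by apply: integral_ge0 => r _; exact: Nu_ge0.
have Icvg : (I k @[k --> \oo] --> 0)%E.
  apply: (dominated_cvg0 (g := fun=> (2 * K)%:E)) => //.
  - move=> k; apply: measurable_Nu_param.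
    exact: (measurable_step _ _ _ (mD _) (mD _) (measurable_cst _)).
  - by move=> k r _; exact: Nu_ge0.
  - by move=> r _; rewrite lee_fin mulr_ge0.
  - apply: aeW => r _; under eq_cvg do rewrite increment_diff.
    have w0 := wpt_cvg0 ((m.1, m.2 * r) :: B) e0.
    apply: (translate_mul_cvg2 mu_gt0 s_ge1 mu_u (mD _) us (Ds' _) ui a0 w0).
    by apply: heis_mul_cvg2 => //; exact: heis_inv_cvg0.
  - by apply: aeW => r _ k; rewrite increment_diff; exact: Nu_diff_le.
  - by rewrite integral_cst//= probability_setT mule1 ltry.
apply: cvge0_le (cvge0D (cvge0Z `|m.2| Icvg) IH) => k.
  by rewrite mule_ge0 ?Nu_ge0// lee_fin invr_ge0 ltW.
have ek0 : 0 <= (e k)^-1 by rewrite invr_ge0 ltW.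
apply: (le_trans (lee_wpmul2l _ (word1_step (e k) m B (a k) mf))); first by rewrite lee_fin.
rewrite ge0_muleDr ?mule_ge0 ?Nu_ge0 ?lee_fin//.
  by rewrite muleA -EFinM normrM (gtr0_norm (epos k)) mulKf// gt_eqF.
exact: I0.
Qed.

End first_order.

Section second_order.
Variables (f : H -> R) (D : 'I_(n + n) -> H -> R) (DD : 'I_(n + n) -> 'I_(n + n) -> H -> R) (K : R).
Hypotheses (fD : forall j, weak_derivative (idx_h j) f (D j))
  (fDD : forall i j, weak_derivative (idx_h i) (D j) (DD i j))
  (DDs' : forall i j, (Ls_norm s' (DD i j) < +oo)%E)
  (DDK : forall i j, (Ls_norm s u * Ls_norm s' (DD i j) <= K%:E)%E) (K0 : 0 <= K).

Let mD j : measurable_fun setT (D j). Proof. by have [_ []] := fD j. Qed.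
Let mDD i j : measurable_fun setT (DD i j). Proof. by have [_ []] := fDD i j. Qed.

(** The error made when the derivative of f along the last move is replaced by its affine expansion
    in r. *)
Definition increment2 e m B r p : R :=
  D m.1 (along (e * m.2) (idx_h m.1) (heis_mul p (wpt e B)) r) -
  ((D m.1 p + e * e1 B (DD ^~ m.1) p) + e * m.2 * DD m.1 m.1 p * r).

(** Second-order remainders of f thus reduce to first-order remainders of Z_m f along the shortened
    word. *)
Lemma increment2_T1 e m B r :
  increment2 e m B r = T1 e ((m.1, m.2 * r) :: B) (D m.1) (DD ^~ m.1).
Proof.
apply/funext => p; rewrite /increment2 /T1 /along /= /e1 big_cons /= -heis_mulA mulrA; ring.
Qed.

Lemma measurable_increment2 e m B :
  measurable_fun setT (fun z : R * H => increment2 e m B z.1 z.2).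
Proof.
have mc0 : measurable_fun setT (fun p => D m.1 p + e * e1 B (DD ^~ m.1) p).
  by apply: measurable_funD => //; apply: measurable_funM => //; exact: measurable_e1.
have mc1 : measurable_fun setT (fun p => e * m.2 * DD m.1 m.1 p) by exact: measurable_funM.
exact: (measurable_step _ _ _ (mD m.1) mc0 mc1).
Qed.

Lemma word2_step e m B a : measurable_fun setT f ->
  (Nu u a (T2 e (m :: B) f D DD) <=
   `|e * m.2|%:E * \int[U]_r Nu u a (increment2 e m B r) + Nu u a (T2 e B f D DD))%E.
Proof.
move=> mf.
have mc0 : measurable_fun setT (fun p => D m.1 p + e * e1 B (DD ^~ m.1) p).
  by apply: measurable_funD => //; apply: measurable_funM => //; exact: measurable_e1.
have mc1 : measurable_fun setT (fun p => e * m.2 * DD m.1 m.1 p) by exact: measurable_funM.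
apply: le_trans (leeD (Nu_step mu_u (e * m.2) a (wpt e B) mrho (fD m.1) mc0 mc1) (lexx _)).
apply: NuD => //; last 2 first.
- exact: measurable_T2.
- move=> p; apply: le_trans (ler_normD _ _); rewrite le_eqVlt; apply/orP; left; apply/eqP.
  congr `|_|; rewrite /T2 e1_cons /along /= mulr1 heis_mulA.
  by field.
apply: measurable_funB.
  apply: measurable_funB; apply: measurableT_comp mf _; last exact: measurable_heis_mulr.
  rewrite /along; apply: measurable_heis_mul; last exact: measurable_cst.
  exact: measurable_heis_mulr.
by apply: measurable_funM => //; apply: measurable_funD => //; exact: measurable_funM.
Qed.

Lemma Nu_T2_nil e a : Nu u a (T2 e [::] f D DD) = 0%E.
Proof.
rewrite /Nu; under eq_integral => p _.
  rewrite /T2 /e1 /= heis_mul0 big_nil !mulr0 subrr !subr0 normr0 mulr0.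
  over.
exact: integral0.
Qed.

Lemma Nu_increment2_le e m B a r : 0 <= e ->
  (Nu u a (increment2 e m B r) <= (e * (2 * K * (`|m.2| * `|r| + wlen B)))%:E)%E.
Proof.
move=> e0; rewrite increment2_T1.
apply: le_trans; first by apply: (word1_bound (f := D m.1) (D := DD ^~ m.1) (K := K)).
by rewrite /wlen big_cons /= normrM.
Qed.

Lemma word2_bound e W a : measurable_fun setT f -> 0 <= e ->
  (Nu u a (T2 e W f D DD) <= (e ^+ 2 * (2 * K * wlen W ^+ 2))%:E)%E.
Proof.
move=> mf e0; elim: W => [|m B IH].
  by rewrite /wlen big_nil expr0n !mulr0 Nu_T2_nil.
apply: (le_trans (word2_step e m B a mf)).
rewrite /wlen big_cons -/(wlen B).
apply: (@le_trans _ _ (`|e * m.2| * (e * (2 * K * (`|m.2| + wlen B))) +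
    e ^+ 2 * (2 * K * wlen B ^+ 2))%:E).
  rewrite EFinD leeD// EFinM lee_wpmul2l// ?lee_fin//.
  apply: integral_unit_le.
  - apply: measurable_Nu_param; exact: measurable_increment2.
  - by move=> r; exact: Nu_ge0.
  - move=> r /andP[r0 r1]; apply: (le_trans (Nu_increment2_le _ _ _ _ e0)).
    by rewrite lee_fin ler_wpM2l// ler_wpM2l ?mulr_ge0// lerD2r (ger0_norm r0) ler_piMr.
(* With a = |m.2| and b the length of B, (a + b)^2 exceeds a (a + b) + b^2 by a b. *)
rewrite lee_fin normrM (ger0_norm e0) -subr_ge0.
have -> : e ^+ 2 * (2 * K * (`|m.2| + wlen B) ^+ 2) -
   (e * `|m.2| * (e * (2 * K * (`|m.2| + wlen B))) + e ^+ 2 * (2 * K * wlen B ^+ 2)) =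
   e ^+ 2 * (2 * K * (`|m.2| * wlen B)) by ring.
by rewrite !mulr_ge0// ?exprn_ge0// wlen_ge0.
Qed.

Hypothesis ui : mu.-integrable setT (EFin \o u).

Lemma word2_cvg (e : nat -> R) (a : nat -> H) W : measurable_fun setT f ->
  (forall k, 0 < e k) -> e k @[k --> \oo] --> (0 : R) -> a k @[k --> \oo] --> (0 : H) ->
  (((e k ^+ 2)^-1)%:E * Nu u (a k) (T2 (e k) W f D DD) @[k --> \oo] --> 0)%E.
Proof.
move=> mf epos e0 a0; elim: W => [|m B IH].
  under eq_cvg do rewrite Nu_T2_nil mule0.
  exact: (@cvg_cst (\bar R) 0%E nat \oo).
have ei0 k : 0 <= (e k)^-1 by rewrite invr_ge0 ltW.
pose J k r := (((e k)^-1)%:E * Nu u (a k) (increment2 (e k) m B r))%E.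
have mN k : measurable_fun setT (fun r => Nu u (a k) (increment2 (e k) m B r)).
  by apply: measurable_Nu_param; exact: measurable_increment2.
have J0 k r : (0 <= J k r)%E by rewrite mule_ge0 ?Nu_ge0// lee_fin.
have Icvg : (\int[U]_r J k r @[k --> \oo] --> 0)%E.
  have dom : (\int[U]_r (2 * K * (`|m.2| * `|r| + wlen B))%:E < +oo)%E.
    apply: (@le_lt_trans _ _ (2 * K * (`|m.2| + wlen B))%:E); last exact: ltry.
    apply: integral_unit_le.
    + apply/measurable_EFinP; apply: measurable_funM => //; apply: measurable_funD => //.
      by apply: measurable_funM => //; exact: measurableT_comp.
    + by move=> r; rewrite lee_fin !mulr_ge0// addr_ge0// ?mulr_ge0// wlen_ge0.
    + move=> r /andP[r0 r1]; rewrite lee_fin ler_wpM2l// ?mulr_ge0// lerD2r.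
      by rewrite (ger0_norm r0) ler_piMr.
  refine (dominated_cvg0 measurableT _ _ _ _ _ dom) => //.
  - by move=> k; apply: (measurable_funeM ((e k)^-1)%:E); exact: mN.
  - by move=> r _; rewrite lee_fin !mulr_ge0// addr_ge0// ?mulr_ge0// wlen_ge0.
  - apply: aeW => r _; under eq_cvg do rewrite /J increment2_T1.
    by apply: (word1_cvg (f := D m.1) (D := DD ^~ m.1) (K := K)).
  - apply: aeW => r _ k; have e0' := ltW (epos k).
    apply: (le_trans (lee_wpmul2l _ (Nu_increment2_le _ _ _ _ e0'))); first by rewrite lee_fin.
    by rewrite -EFinM mulKf// gt_eqF.
apply: cvge0_le (cvge0D (cvge0Z `|m.2| Icvg) IH) => k.
  by rewrite mule_ge0 ?Nu_ge0// lee_fin invr_ge0 exprn_ge0// ltW.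
have ek0 : 0 <= (e k ^+ 2)^-1 by rewrite invr_ge0 exprn_ge0// ltW.
apply: (le_trans (lee_wpmul2l _ (word2_step (e k) m B (a k) mf))); first by rewrite lee_fin.
have I0 : (0 <= \int[U]_r Nu u (a k) (increment2 (e k) m B r))%E.
  by apply: integral_ge0 => r _; exact: Nu_ge0.
rewrite ge0_muleDr ?mule_ge0 ?Nu_ge0 ?lee_fin// leeD2r//.
rewrite /J ge0_integralZl ?lee_fin//; last by move=> r _; exact: Nu_ge0.
rewrite !muleA -!EFinM normrM (gtr0_norm (epos k)).
  have -> // : (e k ^+ 2)^-1 * (e k * `|m.2|) = `|m.2| * (e k)^-1.
  by field; rewrite gt_eqF.
exact: mN.
Qed.

End second_order.

End word_estimates.

(** * A word whose path ends at the inverse of a given point *)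

Section inverse_word.
Context {R : realType} {n : nat}.
Local Notation H := (heis R n).
Local Notation mu := (@mu_heis R n).
Implicit Types (p q w : H) (r e : R) (W A B : seq ('I_(n + n) * R)).
Implicit Types (D : 'I_(n + n) -> H -> R) (DD : 'I_(n + n) -> 'I_(n + n) -> H -> R).

Lemma wpt_cat e A B : wpt e (A ++ B) = heis_mul (wpt e B) (wpt e A).
Proof. by elim: A => [|m A IH] /=; rewrite ?heis_mul0// IH heis_mulA. Qed.

Lemma e1_cat A B D p : e1 (A ++ B) D p = e1 A D p + e1 B D p.
Proof. by rewrite /e1 big_cat. Qed.

(** [B] is travelled before [A], so the cross terms differentiate along [B] the derivatives along
    [A]. *)
Lemma e2_cat A B DD p : e2 (A ++ B) DD p =
  e2 A DD p + e2 B DD p + \sum_(m <- A) m.2 * e1 B (DD ^~ m.1) p.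
Proof.
elim: A => [|m A IH] /=; first by rewrite big_nil add0r addr0.
by rewrite IH e1_cat big_cons; ring.
Qed.

Lemma wpt_dil e W : wpt e W = heis_dil e (wpt 1 W).
Proof.
elim: W => [|m W IH] /=.
  apply: rV_ext; apply: idx_ht => [h|]; rewrite ?heis_dil_h ?heis_dil_t !mxE ?mulr0//.
by rewrite heis_dilM heis_dil_exp -IH mul1r.
Qed.

Lemma wpt_h e W (h : 'I_(n + n)) :
  wpt e W ord0 (idx_h h) = \sum_(m <- W) e * m.2 * (h == m.1)%:R.
Proof.
elim: W => [|m W IH]; first by rewrite big_nil /= mxE.
rewrite /= heis_mul_h IH big_cons addrC !rVE; congr (_ * _%:R + _).
Qed.

(** Reaches the horizontal coordinates of w^-1; the error in t is left to [vertical_word]. *)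
Definition horizontal_word w : seq ('I_(n + n) * R) :=
  [seq (h, - w ord0 (idx_h h)) | h <- index_enum 'I_(n + n)].

Lemma horizontal_word_shift w r : horizontal_word (heis_mul (r *: basis_rV idx_t) w) =
  horizontal_word w.
Proof.
apply/eq_map => h; congr (_, - _).
by rewrite heis_mul_h rVZE basis_rV_h mulr0 add0r.
Qed.

Lemma e1_horizontal_word w D p :
  e1 (horizontal_word w) D p = - \sum_h w ord0 (idx_h h) * D h p.
Proof.
by rewrite /e1 big_map -sumrN; apply: eq_bigr => h _; rewrite mulNr.
Qed.

Variable j1 : 'I_n.
Local Notation x1 := (lshift n j1).
Local Notation y1 := (rshift n j1).

(* The commutator of the flows of [X_1] and [b Y_1] is the flow of [- 4 b T]. *)
Definition vertical_word (b : R) : seq ('I_(n + n) * R) :=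
  [:: (y1, - b); (x1, - 1); (y1, b); (x1, 1)].

(** [X_1, Y_1] f for the pair chosen by [j1], which is - 4 T f in the sense of distributions by
    [weak_vertical]. *)
Definition bracket DD p : R := DD x1 y1 p - DD y1 x1 p.

Lemma wpt_vertical_word b : wpt 1 (vertical_word b) = (- 4 * b) *: basis_rV idx_t.
Proof.
rewrite /= heis_0mul !mul1r !heis_mul_exp.
have -> : idx_h x1 = idx_x j1 by [].
have -> : idx_h y1 = idx_y j1 by [].
rewrite /Zleft !field_frame_x !field_frame_y !xpartE !ypartE.
apply: rV_ext => i; rewrite !rVE !idx_xx !idx_yy !idx_xy !idx_yx.
have -> : (idx_x j1 == idx_t) = false by rewrite /idx_t /idx_x /idx_y eq_lrshift.
have -> : (idx_y j1 == idx_t) = false by rewrite /idx_t /idx_x /idx_y eq_lrshift.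
rewrite !eqxx /=; ring.
Qed.

Lemma e1_vertical_word b D p : e1 (vertical_word b) D p = 0.
Proof. by rewrite /e1 /vertical_word !big_cons big_nil /=; ring. Qed.

Lemma e2_vertical_word b DD p : e2 (vertical_word b) DD p = b * bracket DD p.
Proof. by rewrite /= /e1 !big_cons big_nil /= /bracket; field. Qed.

Lemma e2_vertical_cat b B DD p : e2 (vertical_word b ++ B) DD p = b * bracket DD p + e2 B DD p.
Proof.
by rewrite e2_cat e2_vertical_word /vertical_word !big_cons big_nil /=; ring.
Qed.

(** [vertical_word b] moves t by - 4 b, so the excess of t over - w_t is divided by 4. *)
Definition vertical_gap w : R := (wpt 1 (horizontal_word w) ord0 idx_t + w ord0 idx_t) / 4.

Definition inverse_word w := vertical_word (vertical_gap w) ++ horizontal_word w.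

Lemma wpt_inverse_word e w : wpt e (inverse_word w) = heis_inv (heis_dil e w).
Proof.
rewrite wpt_dil -heis_dilV; congr (heis_dil _ _).
rewrite wpt_cat wpt_vertical_word heis_mul_exp /Zleft field_frame_t /heis_inv.
apply: rV_ext; apply: idx_ht => [h|].
  rewrite rVDE rVZE basis_rV_h mulr0 addr0 wpt_h big_map rVNE (bigD1 h)//= eqxx mulr1 mul1r.
  by rewrite big1 ?addr0// => i /negbTE; rewrite eq_sym => ->; rewrite mulr0.
by rewrite rVDE rVZE basis_rV_t rVNE /vertical_gap; field.
Qed.

Lemma e1_inverse_word w D p :
  e1 (inverse_word w) D p = - \sum_h w ord0 (idx_h h) * D h p.
Proof. by rewrite e1_cat e1_vertical_word add0r e1_horizontal_word. Qed.

(** A shift of w by r in t keeps the horizontal moves and changes the gap by r / 4. Thus [e2] is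
    affine along the flow of T, as the integration by parts in w requires. *)
Lemma e2_inverse_word_shift w r DD p :
  e2 (inverse_word (heis_mul (r *: basis_rV idx_t) w)) DD p =
  e2 (inverse_word w) DD p + r / 4 * bracket DD p.
Proof.
rewrite !e2_vertical_cat /vertical_gap horizontal_word_shift.
by rewrite heis_mul_t heis_formZl heis_form_tl rVZE basis_rV_t; ring.
Qed.

Lemma wpt_map_box (J : seq 'I_(n + n)) r : exists2 r', 0 <= r' &
  forall c : 'I_(n + n) -> R, (forall h, `|c h| <= r) ->
  rV_box r' (wpt 1 [seq (h, c h) | h <- J]).
Proof.
elim: J => [|h J [r' r'0 IH]].
  by exists 0 => // c _ i; rewrite /= mxE normr0.
have [r3 r30 h3] := @rV_box_heis_mul R n r' r.
exists r3 => // c cr; apply: h3; first exact: IH.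
by rewrite mul1r; apply: rV_box_basis; exact: cr.
Qed.

(** Bounded lengths make the Taylor estimates uniform for w in the support of the mollifier. *)
Lemma wlen_inverse_word r : exists2 L, 0 <= L & forall w, rV_box r w ->
  wlen (inverse_word w) <= L.
Proof.
have [r' r'0 hr'] := wpt_map_box (index_enum 'I_(n + n)) r.
exists (2 * `|(r' + `|r|) / 4| + 2 + \sum_(h < n + n) `|r|).
  by rewrite !addr_ge0 ?mulr_ge0// sumr_ge0.
move=> w wr; rewrite /wlen /inverse_word big_cat /= lerD//.
  rewrite !big_cons big_nil /= normrN normrN1 normr1 addr0.
  have gap : `|vertical_gap w| <= `|(r' + `|r|) / 4|.
    rewrite /vertical_gap !normrM ler_wpM2r// (le_trans (ler_normD _ _))//.
    rewrite [leRHS]ger0_norm ?addr_ge0// lerD//.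
      by apply: (hr' (fun h => - w ord0 (idx_h h))) => h; rewrite normrN.
    exact: le_trans (wr _) (ler_norm _).
  have -> : `|vertical_gap w| + (1 + (`|vertical_gap w| + 1)) = 2 * `|vertical_gap w| + 2 by ring.
  by rewrite lerD2r ler_wpM2l.
rewrite big_map; apply: ler_sum => h _.
by rewrite normrN; exact: le_trans (wr _) (ler_norm _).
Qed.

Lemma e1_le W D p : `|e1 W D p| <= wlen W * \sum_h `|D h p|.
Proof.
rewrite /e1 /wlen mulr_suml (le_trans (ler_norm_sum _ _ _))//; apply: ler_sum => m _.
rewrite normrM ler_wpM2l// (bigD1 m.1)//= lerDl; exact: sumr_ge0.
Qed.

Lemma e2_le W DD p : `|e2 W DD p| <= wlen W ^+ 2 * \sum_i \sum_j `|DD i j p|.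
Proof.
set S := \sum_i _.
have Sle i j : `|DD i j p| <= S.
  rewrite /S (bigD1 i)//= (bigD1 j)//= -addrA lerDl addr_ge0// ?sumr_ge0//.
  by move=> *; rewrite sumr_ge0.
have Sle1 j : \sum_h `|DD h j p| <= S.
  by apply: ler_sum => i _; rewrite (bigD1 j)//= lerDl sumr_ge0.
have S0 : 0 <= S by apply: sumr_ge0 => i _; exact: sumr_ge0.
elim: W => [|m B IH]; first by rewrite /= normr0 mulr_ge0// exprn_ge0// wlen_ge0.
rewrite /= /wlen big_cons -/(wlen B).
have B0 := wlen_ge0 B.
apply: (@le_trans _ _ (wlen B ^+ 2 * S + `|m.2| * (wlen B * S) + `|m.2| ^+ 2 / 2 * S)).
  rewrite (le_trans (ler_normD _ _))// lerD//.
    rewrite (le_trans (ler_normD _ _))// lerD// normrM ler_wpM2l//.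
    by rewrite (le_trans (e1_le _ _ _))// ler_wpM2l.
  rewrite normrM; apply: ler_pM => //.
  by rewrite normrM normrX (ger0_norm (_ : 0 <= 2^-1)).
rewrite -subr_ge0.
have -> : (`|m.2| + wlen B) ^+ 2 * S - (wlen B ^+ 2 * S + `|m.2| * (wlen B * S) +
   `|m.2| ^+ 2 / 2 * S) = (`|m.2| * wlen B + `|m.2| ^+ 2 / 2) * S by field.
by rewrite mulr_ge0// addr_ge0// ?mulr_ge0// exprn_ge0.
Qed.

End inverse_word.

Section bounded_support_norms.
Context {R : realType} {n : nat}.
Local Notation H := (heis R n).
Local Notation mu := (@mu_heis R n).
Implicit Types (p q w : H) (f phi P : H -> R) (r : R).

Lemma box_fin r : (mu (rV_box r) < +oo)%E.
Proof. exact: lebesgue_rV_box. Qed.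

Lemma integral_box r : (\int[mu]_p (\1_(rV_box r) p)%:E = mu (rV_box r))%E.
Proof. by rewrite integral_indic ?setIT//; exact: measurable_rV_box. Qed.

Lemma bounded_supp_Ls s phi : (0 < mu setT)%E -> (1 <= s)%E -> bounded_supp phi ->
  (Ls_norm s phi < +oo)%E.
Proof.
move=> mu_gt0 s1 [mphi [C [r [C0 r0 phiC phir]]]]; rewrite /Ls_norm unlock.
case: s s1 => [t t1|_|//]; last first.
  rewrite mu_gt0; apply: le_lt_trans (ltry C); apply/ess_supP.
  by apply: aeW => p /=; rewrite lee_fin.
rewrite lee_fin in t1; have t0 : 0 < t by exact: lt_le_trans t1.
apply: poweR_lty.
apply: (@le_lt_trans _ _ ((C `^ t)%:E * mu (rV_box r))%E); last first.
  by rewrite lte_mul_pinfty ?box_fin// lee_fin powR_ge0.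
rewrite -integral_box -integralZl_ge0 ?powR_ge0//; last first.
  by apply: measurable_indic; exact: measurable_rV_box.
apply: le_integral_nonmeas => p _; first exact: poweR_ge0.
rewrite /= lee_fin indicE; have [pr|pr] := pselect (rV_box r p).
  by rewrite mem_set// mulr1 ge0_ler_powR ?nnegrE// ltW.
by rewrite memNset// mulr0 phir// normr0 powR0// gt_eqF.
Qed.

Lemma box_integrable_locally_bounded P : measurable_fun setT P ->
  (forall r, exists C : R, forall w, rV_box r w -> `|P w| <= C) -> box_integrable P.
Proof.
move=> mP bP; split => // r; have [C hC] := bP r.
apply: integrable_absP; first exact: measurable_boxed.
apply: (@le_lt_trans _ _ (`|C|%:E * mu (rV_box r))%E); last first.
  by rewrite lte_mul_pinfty ?box_fin// lee_fin.
rewrite -integral_box -integralZl_ge0 //; last first.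
  by apply: measurable_indic; exact: measurable_rV_box.
apply: le_integral_nonmeas => p _; first by rewrite lee_fin.
rewrite lee_fin /boxed normrM [`|\1_ _ _|]ger0_norm//.
have [pr|pr] := pselect (rV_box r p); last by rewrite indicE memNset// !mulr0.
by rewrite ler_wpM2r// (le_trans (hC _ pr))// ler_norm.
Qed.

Lemma box_integrable_cst (c : R) : box_integrable (cst c : H -> R).
Proof. by apply: box_integrable_locally_bounded => // r; exists `|c| => w _. Qed.

Lemma bounded_supp_integrable phi : bounded_supp phi -> mu.-integrable setT (EFin \o phi).
Proof.
move=> bphi; have := box_integrableM0 (box_integrable_cst 1) bphi.
by apply: eq_integrable => // p _ /=; rewrite mul1r.
Qed.

End bounded_support_norms.

(** * Integration by parts for the right-invariant fields *)

Section right_derivative.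
Context {R : realType} {n : nat}.
Local Notation H := (heis R n).
Local Notation mu := (@mu_heis R n).
Local Notation U := (uniform_prob (@ltr01 R)).
Variables (rho : H -> R) (mrho : mollifier rho) (k : 'I_(n + n + 1)).
Implicit Types (P : H -> R) (Q r : R).
Local Notation L := (lie (Zright k) rho).
Local Notation ek r := (r *: basis_rV k : H).

Let trho := mollifier_test mrho.

(** P is affine along the flow of the right-invariant field, that is, Z_k^r P is the constant Q. *)
Let Prop_shift P Q := forall (r : R) w, P (heis_mul (ek r) w) = P w + r * Q.

Lemma measurable_heis_mull (a : H) : measurable_fun setT (fun w => heis_mul a w).
Proof. by apply: measurable_heis_mul; [exact: measurable_cst|exact: measurable_id]. Qed.

Lemma Rintegral_shift P Q phi r : box_integrable P -> Prop_shift P Q -> bounded_supp phi ->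
  mu.-integrable setT (EFin \o (fun w => P w * phi (heis_mul (ek r) w))) /\
  \int[mu]_w (P w * phi (heis_mul (ek r) w)) =
  \int[mu]_w (P w * phi w) - r * Q * \int[mu]_w phi w.
Proof.
move=> bP sP bphi.
have i1 := box_integrableM0 bP bphi; have i2 := bounded_supp_integrable bphi.
have i3 : mu.-integrable setT (EFin \o (fun w => r * Q * phi w)).
  by apply: eq_integrable (integrableZl measurableT (r * Q) i2).
have i4 : mu.-integrable setT (EFin \o (fun w => P (heis_mul (ek (- r)) w) * phi w)).
  apply: eq_integrable (integrableB measurableT i1 i3) => // w _ /=.
  by rewrite sP mulNr -EFinB -mulrBl.
have hA (g : H -> \bar R) : measurable_fun setT g -> (forall w, 0 <= g w)%E ->
    (\int[mu]_w g (heis_mul (ek r) w) = 1%:E * \int[mu]_w g w)%E.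
  by move=> mg g0; rewrite mul1e integral_heis_mull.
have [+ +] := Rintegral_change ler01 hA (measurable_heis_mull _) i4.
have E w : heis_mul (ek (- r)) (heis_mul (ek r) w) = w.
  by rewrite heis_mulA -heis_exp_inv heis_Vmul heis_0mul.
rewrite /comp; under eq_fun do rewrite E; under [X in X = _]eq_Rintegral do rewrite E.
move=> -> ->; split => //; rewrite mul1r.
under eq_Rintegral do rewrite sP mulNr mulrBl.
by rewrite RintegralB// RintegralZl.
Qed.

(** The fundamental theorem of calculus for [rho] along the left translations exp(r Z_k), r in
    [0, 1], tested against P. The integral of [L] remains as an unknown, which the choice P = 1
    determines afterwards. *)
Lemma Rintegral_right_lie P Q : box_integrable P -> Prop_shift P Q ->
  \int[mu]_w (P w * L w) - Q * (\int[mu]_w L w) / 2 = - Q.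
Proof.
move=> bP sP; have brho := bounded_supp_test trho.
have [sr _] := trho; have [mrh _] := brho; have [mP _] := bP.
have bL : bounded_supp L by exact: bounded_supp_lie.
have [mL _] := bL.
have [i1 e1] := Rintegral_shift 1 bP sP brho.
have i0 := box_integrableM0 bP brho.
have rho1 : \int[mu]_w rho w = 1.
  by apply: EFin_inj; rewrite EFin_Rintegral ?(mollifier_int mrho)//; exact: bounded_supp_integrable.
have mF : measurable_fun setT (fun z : H * R => P z.1 * L (heis_mul (ek z.2) z.1)).
  apply: measurable_funM; first exact: measurableT_comp mP measurable_fst.
  apply: measurableT_comp mL _; apply: measurable_heis_mul; last exact: measurable_fst.
  by apply: measurable_rVZ; [exact: measurable_snd|exact: measurable_cst].
have iPL := box_integrableM0 bP bL; have iL := bounded_supp_integrable bL.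
have fin : (\int[mu]_w \int[U]_r (`|P w * L (heis_mul (ek r) w)|)%:E < +oo)%E.
  rewrite (tonelli_abs sigma_finite_heis sigma_finite_unit
    (f := fun w r => P w * L (heis_mul (ek r) w)))//.
  have [mPL fPL] := integrable_abs_lty iPL; have [_ fL] := integrable_abs_lty iL.
  pose C := (\int[mu]_w (`|P w * L w|)%:E + `|Q|%:E * \int[mu]_w (`|L w|)%:E)%E.
  have C0 : (0 <= C)%E.
    by rewrite adde_ge0 ?mule_ge0 ?lee_fin//; apply: integral_ge0 => w _; rewrite lee_fin.
  have Cfin : C \is a fin_num.
    by rewrite ge0_fin_numE// /C lte_add_pinfty// lte_mul_pinfty.
  apply: (@le_lt_trans _ _ (fine C)%:E); last exact: ltry.
  apply: integral_unit_le.
  - apply: (measurable_integral_ge0 sigma_finite_heis (f := fun r w => `|P w * L (heis_mul (ek r) w)|)) => //.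
    apply: (measurable_uncurry_swap (f := fun w r => `|P w * L (heis_mul (ek r) w)|)).
    exact: measurableT_comp mF.
  - by move=> r; apply: integral_ge0 => w _; rewrite lee_fin.
  move=> r /andP[r0 r1]; rewrite fineK//.
  rewrite -(integral_heis_mull (ek (- r)) (f := fun w => (`|P w * L (heis_mul (ek r) w)|)%:E)); last 2 first.
  - apply/measurable_EFinP; apply: measurableT_comp => //; apply: measurable_funM => //.
    by apply: measurableT_comp mL _; exact: measurable_heis_mull.
  - by move=> w; rewrite lee_fin.
  rewrite /C -integralZl_ge0//; last exact: measurableT_comp.
  apply: le_integralD => //; first exact: measurableT_comp.
    by apply: measurable_funM => //; exact: measurableT_comp.
  move=> w; rewrite sP heis_mulA -heis_exp_inv heis_mulV heis_0mul.
  rewrite mulNr mulrBl (le_trans (ler_normB _ _))// lerD2l !normrM (ger0_norm r0).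
  by rewrite ler_wpM2r// ler_piMl.
have swap := Rintegral_fubini sigma_finite_heis sigma_finite_unit mF fin.
move: swap => /=.
have -> : \int[U]_r \int[mu]_w (P w * L (heis_mul (ek r) w)) =
    \int[mu]_w (P w * L w) - Q * (\int[mu]_w L w) / 2.
  under eq_Rintegral.
    move=> r _; have [_ ->] := Rintegral_shift r bP sP bL.
    rewrite (_ : _ - _ = \int[mu]_w (P w * L w) + (- (Q * \int[mu]_w L w)) * r); last by ring.
    over.
  by rewrite Rintegral_unit_affine mulNr.
move=> <-.
transitivity (\int[mu]_w (P w * rho (heis_mul (ek 1) w) - P w * rho w)); last first.
  by rewrite RintegralB// e1 rho1; ring.
apply: eq_Rintegral => w _; have := ftc_right k w 1 sr => -[iw ew].
move: iw ew.
have -> : (fun r => L (heis_mul ((1 * r) *: basis_rV k) w)) = (fun r => L (heis_mul (ek r) w)).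
  by apply/funext => r; rewrite mul1r.
have -> : (fun r => (L (heis_mul ((1 * r) *: basis_rV k) w))%:E) =
    (fun r => (L (heis_mul (ek r) w))%:E).
  by apply/funext => r; rewrite mul1r.
rewrite mul1r => iw ew.
by rewrite RintegralZl// -ew mulrBr.
Qed.

(* The right-invariant fields have mean zero on test functions and satisfy
   [int P (Z^r rho) = - Z^r P] when [Z^r P] is constant. *)
Lemma Rintegral_lie_right P Q : box_integrable P -> Prop_shift P Q ->
  \int[mu]_w (P w * L w) = - Q.
Proof.
move=> bP sP; have := Rintegral_right_lie bP sP.
have s1 : Prop_shift (cst 1) 0 by move=> r w; rewrite mulr0 addr0.
have := Rintegral_right_lie (box_integrable_cst 1) s1.
under eq_Rintegral do rewrite mul1r.
by rewrite mul0r mul0r subr0 oppr0 => ->; rewrite mulr0 mul0r subr0.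
Qed.

End right_derivative.

Lemma integrableZ_EFin d (T : measurableType d) (R : realType) (mu : {measure set T -> \bar R})
    (c : R) (F : T -> R) : mu.-integrable setT (EFin \o F) ->
  mu.-integrable setT (EFin \o (fun x => c * F x)).
Proof. by move=> iF; apply: eq_integrable (integrableZl measurableT c iF). Qed.

Lemma Rintegral_sum d (T : measurableType d) (R : realType) (mu : {measure set T -> \bar R})
    (I : Type) (J : seq I) (F : I -> T -> R) :
  (forall i, mu.-integrable setT (EFin \o F i)) ->
  mu.-integrable setT (EFin \o (fun x => \sum_(i <- J) F i x)) /\
  \int[mu]_x (\sum_(i <- J) F i x) = \sum_(i <- J) \int[mu]_x F i x.
Proof.
move=> iF; elim: J => [|i J [IHi IHe]].
  have -> : (fun x => \sum_(i <- [::]) F i x) = cst 0 by apply/funext => x; rewrite big_nil.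
  by rewrite big_nil Rintegral_cst// mul0r; split => //; exact: integrable0.
have -> : (fun x => \sum_(j <- i :: J) F j x) = (fun x => F i x + \sum_(j <- J) F j x).
  by apply/funext => x; rewrite big_cons.
by split; [exact: (integrableD measurableT (iF i) IHi)|rewrite big_cons RintegralD// IHe].
Qed.

(** * Divergence of the contact field *)

Section horizontal_signs.
Context {R : realType} {n : nat}.

(* The contact field is sum_h sign_h (Z_{dual_h} psi) Z_h - 4 psi T. *)
Definition dual_h (h : 'I_(n + n)) : 'I_(n + n) :=
  match fintype.split h with inl j => rshift n j | inr j => lshift n j end.

Definition sign_h (h : 'I_(n + n)) : R :=
  match fintype.split h with inl _ => 1 | inr _ => - 1 end.

Lemma dual_hK : involutive dual_h.
Proof.
move=> h; rewrite /dual_h; case: (splitP h) => j hj.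
  by rewrite split_rshift_n; exact: val_inj.
by rewrite split_lshift_n; exact: val_inj.
Qed.

Lemma sign_h_sqr h : sign_h h * sign_h h = 1.
Proof. by rewrite /sign_h; case: fintype.split => _; rewrite ?mulr1// mulrNN mulr1. Qed.

Lemma sign_h_norm h : `|sign_h h| = 1.
Proof. by rewrite /sign_h; case: fintype.split => _; rewrite ?normrN1// normr1. Qed.

Lemma box_integrable_sum (I : Type) (J : seq I) (F : I -> heis R n -> R) :
  (forall i, box_integrable (F i)) -> box_integrable (fun p => \sum_(i <- J) F i p).
Proof.
move=> bF; elim: J => [|i J IH].
  have -> : (fun x => \sum_(i <- [::]) F i x) = cst 0 by apply/funext => x; rewrite big_nil.
  exact: box_integrable_cst.
have -> : (fun x => \sum_(j <- i :: J) F j x) = (fun x => F i x - (- 1) * \sum_(j <- J) F j x).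
  by apply/funext => x; rewrite big_cons mulN1r opprK.
by apply: box_integrableB => //; exact: box_integrableZ.
Qed.

End horizontal_signs.

Section divergence.
Context {R : realType} {n : nat}.
Local Notation H := (heis R n).
Local Notation mu := (@mu_heis R n).
Local Notation U := (uniform_prob (@ltr01 R)).
Variables (rho : H -> R) (mrho : mollifier rho) (s : \bar R) (s_ge1 : (1 <= s)%E).
Local Notation s' := (hoelder_conjugate s).
Variables (f : H -> R) (D : 'I_(n + n) -> H -> R) (DD : 'I_(n + n) -> 'I_(n + n) -> H -> R).
Hypotheses (fD : forall j, weak_derivative (idx_h j) f (D j))
  (fDD : forall i j, weak_derivative (idx_h i) (D j) (DD i j))
  (DDs' : forall i j, (Ls_norm s' (DD i j) < +oo)%E).
Variable j1 : 'I_n.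
Let mu_gt0 := mollifier_mu_gt0 mrho.
Let bf : box_integrable f.
Proof. by have [lf _ _] := fD (lshift n j1); exact: locally_box_integrable. Qed.
Let bDD i j : box_integrable (DD i j).
Proof. by have [_ lg _] := fDD i j; exact: locally_box_integrable. Qed.

Lemma box_integrable_bracket : box_integrable (bracket j1 DD).
Proof. exact: box_integrableB. Qed.

Lemma common_bound (u : H -> R) : (Ls_norm s u < +oo)%E -> exists2 K : R, 0 <= K &
  forall i j, (Ls_norm s u * Ls_norm s' (DD i j) <= K%:E)%E.
Proof.
move=> us; pose t i j := (Ls_norm s u * Ls_norm s' (DD i j))%E.
have t0 i j : (0 <= t i j)%E by rewrite mule_ge0 ?Lnorm_ge0.
have tf i j : t i j \is a fin_num.
  rewrite fin_numM// ge0_fin_numE ?Lnorm_ge0//; exact: DDs'.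
exists (\sum_i \sum_j fine (t i j)).
  by apply: sumr_ge0 => i _; apply: sumr_ge0 => j _; exact: fine_ge0.
move=> i j; rewrite -/(t i j) -(fineK (tf i j)) lee_fin (bigD1 i)//= (bigD1 j)//= -addrA lerDl.
by rewrite addr_ge0//; repeat (apply: sumr_ge0 => ? _); exact: fine_ge0.
Qed.

(** The value 1 / 4 makes the vertical displacement exactly - e^2. *)
Lemma wpt_quarter_word (e : R) : wpt e (vertical_word j1 (1 / 4)) = (- e ^+ 2) *: basis_rV idx_t.
Proof.
rewrite wpt_dil wpt_vertical_word; apply: rV_ext; apply: idx_ht => [h|].
  by rewrite heis_dil_h !rVZE basis_rV_h !mulr0.
by rewrite heis_dil_t !rVZE basis_rV_t; field.
Qed.

(** The difference quotients of phi with step (k + 1)^-2 converge pointwise to T phi. Written as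
    means of T phi they share its bound, and all vanish off one box, where |f| is integrable. *)
Lemma vertical_quotient_cvg phi : test_function phi ->
  (\int[mu]_p (`|f p * (lie (Zleft idx_t) phi p -
     (k.+1%:R ^+ 2) * (phi (heis_mul p ((k.+1%:R ^- 2) *: basis_rV idx_t)) - phi p))|)%:E
   @[k --> \oo] --> 0)%E.
Proof.
move=> tphi; have [sphi _] := tphi; have bphi := bounded_supp_test tphi.
have [mphi [C1 [r1 [C10 r10 phiC1 phir1]]]] := bphi.
have bL : bounded_supp (lie (Zleft idx_t) phi) by exact: bounded_supp_lie.
have [mL [C2 [r2 [C20 r20 LC2 Lr2]]]] := bL.
have [mf _] := bf.
have h01 k : 0 < (k.+1%:R : R) ^- 2 <= 1.
  rewrite invr_gt0 exprn_gt0 ?ltr0n//= invf_le1 ?exprn_gt0 ?ltr0n//.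
  by rewrite exprn_ege1// ler1n.
pose m (k : nat) : H := (k.+1%:R ^- 2) *: basis_rV idx_t.
have mbox k : rV_box 1 (m k).
  by apply: rV_box_basis; have /andP[h0 h1] := h01 k; rewrite gtr0_norm.
pose Dq k p := k.+1%:R ^+ 2 * (phi (heis_mul p (m k)) - phi p).
have Dq_le k p : `|Dq k p| <= C2.
  have [i E] := ftc_left idx_t p (k.+1%:R ^- 2) sphi.
  rewrite /Dq /m E mulVKf ?expf_neq0 ?pnatr_eq0//.
  rewrite -lee_fin EFin_normr_Rintegral//.
  apply: (le_trans (le_abse_integral _ measurableT (measurable_int _ i))).
  apply: integral_unit_le.
  - by apply: measurableT_comp => //; exact: measurable_int i.
  - by move=> r; exact: abse_ge0.
  - by move=> r _; rewrite lee_fin.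
have [r3 r30 hr3] := @rV_box_heis_mul R n r1 1.
pose r4 : R := Num.max r3 (Num.max r1 r2).
have in4 p : ~ rV_box r4 p -> lie (Zleft idx_t) phi p = 0 /\ forall k, Dq k p = 0.
  move=> pr; have p2 : ~ rV_box r2 p.
    by move=> p2; apply: pr; apply: le_rV_box p2; rewrite !le_max lexx !orbT.
  have p1 : ~ rV_box r1 p.
    by move=> p1; apply: pr; apply: le_rV_box p1; rewrite !le_max lexx !orbT.
  split; first exact: Lr2.
  move=> k; rewrite /Dq (phir1 p)// phir1 ?subrr ?mulr0// => pm.
  apply: pr; apply: (@le_rV_box _ _ r3); first by rewrite le_max lexx.
  rewrite -[p](heis_mulK _ (m k)); apply: hr3 => //.
  by move=> i; rewrite /heis_inv rVNE normrN; exact: mbox.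
have r40 : 0 <= r4 by rewrite le_max r30.
have mDq k : measurable_fun setT (Dq k).
  apply: measurable_funM => //; apply: measurable_funB => //.
  by apply: measurableT_comp mphi _; exact: measurable_heis_mulr.
have dom : (\int[mu]_p ((C2 + C2) * `|boxed r4 f p|)%:E < +oo)%E.
  have [mb fb] := integrable_abs_lty (bf.2 r4).
  rewrite integralZl_ge0//; [|exact: addr_ge0|exact: measurableT_comp].
  by rewrite lte_mul_pinfty// lee_fin addr_ge0.
refine (dominated_cvg0 measurableT _ _ _ _ _ dom) => //.
- move=> k; apply/measurable_EFinP; apply: measurableT_comp => //.
  by apply: measurable_funM => //; apply: measurable_funB => //; exact: mDq.
- by move=> p _; rewrite lee_fin mulr_ge0// addr_ge0.
- apply: aeW => p _.
  suff c : Dq k p @[k --> \oo] --> lie (Zleft idx_t) phi p.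
    have : `|f p * (lie (Zleft idx_t) phi p - Dq k p)| @[k --> \oo] -->
        `|f p * (lie (Zleft idx_t) phi p - lie (Zleft idx_t) phi p)|.
      by apply: cvg_norm; apply: cvgMl_tmp; apply: cvgB => //; exact: cvg_cst.
    rewrite subrr mulr0 normr0 => c'.
    apply: cvg_EFin; first exact: nearW.
    exact: c'.
  have dp : derivable phi p (basis_rV idx_t).
    by apply: diff_derivable; exact: smooth_differentiable.
  have h0 : (k.+1%:R : R) ^- 2 @[k --> \oo] --> (0 : R)^'.
    have hc : (k.+1%:R : R) ^- 2 @[k --> \oo] --> (0 : R).
      rewrite -(mulr0 (0 : R)); under eq_cvg do rewrite -exprVn expr2.
      by apply: cvgM; exact: cvg_harmonic.
    move=> A nA; have : \forall k \near \oo, ((k.+1%:R : R) ^- 2 != 0 -> A ((k.+1%:R : R) ^- 2)).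
      exact: (hc _ nA).
    apply: filterS => k; apply.
    by rewrite invr_eq0 expf_neq0// pnatr_eq0.
  have E k : Dq k p = ((fun h : R => h^-1 *: ((phi \o shift p) (h *: basis_rV idx_t) - phi p))
      \o (fun k => k.+1%:R ^- 2)) k.
    rewrite /Dq /m heis_mul_exp /Zleft field_frame_t /= invrK [p + _]addrC.
    by rewrite /GRing.scale.
  under eq_cvg do rewrite E; rewrite /lie /Zleft field_frame_t.
  exact: (cvg_comp _ _ h0 dp).
- apply: aeW => p _ k; rewrite lee_fin normrM mulrC.
  have [pr|pr] := pselect (rV_box r4 p); last first.
    have [-> D0] := in4 _ pr; rewrite -/(Dq k p) D0.
    by rewrite subrr normr0 mul0r mulr_ge0// addr_ge0.
  by rewrite -/(Dq k p) boxed_in// ler_wpM2r// (le_trans (ler_normB _ _))// lerD.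
Qed.

(** f is expanded to second order along the commutator path, with phi as weight. The first-order
    terms cancel, and the end point is a vertical shift, which is transferred to phi and becomes a
    difference quotient for T phi. *)
Lemma weak_vertical phi : test_function phi ->
  \int[mu]_p (f p * lie (Zleft idx_t) phi p) =
  \int[mu]_p (bracket j1 DD p / 4 * phi p).
Proof.
move=> tphi; have bphi := bounded_supp_test tphi; have [mphi _] := bphi.
have bL : bounded_supp (lie (Zleft idx_t) phi) by exact: bounded_supp_lie.
have [mf _] := bf.
have phis := bounded_supp_Ls mu_gt0 s_ge1 bphi.
have iphi := bounded_supp_integrable bphi.
have [K K0 hK] := common_bound phis.
pose e (k : nat) : R := k.+1%:R^-1.
have e0 k : 0 < e k by rewrite invr_gt0.
pose V := vertical_word j1 (1 / 4 : R).
have c1 := word2_cvg mrho s_ge1 mphi phis fD fDD DDs' hK K0 iphi V mf e0 (@cvg_harmonic R) (@cvg_cst H 0 nat \oo _).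
have c2 := vertical_quotient_cvg tphi.
have bB : box_integrable (fun p => bracket j1 DD p / 4).
  have := box_integrableZ 4^-1 box_integrable_bracket.
  by under eq_fun do rewrite mulrC.
have i1 := box_integrableM0 bf bL; have i2 := box_integrableM0 bB bphi.
set A := Rintegral _ _ _; set B := Rintegral _ _ _.
(* The two errors are the scaled Taylor remainder of f and the defect of the difference quotient of
   phi. *)
suff key k : ((`|A - B|)%:E <= ((e k ^+ 2)^-1)%:E * Nu phi 0 (T2 (e k) V f D DD) +
   \int[mu]_p (`|f p * (lie (Zleft idx_t) phi p -
     (k.+1%:R ^+ 2) * (phi (heis_mul p ((k.+1%:R ^- 2) *: basis_rV idx_t)) - phi p))|)%:E)%E.
  apply/eqP; rewrite -subr_eq0 -normr_eq0 eq_le normr_ge0 andbT.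
  apply/ler_addgt0Pr => d d0; rewrite add0r -lee_fin.
  have [k _ hk] := cvge0_near (cvge0D (c1 _) c2) d0.
  exact: le_trans (key k) (hk k (leqnn k)).
pose h : R := k.+1%:R ^- 2; have h0 : h != 0 by rewrite invr_eq0 expf_neq0// pnatr_eq0.
have eh : e k ^+ 2 = h by rewrite /e exprVn.
pose X p := f p * (lie (Zleft idx_t) phi p - h^-1 * (phi (heis_mul p (h *: basis_rV idx_t)) - phi p)).
pose Y p := h^-1 * (phi p * T2 (e k) V f D DD p).
have T2E p : T2 (e k) V f D DD p =
   f (heis_mul p ((- h) *: basis_rV idx_t)) - f p - h * (bracket j1 DD p / 4).
  rewrite /T2 wpt_quarter_word e1_vertical_word e2_vertical_word eh; by field.
have i3 : mu.-integrable setT (EFin \o (fun p => f p * phi p)) by exact: box_integrableM0.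
have i4 : mu.-integrable setT (EFin \o (fun p => f (heis_mul p ((- h) *: basis_rV idx_t)) * phi p)).
  exact: box_integrableM.
have [] := Rintegral_flow_transpose i4; rewrite opprK => i5 e5.
have iX : mu.-integrable setT (EFin \o X).
  have := integrableB measurableT i1 (integrableZl measurableT h^-1 (integrableB measurableT i5 i3)).
  by apply: eq_integrable => // p _; rewrite /X /=; congr EFin; ring.
have iY : mu.-integrable setT (EFin \o Y).
  have := integrableB measurableT (integrableZl measurableT h^-1 (integrableB measurableT i4 i3)) i2.
  by apply: eq_integrable => // p _; rewrite /Y /= T2E; congr EFin; field.
have AB : A - B = \int[mu]_p X p + \int[mu]_p Y p.
  have i6 : mu.-integrable setT (EFin \o (fun p => f p * phi (heis_mul p (h *: basis_rV idx_t)) - f p * phi p)).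
    exact: (integrableB measurableT i5 i3).
  have i7 : mu.-integrable setT (EFin \o (fun p => f (heis_mul p ((- h) *: basis_rV idx_t)) * phi p - f p * phi p)).
    exact: (integrableB measurableT i4 i3).
  have i6' : mu.-integrable setT (EFin \o (fun p => h^-1 * (f p * phi (heis_mul p (h *: basis_rV idx_t)) - f p * phi p))).
    by apply: eq_integrable (integrableZl measurableT h^-1 i6).
  have i7' : mu.-integrable setT (EFin \o (fun p => h^-1 * (f (heis_mul p ((- h) *: basis_rV idx_t)) * phi p - f p * phi p))).
    by apply: eq_integrable (integrableZl measurableT h^-1 i7).
  have -> : \int[mu]_p X p = A - h^-1 * (\int[mu]_p (f p * phi (heis_mul p (h *: basis_rV idx_t))) - \int[mu]_p (f p * phi p)).
    rewrite -RintegralB// -RintegralZl// -RintegralB//.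
    by apply: eq_Rintegral => p _; rewrite /X; ring.
  have -> : \int[mu]_p Y p = h^-1 * (\int[mu]_p (f (heis_mul p ((- h) *: basis_rV idx_t)) * phi p) - \int[mu]_p (f p * phi p)) - B.
    rewrite -RintegralB// -RintegralZl// -RintegralB//.
    by apply: eq_Rintegral => p _; rewrite /Y T2E; field.
  by rewrite e5; ring.
rewrite AB (le_trans (_ : _ <= (`|\int[mu]_p Y p|)%:E + (`|\int[mu]_p X p|)%:E)%E)//.
  by rewrite -EFinD lee_fin addrC ler_normD.
apply: leeD; rewrite EFin_normr_Rintegral//.
  apply: (le_trans (le_abse_integral _ measurableT (measurable_int _ iY))).
  have -> : ((e k ^+ 2)^-1)%:E = (`|h^-1|)%:E by rewrite eh ger0_norm// invr_ge0 -eh exprn_ge0// ltW.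
  rewrite -NuZ//; last first.
    apply: measurable_T2 => [|j|i j]; first exact: mf.
      by have [_ []] := fD j.
    by have [_ []] := fDD i j.
  apply: le_integral_nonmeas => p _; first exact: abse_ge0.
  by rewrite /= heis_mul0 lee_fin -normrM /Y mulrCA.
apply: (le_trans (le_abse_integral _ measurableT (measurable_int _ iX))).
apply: le_integral_nonmeas => p _; first exact: abse_ge0.
by rewrite lee_fin /X /h invrK.
Qed.

(** The horizontal components contribute sum_h sign_h Z_h Z_{dual h} f, and the component - 4 f
    contributes the bracket through [weak_vertical]. *)
Lemma divergence_formula (b : 'I_(n + n + 1) -> H -> R) g :
  (forall h p, b (idx_h h) p = sign_h h * D (dual_h h) p) ->
  (forall p, b idx_t p = - 4 * f p) -> weak_divergence b g ->
  {ae mu, forall p, g p = \sum_h sign_h h * DD h (dual_h h) p + bracket j1 DD p}.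
Proof.
move=> bh bt [_ lg wd]; have bg := locally_box_integrable lg.
pose S p := \sum_h sign_h h * DD h (dual_h h) p.
have bS : box_integrable S.
  by apply: box_integrable_sum => h; exact/box_integrableZ.
have bD j : box_integrable (D j).
  by have [lf _ _] := fDD j j; exact: locally_box_integrable.
have bB := box_integrable_bracket.
suff h0 : {ae mu, forall p, g p - (S p - (- 1) * bracket j1 DD p) = 0}.
  by apply: filterS h0 => p /eqP; rewrite subr_eq0 mulN1r opprK => /eqP.
apply: (fundamental_lemma mrho).
  by apply: box_integrableB => //; apply: box_integrableB => //; exact: box_integrableZ.
move=> phi tphi; have bphi := bounded_supp_test tphi.
have bL k : bounded_supp (lie (Zleft k) phi) by exact: bounded_supp_lie.
have i1 := box_integrableM0 bg bphi; have i2 := box_integrableM0 bS bphi.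
have i3 := box_integrableM0 bB bphi.
have i4 : mu.-integrable setT (EFin \o (fun p => - 1 * (bracket j1 DD p * phi p))).
  exact: integrableZ_EFin.
have i5 : mu.-integrable setT (EFin \o (fun p => S p * phi p - - 1 * (bracket j1 DD p * phi p))).
  exact: (integrableB measurableT i2 i4).
transitivity (\int[mu]_p (g p * phi p - (S p * phi p - - 1 * (bracket j1 DD p * phi p)))).
  by apply: eq_Rintegral => p _; ring.
rewrite RintegralB// RintegralB// RintegralZl//.
rewrite -[X in X - _]opprK -wd//.
have iD h : mu.-integrable setT (EFin \o (fun p => sign_h h * (D (dual_h h) p * lie (Zleft (idx_h h)) phi p))).
  by apply: integrableZ_EFin; exact: box_integrableM0.
have it : mu.-integrable setT (EFin \o (fun p => - 4 * (f p * lie (Zleft idx_t) phi p))).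
  by apply: integrableZ_EFin; exact: box_integrableM0.
have -> : \int[mu]_p \sum_k b k p * lie (Zleft k) phi p =
    (\sum_h sign_h h * - \int[mu]_p (DD h (dual_h h) p * phi p)) -
    \int[mu]_p (bracket j1 DD p * phi p).
  transitivity (\int[mu]_p ((\sum_h sign_h h * (D (dual_h h) p * lie (Zleft (idx_h h)) phi p)) +
      - 4 * (f p * lie (Zleft idx_t) phi p))).
    apply: eq_Rintegral => p _; rewrite big_split_ord big_ord1 -/idx_t bt; congr (_ + _).
      by apply: eq_bigr => h _; rewrite -/(idx_h h) bh mulrA.
    by rewrite mulrA.
  have [isum es] := Rintegral_sum (index_enum _) iD.
  rewrite RintegralD// es RintegralZl//; last exact: (box_integrableM0 bf (bL _)).
  congr (_ + _).
    apply: eq_bigr => h _; rewrite RintegralZl//; last exact: (box_integrableM0 (bD _) (bL _)).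
    by have [_ _ ->] := fDD h (dual_h h).
  rewrite weak_vertical// -mulN1r -RintegralZl//; last first.
    apply: eq_integrable (integrableZl measurableT 4^-1 i3) => // p _ /=.
    by congr EFin; ring.
  by rewrite -[RHS]mulN1r -RintegralZl//; apply: eq_Rintegral => p _; field.
have iS h : mu.-integrable setT (EFin \o (fun p => sign_h h * (DD h (dual_h h) p * phi p))).
  by apply: integrableZ_EFin; exact: box_integrableM0.
have -> : \int[mu]_p (S p * phi p) = \sum_h sign_h h * \int[mu]_p (DD h (dual_h h) p * phi p).
  transitivity (\int[mu]_p (\sum_h sign_h h * (DD h (dual_h h) p * phi p))).
    apply: eq_Rintegral => p _; rewrite mulr_suml; apply: eq_bigr => h _; rewrite mulrA//.
  have [_ ->] := Rintegral_sum (index_enum _) iS.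
  by apply: eq_bigr => h _; rewrite RintegralZl//; exact: (box_integrableM0 (bDD _ _) bphi).
rewrite (eq_bigr (fun h => - (sign_h h * \int[mu]_p (DD h (dual_h h) p * phi p)))); last first.
  by move=> h _; rewrite mulrN.
by rewrite sumrN; ring.
Qed.

End divergence.

(** * The commutator kernel *)

Section mollify_calculus.
Context {R : realType} {n : nat}.
Local Notation H := (heis R n).
Local Notation mu := (@mu_heis R n).
Implicit Types (p q w : H) (e sg : R) (h : 'I_(n + n)) (rho : H -> R).

Lemma idx_ht_x (j : 'I_n) : (@idx_t n == idx_x j) = false.
Proof. by rewrite /idx_t /idx_x eq_rlshift. Qed.

Lemma idx_ht_y (j : 'I_n) : (@idx_t n == idx_y j) = false.
Proof. by rewrite /idx_t /idx_y eq_rlshift. Qed.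

Lemma idx_hP (P : 'I_(n + n) -> Prop) :
  (forall j, P (lshift n j)) -> (forall j, P (rshift n j)) -> forall h, P h.
Proof.
move=> Px Py h; case: (splitP h) => j hj.
  by rewrite (_ : h = lshift n j)//; exact: val_inj.
by rewrite (_ : h = rshift n j)//; exact: val_inj.
Qed.

(** Horizontal fields are homogeneous of degree 1 and T of degree 2, whence the factors e^-1 and
    e^-2 of the kernel. *)
Lemma heis_dil_frame_h sg e h w : e != 0 ->
  heis_dil e^-1 (field_frame sg (idx_h h) (heis_dil e w)) = e^-1 *: field_frame sg (idx_h h) w.
Proof.
move=> e0; move: h; apply: idx_hP => j.
  have -> : idx_h (lshift n j) = idx_x j by [].
  rewrite !field_frame_x !ypartE; apply: rV_ext; apply: idx_ht => [i|].
    by rewrite heis_dil_h !rVDE !rVZE basis_rV_h rVDE rVZE basis_rV_h !mulr0 !addr0.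
  rewrite heis_dil_t !(rVDE, rVZE) basis_rV_t basis_rVE idx_ht_x mulr0n (heis_dil_h e w (rshift n j) : _ = e * w ord0 (idx_y j)).
  by field.
have -> : idx_h (rshift n j) = idx_y j by [].
rewrite !field_frame_y !xpartE; apply: rV_ext; apply: idx_ht => [i|].
  by rewrite heis_dil_h !(rVDE, rVNE, rVZE) basis_rV_h !mulr0 !subr0.
rewrite heis_dil_t !(rVDE, rVNE, rVZE) basis_rV_t basis_rVE idx_ht_y mulr0n (heis_dil_h e w (lshift n j) : _ = e * w ord0 (idx_x j)).
by field.
Qed.

Lemma heis_dil_frame_t sg e w : 
  heis_dil e^-1 (field_frame sg idx_t (heis_dil e w)) = (e ^+ 2)^-1 *: field_frame sg idx_t w.
Proof.
rewrite !field_frame_t; apply: rV_ext; apply: idx_ht => [i|].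
  by rewrite heis_dil_h rVZE basis_rV_h !mulr0.
by rewrite heis_dil_t rVZE basis_rV_t exprVn.
Qed.

Lemma derive_mollify rho e v q : smooth rho ->
  'D_v (mollify rho e) q = (e ^+ (2 * n + 2))^-1 * 'D_(heis_dil e^-1 v) rho (heis_dil e^-1 q).
Proof.
move=> srho; have -> : mollify rho e = (e ^+ (2 * n + 2))^-1 *: (rho \o heis_dil e^-1) by [].
have sc := smooth_affine (affine_heis_dil e^-1) srho.
rewrite deriveZ; last by apply: diff_derivable; exact: smooth_differentiable.
by rewrite (derive_affine _ _ _ (affine_heis_dil e^-1)).
Qed.

Lemma lie_mollify_h sg rho e h w : e != 0 -> smooth rho ->
  lie (field_frame sg (idx_h h)) (mollify rho e) (heis_dil e w) =
  (e ^+ (2 * n + 2))^-1 * (e^-1 * lie (field_frame sg (idx_h h)) rho w).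
Proof.
move=> e0 srho; rewrite /lie derive_mollify// heis_dil_frame_h// heis_dilK//.
by rewrite derive_dirZ//; exact: smooth_differentiable.
Qed.

Lemma lie_mollify_t sg rho e w : e != 0 -> smooth rho ->
  lie (field_frame sg idx_t) (mollify rho e) (heis_dil e w) =
  (e ^+ (2 * n + 2))^-1 * ((e ^+ 2)^-1 * lie (field_frame sg idx_t) rho w).
Proof.
move=> e0 srho; rewrite /lie derive_mollify// heis_dil_frame_t heis_dilK//.
by rewrite derive_dirZ//; exact: smooth_differentiable.
Qed.

(** The T-component of the difference of the frames later completes the vertical quotient to a
    second-order Taylor remainder. *)
Lemma lie_left_right rho h w : smooth rho ->
  lie (Zleft (idx_h h)) rho w = lie (Zright (idx_h h)) rho w +
    4 * (sign_h h * w ord0 (idx_h (dual_h h))) * lie (Zright idx_t) rho w.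
Proof.
move=> srho; have dr := smooth_differentiable w srho.
rewrite /lie -derive_dirD//; congr ('D_ _ rho w).
move: h; apply: idx_hP => j; rewrite /Zleft /Zright /sign_h /dual_h field_frame_t.
  rewrite split_lshift_n; have -> : idx_h (lshift n j) = idx_x j by [].
  have -> : idx_h (rshift n j) = idx_y j by [].
  by rewrite !field_frame_x !ypartE -addrA -scalerDl; congr (_ + _ *: _); ring.
rewrite split_rshift_n; have -> : idx_h (rshift n j) = idx_y j by [].
have -> : idx_h (lshift n j) = idx_x j by [].
by rewrite !field_frame_y !xpartE -!(scaleNr _ (basis_rV idx_t)) -addrA -scalerDl; congr (_ + _ *: _); ring.
Qed.

Lemma lie_left_right_t rho w : lie (Zleft idx_t) rho w = lie (Zright idx_t) rho w.
Proof. by rewrite /lie /Zleft /Zright !field_frame_t. Qed.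

Lemma Rintegral_rescale (F : H -> R) e : 0 < e ->
  mu.-integrable setT (EFin \o (fun w => e ^+ (2 * n + 2) * F (heis_dil e w))) ->
  \int[mu]_q F q = \int[mu]_w (e ^+ (2 * n + 2) * F (heis_dil e w)).
Proof.
move=> e0 iF; have ei0 : 0 < e^-1 by rewrite invr_gt0.
have c0 : 0 <= (e^-1 ^+ (2 * n + 2))^-1 by rewrite invr_ge0 exprn_ge0// ltW.
have mA : measurable_fun setT (fun q : H => heis_dil e^-1 q).
  by apply: measurable_heis_dil; [exact: measurable_cst|exact: measurable_id].
have [_] := Rintegral_change c0 (fun (g : H -> \bar R) => @integral_heis_dil R n e^-1 g ei0) mA iF.
have E q : heis_dil e (heis_dil e^-1 q) = q.
  by rewrite -{1}[e]invrK heis_dilK// gt_eqF.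
under eq_Rintegral do rewrite E.
rewrite exprVn invrK => h.
have i1 : mu.-integrable setT (EFin \o F).
  have [] := Rintegral_change c0 (fun (g : H -> \bar R) => @integral_heis_dil R n e^-1 g ei0) mA iF.
  rewrite /comp; under eq_fun do rewrite E.
  move=> /(integrableZ_EFin (e ^+ (2 * n + 2))^-1) + _; apply: eq_integrable => // q _ /=.
  by rewrite mulKf// expf_neq0// gt_eqF.
move: h; rewrite RintegralZl// => /mulfI; apply.
by rewrite expf_neq0// gt_eqF.
Qed.

End mollify_calculus.

Section inverse_word_measurable.
Context {R : realType} {n : nat}.
Local Notation H := (heis R n).
Implicit Types (DD : 'I_(n + n) -> 'I_(n + n) -> H -> R) (J : seq 'I_(n + n)).
Variable j1 : 'I_n.

Lemma measurable_heis_coord d (T : measurableType d) (A : T -> H) i : measurable_fun setT A ->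
  measurable_fun setT (fun x => A x ord0 i).
Proof. by move=> mA; exact: measurableT_comp (measurable_coord_rV i) mA. Qed.

Lemma measurable_wpt_map J :
  measurable_fun setT (fun w : H => wpt 1 [seq (h, - w ord0 (idx_h h)) | h <- J]).
Proof.
elim: J => [|h J IH] /=; first exact: measurable_cst.
apply: measurable_heis_mul => //; apply: measurable_rVZ; last exact: measurable_cst.
apply: measurable_funM => //; apply: measurableT_comp => //.
exact: measurable_coord_rV.
Qed.

Lemma measurable_vertical_gap : measurable_fun setT (@vertical_gap R n).
Proof.
apply: measurable_funM => //; apply: measurable_funD; last exact: measurable_coord_rV.
exact: measurable_heis_coord (measurable_wpt_map _).
Qed.

Section e2_param.
Context d (T : measurableType d) (DD : T -> 'I_(n + n) -> 'I_(n + n) -> H -> R) (P W : T -> H).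
Hypotheses (mDD : forall i j, measurable_fun setT (fun x => DD x i j (P x))) (mW : measurable_fun setT W).

Lemma measurable_e2_map J :
  measurable_fun setT (fun x => e2 [seq (h, - W x ord0 (idx_h h)) | h <- J] (DD x) (P x)).
Proof.
have mw h : measurable_fun setT (fun x => - W x ord0 (idx_h h)).
  by apply: measurableT_comp => //; exact: measurable_heis_coord.
elim: J => [|h J IH] /=; first exact: measurable_cst.
apply: measurable_funD; last first.
  by apply: measurable_funM => //; apply: measurable_funM => //; exact: measurable_funX.
apply: measurable_funD => //; apply: measurable_funM => //.
rewrite (_ : (fun x => e1 _ _ _) =
    (fun x => \sum_(i <- J) - W x ord0 (idx_h i) * DD x i h (P x))); last first.
  by apply/funext => x; rewrite /e1 big_map.
by apply: measurable_sum => i; exact: measurable_funM.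
Qed.

Lemma measurable_e2_inverse_word :
  measurable_fun setT (fun x => e2 (inverse_word j1 (W x)) (DD x) (P x)).
Proof.
under eq_fun do rewrite e2_vertical_cat.
apply: measurable_funD; last exact: measurable_e2_map.
apply: measurable_funM; first exact: measurableT_comp measurable_vertical_gap mW.
exact: measurable_funB.
Qed.

End e2_param.

End inverse_word_measurable.

Section commutator_kernel.
Context {R : realType} {n : nat}.
Local Notation H := (heis R n).
Local Notation mu := (@mu_heis R n).
Variables (rho : H -> R) (mrho : mollifier rho) (s : \bar R) (s_ge1 : (1 <= s)%E).
Local Notation s' := (hoelder_conjugate s).
Variables (u : H -> R) (mu_u : measurable_fun setT u) (us : (Ls_norm s u < +oo)%E).
Variables (f : H -> R) (D : 'I_(n + n) -> H -> R) (DD : 'I_(n + n) -> 'I_(n + n) -> H -> R).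
Hypotheses (fD : forall j, weak_derivative (idx_h j) f (D j))
  (fDD : forall i j, weak_derivative (idx_h i) (D j) (DD i j))
  (DDs' : forall i j, (Ls_norm s' (DD i j) < +oo)%E).
Variables (j1 : 'I_n) (g : H -> R) (mg : measurable_fun setT g).

(** The pointwise expression of the divergence found in [divergence_formula]. *)
Definition div_rep p : R := \sum_h sign_h h * DD h (dual_h h) p + bracket j1 DD p.

Local Notation Rh h := (lie (Zright (idx_h h)) rho).
Local Notation Tr := (lie (Zright idx_t) rho).

Definition ker_pt (e : R) (w : H) : H := heis_inv (heis_dil e w).

(* The integrand of the commutator after the substitution [q = dil e w], and its
   limit as e goes to 0 *)
Definition ker (e : R) (p w : H) : R :=
  - (u (heis_mul p (ker_pt e w)) * (g (heis_mul p (ker_pt e w)) * rho w +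
     (\sum_h sign_h h * (e^-1 * (D (dual_h h) p - D (dual_h h) (heis_mul p (ker_pt e w)))) * Rh h w) +
     4 * ((e ^+ 2)^-1 * (f (heis_mul p (ker_pt e w)) - f p +
            e * \sum_h w ord0 (idx_h h) * D h p)) * Tr w)).

Definition ker0 (p w : H) : R :=
  - (u p * (div_rep p * rho w +
     (\sum_h sign_h h * (\sum_i w ord0 (idx_h i) * DD i (dual_h h) p) * Rh h w) +
     4 * e2 (inverse_word j1 w) DD p * Tr w)).

Local Notation W w := (inverse_word j1 w).

(** The quotient splits into a scaled Taylor remainder along the word ending at (dil_e w)^-1 and a
    limit free of e; [ker_f] does the same to second order. *)
Lemma ker_D (e : R) p w h : e != 0 ->
  e^-1 * (D h p - D h (heis_mul p (ker_pt e w))) =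
  - (e^-1 * T1 e (W w) (D h) (DD ^~ h) p) - e1 (W w) (DD ^~ h) p.
Proof. by move=> e0; rewrite /T1 wpt_inverse_word -/(ker_pt e w); field. Qed.

Lemma ker_f (e : R) p w : e != 0 ->
  (e ^+ 2)^-1 * (f (heis_mul p (ker_pt e w)) - f p + e * \sum_h w ord0 (idx_h h) * D h p) =
  (e ^+ 2)^-1 * T2 e (W w) f D DD p + e2 (W w) DD p.
Proof.
move=> e0; rewrite /T2 wpt_inverse_word -/(ker_pt e w) e1_inverse_word.
by set X := \sum_h _; field.
Qed.

Lemma ker_h p (w : H) h : \sum_i w ord0 (idx_h i) * DD i h p = - e1 (W w) (DD ^~ h) p.
Proof. by rewrite e1_inverse_word opprK. Qed.

Definition DDsum p : R := \sum_i \sum_j `|DD i j p|.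

Lemma DDsum_ge0 p : 0 <= DDsum p.
Proof. by apply: sumr_ge0 => i _; exact: sumr_ge0. Qed.

Lemma DD_le i j p : `|DD i j p| <= DDsum p.
Proof.
rewrite /DDsum (bigD1 i)//= (bigD1 j)//= -addrA lerDl addr_ge0// ?sumr_ge0//.
by move=> *; rewrite sumr_ge0.
Qed.

Lemma DD_le1 j p : \sum_i `|DD i j p| <= DDsum p.
Proof. by apply: ler_sum => i _; rewrite (bigD1 j)//= lerDl sumr_ge0. Qed.

(** One [DDsum] bounds the sum over h, and two bound the bracket. *)
Lemma div_rep_le p : `|div_rep p| <= 3 * DDsum p.
Proof.
rewrite /div_rep (le_trans (ler_normD _ _))//.
rewrite (_ : 3 * DDsum p = DDsum p + (DDsum p + DDsum p)); last by ring.
apply: lerD.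
  rewrite (le_trans (ler_norm_sum _ _ _))//; apply: ler_sum => h _.
  by rewrite normrM sign_h_norm mul1r (bigD1 (dual_h h))//= lerDl sumr_ge0.
by rewrite (le_trans (ler_normB _ _))// lerD// DD_le.
Qed.

Definition ker_coef w : R := 3 * rho w + wlen (W w) * (\sum_h `|Rh h w|) +
  4 * wlen (W w) ^+ 2 * `|Tr w|.

Definition ker_err (e : R) w p : R :=
  rho w * `|div_rep (heis_mul p (ker_pt e w)) - div_rep p| +
  ((\sum_h (`|Rh h w| * e^-1) * `|T1 e (W w) (D (dual_h h)) (DD ^~ (dual_h h)) p|) +
   (4 * `|Tr w| * (e ^+ 2)^-1) * `|T2 e (W w) f D DD p|).

(** With a = p (dil_e w)^-1, u(a) X_e - u(p) X_0 = u(a) (X_e - X_0) + (u(a) - u(p)) X_0. The first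
    term collects remainders weighted by the translate of u, the second pairs a difference of u with
    second derivatives. *)
Lemma ker_bound (e : R) p w : 0 < e ->
  g (heis_mul p (ker_pt e w)) = div_rep (heis_mul p (ker_pt e w)) ->
  `|ker e p w - ker0 p w| <= `|u (heis_mul p (ker_pt e w))| * ker_err e w p +
    ker_coef w * (`|u (heis_mul p (ker_pt e w)) - u p| * DDsum p).
Proof.
move=> e0 gp; have en0 : e != 0 by rewrite gt_eqF.
have rho0 := mollifier_ge0 mrho w.
rewrite /ker /ker0 gp ker_f//.
under eq_bigr do rewrite ker_D//.
under [X in _ - - (u p * (_ + X + _))]eq_bigr do rewrite ker_h.
set a := heis_mul p _; set G1 := div_rep a; set G := div_rep p.
pose t h := e^-1 * T1 e (W w) (D (dual_h h)) (DD ^~ (dual_h h)) p.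
pose x h := e1 (W w) (DD ^~ (dual_h h)) p.
set y := e2 (W w) DD p.
rewrite [X in `|X|](_ : _ = - (u a * ((G1 - G) * rho w + ((\sum_h sign_h h * - t h * Rh h w) +
     4 * ((e ^+ 2)^-1 * T2 e (W w) f D DD p) * Tr w)) +
   (u a - u p) * (G * rho w + (\sum_h sign_h h * - x h * Rh h w) + 4 * y * Tr w))); last first.
  have -> : \sum_h sign_h h * (- t h - x h) * Rh h w =
      (\sum_h sign_h h * - t h * Rh h w) + \sum_h sign_h h * - x h * Rh h w.
    by rewrite -big_split; apply: eq_bigr => h _ /=; rewrite mulrDr mulrDl.
  by ring.
rewrite normrN (le_trans (ler_normD _ _))// lerD// normrM.
  rewrite ler_wpM2l// /ker_err (le_trans (ler_normD _ _))// lerD//.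
    by rewrite normrM (ger0_norm rho0) mulrC.
  rewrite (le_trans (ler_normD _ _))// lerD//.
    rewrite (le_trans (ler_norm_sum _ _ _))//; apply: ler_sum => h _.
    rewrite !normrM normrN sign_h_norm mul1r normrM gtr0_norm ?invr_gt0//.
    by rewrite le_eqVlt; apply/orP; left; apply/eqP; ring.
  have e2i : 0 <= (e ^+ 2)^-1 by rewrite invr_ge0 exprn_ge0 ?ltW.
  rewrite !normrM (ger0_norm e2i) (ger0_norm (ler0n R 4)).
  by rewrite le_eqVlt; apply/orP; left; apply/eqP; ring.
rewrite mulrCA ler_wpM2l// /ker_coef (mulrDl _ _ (DDsum p)) (mulrDl _ _ (DDsum p)) (le_trans (ler_normD _ _))// lerD//.
  rewrite (le_trans (ler_normD _ _))// lerD//.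
    by rewrite normrM (ger0_norm rho0) mulrAC ler_wpM2r// div_rep_le.
  rewrite (le_trans (ler_norm_sum _ _ _))// mulrAC mulr_sumr; apply: ler_sum => h _.
  rewrite !normrM normrN sign_h_norm mul1r ler_wpM2r//.
  rewrite (le_trans (e1_le _ _ _))// ler_wpM2l ?wlen_ge0//; exact: DD_le1.
rewrite !normrM (ger0_norm (ler0n R 4)) [leRHS]mulrAC ler_wpM2r// -[leRHS]mulrA ler_wpM2l//.
exact: e2_le.
Qed.

End commutator_kernel.

Lemma cvge0_sum (R : realType) (I : Type) (J : seq I) (F : I -> nat -> \bar R) :
  (forall i, (F i k @[k --> \oo] --> 0)%E) -> (\sum_(i <- J) F i k @[k --> \oo] --> 0)%E.
Proof.
move=> F0; elim: J => [|i J IH].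
  under eq_cvg do rewrite big_nil.
  exact: (@cvg_cst (\bar R) 0%E nat \oo).
under eq_cvg do rewrite big_cons.
exact: cvge0D.
Qed.

(** * Bounds and convergence of the kernel for fixed w *)

Section kernel_estimates.
Context {R : realType} {n : nat}.
Local Notation H := (heis R n).
Local Notation mu := (@mu_heis R n).
Variables (rho : H -> R) (mrho : mollifier rho) (s : \bar R) (s_ge1 : (1 <= s)%E).
Local Notation s' := (hoelder_conjugate s).
Variables (u : H -> R) (mu_u : measurable_fun setT u) (us : (Ls_norm s u < +oo)%E).
Variables (f : H -> R) (D : 'I_(n + n) -> H -> R) (DD : 'I_(n + n) -> 'I_(n + n) -> H -> R).
Hypotheses (fD : forall j, weak_derivative (idx_h j) f (D j))
  (fDD : forall i j, weak_derivative (idx_h i) (D j) (DD i j))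
  (DDs' : forall i j, (Ls_norm s' (DD i j) < +oo)%E).
Variables (j1 : 'I_n) (g : H -> R) (mg : measurable_fun setT g).
Local Notation G := (div_rep DD j1).
Hypothesis gG : {ae mu, forall p, g p = G p}.
Variables (K : R) (K0 : 0 <= K).
Hypothesis uK : (Ls_norm s u * \sum_i \sum_j Ls_norm s' (DD i j) <= K%:E)%E.

Let mu_gt0 := mollifier_mu_gt0 mrho.
Let mf : measurable_fun setT f.
Proof. by have [[]] := fD (lshift n j1). Qed.
Let mD j : measurable_fun setT (D j). Proof. by have [_ []] := fD j. Qed.
Let mDD i j : measurable_fun setT (DD i j). Proof. by have [_ []] := fDD i j. Qed.
Local Notation Rh h := (lie (Zright (idx_h h)) rho).
Local Notation Tr := (lie (Zright idx_t) rho).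
Local Notation W w := (inverse_word j1 w).
Local Notation S := (DDsum DD).

Lemma measurable_DDsum : measurable_fun setT S.
Proof.
by apply: measurable_sum => i; apply: measurable_sum => j; exact: measurableT_comp.
Qed.

Lemma measurable_div_rep : measurable_fun setT G.
Proof.
apply: measurable_funD; last exact: measurable_funB.
by apply: measurable_sum => h; exact: measurable_funM.
Qed.

Lemma Lnorm_sum_le (I : Type) (J : seq I) (F : I -> H -> R) (t : \bar R) : (1 <= t)%E ->
  (forall i, measurable_fun setT (F i)) ->
  (Ls_norm t (fun p => \sum_(i <- J) F i p)%R <= \sum_(i <- J) Ls_norm t (F i))%E.
Proof.
move=> t1 mF; elim: J => [|i J IH].
  rewrite big_nil (_ : (fun p => _) = cst 0); last by apply/funext => p; rewrite big_nil.
  rewrite /Ls_norm (_ : EFin \o cst 0 = cst 0%E)// Lnorm0 //.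
  by rewrite gt_eqF// (lt_le_trans _ t1).
rewrite big_cons (_ : (fun p => _) = (F i \+ (fun p => \sum_(i <- J) F i p))%R); last first.
  by apply/funext => p; rewrite big_cons.
apply: le_trans (leeD (lexx _) IH).
by apply: eminkowski => //; exact: measurable_sum.
Qed.

Let s'1 : (1 <= s')%E. Proof. exact: hoelder_conj_ge1. Qed.
Let s'0 : (0 < s')%E. Proof. exact: lt_le_trans s'1. Qed.

Lemma Ls_norm_DDsum : (Ls_norm s' S <= \sum_i \sum_j Ls_norm s' (DD i j))%E.
Proof.
have mA i j : measurable_fun setT (fun p => `|DD i j p|) by exact: measurableT_comp.
apply: (le_trans (Lnorm_sum_le _ s'1 _)).
  by move=> i; exact: measurable_sum.
apply: lee_sum => i _; apply: (le_trans (Lnorm_sum_le _ s'1 _)) => //.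
apply: lee_sum => j _; apply: Lnorm_le => //.
by apply: aeW => p; rewrite normr_id.
Qed.

Lemma DDsum_norm_fin : (Ls_norm s' S < +oo)%E.
Proof.
apply: (le_lt_trans Ls_norm_DDsum).
by apply: lte_sum_pinfty => i _; apply: lte_sum_pinfty => j _; exact: DDs'.
Qed.

Lemma uS_le : (Ls_norm s u * Ls_norm s' S <= K%:E)%E.
Proof.
apply: le_trans uK; apply: lee_wpmul2l; first exact: Lnorm_ge0.
exact: Ls_norm_DDsum.
Qed.

Lemma uDD_le i j : (Ls_norm s u * Ls_norm s' (DD i j) <= K%:E)%E.
Proof.
apply: le_trans uS_le; apply: lee_wpmul2l; first exact: Lnorm_ge0.
apply: Lnorm_le => //; last exact: measurable_DDsum.
by apply: aeW => p; rewrite [leRHS]ger0_norm ?DDsum_ge0// DD_le.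
Qed.

Lemma Ls_norm_div_rep : (Ls_norm s' G <= 3%:E * Ls_norm s' S)%E.
Proof.
have mS := measurable_DDsum.
apply: (@le_trans _ _ (Ls_norm s' (S \+ (S \+ S))%R)).
  apply: Lnorm_le => //.
  - apply: aeW => p; rewrite (le_trans (div_rep_le _ _ _))//.
    by rewrite [leRHS]ger0_norm ?addr_ge0 ?DDsum_ge0//= le_eqVlt; apply/orP; left; apply/eqP; ring.
  - exact: measurable_div_rep.
  - by apply: measurable_funD => //; exact: measurable_funD.
apply: (le_trans (eminkowski _ _ _ _)) => //; first exact: measurable_funD.
have fS : Ls_norm s' S \is a fin_num by rewrite ge0_fin_numE ?DDsum_norm_fin ?Lnorm_ge0.
have -> : (3%:E * Ls_norm s' S = Ls_norm s' S + (Ls_norm s' S + Ls_norm s' S))%E.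
  by rewrite -(fineK fS) -EFinM -!EFinD; congr EFin; ring.
apply: leeD; first exact: lexx.
exact: eminkowski.
Qed.

Lemma div_rep_norm_fin : (Ls_norm s' G < +oo)%E.
Proof. by apply: (le_lt_trans Ls_norm_div_rep); rewrite lte_mul_pinfty ?DDsum_norm_fin. Qed.

Lemma uG_le : (Ls_norm s u * Ls_norm s' G <= (3 * K)%:E)%E.
Proof.
apply: (@le_trans _ _ (3%:E * (Ls_norm s u * Ls_norm s' S))%E).
  by rewrite muleCA; apply: lee_wpmul2l; [exact: Lnorm_ge0|exact: Ls_norm_div_rep].
by rewrite EFinM; apply: lee_wpmul2l => //; exact: uS_le.
Qed.

Definition Vu (e : R) (w : H) : \bar R :=
  (\int[mu]_p (`|u (heis_mul p (ker_pt e w)) - u p| * `|S p|)%:E)%E.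

Definition ker_int (e : R) (w : H) : \bar R :=
  (\int[mu]_p (`|ker rho u f D g e p w - ker0 rho u DD j1 p w|)%:E)%E.

Lemma ker_coef_ge0 w : 0 <= ker_coef rho j1 w.
Proof.
rewrite /ker_coef !addr_ge0// !mulr_ge0 ?wlen_ge0 ?exprn_ge0 ?wlen_ge0//.
  exact: mollifier_ge0 mrho w.
by apply: sumr_ge0 => h _.
Qed.

Lemma measurable_ker_err e w : measurable_fun setT (ker_err rho f D DD j1 e w).
Proof.
have mG := measurable_div_rep.
apply: measurable_funD.
  apply: measurable_funM => //; apply: measurableT_comp => //; apply: measurable_funB => //.
  by apply: measurableT_comp mG _; exact: measurable_heis_mulr.
apply: measurable_funD.
  apply: measurable_sum => h; apply: measurable_funM => //.
  by apply: measurableT_comp => //; exact: measurable_T1.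
by apply: measurable_funM => //; apply: measurableT_comp => //; exact: measurable_T2.
Qed.

Lemma ker_int_le (e : R) w : 0 < e ->
  (ker_int e w <= Nu u (ker_pt e w) (ker_err rho f D DD j1 e w) +
                  (ker_coef rho j1 w)%:E * Vu e w)%E.
Proof.
move=> e0; have mS := measurable_DDsum.
have mua : measurable_fun setT (fun p => u (heis_mul p (ker_pt e w))).
  by apply: measurableT_comp mu_u _; exact: measurable_heis_mulr.
have m1 : measurable_fun setT (fun p => `|u (heis_mul p (ker_pt e w)) - u p| * `|S p|).
  by apply: measurable_funM; apply: measurableT_comp => //; exact: measurable_funB.
have m2 := measurable_Nu_integrand mu_u (ker_pt e w) (measurable_ker_err e w).
rewrite /Vu -integralZl_ge0 ?ker_coef_ge0//.
rewrite -ge0_integralD//; last 3 first.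
- exact/measurable_EFinP.
- by move=> p _; rewrite lee_fin mulr_ge0 ?ker_coef_ge0// mulr_ge0.
- by apply/measurable_EFinP; exact: measurable_funM.
apply: le_integral_ae_nonmeas => //.
- apply: emeasurable_funD; apply/measurable_EFinP => //; exact: measurable_funM.
- move=> p _; rewrite adde_ge0// lee_fin ?mulr_ge0// ?ker_coef_ge0// mulr_ge0//.
apply: filterS (ae_heis_mulr (ker_pt e w) gG) => p gp _.
rewrite -EFinD lee_fin (le_trans (ker_bound mrho _ _ _ e0 gp))//.
rewrite (ger0_norm (DDsum_ge0 _ _)) lerD2r ler_wpM2l// ler_norm//.
Qed.

Lemma Nu_sum_le a (J : seq 'I_(n + n)) (c : 'I_(n + n) -> R) (F : 'I_(n + n) -> H -> R) :
  (forall h, measurable_fun setT (F h)) -> (forall h, 0 <= c h) ->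
  (Nu u a (fun p => \sum_(h <- J) c h * F h p)%R <=
   \sum_(h <- J) (c h)%:E * Nu u a (F h))%E.
Proof.
move=> mF c0; elim: J => [|h J IH].
  rewrite big_nil /Nu; under eq_integral do rewrite big_nil normr0 mulr0.
  by rewrite integral0.
rewrite big_cons; apply: le_trans (leeD (lexx _) IH).
have -> : ((c h)%:E * Nu u a (F h) = Nu u a (fun p => c h * F h p)%R)%E.
  by rewrite NuZ// ger0_norm.
apply: NuD => //; first exact: measurable_funM.
  by apply: measurable_sum => i; exact: measurable_funM.
by move=> p; rewrite big_cons ler_normD.
Qed.

Lemma Nu_abs a F : Nu u a (fun p => `|F p|) = Nu u a F.
Proof. by apply: eq_integral => p _; rewrite normr_id. Qed.

Lemma Nu_ker_err (e : R) w a : 0 < e ->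
  (Nu u a (ker_err rho f D DD j1 e w) <=
   (rho w)%:E * Nu u a (fun p => G (heis_mul p (ker_pt e w)) - G p)%R +
   (\sum_h ((`|Rh h w|)%:E * ((e^-1)%:E * Nu u a (T1 e (W w) (D (dual_h h)) (DD ^~ (dual_h h))))) +
    (4 * `|Tr w|)%:E * (((e ^+ 2)^-1)%:E * Nu u a (T2 e (W w) f D DD))))%E.
Proof.
move=> e0; have mG := measurable_div_rep; have rho0 := mollifier_ge0 mrho w.
have ei0 : 0 <= e^-1 by rewrite invr_ge0 ltW.
have e2i0 : 0 <= (e ^+ 2)^-1 by rewrite invr_ge0 exprn_ge0 ?ltW.
have mGa : measurable_fun setT (fun p => G (heis_mul p (ker_pt e w)) - G p).
  apply: measurable_funB => //.
  by apply: measurableT_comp mG _; exact: measurable_heis_mulr.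
have mT1 h : measurable_fun setT (T1 e (W w) (D (dual_h h)) (DD ^~ (dual_h h))).
  exact: measurable_T1.
have mT2 : measurable_fun setT (T2 e (W w) f D DD) by exact: measurable_T2.
have mA (F : H -> R) : measurable_fun setT F -> measurable_fun setT (fun p => `|F p|).
  by move=> mF; exact: measurableT_comp.
have m1 : measurable_fun setT (fun p => \sum_h (`|Rh h w| * e^-1) *
    `|T1 e (W w) (D (dual_h h)) (DD ^~ (dual_h h)) p|).
  by apply: measurable_sum => h; apply: measurable_funM => //; exact: mA.
have m2 : measurable_fun setT (fun p => (4 * `|Tr w| * (e ^+ 2)^-1) * `|T2 e (W w) f D DD p|).
  by apply: measurable_funM => //; exact: mA.
have m0 : measurable_fun setT (fun p => rho w * `|G (heis_mul p (ker_pt e w)) - G p|).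
  by apply: measurable_funM => //; exact: mA.
apply: (le_trans (NuD mu_u a m0 (measurable_funD m1 m2) _)).
  by move=> p; rewrite /ker_err ler_normD.
apply: leeD.
  by rewrite (NuZ mu_u _ _ (mA _ mGa)) (ger0_norm rho0) Nu_abs.
apply: (le_trans (NuD mu_u a m1 m2 _)); first by move=> p; rewrite ler_normD.
apply: leeD.
  apply: (le_trans (Nu_sum_le _ _ _ _)) => [h|h|]; [exact: mA|exact: mulr_ge0|].
  by apply: lee_sum => h _; rewrite Nu_abs EFinM muleA.
by rewrite (NuZ mu_u _ _ (mA _ mT2)) ger0_norm ?mulr_ge0// Nu_abs EFinM muleA.
Qed.

Lemma ker_int_bound (e : R) w : 0 < e ->
  (ker_int e w <= (4 * K * ker_coef rho j1 w)%:E)%E.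
Proof.
move=> e0; have e0' := ltW e0; have rho0 := mollifier_ge0 mrho w.
apply: (le_trans (ker_int_le w e0)).
(* The three kinds of remainder add up to 2 K [ker_coef], the 3 of [div_rep_le] included, and the
   differences of u contribute another 2 K [ker_coef]. *)
rewrite (_ : 4 * K * ker_coef rho j1 w = (rho w * (2 * (3 * K)) +
   (\sum_h `|Rh h w| * (2 * K * wlen (W w)) + 4 * `|Tr w| * (2 * K * wlen (W w) ^+ 2))) +
   ker_coef rho j1 w * (2 * K)); last by rewrite -mulr_suml /ker_coef; ring.
rewrite [X in (_ <= X)%E]EFinD; apply: leeD; last first.
  rewrite [X in (_ <= X)%E]EFinM; apply: lee_wpmul2l; first by rewrite lee_fin ker_coef_ge0.
  have mS := measurable_DDsum.
  have mua : measurable_fun setT (fun p => u (heis_mul p (ker_pt e w))).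
    by apply: measurableT_comp mu_u _; exact: measurable_heis_mulr.
  apply: (@le_trans _ _ (\int[mu]_p (`|u (heis_mul p (ker_pt e w)) * S p|)%:E +
     \int[mu]_p (`|u (heis_mul p 0) * S p|)%:E)%E).
    apply: le_integralD => //.
    - by apply: measurableT_comp => //; exact: measurable_funM.
    - under eq_fun do rewrite heis_mul0.
      by apply: measurableT_comp => //; exact: measurable_funM.
    - by move=> p; rewrite heis_mul0 !normrM -mulrDl ler_wpM2r// ler_normB.
  rewrite mulr_natl mulr2n EFinD; apply: leeD; apply: le_trans uS_le;
    by apply: (holder_heis mu_gt0 s_ge1) => //; exact: DDsum_norm_fin.
apply: (le_trans (Nu_ker_err w _ e0)); rewrite [X in (_ <= X)%E]EFinD; apply: leeD.
  rewrite [X in (_ <= X)%E]EFinM; apply: lee_wpmul2l; first by rewrite lee_fin.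
  apply: (Nu_diff_le mrho s_ge1 mu_u us) => //; [exact: measurable_div_rep|
    exact: div_rep_norm_fin|exact: uG_le].
rewrite [X in (_ <= X)%E]EFinD; apply: leeD.
  rewrite -sumEFin; apply: lee_sum => h _; rewrite [X in (_ <= X)%E]EFinM; apply: lee_wpmul2l; first by rewrite lee_fin.
  apply: (le_trans (lee_wpmul2l _ (word1_bound mrho s_ge1 mu_u us
    (fun j => fDD j (dual_h h)) (fun j => DDs' j (dual_h h)) (fun j => uDD_le j (dual_h h)) (W w) _ _ e0'))) => //.
    by rewrite lee_fin invr_ge0.
  by rewrite -EFinM mulKf ?gt_eqF.
rewrite [X in (_ <= X)%E]EFinM; apply: lee_wpmul2l; first by rewrite lee_fin mulr_ge0.
apply: (le_trans (lee_wpmul2l _ (word2_bound mrho s_ge1 mu_u us fD fDD DDs' uDD_le K0 (W w) _ mf e0'))).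
  by rewrite lee_fin invr_ge0 exprn_ge0.
by rewrite -EFinM mulKf// expf_neq0// gt_eqF.
Qed.

Hypothesis ui : mu.-integrable setT (EFin \o u).

Lemma ker_int_cvg (e : nat -> R) w : (forall k, 0 < e k) -> e k @[k --> \oo] --> (0 : R) ->
  (ker_int (e k) w @[k --> \oo] --> 0)%E.
Proof.
move=> epos e0; have a0 : ker_pt (e k) w @[k --> \oo] --> (0 : H).
  by apply: heis_inv_cvg0; exact: heis_dil_cvg0.
have mS := measurable_DDsum; have mG := measurable_div_rep.
pose F k := ((rho w)%:E * Nu u (ker_pt (e k) w) (fun p => G (heis_mul p (ker_pt (e k) w)) - G p)%R +
   (\sum_h ((`|Rh h w|)%:E * (((e k)^-1)%:E * Nu u (ker_pt (e k) w)
        (T1 (e k) (W w) (D (dual_h h)) (DD ^~ (dual_h h))))) +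
    (4 * `|Tr w|)%:E * (((e k ^+ 2)^-1)%:E * Nu u (ker_pt (e k) w) (T2 (e k) (W w) f D DD))) +
    (ker_coef rho j1 w)%:E * Vu (e k) w)%E.
have F0 : (F k @[k --> \oo] --> 0)%E.
  apply: cvge0D; last first.
    apply: cvge0Z; exact: (translate_mul_cvg mu_gt0 s_ge1 mu_u mS us DDsum_norm_fin ui a0).
  apply: cvge0D.
    apply: cvge0Z; apply: (translate_mul_cvg2 mu_gt0 s_ge1 mu_u mG us div_rep_norm_fin ui a0 a0).
    under eq_cvg do rewrite heis_Vmul.
    exact: (@cvg_cst H 0 nat \oo).
  apply: cvge0D.
    apply: cvge0_sum => h; apply: cvge0Z.
    exact: (word1_cvg mrho s_ge1 mu_u us
      (fun j => fDD j (dual_h h)) (fun j => DDs' j (dual_h h)) (fun j => uDD_le j (dual_h h)) K0 ui (W w) _ epos e0 a0).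
  apply: cvge0Z.
  exact: (word2_cvg mrho s_ge1 mu_u us fD fDD DDs' uDD_le K0 ui (W w) mf epos e0 a0).
apply: cvge0_le F0 => k; first by apply: integral_ge0 => p _; rewrite lee_fin.
by apply: (le_trans (ker_int_le w (epos k))); rewrite leeD2r// Nu_ker_err.
Qed.

End kernel_estimates.

Lemma compact_measurable_rV (R : realType) m (K : set 'rV[R]_m) : compact K -> measurable K.
Proof.
move=> cK; rewrite -[K]setCK; apply: measurableC; apply: open_measurable_rV.
by apply: closed_openC; apply: compact_closed => //; exact: norm_hausdorff.
Qed.

Section kernel_passage.
Context {R : realType} {n : nat}.
Local Notation H := (heis R n).
Local Notation mu := (@mu_heis R n).

(** The formula for [c p] is asked only where the kernel is integrable in w, which Fubini grants for
    almost every p. *)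
Lemma ae_le_integral_kernel (K : set H) (F : H -> H -> R) (c : H -> R) :
  measurable_fun setT (fun z : H * H => F z.1 z.2) ->
  (\int[mu]_w \int[mu]_p (`|F p w|)%:E < +oo)%E ->
  {ae mu, forall p, K p -> mu.-integrable setT (EFin \o F p) -> c p = \int[mu]_w F p w} ->
  {ae mu, forall p, K p -> ((`|c p|)%:E <= \int[mu]_w (`|F p w|)%:E)%E}.
Proof.
move=> mF fin hc.
rewrite (tonelli_abs sigma_finite_heis sigma_finite_heis (f := fun w p => F p w))// in fin *; last first.
  exact: (measurable_uncurry_swap (f := F)).
have [ae _ _] := Rintegral_fubini_fst sigma_finite_heis sigma_finite_heis mF fin.
apply: filterS2 hc ae => p hp ip Kp; rewrite (hp Kp ip) EFin_normr_Rintegral//.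
exact: (le_abse_integral _ measurableT (measurable_int _ ip)).
Qed.

(** Tonelli acts on the kernels alone; [c] is compared with them by monotonicity of the integral. *)
Lemma le_integral_kernel2 (K : set H) (F1 F2 : H -> H -> R) (c : H -> R) : measurable K ->
  measurable_fun setT (fun z : H * H => F1 z.1 z.2) ->
  measurable_fun setT (fun z : H * H => F2 z.1 z.2) ->
  {ae mu, forall p, K p ->
    ((`|c p|)%:E <= \int[mu]_w (`|F1 p w|)%:E + \int[mu]_w (`|F2 p w|)%:E)%E} ->
  (\int[mu]_(p in K) (`|c p|)%:E <=
   \int[mu]_w \int[mu]_p (`|F1 p w|)%:E + \int[mu]_w \int[mu]_p (`|F2 p w|)%:E)%E.
Proof.
move=> mK mF1 mF2 hc.
have swap (F : H -> H -> R) : measurable_fun setT (fun z : H * H => F z.1 z.2) ->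
    (\int[mu]_w \int[mu]_p (`|F p w|)%:E = \int[mu]_p \int[mu]_w (`|F p w|)%:E)%E.
  move=> mF; apply: (tonelli_abs sigma_finite_heis sigma_finite_heis (f := fun w p => F p w)).
  exact: (measurable_uncurry_swap (f := F)).
have mI (F : H -> H -> R) : measurable_fun setT (fun z : H * H => F z.1 z.2) ->
    measurable_fun setT (fun p => \int[mu]_w (`|F p w|)%:E)%E.
  move=> mF; apply: (measurable_integral_ge0 sigma_finite_heis (f := fun p w => `|F p w|)) => //.
  exact: measurableT_comp.
have I0 (F : H -> H -> R) p : (0 <= \int[mu]_w (`|F p w|)%:E)%E.
  by apply: integral_ge0 => w _; rewrite lee_fin.
have mI1 := mI _ mF1; have mI2 := mI _ mF2; rewrite (swap _ mF1) (swap _ mF2) -ge0_integralD//.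
apply: (@le_trans _ _ (\int[mu]_(p in K) (\int[mu]_w (`|F1 p w|)%:E + \int[mu]_w (`|F2 p w|)%:E))%E).
  apply: le_integral_ae_nonmeas => //; first by apply: measurable_funTS; exact: emeasurable_funD.
  by move=> p _; rewrite adde_ge0.
apply: ge0_subset_integral => //; first exact: emeasurable_funD.
by move=> p _; rewrite adde_ge0.
Qed.

End kernel_passage.

Section kernel_majorant.
Context {R : realType} {n : nat}.
Local Notation H := (heis R n).
Local Notation mu := (@mu_heis R n).
Variables (rho : H -> R) (mrho : mollifier rho) (j1 : 'I_n).

(** On a box containing the support the word lengths and the derivatives of [rho] are bounded; off
    it every term of the coefficient vanishes. *)
Lemma ker_coef_majorant : exists C r : R, [/\ 0 <= C, 0 <= r,
  forall w, ~ rV_box r w -> rho w = 0 /\ forall V, lie V rho w = 0 &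
  forall w, ker_coef rho j1 w <= C * \1_(rV_box r) w].
Proof.
have trho := mollifier_test mrho; have [_ crho] := trho.
have [r r0 hr] := support_box crho.
have [L L0 hL] := wlen_inverse_word j1 r.
have [_ [C1 [r1 [C10 _ hC1 _]]]] := bounded_supp_test trho.
have [_ [C2 [r2 [C20 _ hC2 _]]]] := bounded_supp_lie (-1) idx_t trho.
have /choice[C3 hC3] : forall h : 'I_(n + n), exists C : R, forall w, `|lie (Zright (idx_h h)) rho w| <= C.
  by move=> h; have [_ [C [r' [_ _ hC _]]]] := bounded_supp_lie (-1) (idx_h h) trho; exists C.
have C30 h : 0 <= C3 h by apply: le_trans (hC3 h 0).
exists (3 * C1 + L * (\sum_h C3 h) + 4 * L ^+ 2 * C2), r; split => //.
- by rewrite !addr_ge0 ?mulr_ge0 ?exprn_ge0// sumr_ge0.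
- exact: ltW.
- move=> w; have [wr|wr] := pselect (rV_box r w).
    rewrite indicE mem_set// mulr1 /ker_coef !lerD// ?ler_wpM2l//.
    - by rewrite (le_trans (ler_norm _)).
    - by apply: ler_pM => //; [exact: wlen_ge0|exact: sumr_ge0|exact: hL|exact: ler_sum].
    - apply: ler_pM => //; first by rewrite mulr_ge0// exprn_ge0// wlen_ge0.
      rewrite ler_wpM2l// ler_pXn2r ?nnegrE ?wlen_ge0//; exact: hL.
  have [rw0 l0] := hr _ wr; rewrite indicE memNset// mulr0 /ker_coef rw0 l0 normr0 !mulr0 add0r addr0.
  by rewrite big1 ?mulr0// => h _; rewrite l0 normr0.
Qed.

End kernel_majorant.

(** * Vanishing mean of the limit kernel *)

Section zero_mean.
Context {R : realType} {n : nat}.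
Local Notation H := (heis R n).
Local Notation mu := (@mu_heis R n).
Variables (rho : H -> R) (mrho : mollifier rho) (j1 : 'I_n).
Variables (u : H -> R) (DD : 'I_(n + n) -> 'I_(n + n) -> H -> R).

Let trho := mollifier_test mrho.

Lemma box_integrable_linear (c : 'I_(n + n) -> R) :
  box_integrable (fun w : H => \sum_i w ord0 (idx_h i) * c i).
Proof.
apply: box_integrable_locally_bounded.
  by apply: measurable_sum => i; apply: measurable_funM => //; exact: measurable_coord_rV.
move=> r; exists (\sum_i r * `|c i|) => w wr.
rewrite (le_trans (ler_norm_sum _ _ _))//; apply: ler_sum => i _.
by rewrite normrM ler_wpM2r//; exact: wr.
Qed.

Lemma box_integrable_e2 p : box_integrable (fun w : H => e2 (inverse_word j1 w) DD p).
Proof.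
apply: box_integrable_locally_bounded.
  by apply: (@measurable_e2_inverse_word R n j1 _ _ (fun _ => DD) (fun _ => p) id).
move=> r; have [L L0 hL] := wlen_inverse_word j1 r.
exists (L ^+ 2 * \sum_i \sum_j `|DD i j p|) => w wr.
rewrite (le_trans (e2_le _ _ _))// ler_wpM2r//.
  by apply: sumr_ge0 => i _; exact: sumr_ge0.
by rewrite ler_pXn2r ?nnegrE ?wlen_ge0//; exact: hL.
Qed.

(** Each coefficient is affine in w along the flow of the right field it multiplies. The slopes are
    sign_h Z_h Z_{dual h} f for the horizontal terms and the bracket for the vertical one;
    [Rintegral_lie_right] subtracts them from [div_rep], their sum. *)
Lemma ker0_zero_mean p : mu.-integrable setT (EFin \o ker0 rho u DD j1 p) /\
  \int[mu]_w ker0 rho u DD j1 p w = 0.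
Proof.
have bL k : bounded_supp (lie (Zright k) rho) by exact: bounded_supp_lie.
have brho := bounded_supp_test trho.
pose P1 h (w : H) := sign_h h * \sum_i w ord0 (idx_h i) * DD i (dual_h h) p.
have bP1 h : box_integrable (P1 h) by apply: box_integrableZ; exact: box_integrable_linear.
have bP2 : box_integrable (fun w : H => 4 * e2 (inverse_word j1 w) DD p).
  by apply: box_integrableZ; exact: box_integrable_e2.
have i1 h : mu.-integrable setT (EFin \o (fun w => P1 h w * lie (Zright (idx_h h)) rho w)).
  exact: box_integrableM0.
have i2 : mu.-integrable setT (EFin \o (fun w => 4 * e2 (inverse_word j1 w) DD p * lie (Zright idx_t) rho w)).
  exact: box_integrableM0.
have i0 : mu.-integrable setT (EFin \o (fun w => div_rep DD j1 p * rho w)).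
  by apply: integrableZ_EFin; exact: bounded_supp_integrable.
have [i3 e3] := Rintegral_sum (index_enum 'I_(n + n)) i1.
have i4 := integrableD measurableT (integrableD measurableT i0 i3) i2.
have E : ker0 rho u DD j1 p = (fun w => - u p * (div_rep DD j1 p * rho w +
   (\sum_h P1 h w * lie (Zright (idx_h h)) rho w) +
   4 * e2 (inverse_word j1 w) DD p * lie (Zright idx_t) rho w)).
  by apply/funext => w; rewrite /ker0 mulNr.
rewrite E; split; first exact: integrableZ_EFin.
rewrite RintegralZl//; apply/eqP; rewrite mulf_eq0; apply/orP; right; apply/eqP.
rewrite RintegralD//; last exact: (integrableD measurableT i0 i3).
rewrite RintegralD// e3 RintegralZl//; last exact: bounded_supp_integrable.
have -> : \int[mu]_w rho w = 1.
  by apply: EFin_inj; rewrite EFin_Rintegral ?(mollifier_int mrho)//; exact: bounded_supp_integrable.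
rewrite (Rintegral_lie_right mrho (k := idx_t) (Q := bracket j1 DD p) bP2); last first.
  by move=> r w; rewrite e2_inverse_word_shift; field.
have -> : \sum_h \int[mu]_w (P1 h w * lie (Zright (idx_h h)) rho w) =
    \sum_h - (sign_h h * DD h (dual_h h) p).
  apply: eq_bigr => h _; apply: (Rintegral_lie_right mrho (bP1 h)) => r w.
  rewrite /P1 mulrCA -mulrDr; congr (_ * _).
  rewrite (eq_bigr (fun i => w ord0 (idx_h i) * DD i (dual_h h) p + r * (i == h)%:R * DD i (dual_h h) p)).
    rewrite big_split /=; congr (_ + _); rewrite (bigD1 h)//= eqxx mulr1 big1 ?addr0// => i ih.
    by rewrite (negbTE ih) mulr0 mul0r.
  move=> i _; rewrite heis_mul_h rVZE basis_rVE -mulrDl addrC; congr ((_ + _ * _%:R) * _).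
by rewrite sumrN mulr1 /div_rep; ring.
Qed.

End zero_mean.

(** * From the definition of the commutator to its kernel *)

Section rescaled_commutator.
Context {R : realType} {n : nat}.
Local Notation H := (heis R n).
Local Notation mu := (@mu_heis R n).
Variables (rho : H -> R) (mrho : mollifier rho).
Variables (f : H -> R) (D : 'I_(n + n) -> H -> R) (g : H -> R).
Variables (b : 'I_(n + n + 1) -> H -> R).
Hypotheses (bh : forall h p, b (idx_h h) p = sign_h h * D (dual_h h) p)
  (bt : forall p, b idx_t p = - 4 * f p).
Implicit Types (u v : H -> R) (e : R) (p w : H).

Let srho : smooth rho := (mollifier_test mrho).1.

(** The rescaled integrand of the divergence term in [commutator1]. *)
Definition cross v e p w : R := v (heis_mul p (ker_pt e w)) * g (heis_mul p (ker_pt e w)) * rho w.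

(** The integrand of the second term in [commutator1], before rescaling. *)
Definition stencil v e p q : R := v (heis_mul p (heis_inv q)) *
  \sum_j (b j p * lie (Zleft j) (mollify rho e) q -
          b j (heis_mul p (heis_inv q)) * lie (Zright j) (mollify rho e) q).

Lemma sum_dual (F : 'I_(n + n) -> R) : \sum_h F (dual_h h) = \sum_h F h.
Proof. by rewrite [RHS](reindex_inj (can_inj (@dual_hK n))). Qed.

(** The left fields are rewritten through the right ones. Since sign_h^2 = 1, the extra T-terms add
    up to 4 e^-1 sum_h w_h Z_h f(p), the first-order part needed beside 4 e^-2 times the difference
    of f. *)
Lemma frame_sum e p w : e != 0 ->
  \sum_j (b j p * lie (Zleft j) (mollify rho e) (heis_dil e w) -
          b j (heis_mul p (ker_pt e w)) * lie (Zright j) (mollify rho e) (heis_dil e w)) =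
  (e ^+ (2 * n + 2))^-1 *
  ((\sum_h sign_h h * (e^-1 * (D (dual_h h) p - D (dual_h h) (heis_mul p (ker_pt e w)))) *
      lie (Zright (idx_h h)) rho w) +
   4 * ((e ^+ 2)^-1 * (f (heis_mul p (ker_pt e w)) - f p +
          e * \sum_h w ord0 (idx_h h) * D h p)) * lie (Zright idx_t) rho w).
Proof.
move=> e0; have E0 : e ^+ (2 * n + 2) != 0 by rewrite expf_neq0.
rewrite big_split_ord big_ord1.
have -> : rshift (n + n) ord0 = @idx_t n by [].
rewrite !bt (lie_mollify_t 1 w e0 srho) (lie_mollify_t (-1) w e0 srho).
rewrite -/Zleft -/Zright lie_left_right_t.
rewrite -(sum_dual (fun h => w ord0 (idx_h h) * D h p)).
set P := heis_mul p (ker_pt e w); set T := lie (Zright idx_t) rho w.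
rewrite (eq_bigr (fun h => (e ^+ (2 * n + 2))^-1 *
    (sign_h h * (e^-1 * (D (dual_h h) p - D (dual_h h) P)) * lie (Zright (idx_h h)) rho w) +
    (e ^+ (2 * n + 2))^-1 * (4 * e^-1 * T) * (w ord0 (idx_h (dual_h h)) * D (dual_h h) p))); last first.
  move=> h _; rewrite -!/(idx_h h) !bh.
  rewrite (lie_mollify_h 1 h w e0 srho) (lie_mollify_h (-1) h w e0 srho) -/Zleft -/Zright.
  rewrite (lie_left_right h w srho) -/T.
  rewrite (_ : sign_h h * D (dual_h h) p * _ - _ = (e ^+ (2 * n + 2))^-1 *
    (sign_h h * (e^-1 * (D (dual_h h) p - D (dual_h h) P)) * lie (Zright (idx_h h)) rho w) +
    (sign_h h ^+ 2) * ((e ^+ (2 * n + 2))^-1 * (4 * e^-1 * T) * (w ord0 (idx_h (dual_h h)) * D (dual_h h) p))).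
    by rewrite expr2 sign_h_sqr mul1r.
  by ring.
rewrite big_split /= -!mulr_sumr; move: E0; move: (e ^+ (2 * n + 2)) => E E0.
by field; rewrite e0 E0.
Qed.

Lemma cross_rescale v e p w : e != 0 ->
  e ^+ (2 * n + 2) * (v (heis_mul p (heis_inv (heis_dil e w))) * g (heis_mul p (heis_inv (heis_dil e w))) *
     mollify rho e (heis_dil e w)) = cross v e p w.
Proof.
move=> e0; have E0 : e ^+ (2 * n + 2) != 0 by rewrite expf_neq0.
by rewrite /mollify heis_dilK// /cross -/(ker_pt e w); field.
Qed.

Lemma stencil_rescale v e p w : e != 0 ->
  e ^+ (2 * n + 2) * stencil v e p (heis_dil e w) = - ker rho v f D g e p w - cross v e p w.
Proof.
move=> e0; have E0 : e ^+ (2 * n + 2) != 0 by rewrite expf_neq0.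
rewrite /stencil -/(ker_pt e w) frame_sum// /ker /cross; move: (e ^+ (2 * n + 2)) E0 => E E0.
by field; rewrite e0 E0.
Qed.

(** The two integrals of the definition are merged by linearity, which calls for integrability of
    [cross] and of [ker] separately. *)
Lemma commutator1_ker v e p : 0 < e ->
  mu.-integrable setT (EFin \o cross v e p) -> mu.-integrable setT (EFin \o ker rho v f D g e p) ->
  commutator1 rho e (fun _ => v) (fun j _ => b j) (fun _ => g) 0 p = \int[mu]_w ker rho v f D g e p w.
Proof.
move=> e0 ic ik; have en0 : e != 0 by rewrite gt_eqF.
have iB : mu.-integrable setT (EFin \o (fun w => - ker rho v f D g e p w - cross v e p w)).
  have := integrableB measurableT (integrableZ_EFin (-1) ik) ic.
  by apply: eq_integrable => // w _; rewrite /= mulN1r.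
rewrite /commutator1 /heis_conv.
rewrite (Rintegral_rescale e0 (F := fun q => v (heis_mul p (heis_inv q)) * g (heis_mul p (heis_inv q)) * mollify rho e q)); last first.
  by under eq_fun do rewrite cross_rescale//.
under eq_Rintegral do rewrite cross_rescale//.
rewrite (Rintegral_rescale e0 (F := stencil v e p)); last first.
  by under eq_fun do rewrite stencil_rescale//.
under [X in _ - X]eq_Rintegral do rewrite stencil_rescale//.
rewrite RintegralB//; last by have := integrableZ_EFin (-1) ik; apply: eq_integrable => // w _; rewrite /= mulN1r.
rewrite (_ : \int[mu]_w (- ker rho v f D g e p w) = - \int[mu]_w ker rho v f D g e p w); first by ring.
by rewrite -mulN1r -RintegralZl//; apply: eq_Rintegral => w _; rewrite mulN1r.
Qed.

(** The kernel sees u only at the points p (dil_e w)^-1 with w in the support of [rho]; this allows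
    u to be cut off. *)
Lemma ker_local u v r e p :
  (forall w, ~ rV_box r w -> rho w = 0 /\ forall V, lie V rho w = 0) ->
  (forall w, rV_box r w -> u (heis_mul p (ker_pt e w)) = v (heis_mul p (ker_pt e w))) ->
  ker rho u f D g e p = ker rho v f D g e p /\ cross u e p = cross v e p.
Proof.
move=> hr uv; split; apply/funext => w; (have [wr|wr] := pselect (rV_box r w); first by rewrite /ker /cross uv).
  have [rw0 l0] := hr _ wr; rewrite /ker rw0 l0 !mulr0 !big1 ?addr0 ?mulr0// => h _;
  by rewrite l0 mulr0.
by have [rw0 l0] := hr _ wr; rewrite /cross rw0 !mulr0.
Qed.

End rescaled_commutator.

Section kernel_measurable.
Context {R : realType} {n : nat}.
Local Notation H := (heis R n).
Variables (rho : H -> R) (mrho : mollifier rho) (j1 : 'I_n).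
Context d (T : measurableType d) (P W : T -> H).
Hypotheses (mP : measurable_fun setT P) (mW : measurable_fun setT W).
Variables (v f g : T -> H -> R) (D : 'I_(n + n) -> T -> H -> R)
  (DD : 'I_(n + n) -> 'I_(n + n) -> T -> H -> R).
Local Notation joint F := (measurable_fun setT (fun z : T * H => F z.1 z.2)).
Hypotheses (mv : joint v) (mf : joint f) (mg : joint g) (mD : forall j, joint (D j))
  (mDD : forall i j, joint (DD i j)).

Let mrho_ : measurable_fun setT rho.
Proof. by have [] := bounded_supp_test (mollifier_test mrho). Qed.
Let mlie k : measurable_fun setT (lie (Zright k) rho).
Proof. by have [] := bounded_supp_lie (-1) k (mollifier_test mrho). Qed.

Lemma measurable_ker_pt e : measurable_fun setT (fun x : T => heis_mul (P x) (ker_pt e (W x))).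
Proof.
apply: measurable_heis_mul => //.
by apply: measurable_heis_inv; apply: measurable_heis_dil => //; exact: measurable_cst.
Qed.

Lemma measurable_at (F : T -> H -> R) (Q : T -> H) : joint F -> measurable_fun setT Q ->
  measurable_fun setT (fun x => F x (Q x)).
Proof. by move=> mF mQ; exact: (measurableT_comp mF (measurable_fun_pair (@measurable_id _ T setT) mQ)). Qed.

Let mat (F : T -> H -> R) e : joint F ->
  measurable_fun setT (fun x : T => F x (heis_mul (P x) (ker_pt e (W x)))).
Proof. by move=> mF; apply: measurable_at => //; exact: measurable_ker_pt. Qed.
Let mp (F : T -> H -> R) : joint F -> measurable_fun setT (fun x : T => F x (P x)).
Proof. by move=> mF; exact: measurable_at. Qed.
Let mwt (F : H -> R) : measurable_fun setT F -> measurable_fun setT (fun x : T => F (W x)).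
Proof. by move=> mF; exact: measurableT_comp mF mW. Qed.
Let mw i : measurable_fun setT (fun x : T => W x ord0 i).
Proof. exact: (mwt (measurable_coord_rV i)). Qed.

Lemma measurable_ker e : measurable_fun setT (fun x : T =>
  ker rho (v x) (f x) (fun j => D j x) (g x) e (P x) (W x)).
Proof.
apply: measurableT_comp => //; apply: measurable_funM; first exact: mat.
apply: measurable_funD; last first.
  apply: measurable_funM; last exact: mwt.
  apply: measurable_funM => //; apply: measurable_funM => //; apply: measurable_funD.
    by apply: measurable_funB; [exact: mat|exact: mp].
  by apply: measurable_funM => //; apply: measurable_sum => h; apply: measurable_funM => //; exact: mp.
apply: measurable_funD.
  by apply: measurable_funM; [exact: mat|exact: mwt].
apply: measurable_sum => h; apply: measurable_funM; last exact: mwt.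
apply: measurable_funM => //; apply: measurable_funM => //; apply: measurable_funB; first exact: mp.
exact: mat.
Qed.

Lemma measurable_ker0 : measurable_fun setT (fun x : T =>
  ker0 rho (v x) (fun i j => DD i j x) j1 (P x) (W x)).
Proof.
have mDDp i j : measurable_fun setT (fun x => DD i j x (P x)) by exact: mp.
apply: measurableT_comp => //; apply: measurable_funM; first exact: mp.
apply: measurable_funD; last first.
  apply: measurable_funM; last exact: mwt.
  by apply: measurable_funM => //; apply: (@measurable_e2_inverse_word R n j1 _ _ (fun x i j => DD i j x)).
apply: measurable_funD.
  apply: measurable_funM; last exact: mwt.
  apply: measurable_funD; last exact: measurable_funB.
  by apply: measurable_sum => h; exact: measurable_funM.
apply: measurable_sum => h; apply: measurable_funM; last exact: mwt.
by apply: measurable_funM => //; apply: measurable_sum => i; exact: measurable_funM.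
Qed.

Definition cker (u c : H -> R) (e : R) (p w : H) : R :=
  u (heis_mul p (ker_pt e w)) * rho w * (c p - c (heis_mul p (ker_pt e w))).

Lemma measurable_cker e : measurable_fun setT (fun x : T => cker (v x) (f x) e (P x) (W x)).
Proof.
apply: measurable_funM; first by apply: measurable_funM; [exact: mat|exact: mwt].
by apply: measurable_funB; [exact: mp|exact: mat].
Qed.

End kernel_measurable.

(** * The first commutator at a fixed time *)

Section commutator1_estimate.
Context {R : realType} {n : nat}.
Local Notation H := (heis R n).
Local Notation mu := (@mu_heis R n).
Variables (rho : H -> R) (mrho : mollifier rho) (s : \bar R) (s_ge1 : (1 <= s)%E).
Local Notation s' := (hoelder_conjugate s).
Variables (v : H -> R) (mv : measurable_fun setT v) (vs : (Ls_norm s v < +oo)%E).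
Hypothesis vi : mu.-integrable setT (EFin \o v).
Variables (f : H -> R) (D : 'I_(n + n) -> H -> R) (DD : 'I_(n + n) -> 'I_(n + n) -> H -> R).
Hypotheses (fD : forall j, weak_derivative (idx_h j) f (D j))
  (fDD : forall i j, weak_derivative (idx_h i) (D j) (DD i j))
  (DDs' : forall i j, (Ls_norm s' (DD i j) < +oo)%E).
Variables (j1 : 'I_n) (g : H -> R) (mg : measurable_fun setT g).
Hypothesis gG : {ae mu, forall p, g p = div_rep DD j1 p}.
Variables (b : 'I_(n + n + 1) -> H -> R).
Hypotheses (bh : forall h p, b (idx_h h) p = sign_h h * D (dual_h h) p)
  (bt : forall p, b idx_t p = - 4 * f p).
Implicit Types (e : R).

Let mu_gt0 := mollifier_mu_gt0 mrho.
Let mf : measurable_fun setT f.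
Proof. by have [[]] := fD (lshift n j1). Qed.
Let mD j : measurable_fun setT (D j). Proof. by have [_ []] := fD j. Qed.
Let mDD i j : measurable_fun setT (DD i j). Proof. by have [_ []] := fDD i j. Qed.
Let mG : measurable_fun setT (div_rep DD j1). Proof. exact: measurable_div_rep. Qed.
Let mrho_ : measurable_fun setT rho.
Proof. by have [] := bounded_supp_test (mollifier_test mrho). Qed.
Let jm (F : H -> R) : measurable_fun setT F -> measurable_fun setT (fun z : (H * H) * H => F z.2).
Proof. by move=> mF; exact: measurableT_comp mF measurable_snd. Qed.
Let mker_pt e : measurable_fun setT (fun z : H * H => heis_mul z.1 (ker_pt e z.2)).
Proof. exact: (measurable_ker_pt measurable_fst measurable_snd). Qed.

(** g coincides almost everywhere with [div_rep], which is in L^{s'}, so v g is integrable by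
    Hoelder; Fubini then gives almost every section. *)
Lemma cross_integrable e : {ae mu, forall p, mu.-integrable setT (EFin \o cross rho g v e p)}.
Proof.
have mc : measurable_fun setT (fun z : H * H => cross rho g v e z.1 z.2).
  apply: measurable_funM; last exact: measurableT_comp mrho_ measurable_snd.
  by apply: measurable_funM; [exact: measurableT_comp mv (mker_pt e)|exact: measurableT_comp mg (mker_pt e)].
have mvg : measurable_fun setT (fun p => v p * g p) by exact: measurable_funM.
have fin : (\int[mu]_p (`|v p * g p|)%:E < +oo)%E.
  rewrite (ae_eq_integral (fun p => (`|v p * div_rep DD j1 p|)%:E))//.
  - have iG := integrable_mul_heis mu_gt0 s_ge1 mv mG vs (div_rep_norm_fin mrho s_ge1 fDD DDs' j1).
    by have [] := integrable_abs_lty iG.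
  - by apply/measurable_EFinP; apply: measurableT_comp => //; exact: measurable_funM.
  - by apply/measurable_EFinP; apply: measurableT_comp => //; exact: measurable_funM.
  - by apply: filterS gG => p gp _; rewrite gp.
have [] // := Rintegral_fubini_fst sigma_finite_heis sigma_finite_heis mc.
rewrite (tonelli_abs sigma_finite_heis sigma_finite_heis (f := cross rho g v e))//.
have E w : (\int[mu]_p (`|cross rho g v e p w|)%:E = (rho w)%:E * \int[mu]_p (`|v p * g p|)%:E)%E.
  rewrite -(integral_heis_mulr (ker_pt e w) (f := fun p => (`|v p * g p|)%:E)).
    rewrite -integralZl_ge0 ?(mollifier_ge0 mrho)//.
    + by apply: eq_integral => p _; rewrite /cross normrM (ger0_norm (mollifier_ge0 mrho w)) mulrC.
    + apply: measurableT_comp => //; apply: (measurableT_comp mvg); exact: measurable_heis_mulr.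
  - by apply/measurable_EFinP; exact: measurableT_comp.
  - by move=> p; rewrite lee_fin.
under eq_integral do rewrite E.
rewrite ge0_integralZr//; last 3 first.
- by apply/measurable_EFinP.
- by move=> w _; rewrite lee_fin (mollifier_ge0 mrho).
- by apply: integral_ge0 => p _; rewrite lee_fin.
by rewrite (mollifier_int mrho) mul1e.
Qed.

Variables (M : R) (M0 : 0 <= M).
Hypothesis vM : (Ls_norm s v * \sum_i \sum_j Ls_norm s' (DD i j) <= M%:E)%E.
Local Notation kint := (ker_int rho v f D DD j1 g).

Lemma measurable_ker_diff e : measurable_fun setT (fun z : H * H => ker rho v f D g e z.1 z.2 - ker0 rho v DD j1 z.1 z.2).
Proof.
apply: measurable_funB.
  apply: (measurable_ker mrho measurable_fst measurable_snd (v := fun _ => v) (f := fun _ => f)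
    (g := fun _ => g) (D := fun j _ => D j)) => *; exact: jm.
apply: (measurable_ker0 mrho j1 measurable_fst measurable_snd (v := fun _ => v)
  (DD := fun i j _ => DD i j)) => *; exact: jm.
Qed.

Lemma ker_int_ge0 e w : (0 <= kint e w)%E.
Proof. by apply: integral_ge0 => p _; rewrite lee_fin. Qed.

Lemma measurable_ker_int e : measurable_fun setT (kint e).
Proof.
apply: (measurable_integral_ge0 sigma_finite_heis (f := fun w p =>
  `|ker rho v f D g e p w - ker0 rho v DD j1 p w|)) => //.
apply: measurableT_comp => //.
exact: (measurable_uncurry_swap (f := fun p w => ker rho v f D g e p w - ker0 rho v DD j1 p w) (measurable_ker_diff e)).
Qed.

Lemma ker_int_box C r e w : (forall w, ker_coef rho j1 w <= C * \1_(rV_box r) w) -> 0 < e ->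
  (kint e w <= (4 * M * C * \1_(rV_box r) w)%:E)%E.
Proof.
move=> hC e0; apply: (le_trans (ker_int_bound mrho s_ge1 mv vs fD fDD DDs' gG M0 vM w e0)).
by rewrite lee_fin -mulrA -[leRHS]mulrA -[leRHS]mulrA !ler_wpM2l.
Qed.

Lemma integral_box_cst C r : 0 <= C ->
  (\int[mu]_w (C * \1_(rV_box r) w)%:E = C%:E * mu (rV_box r))%E.
Proof.
move=> C0; rewrite integralZl_ge0 ?integral_box//.
by apply: measurable_indic; exact: measurable_rV_box.
Qed.

Lemma ker_int_integral_le C r e : 0 <= C -> (forall w, ker_coef rho j1 w <= C * \1_(rV_box r) w) ->
  0 < e -> (\int[mu]_w kint e w <= (4 * M * C)%:E * mu (rV_box r))%E.
Proof.
move=> C0 hC e0; rewrite -integral_box_cst ?mulr_ge0//.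
by apply: le_integral_nonmeas => w _; [exact: ker_int_ge0|exact: ker_int_box].
Qed.

Lemma ker_int_integral_cvg (e : nat -> R) : (forall k, 0 < e k) -> e k @[k --> \oo] --> (0 : R) ->
  (\int[mu]_w kint (e k) w @[k --> \oo] --> 0)%E.
Proof.
move=> e0 ecvg; have [C [r [C0 r0 _ hC]]] := ker_coef_majorant mrho j1.
apply: (dominated_cvg0 (g := fun w => (4 * M * C * \1_(rV_box r) w)%:E)) => //.
- by move=> k; exact: measurable_ker_int.
- by move=> k w _; exact: ker_int_ge0.
- by move=> w _; rewrite lee_fin !mulr_ge0.
- apply: aeW => w _; exact: (ker_int_cvg mrho s_ge1 mv vs fD fDD DDs' gG M0 vM vi w e0 ecvg).
- by apply: aeW => w _ k; exact: ker_int_box.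
- by rewrite integral_box_cst ?mulr_ge0// lte_mul_pinfty ?box_fin// lee_fin !mulr_ge0.
Qed.

(** [ker0] has zero mean in w, so subtracting it does not change the integral that represents the
    commutator. *)
Lemma commutator1_le u (K : set H) r e : 0 < e ->
  (forall w, ~ rV_box r w -> rho w = 0 /\ forall V, lie V rho w = 0) ->
  (forall p w, K p -> rV_box r w -> u (heis_mul p (ker_pt e w)) = v (heis_mul p (ker_pt e w))) ->
  {ae mu, forall p, K p ->
    ((`|commutator1 rho e (fun _ => u) (fun j _ => b j) (fun _ => g) 0 p|)%:E <=
     \int[mu]_w (`|ker rho v f D g e p w - ker0 rho v DD j1 p w|)%:E)%E}.
Proof.
move=> e0 hr uv.
apply: (ae_le_integral_kernel (F := fun p w => ker rho v f D g e p w - ker0 rho v DD j1 p w)) => //.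
- exact: measurable_ker_diff.
- have [C [r' [C0 r0 _ hC]]] := ker_coef_majorant mrho j1.
  apply: (le_lt_trans (ker_int_integral_le C0 hC e0)).
  by rewrite lte_mul_pinfty ?box_fin// lee_fin !mulr_ge0.
apply: filterS (cross_integrable e) => p ic Kp iF.
have [i0 z0] := ker0_zero_mean mrho j1 v DD p.
have ik : mu.-integrable setT (EFin \o ker rho v f D g e p).
  have := integrableD measurableT iF i0; apply: eq_integrable => // w _ /=.
  by rewrite -EFinD subrK.
have [Ek Ec] := ker_local f D g hr (fun w => uv p w Kp).
rewrite (commutator1_ker mrho bh bt e0)//; last 2 first.
- by rewrite Ec.
- by rewrite Ek.
rewrite Ek RintegralB// z0 subr0//.
Qed.

End commutator1_estimate.

(** * The second commutator at a fixed time *)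

Section commutator2_estimate.
Context {R : realType} {n : nat}.
Local Notation H := (heis R n).
Local Notation mu := (@mu_heis R n).
Variables (rho : H -> R) (mrho : mollifier rho) (s : \bar R) (s_ge1 : (1 <= s)%E).
Local Notation s' := (hoelder_conjugate s).
Variables (v : H -> R) (mv : measurable_fun setT v) (vs : (Ls_norm s v < +oo)%E).
Hypothesis vi : mu.-integrable setT (EFin \o v).
Variables (d : H -> R) (md : measurable_fun setT d) (ds : (Ls_norm s' d < +oo)%E).
Variables (M : R) (M0 : 0 <= M).
Hypothesis vM : (Ls_norm s v * Ls_norm s' d <= M%:E)%E.
Implicit Types (e : R).

Let mu_gt0 := mollifier_mu_gt0 mrho.
Let mrho_ : measurable_fun setT rho.
Proof. by have [] := bounded_supp_test (mollifier_test mrho). Qed.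
Let rho0 := mollifier_ge0 mrho.

Definition cker_int (e : R) (w : H) : \bar R := (\int[mu]_p (`|cker rho v d e p w|)%:E)%E.

Lemma measurable_cker_pair e : measurable_fun setT (fun z : H * H => cker rho v d e z.1 z.2).
Proof.
by apply: (measurable_cker mrho measurable_fst measurable_snd (v := fun _ => v) (f := fun _ => d));
  exact: measurableT_comp _ measurable_snd.
Qed.

Lemma cker_int_ge0 e w : (0 <= cker_int e w)%E.
Proof. by apply: integral_ge0 => p _; rewrite lee_fin. Qed.

Lemma measurable_cker_int e : measurable_fun setT (cker_int e).
Proof.
apply: (measurable_integral_ge0 sigma_finite_heis (f := fun w p => `|cker rho v d e p w|)) => //.
apply: measurableT_comp => //.
exact: (measurable_uncurry_swap (f := cker rho v d e) (measurable_cker_pair e)).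
Qed.

(** No negative power of e occurs: this is a weighted translation difference of d, to which
    [translate_mul_cvg2] applies directly. *)
Lemma cker_intE e w : cker_int e w =
  ((rho w)%:E * Nu v (ker_pt e w) (fun p => d (heis_mul p (ker_pt e w)) - d p)%R)%E.
Proof.
rewrite /cker_int /Nu -integralZl_ge0//.
  apply: eq_integral => p _; congr EFin.
  by rewrite /cker !normrM (ger0_norm (rho0 w)) distrC; ring.
apply: measurable_funM; apply: measurableT_comp => //.
  by apply: (measurableT_comp mv); exact: measurable_heis_mulr.
by apply: measurable_funB => //; apply: (measurableT_comp md); exact: measurable_heis_mulr.
Qed.

Lemma cker_int_le e w : (cker_int e w <= (2 * M * rho w)%:E)%E.
Proof.
rewrite cker_intE mulrC EFinM; apply: lee_wpmul2l; first by rewrite lee_fin.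
exact: (Nu_diff_le mrho s_ge1 mv vs).
Qed.

Lemma integral_rho_cst C : 0 <= C -> (\int[mu]_w (C * rho w)%:E = C%:E)%E.
Proof. by move=> C0; rewrite integralZl_ge0// (mollifier_int mrho) mule1. Qed.

Lemma cker_int_integral_le e : (\int[mu]_w cker_int e w <= (2 * M)%:E)%E.
Proof.
rewrite -integral_rho_cst ?mulr_ge0//.
by apply: le_integral_nonmeas => w _; [exact: cker_int_ge0|exact: cker_int_le].
Qed.

Lemma cker_int_integral_cvg (e : nat -> R) : e k @[k --> \oo] --> (0 : R) ->
  (\int[mu]_w cker_int (e k) w @[k --> \oo] --> 0)%E.
Proof.
move=> ecvg.
apply: (dominated_cvg0 (g := fun w => (2 * M * rho w)%:E)) => //.
- by move=> k; exact: measurable_cker_int.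
- by move=> k w _; exact: cker_int_ge0.
- by move=> w _; rewrite lee_fin !mulr_ge0.
- apply: aeW => w _; under eq_cvg do rewrite cker_intE; apply: cvge0Z.
  have a0 : ker_pt (e k) w @[k --> \oo] --> (0 : H).
    by apply: heis_inv_cvg0; exact: heis_dil_cvg0.
  apply: (translate_mul_cvg2 mu_gt0 s_ge1 mv md vs ds vi a0 a0).
  under eq_cvg do rewrite heis_Vmul.
  exact: (@cvg_cst H 0 nat \oo).
- by apply: aeW => w _ k; exact: cker_int_le.
- by rewrite integral_rho_cst ?mulr_ge0// ltry.
Qed.

Lemma cker_rescale u c e p w : e != 0 ->
  e ^+ (2 * n + 2) * (u (heis_mul p (heis_inv (heis_dil e w))) * mollify rho e (heis_dil e w) *
     (c p - c (heis_mul p (heis_inv (heis_dil e w))))) = cker rho u c e p w.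
Proof.
move=> e0; have E0 : e ^+ (2 * n + 2) != 0 by rewrite expf_neq0.
by rewrite /mollify heis_dilK// /cker -/(ker_pt e w); field.
Qed.

Lemma cker_local u c r e p : (forall w, ~ rV_box r w -> rho w = 0) -> c p = d p ->
  (forall w, rV_box r w -> u (heis_mul p (ker_pt e w)) = v (heis_mul p (ker_pt e w)) /\
     c (heis_mul p (ker_pt e w)) = d (heis_mul p (ker_pt e w))) ->
  cker rho u c e p = cker rho v d e p.
Proof.
move=> hr cd uv; apply/funext => w; rewrite /cker.
have [/uv[-> ->]|wr] := pselect (rV_box r w); first by rewrite cd.
by rewrite (hr _ wr) !mulr0 !mul0r.
Qed.

Lemma commutator2_le u c (K : set H) r e : 0 < e ->
  (forall w, ~ rV_box r w -> rho w = 0) -> (forall p, K p -> c p = d p) ->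
  (forall p w, K p -> rV_box r w -> u (heis_mul p (ker_pt e w)) = v (heis_mul p (ker_pt e w)) /\
     c (heis_mul p (ker_pt e w)) = d (heis_mul p (ker_pt e w))) ->
  {ae mu, forall p, K p ->
    ((`|commutator2 rho e (fun _ => u) (fun _ => c) 0 p|)%:E <= \int[mu]_w (`|cker rho v d e p w|)%:E)%E}.
Proof.
move=> e0 hr cd uv; have en0 : e != 0 by rewrite gt_eqF.
apply: (ae_le_integral_kernel (F := cker rho v d e)) => //.
  exact: measurable_cker_pair.
  by apply: (le_lt_trans (cker_int_integral_le e)); rewrite ltry.
apply: aeW => p Kp; rewrite -(cker_local hr (cd p Kp) (fun w => uv p w Kp)) => iF.
rewrite /commutator2 (Rintegral_rescale e0 (F := fun q => u (heis_mul p (heis_inv q)) * mollify rho e q *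
                   (c p - c (heis_mul p (heis_inv q))))); last first.
  by under eq_fun do rewrite cker_rescale//.
by under eq_Rintegral do rewrite cker_rescale//.
Qed.

End commutator2_estimate.

(** Dominated convergence is sequential, whence this reduction. Were the limit to fail, some level a
    > 0 would be exceeded at a point of each interval (0, 1 / (k + 1)], and these points form a
    forbidden sequence. *)
Lemma cvge0_at_right (R : realType) (F : R -> \bar R) : (forall e, 0 <= F e)%E ->
  (forall e : nat -> R, (forall k, 0 < e k <= 1) -> e k @[k --> \oo] --> (0 : R) ->
    (F (e k) @[k --> \oo] --> 0)%E) ->
  (F e @[e --> (0 : R)^'+] --> 0)%E.
Proof.
move=> F0 Fseq; apply: ge0_cvge0 => // a a0; apply: contrapT => nF.
have /choice[e he] (k : nat) : exists e : R, [/\ 0 < e <= 1, e <= k.+1%:R^-1 & ~ (F e <= a%:E)%E].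
  apply: contrapT => ne; apply: nF; near=> e; apply: contrapT => ae; apply: ne.
  exists e; split => //; last first.
    by near: e; apply: nbhs_right_le; rewrite invr_gt0.
  by apply/andP; split; near: e; [exact: nbhs_right_gt|exact: nbhs_right_le].
have e0 : e k @[k --> \oo] --> (0 : R).
  apply: (squeeze_cvgr _ (cvg_cst 0) (@cvg_harmonic R)).
  by apply: nearW => k; have [/andP[/ltW-> _] ->] := he k.
have e01 k : 0 < e k <= 1 by have [] := he k.
have [k _ /(_ k (leqnn k)) Fk] := cvge0_near (Fseq e e01 e0) a0.
by have [_ _] := he k.
Unshelve. all: by end_near. Qed.

(** * Integration in time *)

Section parameter_norm.
Context {R : realType} {n : nat}.
Local Notation H := (heis R n).
Local Notation mu := (@mu_heis R n).
Context d (T : measurableType d).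
Implicit Types (F : T -> H -> R).

(** For exponent +oo, the essential supremum of F x exceeds y exactly when the set where |F x| > y
    has positive measure, and that measure depends measurably on x by Tonelli. *)
Lemma measurable_Ls_norm (t : \bar R) F : (1 <= t)%E -> (0 < mu setT)%E ->
  measurable_fun setT (fun z : T * H => F z.1 z.2) ->
  measurable_fun setT (fun x => Ls_norm t (F x)).
Proof.
move=> t1 mu_gt0 mF; rewrite /Ls_norm unlock; case: t t1 => [r r1|_|//].
  rewrite (_ : (fun x => _) = (fun x => (\int[mu]_p (`|F x p| `^ r)%:E) `^ r^-1)%E); last first.
    by apply/funext => x; congr (_ `^ _)%E; apply: eq_integral => p _.
  apply: (measurableT_comp (measurable_poweR r^-1)).
  apply: (measurable_integral_ge0 sigma_finite_heis (f := fun x p => `|F x p| `^ r)).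
    by move=> x p; exact: powR_ge0.
  apply: (measurableT_comp (measurable_powR r)).
  exact: measurableT_comp.
rewrite mu_gt0; apply: (measurability _ (ErealGenOInfty.measurableE R)) => // _ [_ [y ->]] <-.
pose A x : set H := [set p | y < `|F x p|].
have mA : measurable [set z : T * H | y < `|F z.1 z.2|].
  have : measurable_fun setT (fun z : T * H => `|F z.1 z.2|) by exact: measurableT_comp.
  move=> /(_ measurableT `]y, +oo[%classic (measurable_itv _)); rewrite setTI.
  by congr (measurable _); apply/seteqP; split => z; rewrite /= in_itv/= andbT.
have mAx x : measurable (A x).
  by have := measurable_xsection x mA; congr (measurable _); rewrite xsectionE.
have mG : measurable_fun setT (fun x => \int[mu]_p (\1_(A x) p)%:E)%E.
  apply: (measurable_integral_ge0 sigma_finite_heis (f := fun x p => \1_(A x) p)) => //.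
  have := @measurable_indic _ _ R setT _ mA; congr (measurable_fun _ _).
rewrite (_ : _ `&` _ = setT `&` [set x | (0 < \int[mu]_p (\1_(A x) p)%:E)%E]); last first.
  rewrite !setTI; apply/seteqP; split => x; rewrite /= in_itv/= andbT integral_indic ?setIT//.
    rewrite ltNge => /negP nle; rewrite lt0e measure_ge0 andbT; apply/eqP => A0.
    apply: nle; apply/ess_supP; exists (A x); split => // p /=.
    by move/negP; rewrite lee_fin -ltNge.
  move=> A0; rewrite ltNge; apply/negP => /ess_supP[N [mN N0 AN]].
  move: A0; rewrite lt0e => /andP[/eqP A0 _]; apply: A0.
  apply: (subset_measure0 _ _ _ N0) => // p Ap; apply: AN => /=.
  by rewrite lee_fin; apply/negP; rewrite -ltNge.
exact: emeasurable_fun_o_infty.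
Qed.

End parameter_norm.

Section time_patch.
Context {R : realType} {n : nat}.
Local Notation H := (heis R n).
Local Notation mu := (@mu_heis R n).
Implicit Types (taubar : \bar R) (X : R -> H -> R).

Lemma measurable_time_left taubar : measurable (time_left taubar).
Proof.
rewrite (_ : time_left taubar = EFin @^-1` `]-oo, taubar[%classic); last first.
  by apply/seteqP; split => t; rewrite /= in_itv.
by rewrite -[X in measurable X]setTI; apply: EFin_measurable => //; exact: emeasurable_itv.
Qed.

Lemma time_intE taubar : time_int taubar = `]0, +oo[%classic `&` time_left taubar.
Proof. by apply/seteqP; split => t; rewrite /= in_itv/= andbT. Qed.

Lemma measurable_time_int taubar : measurable (time_int taubar).
Proof. by rewrite time_intE; apply: measurableI => //; exact: measurable_time_left. Qed.

(** Extension by 0 turns data that are jointly measurable over a time interval into functions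
    jointly measurable on the whole of R x H. *)
Definition time_patch (A : set R) X : R -> H -> R := fun t p => if t \in A then X t p else 0.

Lemma time_patch_in A X t : A t -> time_patch A X t = X t.
Proof. by move=> At; rewrite /time_patch mem_set. Qed.

Lemma time_patch_out A X t : ~ A t -> time_patch A X t = cst 0.
Proof. by move=> At; rewrite /time_patch memNset. Qed.

Lemma measurable_time_patch A X : measurable A -> joint_measurable A X ->
  measurable_fun setT (fun z : R * H => time_patch A X z.1 z.2).
Proof.
move=> mA mX; have mAT : measurable (A `*` [set: H]) by exact: measurableX.
rewrite (_ : (fun z => _) = (fun z : R * H => X z.1 z.2) \_ (A `*` setT)); last first.
  apply/funext => -[t p]; rewrite /time_patch /restrict /=.
  have [At|At] := pselect (A t); first by rewrite !mem_set.
  by rewrite !memNset// => -[].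
by apply/measurable_restrict => //; rewrite setTI.
Qed.

End time_patch.

Section time_kernel.
Context {R : realType} {n : nat}.
Local Notation H := (heis R n).
Local Notation mu := (@mu_heis R n).
Variables (rho : H -> R) (mrho : mollifier rho) (j1 : 'I_n).
Variables (v f g : R -> H -> R) (D : 'I_(n + n) -> R -> H -> R)
  (DD : 'I_(n + n) -> 'I_(n + n) -> R -> H -> R).
Local Notation joint F := (measurable_fun setT (fun z : R * H => F z.1 z.2)).
Hypotheses (mv : joint v) (mf : joint f) (mg : joint g) (mD : forall j, joint (D j))
  (mDD : forall i j, joint (DD i j)).

Let mtime : measurable_fun setT (fun z : (R * H) * H => z.1.1).
Proof. exact: measurableT_comp measurable_fst measurable_fst. Qed.
Let mpt : measurable_fun setT (fun z : (R * H) * H => z.1.2).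
Proof. exact: measurableT_comp measurable_snd measurable_fst. Qed.
Let jm (F : R -> H -> R) : joint F ->
  measurable_fun setT (fun z : ((R * H) * H) * H => F z.1.1.1 z.2).
Proof.
move=> mF; refine (measurableT_comp mF (measurable_fun_pair _ measurable_snd)).
exact: (measurableT_comp mtime measurable_fst).
Qed.

Lemma measurable_double_integral (F : R -> H -> H -> R) :
  measurable_fun setT (fun z : (R * H) * H => F z.1.1 z.2 z.1.2) ->
  measurable_fun setT (fun t => \int[mu]_w \int[mu]_p (`|F t p w|)%:E)%E.
Proof.
move=> mF; refine (measurable_integral_snd (f := fun z : R * H => (\int[mu]_p (`|F z.1 p z.2|)%:E)%E) _ _ _).
- apply: (measurable_integral_ge0 sigma_finite_heis (f := fun (z : R * H) p => `|F z.1 p z.2|)) => //.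
  exact: measurableT_comp.
- by move=> z; apply: integral_ge0 => p _; rewrite lee_fin.
- exact: sigma_finite_heis.
Qed.

Lemma measurable_ker_int_time e : measurable_fun setT (fun t => \int[mu]_w
  ker_int rho (v t) (f t) (fun j => D j t) (fun i j => DD i j t) j1 (g t) e w)%E.
Proof.
apply: (measurable_double_integral (F := fun t p w =>
  ker rho (v t) (f t) (fun j => D j t) (g t) e p w - ker0 rho (v t) (fun i j => DD i j t) j1 p w)).
apply: measurable_funB.
  apply: (measurable_ker mrho measurable_snd mpt (v := fun z => v z.1.1) (f := fun z => f z.1.1)
    (g := fun z => g z.1.1) (D := fun j z => D j z.1.1)) => *; exact: jm.
apply: (measurable_ker0 mrho j1 measurable_snd mpt (v := fun z => v z.1.1)
  (DD := fun i j z => DD i j z.1.1)) => *; exact: jm.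
Qed.

Lemma measurable_cker_int_time e : measurable_fun setT (fun t => \int[mu]_w
  cker_int rho (v t) (f t) e w)%E.
Proof.
apply: (measurable_double_integral (F := fun t p w => cker rho (v t) (f t) e p w)).
apply: (measurable_cker mrho measurable_snd mpt (v := fun z => v z.1.1) (f := fun z => f z.1.1)) => *; exact: jm.
Qed.

End time_kernel.

Section zero_field.
Context {R : realType} {n : nat}.
Local Notation H := (heis R n).
Local Notation mu := (@mu_heis R n).

(** Serves the times at which the field is extended by 0. *)
Lemma weak_derivative0 j : weak_derivative j (cst 0 : H -> R) (cst 0).
Proof.
have l0 : locally_integrable_rV (cst 0 : H -> R).
  split; first exact: measurable_cst.
  by move=> K _; exact: integrable0.
split => // phi _.
have z (F : H -> R) : \int[mu]_p (0 * F p) = 0.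
  by under eq_Rintegral do rewrite mul0r; rewrite /Rintegral integral0.
by rewrite !z oppr0.
Qed.

Lemma Ls_norm0 (t : \bar R) : (1 <= t)%E -> Ls_norm t (cst 0 : H -> R) = 0%E.
Proof.
move=> t1; rewrite /Ls_norm (_ : EFin \o cst 0 = cst 0%E)// Lnorm0 //.
by rewrite gt_eqF// (lt_le_trans _ t1).
Qed.

Lemma Ls_norm_boxed r t (f : H -> R) : Ls_norm t (boxed r f) = Ls_norm_on (rV_box r) t f.
Proof.
rewrite /Ls_norm_on; congr (Ls_norm t _); apply/funext => p; rewrite /restrict.
have [pr|pr] := pselect (rV_box r p); first by rewrite mem_set// boxed_in.
by rewrite memNset// boxed_out.
Qed.

End zero_field.

Section commutator_geometry.
Context {R : realType} {n : nat}.
Local Notation H := (heis R n).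

Lemma rV_box_ker_pt (r e : R) (w : H) : 0 <= e <= 1 -> rV_box r w -> rV_box r (ker_pt e w).
Proof.
by move=> e01 wr i; rewrite /ker_pt /heis_inv rVNE normrN; exact: heis_dil_box e01 wr i.
Qed.

(** [r0] bounds the support of [rho] and [r] the points reached from K. Dilations with e at most 1
    do not leave a box, so one [r] serves all such e. *)
Lemma commutator_box (rho : H -> R) (K : set H) : mollifier rho -> compact K ->
  exists r0 r : R, [/\ (forall w, ~ rV_box r0 w -> rho w = 0 /\ forall V, lie V rho w = 0),
    K `<=` rV_box r &
    forall e p w, 0 <= e <= 1 -> K p -> rV_box r0 w -> rV_box r (heis_mul p (ker_pt e w))].
Proof.
move=> mrho cK; have [_ crho] := mollifier_test mrho.
have [r0 _ hr0] := support_box crho; have [r1 _ Kr1] := compact_rV_box cK.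
have [r2 _ hr2] := @rV_box_heis_mul R n r1 r0.
exists r0, (Num.max r1 r2); split => // [p /Kr1|e p w e01 /Kr1 pr wr].
  by apply: le_rV_box; rewrite le_max lexx.
apply: (@le_rV_box _ _ r2); first by rewrite le_max lexx orbT.
by apply: hr2 => //; exact: rV_box_ker_pt.
Qed.

End commutator_geometry.

(** * Both commutators at a fixed time, with u and c cut off to a box *)

Section fixed_time.
Context {R : realType} {n : nat}.
Local Notation H := (heis R n).
Local Notation mu := (@mu_heis R n).
Variables (rho : H -> R) (mrho : mollifier rho) (s : \bar R) (s_ge1 : (1 <= s)%E).
Local Notation s' := (hoelder_conjugate s).
Variables (K : set H) (mK : measurable K) (r0 r : R).
Hypotheses (rho_supp : forall w, ~ rV_box r0 w -> rho w = 0 /\ forall V, lie V rho w = 0)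
  (Kr : K `<=` rV_box r)
  (Kr0 : forall e p w, 0 <= e <= 1 -> K p -> rV_box r0 w -> rV_box r (heis_mul p (ker_pt e w))).
Variables (u : H -> R) (mu_u : measurable_fun setT u) (us : (Ls_norm s (boxed r u) < +oo)%E).
Variables (c : H -> R) (mc : measurable_fun setT c) (cs : (Ls_norm s' (boxed r c) < +oo)%E).
Variables (f : H -> R) (D : 'I_(n + n) -> H -> R) (DD : 'I_(n + n) -> 'I_(n + n) -> H -> R).
Hypotheses (fD : forall j, weak_derivative (idx_h j) f (D j))
  (fDD : forall i j, weak_derivative (idx_h i) (D j) (DD i j))
  (DDs' : forall i j, (Ls_norm s' (DD i j) < +oo)%E).
Variables (j1 : 'I_n) (g : H -> R) (b : 'I_(n + n + 1) -> H -> R).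
Hypotheses (bh : forall h p, b (idx_h h) p = sign_h h * D (dual_h h) p)
  (bt : forall p, b idx_t p = - 4 * f p) (bg : weak_divergence b g).

Let mu_gt0 := mollifier_mu_gt0 mrho.
Let v := boxed r u.
Let d := boxed r c.
Let mv : measurable_fun setT v. Proof. exact: measurable_boxed. Qed.
Let md : measurable_fun setT d. Proof. exact: measurable_boxed. Qed.
Let mg : measurable_fun setT g. Proof. by have [_ []] := bg. Qed.

Lemma divergence_ae : {ae mu, forall p, g p = div_rep DD j1 p}.
Proof. exact: (divergence_formula mrho s_ge1 fD fDD DDs' j1 bh bt bg). Qed.

(** Hoelder against the indicator of the box places the cut-off in L^1 as well as in L^s. *)
Lemma boxed_integrable : mu.-integrable setT (EFin \o v).
Proof.
have b1 : bounded_supp (\1_(rV_box r) : H -> R).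
  split; first by apply: measurable_indic; exact: measurable_rV_box.
  exists 1, (Num.max 0 r); split => // [|p|p pr]; first by rewrite le_max lexx.
    by rewrite indicE; case: (_ \in _); rewrite ?normr1 ?normr0.
  rewrite indicE memNset// => pr'; apply: pr; apply: le_rV_box pr'.
  by rewrite le_max lexx orbT.
have s'1 : (1 <= s')%E by exact: hoelder_conj_ge1.
have := integrable_mul_heis mu_gt0 s_ge1 mv b1.1 us (bounded_supp_Ls mu_gt0 s'1 b1).
apply: eq_integrable => // p _; rewrite /= /v /boxed indicE.
by case: (_ \in _); rewrite ?mulr1// !mulr0.
Qed.

Local Notation kint := (ker_int rho v f D DD j1 g).
Local Notation cint := (cker_int rho v d).

Lemma norm_sum_fin : ((\sum_i \sum_j Ls_norm s' (DD i j))%E < +oo)%E.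
Proof. by apply: lte_sum_pinfty => i _; apply: lte_sum_pinfty => j _; exact: DDs'. Qed.

Let S := (\sum_i \sum_j Ls_norm s' (DD i j))%E.
Let S0 : (0 <= S)%E.
Proof. by apply: sume_ge0 => i _; apply: sume_ge0 => j _; exact: Lnorm_ge0. Qed.
Let N0 t (F : H -> R) : (0 <= Ls_norm t F)%E. Proof. exact: Lnorm_ge0. Qed.

Let M := fine (Ls_norm s v * S).
Let M0 : 0 <= M. Proof. by rewrite fine_ge0// mule_ge0. Qed.
Let vM : (Ls_norm s v * S <= M%:E)%E.
Proof.
rewrite fineK// ge0_fin_numE ?mule_ge0// lte_mul_pinfty ?norm_sum_fin//.
by rewrite ge0_fin_numE.
Qed.

Let M' := fine (Ls_norm s v * Ls_norm s' d).
Let M'0 : 0 <= M'. Proof. by rewrite fine_ge0// mule_ge0. Qed.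
Let vM' : (Ls_norm s v * Ls_norm s' d <= M'%:E)%E.
Proof. by rewrite fineK// ge0_fin_numE ?mule_ge0// lte_mul_pinfty// ge0_fin_numE. Qed.

Lemma commutator_le e : 0 < e <= 1 ->
  (\int[mu]_(p in K) (`|commutator rho e (fun _ => u) (fun j _ => b j) (fun _ => g) (fun _ => c) 0 p|)%:E <=
   \int[mu]_w kint e w + \int[mu]_w cint e w)%E.
Proof.
move=> /andP[e0 e1]; have e01 : 0 <= e <= 1 by rewrite ltW.
apply: le_integral_kernel2 => //.
- have h := measurable_ker_diff mrho mv fD fDD j1 mg e; exact: h.
- exact: measurable_cker_pair.
have uv p w : K p -> rV_box r0 w -> u (heis_mul p (ker_pt e w)) = v (heis_mul p (ker_pt e w)).
  by move=> Kp wr; rewrite /v boxed_in//; exact: Kr0.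
have cd p w : K p -> rV_box r0 w -> c (heis_mul p (ker_pt e w)) = d (heis_mul p (ker_pt e w)).
  by move=> Kp wr; rewrite /d boxed_in//; exact: Kr0.
have c1 := commutator1_le mrho s_ge1 mv us fD fDD DDs' mg divergence_ae bh bt M0 vM e0 rho_supp uv.
have c2 : {ae mu, forall p, K p ->
    ((`|commutator2 rho e (fun _ => u) (fun _ => c) 0 p|)%:E <= \int[mu]_w (`|cker rho v d e p w|)%:E)%E}.
  apply: (commutator2_le mrho s_ge1 mv us md cs M'0 vM' e0 (r := r0)).
  - by move=> w /rho_supp[].
  - by move=> p /Kr pr; rewrite /d boxed_in.
  - by move=> p w Kp wr; split; [exact: uv|exact: cd].
apply: filterS2 c1 c2 => p c1 c2 Kp; apply: le_trans (leeD (c1 Kp) (c2 Kp)).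
by rewrite -EFinD lee_fin ler_normD.
Qed.

Lemma kint_cvg (e : nat -> R) : (forall k, 0 < e k <= 1) -> e k @[k --> \oo] --> (0 : R) ->
  (\int[mu]_w kint (e k) w @[k --> \oo] --> 0)%E.
Proof.
move=> e01; apply: (ker_int_integral_cvg mrho s_ge1 mv us boxed_integrable fD fDD DDs' mg divergence_ae M0 vM).
by move=> k; have /andP[] := e01 k.
Qed.

Lemma cint_cvg (e : nat -> R) : e k @[k --> \oo] --> (0 : R) ->
  (\int[mu]_w cint (e k) w @[k --> \oo] --> 0)%E.
Proof. exact: (cker_int_integral_cvg mrho s_ge1 mv us boxed_integrable md cs M'0 vM'). Qed.

(** The norms stay visible as factors, uniformly in e, so that the bound can serve as a majorant in
    time. *)
Lemma kint_le C r' e : 0 <= C -> (forall w, ker_coef rho j1 w <= C * \1_(rV_box r') w) -> 0 < e ->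
  (\int[mu]_w kint e w <= (4 * C * fine (mu (rV_box r')))%:E * (Ls_norm s v * S))%E.
Proof.
move=> C0 hC e0.
have h := ker_int_integral_le mrho s_ge1 mv us fD fDD DDs' divergence_ae M0 vM C0 hC e0.
apply: (le_trans h).
have -> : (mu (rV_box r') = (fine (mu (rV_box r')))%:E)%E.
  by rewrite fineK// ge0_fin_numE ?measure_ge0// box_fin.
have -> : (Ls_norm s v * S = M%:E)%E.
  by rewrite fineK// ge0_fin_numE ?mule_ge0//; apply: (le_lt_trans vM); rewrite ltry.
by rewrite /= -!EFinM lee_fin le_eqVlt; apply/orP; left; apply/eqP; ring.
Qed.

Lemma cint_le e : (\int[mu]_w cint e w <= 2%:E * (Ls_norm s v * Ls_norm s' d))%E.
Proof.
apply: (le_trans (cker_int_integral_le mrho s_ge1 mv us md cs M'0 vM' e)).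
rewrite EFinM lee_wpmul2l// fineK// ge0_fin_numE ?mule_ge0//.
by apply: (le_lt_trans vM'); rewrite ltry.
Qed.

End fixed_time.

Lemma contact_field_h (R : realType) n (psi : R -> heis R n -> R) Dpsi (h : 'I_(n + n)) t p :
  contact_field psi Dpsi (idx_h h) t p = sign_h h * Dpsi (dual_h h) t p.
Proof.
by rewrite /contact_field split_idx_h /sign_h /dual_h; case: fintype.split => j; rewrite ?mul1r// mulN1r.
Qed.

Lemma contact_field_t (R : realType) n (psi : R -> heis R n -> R) Dpsi t p :
  contact_field psi Dpsi idx_t t p = - 4 * psi t p.
Proof. by rewrite /contact_field split_idx_t. Qed.

Lemma commutator_at (R : realType) n (rho : heis R n -> R) e u b divb c t p :
  commutator rho e u b divb c t p =
  commutator rho e (fun _ => u t) (fun j _ => b j t) (fun _ => divb t) (fun _ => c t) 0 p.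
Proof. by []. Qed.

Lemma le_integral_restrict d (T : measurableType d) (R : realType) (mu : {measure set T -> \bar R})
    (A B : set T) (f g : T -> \bar R) :
  (forall t, A t -> 0 <= f t)%E -> (forall t, B t -> 0 <= g t)%E ->
  (forall t, A t -> f t <= (g \_ B) t)%E ->
  (\int[mu]_(t in A) f t <= \int[mu]_(t in B) g t)%E.
Proof.
move=> f0 g0 fg; rewrite integral_mkcond [leRHS]integral_mkcond.
apply: le_integral_nonmeas => t _; rewrite {1}/restrict; case: ifPn => [/set_mem At|_].
- exact: f0.
- exact: lexx.
- exact: fg.
- by rewrite /restrict; case: ifPn => // /set_mem; exact: g0.
Qed.

Lemma le_integral_setT d (T : measurableType d) (R : realType) (mu : {measure set T -> \bar R})
    (A : set T) (f g : T -> \bar R) :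
  (forall t, A t -> 0 <= f t)%E -> (forall t, 0 <= g t)%E -> (forall t, A t -> f t <= g t)%E ->
  (\int[mu]_(t in A) f t <= \int[mu]_t g t)%E.
Proof.
move=> f0 g0 fg; apply: le_integral_restrict => // t At.
by rewrite /restrict mem_set//; exact: fg.
Qed.

Lemma ae_lty_integral d (T : measurableType d) (R : realType) (mu : {measure set T -> \bar R})
    (A : set T) (f : T -> \bar R) : measurable A -> measurable_fun A f ->
  (forall t, 0 <= f t)%E -> (\int[mu]_(t in A) f t < +oo)%E ->
  {ae mu, forall t, A t -> (f t < +oo)%E}.
Proof.
move=> mA mf f0 fin; have ifA : mu.-integrable A f.
  apply/integrableP; split => //; rewrite (eq_integral f)// => t _.
  by rewrite gee0_abs.
by apply: filterS (integrable_ae mA ifA) => t h Lt; rewrite -ge0_fin_numE// h.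
Qed.

Lemma lty_integralZl d (T : measurableType d) (R : realType) (mu : {measure set T -> \bar R})
    (A : set T) (f : T -> \bar R) (k l : R) : measurable A -> measurable_fun A f ->
  (forall t, 0 <= f t)%E -> 0 <= k -> 0 <= l -> (\int[mu]_(t in A) f t < +oo)%E ->
  (\int[mu]_(t in A) (k%:E * (l%:E * f t)) < +oo)%E.
Proof.
move=> mA mf f0 k0 l0 fin; under eq_integral do rewrite muleA -EFinM.
by rewrite ge0_integralZl// ?lee_fin ?mulr_ge0// lte_mul_pinfty// lee_fin mulr_ge0.
Qed.

(** * Dominated convergence in time *)

Section commutator_in_time.
Context {R : realType} {n : nat}.
Local Notation H := (heis R n).
Local Notation mu := (@mu_heis R n).
Local Notation leb := (@lebesgue_measure R).
Variables (rho : H -> R) (mrho : mollifier rho).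
Variables (taubar s : \bar R) (s_ge1 : (1 <= s)%E).
Local Notation s' := (hoelder_conjugate s).
Variables (psi : R -> H -> R) (Dpsi : 'I_(n + n) -> R -> H -> R)
  (D2psi : 'I_(n + n) -> 'I_(n + n) -> R -> H -> R).
Hypothesis psi_W2 : L1W2H s' taubar psi Dpsi D2psi.
Variables (c : R -> H -> R) (c_L1 : LrLs_loc 1%E s' taubar c).
Variables (u0 : H -> R) (u0_Ls : Ls_loc s u0).
Variables (u : R -> H -> R) (u_Loo : LrLs_loc +oo%E s taubar u).
Variables (divb : R -> H -> R) (divb_measurable : joint_measurable (time_left taubar) divb).
Local Notation bt t := (fun j => extend (cst 0) (contact_field psi Dpsi j) t).
Hypothesis divb_div : {ae leb, forall t, time_left taubar t -> weak_divergence (bt t) (divb t)}.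
Variables (j1 : 'I_n) (K : set H) (mK : measurable K) (r0 r : R).
Hypotheses (rho_supp : forall w, ~ rV_box r0 w -> rho w = 0 /\ forall V, lie V rho w = 0)
  (Kr : K `<=` rV_box r)
  (Kr0 : forall e p w, 0 <= e <= 1 -> K p -> rV_box r0 w -> rV_box r (heis_mul p (ker_pt e w))).

Let I := time_int taubar.
Let L := time_left taubar.
Let mI : measurable I := measurable_time_int taubar.
Let mL : measurable L := measurable_time_left taubar.
Let mu_gt0 := mollifier_mu_gt0 mrho.
Let s'1 : (1 <= s')%E. Proof. exact: hoelder_conj_ge1. Qed.

Let f := time_patch I psi.
Let D j := time_patch I (Dpsi j).
Let DD i j := time_patch I (D2psi i j).
Let cI := time_patch I c.
Let g := time_patch L divb.
(** Agrees with the extension of u at the times of [L] other than 0, hence at almost every time of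
    [L]. *)
Let uI (t : R) : H -> R := if t < 0 then u0 else time_patch I u t.
Let v t := boxed r (uI t).
Let d t := boxed r (cI t).
Let S t := (\sum_i \sum_j Ls_norm s' (DD i j t))%E.
Let N t := Ls_norm s' (d t).
Let A e t := (\int[mu]_w ker_int rho (v t) (f t) (fun j => D j t) (fun i j => DD i j t) j1 (g t) e w)%E.
Let B e t := (\int[mu]_w cker_int rho (v t) (d t) e w)%E.
(** One bound for almost all times: the first term covers the times in [I], the second the negative
    times. *)
Let Mu := fine ('N[leb]_+oo[(fun t => Ls_norm_on (rV_box r) s (u t)) \_ I]%E) +
  fine (Ls_norm_on (rV_box r) s u0).

Local Notation joint F := (measurable_fun setT (fun z : R * H => F z.1 z.2)).

Let mbox : measurable_fun setT (fun z : R * H => \1_(rV_box r) z.2 : R).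
Proof.
apply: (measurableT_comp _ measurable_snd).
by apply: measurable_indic; exact: measurable_rV_box.
Qed.

Let muI : joint uI.
Proof.
rewrite (_ : (fun z => _) = (fun z : R * H => if z.1 < 0 then u0 z.2 else time_patch I u z.1 z.2)); last first.
  by apply/funext => z; rewrite /uI; case: ifP.
apply: measurable_fun_ifT.
- by apply: measurable_fun_ltr => //; exact: measurable_fst.
- exact: (measurableT_comp u0_Ls.1 measurable_snd).
- exact: (measurable_time_patch mI u_Loo.1).
Qed.

Let mv : joint v. Proof. exact: measurable_funM. Qed.
Let mcI : joint cI. Proof. exact: (measurable_time_patch mI c_L1.1). Qed.
Let md : joint d. Proof. exact: measurable_funM. Qed.
Let mf : joint f. Proof. exact: (measurable_time_patch mI (L1W2H_measurable psi_W2)). Qed.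
Let mD j : joint (D j). Proof. exact: (measurable_time_patch mI (L1W2H_measurable1 psi_W2 j)). Qed.
Let mDD i j : joint (DD i j).
Proof. exact: (measurable_time_patch mI (L1W2H_measurable2 psi_W2 i j)). Qed.
Let mg : joint g. Proof. exact: (measurable_time_patch mL divb_measurable). Qed.

Let msection (F : R -> H -> R) t : joint F -> measurable_fun setT (F t).
Proof. by move=> mF; exact: (measurableT_comp mF (measurable_pair1 t)). Qed.

Let N_ge0 t F : (0 <= @Ls_norm R n t F)%E. Proof. exact: Lnorm_ge0. Qed.
Let S_ge0 t : (0 <= S t)%E.
Proof. by apply: sume_ge0 => i _; apply: sume_ge0 => j _; exact: Lnorm_ge0. Qed.

Let mS : measurable_fun setT S.
Proof.
by apply: emeasurable_sum => i; apply: emeasurable_sum => j; exact: measurable_Ls_norm.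
Qed.

Let mN : measurable_fun setT N. Proof. exact: measurable_Ls_norm. Qed.
Let mA e : measurable_fun setT (A e). Proof. exact: measurable_ker_int_time. Qed.
Let mB e : measurable_fun setT (B e). Proof. exact: measurable_cker_int_time. Qed.

Let A_ge0 e t : (0 <= A e t)%E.
Proof. by apply: integral_ge0 => w _; apply: integral_ge0 => p _; rewrite lee_fin. Qed.
Let B_ge0 e t : (0 <= B e t)%E.
Proof. by apply: integral_ge0 => w _; apply: integral_ge0 => p _; rewrite lee_fin. Qed.

Let boxed0 : boxed r (cst 0 : H -> R) = cst 0.
Proof. by apply/funext => p; rewrite /boxed mul0r. Qed.

Let W2_ge0 t : (0 <= W2H_norm s' (psi t) (fun j => Dpsi j t) (fun i j => D2psi i j t))%E.
Proof.
apply: adde_ge0; last by apply: sume_ge0 => i _; exact: sume_ge0.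
by apply: adde_ge0 => //; exact: sume_ge0.
Qed.

(** Only times in [I] contribute, the patched derivatives being 0 at the others. *)
Let S_fin : (\int[leb]_(t in L) S t < +oo)%E.
Proof.
apply: le_lt_trans (L1W2H_finite psi_W2).
apply: le_integral_restrict => // t Lt; rewrite /restrict.
have [It|It] := pselect (I t).
  rewrite mem_set//.
  apply: (@le_trans _ _ (\sum_i \sum_j Ls_norm s' (D2psi i j t))%E).
    by apply: lee_sum => i _; apply: lee_sum => j _; rewrite /DD time_patch_in.
  by apply: leeDr; apply: adde_ge0 => //; exact: sume_ge0.
rewrite memNset// /S big1// => i _; rewrite big1// => j _.
by rewrite /DD time_patch_out// Ls_norm0.
Qed.

Let N_fin : (\int[leb]_(t in L) N t < +oo)%E.
Proof.
have [_ /(_ _ (@rV_box_compact R (n + n + 1) r))] := c_L1; rewrite Lnorm1.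
apply: le_lt_trans.
apply: le_integral_setT => [t _|t|t Lt]; [exact: N_ge0|exact: abse_ge0|rewrite /restrict].
have [It|It] := pselect (I t).
  by rewrite mem_set// gee0_abs ?Lnorm_ge0// /N /d /cI time_patch_in// Ls_norm_boxed.
by rewrite /N /d /cI time_patch_out// boxed0 Ls_norm0// abse_ge0.
Qed.

Let v_le : {ae leb, forall t, (Ls_norm s (v t) <= Mu%:E)%E}.
Proof.
have [_ /(_ _ (@rV_box_compact R (n + n + 1) r))] := u_Loo => uoo.
have u0fin : Ls_norm_on (rV_box r) s u0 \is a fin_num.
  by rewrite ge0_fin_numE; [exact: u0_Ls.2 _ (@rV_box_compact R (n + n + 1) r)|exact: Lnorm_ge0].
have leb_gt0 : (0 < leb setT)%E.
  apply: (@lt_le_trans _ _ (leb `[0, 1]%classic)); last by apply: le_measure; rewrite ?inE.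
  by rewrite lebesgue_measure_itv/= lte_fin ltr01 -EFinD subr0 lte_fin.
rewrite /Mu; set E := ('N[leb]_+oo[_])%E.
have E0 : (0 <= E)%E by exact: Lnorm_ge0.
have Efin : E \is a fin_num by rewrite ge0_fin_numE.
have h : {ae leb, forall t, (`|((fun t => Ls_norm_on (rV_box r) s (u t)) \_ I) t| <= E)%E}.
  by rewrite /E unlock leb_gt0; exact: (ess_sup_ge leb (abse \o _)).
have M1 : 0 <= fine E by rewrite fine_ge0.
have M2 : 0 <= fine (Ls_norm_on (rV_box r) s u0) by rewrite fine_ge0// Lnorm_ge0.
have aeF : Filter (almost_everywhere leb) by exact: ae_filter_ringOfSetsType.
apply: filterS h => t ht; rewrite /v /uI.
have [t0|t0] := ltP t 0.
  by rewrite Ls_norm_boxed -(fineK u0fin) lee_fin lerDr.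
have [It|It] := pselect (I t); last by rewrite time_patch_out// boxed0 Ls_norm0// lee_fin addr_ge0.
move: ht; rewrite time_patch_in// Ls_norm_boxed /restrict mem_set// gee0_abs ?Lnorm_ge0// => ht.
by apply: (le_trans ht); rewrite -[leLHS](fineK Efin) lee_fin lerDl.
Qed.

Let N_ae_fin : {ae leb, forall t, L t -> (N t < +oo)%E}.
Proof.
apply: (@ae_lty_integral _ _ R leb L N mL (measurable_funTS mN)); last exact: N_fin.
by move=> t; exact: N_ge0.
Qed.

(** At negative times every function involved is 0, and on [I] the Sobolev hypothesis holds almost
    everywhere. Time 0 belongs to neither half and is discarded as a null set. *)
Let field_ae : {ae leb, forall t, L t ->
  [/\ t != 0, (forall j, weak_derivative (idx_h j) (f t) (D j t)),
    (forall i j, weak_derivative (idx_h i) (D j t) (DD i j t)) &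
    forall i j, (Ls_norm s' (DD i j t) < +oo)%E]}.
Proof.
have aeF : Filter (almost_everywhere leb) by exact: ae_filter_ringOfSetsType.
have ae0 : {ae leb, forall t, t != 0}.
  exists [set 0]; split => //; first exact: lebesgue_measure_set1.
  by move=> t /= /negP; rewrite negbK => /eqP.
apply: filterS2 ae0 (L1W2H_ae psi_W2) => t t0 Wt Lt; split => //.
- move=> j; have [It|It] := pselect (I t); last by rewrite /f /D !time_patch_out//; exact: weak_derivative0.
  by rewrite /f /D !time_patch_in//; exact: W2H_first (Wt It) j.
- move=> i j; have [It|It] := pselect (I t); last by rewrite /D /DD !time_patch_out//; exact: weak_derivative0.
  by rewrite /D /DD !time_patch_in//; exact: W2H_second (Wt It) i j.
- move=> i j; have [It|It] := pselect (I t); last by rewrite /DD time_patch_out// Ls_norm0.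
  rewrite /DD time_patch_in//; apply: le_lt_trans (W2H_finite (Wt It)).
  rewrite /W2H_norm [leRHS]addeC; apply: (@le_trans _ _ (\sum_i \sum_j Ls_norm s' (D2psi i j t))%E).
    rewrite (bigD1 i)//= (bigD1 j)//= -addeA leeDl// adde_ge0// ?sume_ge0// => k _.
    exact: sume_ge0.
  by rewrite leeDl// adde_ge0// sume_ge0.
Qed.

Let bt_h t h p : L t -> t != 0 -> bt t (idx_h h) p = sign_h h * D (dual_h h) t p.
Proof.
move=> Lt t0; rewrite /extend; case: ltP => ht.
  rewrite /D time_patch_out ?mulr0// => -[/lt_trans/(_ ht)]; by rewrite ltxx.
have It : I t by split => //; rewrite lt_neqAle eq_sym t0.
by rewrite contact_field_h /D time_patch_in.
Qed.

Let bt_t t p : L t -> t != 0 -> bt t idx_t p = - 4 * f t p.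
Proof.
move=> Lt t0; rewrite /extend; case: ltP => ht.
  rewrite /f time_patch_out ?mulr0// => -[/lt_trans/(_ ht)]; by rewrite ltxx.
have It : I t by split => //; rewrite lt_neqAle eq_sym t0.
by rewrite contact_field_t /f time_patch_in.
Qed.

Let extend_u t : L t -> t != 0 -> extend u0 u t = uI t.
Proof.
move=> Lt t0; apply/funext => p; rewrite /extend /uI; case: ltP => ht //.
by rewrite time_patch_in//; split => //; rewrite lt_neqAle eq_sym t0.
Qed.

Let extend_c t : L t -> t != 0 -> extend (cst 0) c t = cI t.
Proof.
move=> Lt t0; apply/funext => p; rewrite /extend; case: ltP => ht.
  by rewrite /cI time_patch_out// => -[/lt_trans/(_ ht)]; rewrite ltxx.
by rewrite /cI time_patch_in//; split => //; rewrite lt_neqAle eq_sym t0.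
Qed.

Local Notation G e t := (\int[mu]_(p in K) `|commutator rho e (extend u0 u)
  (fun j => extend (cst 0) (contact_field psi Dpsi j)) divb (extend (cst 0) c) t p|%:E)%E.

(** All facts used at a fixed time, gathered on one set of full measure that does not depend on e or
    on the sequence. *)
Let good : {ae leb, forall t, L t -> [/\
  forall e, 0 < e <= 1 -> (G e t <= A e t + B e t)%E,
  forall e : nat -> R, (forall k, 0 < e k <= 1) -> e k @[k --> \oo] --> (0 : R) ->
    (A (e k) t @[k --> \oo] --> 0)%E,
  forall e : nat -> R, e k @[k --> \oo] --> (0 : R) -> (B (e k) t @[k --> \oo] --> 0)%E,
  forall C r' e, 0 <= C -> (forall w, ker_coef rho j1 w <= C * \1_(rV_box r') w) -> 0 < e ->
    (A e t <= (4 * C * fine (mu (rV_box r')))%:E * (Mu%:E * S t))%E &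
  forall e, (B e t <= 2%:E * (Mu%:E * N t))%E]}.
Proof.
have aeF : Filter (almost_everywhere leb) by exact: ae_filter_ringOfSetsType.
near=> t => Lt.
have vle : (Ls_norm s (v t) <= Mu%:E)%E by near: t; exact: v_le.
have Nlt : (N t < +oo)%E by move: Lt; near: t; exact: N_ae_fin.
have [t0 fD fDD DDs'] : [/\ t != 0, (forall j, weak_derivative (idx_h j) (f t) (D j t)),
    (forall i j, weak_derivative (idx_h i) (D j t) (DD i j t)) &
    forall i j, (Ls_norm s' (DD i j t) < +oo)%E] by move: Lt; near: t; exact: field_ae.
have bg : weak_divergence (bt t) (g t).
  by rewrite /g time_patch_in//; move: Lt; near: t; exact: divb_div.
have vs : (Ls_norm s (boxed r (uI t)) < +oo)%E by apply: (le_lt_trans vle); rewrite ltry.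
have mut := msection t muI; have mct := msection t mcI.
have bh h p := @bt_h t h p Lt t0; have btt p := @bt_t t p Lt t0.
split.
- move=> e e01.
  have -> : G e t = (\int[mu]_(p in K) (`|commutator rho e (fun _ => uI t) (fun j _ => bt t j)
      (fun _ => g t) (fun _ => cI t) 0 p|)%:E)%E.
    apply: eq_integral => p _; rewrite [in LHS]commutator_at extend_u// extend_c//.
    by rewrite /g time_patch_in.
  exact: (commutator_le mrho s_ge1 mK rho_supp Kr Kr0 mut vs mct Nlt fD fDD DDs' j1 bh btt bg e01).
- by move=> e; exact: (kint_cvg mrho s_ge1 mut vs fD fDD DDs' j1 bh btt bg).
- by move=> e; exact: (cint_cvg mrho s_ge1 mut vs mct Nlt).
- move=> C r' e C0 hC e0.
  apply: (le_trans (kint_le mrho s_ge1 mut vs fD fDD DDs' bh btt bg C0 hC e0)).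
  apply: lee_wpmul2l; first by rewrite lee_fin !mulr_ge0// fine_ge0.
  exact: (lee_wpmul2r (S_ge0 t) vle).
- move=> e; apply: (le_trans (cint_le mrho s_ge1 mut vs mct Nlt e)).
  by apply: lee_wpmul2l => //; exact: (lee_wpmul2r (N_ge0 s' (d t)) vle).
Unshelve. all: by end_near. Qed.

Lemma commutator_cvg0_seq (e : nat -> R) : (forall k, 0 < e k <= 1) ->
  e k @[k --> \oo] --> (0 : R) -> (\int[leb]_(t in L) G (e k) t @[k --> \oo] --> 0)%E.
Proof.
have aeF : Filter (almost_everywhere leb) by exact: ae_filter_ringOfSetsType.
move=> e01 e0.
have Mu0 : 0 <= Mu by rewrite addr_ge0// fine_ge0// Lnorm_ge0.
apply: (@cvge0_le _ _ (fun k => \int[leb]_(t in L) A (e k) t + \int[leb]_(t in L) B (e k) t)%E).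
- by move=> k; apply: integral_ge0 => t _; apply: integral_ge0 => p _; rewrite lee_fin.
- move=> k; rewrite -ge0_integralD//; last 2 first.
  + exact: (measurable_funTS (mA _)).
  + exact: (measurable_funTS (mB _)).
  apply: le_integral_ae_nonmeas => //.
  + exact: (measurable_funTS (emeasurable_funD (mA _) (mB _))).
  + by move=> t _; apply: integral_ge0 => p _; rewrite lee_fin.
  + by move=> t _; rewrite adde_ge0.
  by apply: filterS good => t h Lt; have [h1 _ _ _ _] := h Lt; exact: h1.
apply: cvge0D.
  have [C [r' [C0 _ _ hC]]] := ker_coef_majorant mrho j1.
  have c0 : 0 <= 4 * C * fine (mu (rV_box r')) by rewrite !mulr_ge0// fine_ge0.
  apply: (dominated_cvg0 (mu := leb) (g := fun t => ((4 * C * fine (mu (rV_box r')))%:E * (Mu%:E * S t))%E)) => //.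
  + by move=> k; exact: (measurable_funTS (mA _)).
  + by move=> t _; rewrite !mule_ge0.
  + by apply: filterS good => t h Lt; have [_ h1 _ _ _] := h Lt; exact: h1.
  + by apply: filterS good => t h Lt k; have [_ _ _ h1 _] := h Lt; apply: h1 => //; have /andP[] := e01 k.
  + exact: (@lty_integralZl _ _ R leb L S _ _ mL (measurable_funTS mS) S_ge0 c0 Mu0 S_fin).
apply: (dominated_cvg0 (mu := leb) (g := fun t => (2%:E * (Mu%:E * N t))%E)) => //.
- by move=> k; exact: (measurable_funTS (mB _)).
- by move=> t _; apply: mule_ge0 => //; apply: mule_ge0 => //; exact: N_ge0.
- by apply: filterS good => t h Lt; have [_ _ h1 _ _] := h Lt; exact: h1.
- by apply: filterS good => t h Lt k; have [_ _ _ _ h1] := h Lt; exact: h1.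
- have N0 t : (0 <= N t)%E by exact: N_ge0.
  exact: (@lty_integralZl _ _ R leb L N _ _ mL (measurable_funTS mN) N0 (ler0n R 2) Mu0 N_fin).
Qed.

End commutator_in_time.

Theorem lemma4p10 (R : realType) (n : nat) (n_ge1 : (1 <= n)%N)
    (rho : heis R n -> R) (rho_mollifier : mollifier rho)
    (taubar : \bar R) (taubar_gt0 : (0 < taubar)%E)
    (s : \bar R) (s_ge1 : (1 <= s)%E)
    (psi : R -> heis R n -> R) (Dpsi : 'I_(n + n) -> R -> heis R n -> R)
    (D2psi : 'I_(n + n) -> 'I_(n + n) -> R -> heis R n -> R)
    (psi_W2 : L1W2H (hoelder_conjugate s) taubar psi Dpsi D2psi)
    (c : R -> heis R n -> R)
    (c_L1 : LrLs_loc 1%E (hoelder_conjugate s) taubar c)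
    (u0 : heis R n -> R) (u0_Ls : Ls_loc s u0)
    (u : R -> heis R n -> R) (u_Loo : LrLs_loc +oo%E s taubar u)
    (divb : R -> heis R n -> R)
    (divb_measurable : joint_measurable (time_left taubar) divb)
    (divb_div : {ae @lebesgue_measure R, forall tau, time_left taubar tau ->
       weak_divergence
         (fun j => extend (cst 0) (contact_field psi Dpsi j) tau)
         (divb tau)}) :
  forall K : set (heis R n), compact K ->
    (\int[@lebesgue_measure R]_(tau in time_left taubar)
       \int[@mu_heis R n]_(p in K)
         `|commutator rho eps (extend u0 u)
             (fun j => extend (cst 0) (contact_field psi Dpsi j))
             divb (extend (cst 0) c) tau p|%:E)%E
      @[eps --> (0:R)^'+] --> 0%E.
Proof.
move=> K cK; have [r0 [r [hr0 Kr Kr0]]] := commutator_box rho_mollifier cK.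
apply: cvge0_at_right.
  by move=> e; apply: integral_ge0 => t _; apply: integral_ge0 => p _; rewrite lee_fin.
move=> e e01 e0.
(* n >= 1 provides the pair X_1, Y_1 out of which the vertical moves are made. *)
exact: (commutator_cvg0_seq rho_mollifier s_ge1 psi_W2 c_L1 u0_Ls u_Loo divb_measurable divb_div
  (Ordinal n_ge1) (compact_measurable_rV cK) hr0 Kr Kr0 e01 e0).
Qed.
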